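(* Let $(\mathcal{A},X_B,D)$ be a higher order Kasparov module. Then the logarithmic transform $(\mathcal{A},X_B,D_{\log})$, where $D_{\log}:=\operatorname{sgnlog}(D)=D|D|^{-1}\log(1+|D|)$, is an ordinary unbounded Kasparov module representing the same $KK$-class. Moreover the commutators $[D_{\log},ab]$ are $B$-compact for all $a,b\in\mathcal{A}$.
   Context: Let $B$ be a $C^*$-algebra and $X_B$ a countably generated right Hilbert $C^*$-module over $B$; $\operatorname{End}^*_B(X_B)$ and $\mathbb{K}_B(X_B)$ denote the adjointable and the $B$-compact operators. For a densely defined operator $T$ and a self-adjoint regular operator $D$ on $X_B$, and $\varepsilon>0$, $T$ is $\varepsilon$-bounded with respect to $D$ if $T(1+D^2)^{-\frac{1-\varepsilon}{2}}$ and $(1+D^2)^{-\frac{1-\varepsilon}{2}}T$ are densely defined and norm-bounded. Let $m>0$ and $\varepsilon=1/m$. A higher order Kasparov module of order $m$ is a triple $(\mathcal{A},X_B,D)$ with $\mathcal{A}$ a $*$-algebra with a $*$-representation on $X_B$ (suppressed in notation) and $D$ a self-adjoint regular operator on $X_B$ such that for all $a\in\mathcal{A}$: (1) $a(1+D^2)^{-1/2}\in\mathbb{K}_B(X_B)$; (2) $a\operatorname{Dom}(D)\subset\operatorname{Dom}(D)$ and $[D,a]$ is $\varepsilon$-bounded with respect to $D$. It is even if $X_B$ is $\mathbb{Z}/2$-graded, $D$ is odd and $\mathcal{A}$ acts by even operators; otherwise odd. An ordinary unbounded Kasparov module is one of order $m=1$, i.e. the commutators $[D,a]$ are bounded. $\operatorname{sgnlog}(x)=\operatorname{sgn}(x)\log(1+|x|)$,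 applied to $D$ by functional calculus (so $D_{\log}$ is defined also if $D$ is not invertible). The $KK$-class of a (higher order) Kasparov module is the class in $KK_*(A,B)$ of its bounded transform $(A,X_B,D(1+D^2)^{-1/2})$, where $A$ is the $C^*$-closure of $\mathcal{A}$. *)

(* Defs.v *)
From HB Require Import structures.
From mathcomp Require Import all_boot all_order all_algebra.
From mathcomp Require Import complex ring.
From mathcomp Require Import all_classical all_reals all_analysis.
From Stdlib Require Import Relation_Operators.

Set Implicit Arguments.
Unset Strict Implicit.
Unset Printing Implicit Defensive.
Import Order.TTheory GRing.Theory Num.Theory.
Import numFieldNormedType.Exports.

Local Open Scope classical_set_scope.
Local Open Scope complex_scope.
Local Open Scope ring_scope.

(* Algebras need not be unital, so the ring hierarchy cannot be used. *)
HB.mixin Record isStarAlgebra (R : realType) V & GRing.Lmodule R[i] V := {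
  amul : V -> V -> V;
  astar : V -> V;
  amulA : forall a b c, amul a (amul b c) = amul (amul a b) c;
  amulDl : forall a b c, amul (a + b) c = amul a c + amul b c;
  amulDr : forall a b c, amul a (b + c) = amul a b + amul a c;
  amulZl : forall (k : R[i]) a b, amul (k *: a) b = k *: amul a b;
  amulZr : forall (k : R[i]) a b, amul a (k *: b) = k *: amul a b;
  astarK : forall a, astar (astar a) = a;
  astarD : forall a b, astar (a + b) = astar a + astar b;
  astarZ : forall (k : R[i]) a, astar (k *: a) = k^*%C *: astar a;
  astarM : forall a b, astar (amul a b) = amul (astar b) (astar a)
}.

#[short(type="starAlgType")]
HB.structure Definition StarAlgebra (R : realType) :=
  {V of GRing.Lmodule R[i] V & isStarAlgebra R V}.

(* As usual over R[i], norms take values in the nonnegative reals of R[i]. *)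
HB.mixin Record isCStarAlgebra (R : realType) V
    & CompleteNormedModule R[i] V & isStarAlgebra R V := {
  ler_amul : forall a b : V, `|amul a b| <= `|a| * `|b|;
  cstar_identity : forall a : V, `|amul (astar a) a| = `|a| ^+ 2
}.

#[short(type="cstarAlgType")]
HB.structure Definition CStarAlgebra (R : realType) :=
  {V of CompleteNormedModule R[i] V & isStarAlgebra R V & isCStarAlgebra R V}.

(* Right Hilbert modules; the inner product is linear in the second variable.
   Definiteness of the inner product follows from hnormE. *)
HB.mixin Record isHilbertModule (R : realType) (B : cstarAlgType R) X
    & CompleteNormedModule R[i] X := {
  ract : X -> B -> X;
  ip : X -> X -> B;
  ractDl : forall x y b, ract (x + y) b = ract x b + ract y b;
  ractDr : forall x b c, ract x (b + c) = ract x b + ract x c;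
  ractZl : forall (k : R[i]) x b, ract (k *: x) b = k *: ract x b;
  ractZr : forall (k : R[i]) x b, ract x (k *: b) = k *: ract x b;
  ractA : forall x b c, ract x (amul b c) = ract (ract x b) c;
  ipDr : forall x y z, ip x (y + z) = ip x y + ip x z;
  ipZr : forall (k : R[i]) x y, ip x (k *: y) = k *: ip x y;
  ip_ract : forall x y b, ip x (ract y b) = amul (ip x y) b;
  ip_star : forall x y, astar (ip x y) = ip y x;
  ip_ge0 : forall x, exists b, ip x x = amul (astar b) b;
  hnormE : forall x, `|x| ^+ 2 = `|ip x x|
}.

#[short(type="hilbModType")]
HB.structure Definition HilbertModule (R : realType) (B : cstarAlgType R) :=
  {X of CompleteNormedModule R[i] X & isHilbertModule R B X}.

Arguments ip {R B X} : rename.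
Arguments ract {R B X} : rename.

Section star_morphisms.
Context {R : realType}.

Definition star_morphism (A A' : starAlgType R) (h : A -> A') : Prop :=
  [/\ forall (k : R[i]) a b, h (k *: a + b) = k *: h a + h b,
      forall a b, h (amul a b) = amul (h a) (h b)
    & forall a, h (astar a) = astar (h a)].

End star_morphisms.

Section operators.
Context {R : realType} {B : cstarAlgType R} {X : hilbModType B}.
Implicit Types (T S : X -> X) (G H D : set (X * X)).

Definition countably_generated : Prop :=
  exists u : nat -> X, forall M : set X, closed M ->
    (forall (k : R[i]) x y, M x -> M y -> M (k *: x + y)) ->
    (forall x b, M x -> M (ract x b)) ->
    (forall n, M (u n)) -> M = setT.

Definition is_adjoint T S : Prop := forall x y, ip (T x) y = ip x (S y).

(* Norm limits of finite sums of the rank one operators z |-> x <y, z>. *)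
Definition compact_op T : Prop :=
  forall e : R, 0 < e -> exists n (x y : 'I_n -> X), forall z,
    `|T z - \sum_(j < n) ract (x j) (ip (y j) z)| <= e%:C * `|z|.

Definition star_representation (A : starAlgType R) (pi : A -> X -> X) : Prop :=
  [/\ forall (k : R[i]) a b x, pi (k *: a + b) x = k *: pi a x + pi b x,
      forall a b x, pi (amul a b) x = pi a (pi b x)
    & forall a, is_adjoint (pi a) (pi (astar a))].

(* Unbounded operators are identified with their graphs in X * X. *)
Definition graph T : set (X * X) := [set p | T p.1 = p.2].

Definition dom G : set X := [set x | exists y, G (x, y)].

Definition comp G H : set (X * X) :=
  [set p | exists2 y, H (p.1, y) & G (y, p.2)].

Definition adj G : set (X * X) :=
  [set p | forall x y, G (x, y) -> ip y p.1 = ip x p.2].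

Definition densely_defined_op G : Prop :=
  [/\ dense (dom G),
      forall x y y', G (x, y) -> G (x, y') -> y = y',
      forall (k : R[i]) x y x' y', G (x, y) -> G (x', y') ->
        G (k *: x + x', k *: y + y')
    & forall x y b, G (x, y) -> G (ract x b, ract y b)].

(* The last clause is the density of the range of 1 + D^* D. *)
Definition regular D : Prop :=
  [/\ densely_defined_op D, closed D, dense (dom (adj D))
    & dense [set z | exists x y w,
        [/\ D (x, y), adj D (y, w) & z = x + w]]].

Definition selfadjoint_regular D : Prop := regular D /\ adj D = D.

Definition norm_bounded G : Prop :=
  exists M : R, forall x y, G (x, y) -> `|y| <= M%:C * `|x|.

(* The graph G is that of an everywhere defined B-compact operator. *)
Definition is_compact G : Prop := exists2 K, compact_op K & G = graph K.

(* The densely defined operator G extends to a B-compact operator. *)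
Definition extends_to_compact G : Prop :=
  dense (dom G) /\ exists2 K, compact_op K & G `<=` graph K.

Definition commutator D T : set (X * X) :=
  [set p | exists u v, [/\ D (p.1, u), D (T p.1, v) & p.2 = v - T u]].

Definition C0 (g : R -> R[i]) : Prop :=
  [/\ continuous (g : R -> R[i]^o),
      (g t : R[i]^o) @[t --> +oo] --> (0 : R[i]^o)
    & (g t : R[i]^o) @[t --> -oo] --> (0 : R[i]^o)].

(* Phi is the *-homomorphism C_0(R) -> End^*(X) that maps t |-> (t + i)^-1 to
   (D + i)^-1. As this function generates C_0(R), there is at most one such Phi
   (its values outside C_0(R) are irrelevant), and there is one when D is
   self-adjoint and regular. *)
Definition C0_calculus D (Phi : (R -> R[i]) -> X -> X) : Prop :=
  [/\ forall (k : R[i]) g h x, C0 g -> C0 h ->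
        Phi (fun t => k * g t + h t) x = k *: Phi g x + Phi h x,
      forall g h x, C0 g -> C0 h ->
        Phi (fun t => g t * h t) x = Phi g (Phi h x),
      forall g, C0 g -> is_adjoint (Phi g) (Phi (fun t => (g t)^*%C))
    & forall x z, Phi (fun t => (t%:C + 'i%C)^-1) z = x <->
        D (x, z - 'i%C *: x)].

(* f(D) for continuous, possibly unbounded f: the closure of the operator
   Phi(g) x |-> Phi(f g) x, for g in C_0(R) with f g in C_0(R). *)
Definition func_calc D (f : R -> R) : set (X * X) :=
  [set p | exists2 Phi, C0_calculus D Phi &
    closure [set q : X * X | exists (g : R -> R[i]) (x : X),
      [/\ C0 g, C0 (fun t => (f t)%:C * g t)
        & q = (Phi g x, Phi (fun t => (f t)%:C * g t) x)]] p].

(* (1 + D^2)^s *)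
Definition bracket_pow D (s : R) : set (X * X) :=
  func_calc D (fun t => (1 + t ^+ 2) `^ s).

Definition eps_bounded (eps : R) D G : Prop :=
  let P := bracket_pow D (- ((1 - eps) / 2)) in
  [/\ dense (dom (comp G P)), norm_bounded (comp G P),
      dense (dom (comp P G)) & norm_bounded (comp P G)].

Definition sgnlog (t : R) : R := Num.sg t * ln (1 + `|t|).

Definition log_transform D : set (X * X) := func_calc D sgnlog.

(* D (1 + D^2)^(-1/2) *)
Definition bounded_transform D : set (X * X) :=
  comp D (bracket_pow D (- (1 / 2))).

(* B is trivially graded, so that a Z/2-grading of X is given by a self-adjoint
   unitary. The value None stands for an odd (ungraded) module. *)
Definition is_grading (gr : option (X -> X)) : Prop :=
  if gr is Some g then (forall x, g (g x) = x) /\ is_adjoint g g else True.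

Definition even_for (gr : option (X -> X)) T : Prop :=
  if gr is Some g then forall x, T (g x) = g (T x) else True.

Definition odd_for (gr : option (X -> X)) G : Prop :=
  if gr is Some g then forall x y, G (x, y) -> G (g x, - g y) else True.

(* Kasparov modules of order m, hence with eps = 1 / m. *)
Definition higher_order_kasparov (A : starAlgType R) (m : R)
    (pi : A -> X -> X) (gr : option (X -> X)) D : Prop :=
  [/\ 0 < m,
      [/\ countably_generated, star_representation pi &
          selfadjoint_regular D],
      forall a, is_compact (comp (graph (pi a)) (bracket_pow D (- (1 / 2)))),
      forall a, (forall x, dom D x -> dom D (pi a x)) /\
        eps_bounded m^-1 D (commutator D (pi a))
    & [/\ is_grading gr, forall a, even_for gr (pi a) & odd_for gr D]].

Definition unbounded_kasparov (A : starAlgType R)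
    (pi : A -> X -> X) (gr : option (X -> X)) D : Prop :=
  higher_order_kasparov 1 pi gr D.

Definition kasparov_module (A : starAlgType R)
    (pi : A -> X -> X) (gr : option (X -> X)) (F : X -> X) : Prop :=
  [/\ countably_generated, star_representation pi,
      exists2 F', is_adjoint F F' &
        forall a, compact_op (fun x => pi a (F x - F' x)),
      forall a, compact_op (fun x => pi a (F (F x) - x)) /\
                compact_op (fun x => F (pi a x) - pi a (F x))
    & [/\ is_grading gr, forall a, even_for gr (pi a) & odd_for gr (graph F)]].

End operators.

Arguments countably_generated {R B} X.

Section path_algebra.
Context {R : realType} (B : cstarAlgType R).
Local Notation C := R[i].

Definition clamp01 (t : R) : R := Num.max 0 (Num.min t 1).

(* C([0,1], B), each path being extended to the real line by its values at the
   end points. *)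
Record path_alg := PathAlg {
  path_fun :> R -> B;
  _ : `[< continuous path_fun /\ path_fun = path_fun \o clamp01 >]
}.

HB.instance Definition _ := [isSub for path_fun].
HB.instance Definition _ := [Choice of path_alg by <:].

Lemma path_cts (f : path_alg) : continuous f.
Proof. by case: f => f /= /asboolP[]. Qed.

Lemma path_clamp (f : path_alg) t : f t = f (clamp01 t).
Proof. by case: f => f /= /asboolP[_ {1}->]. Qed.

Lemma path_eq (f g : path_alg) : (forall t, f t = g t) -> f = g.
Proof. by move=> fg; apply/val_inj/funext. Qed.


Lemma clamp01_id t : 0 <= t <= 1 -> clamp01 t = t.
Proof. by move=> /andP[t0 t1]; rewrite /clamp01 (min_idPl t1) (max_idPr t0). Qed.

Lemma clamp01_itv t : 0 <= clamp01 t <= 1.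
Proof. by rewrite /clamp01 le_max lexx ge_max ler01 ge_min lexx orbT. Qed.

Lemma clamp01K t : clamp01 (clamp01 t) = clamp01 t.
Proof. by rewrite clamp01_id // clamp01_itv. Qed.

Lemma path_subproof (f : R -> B) : continuous f ->
  (forall t, f t = f (clamp01 t)) ->
  `[< continuous f /\ f = f \o clamp01 >].
Proof. by move=> fc fe; apply/asboolP; split => //; apply/funext. Qed.

Definition mk_path (f : R -> B) (fc : continuous f)
  (fe : forall t, f t = f (clamp01 t)) : path_alg :=
  PathAlg (path_subproof fc fe).

Let zero_cts : continuous ((fun=> 0) : R -> B).
Proof. by move=> t; exact: cvg_cst. Qed.

Let add_cts (f g : path_alg) : continuous (fun t => f t + g t).
Proof. by move=> t; apply: cvgD; exact: path_cts. Qed.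

Let opp_cts (f : path_alg) : continuous (fun t => - f t).
Proof. by move=> t; apply: cvgN; exact: path_cts. Qed.

Let scale_cts (k : C) (f : path_alg) : continuous (fun t => k *: f t).
Proof. by move=> t; apply: cvgZr; exact: path_cts. Qed.

Let mul_cts (f g : path_alg) : continuous (fun t => amul (f t) (g t)).
Proof.
move=> t; apply/cvgrPdist_le => /= e e0.
have e20 : 0 < e / 2 by rewrite divr_gt0.
have F0 : 0 < `|f t| + 1 by rewrite ltr_wpDl.
have G0 : 0 < `|g t| + 1 by rewrite ltr_wpDl.
have /cvgrPdist_le fc := @path_cts f t.
have /cvgrPdist_le gc := @path_cts g t.
near=> s.
rewrite -[X in `|X|](_ : amul (f t - f s) (g s) + amul (f t) (g t - g s) = _).
  rewrite (splitr e) (le_trans (ler_normD _ _))// lerD//.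
  - rewrite (le_trans (ler_amul _ _))//.
    rewrite (@le_trans _ _ (e / 2 / (`|g t| + 1) * (`|g t| + 1)))//.
      apply: ler_pM => //.
        by near: s; apply: fc; rewrite divr_gt0.
      have -> : g s = g t - (g t - g s) by rewrite opprB addrC subrK.
      rewrite (le_trans (ler_normB _ _))// lerD2l.
      by near: s; apply: gc.
    by rewrite divfK// gt_eqF.
  - rewrite (le_trans (ler_amul _ _))//.
    rewrite (@le_trans _ _ ((`|f t| + 1) * (e / 2 / (`|f t| + 1))))//.
      apply: ler_pM => //; first by rewrite lerDl.
      by near: s; apply: gc; rewrite divr_gt0.
    by rewrite mulrC divfK// gt_eqF.
have amulNl a b : amul (- a) b = - amul a b :> B.
  by rewrite -scaleN1r amulZl scaleN1r.
have amulNr a b : amul a (- b) = - amul a b :> B.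
  by rewrite -scaleN1r amulZr scaleN1r.
by rewrite amulDl amulDr amulNl amulNr addrC addrA subrK.
Unshelve. all: by end_near. Qed.

Let norm_star_le (a : B) : `|a| <= `|astar a|.
Proof.
have [->|a0] := eqVneq a 0; first by rewrite normr0.
have a1 : 0 < `|a| by rewrite normr_gt0.
by rewrite -(ler_pM2r a1) -expr2 -cstar_identity ler_amul.
Qed.

Lemma norm_astar (a : B) : `|astar a| = `|a|.
Proof.
apply/eqP; rewrite eq_le norm_star_le andbT.
by rewrite -[X in _ <= `|X|]astarK norm_star_le.
Qed.

Let star_cts (f : path_alg) : continuous (fun t => astar (f t)).
Proof.
move=> t; apply/cvgrPdist_le => /= e e0.
have /cvgrPdist_le fc := @path_cts f t.
near=> s.
rewrite -scaleN1r; have -> : -1 = (-1)^*%C :> C by rewrite rmorphN1.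
rewrite -astarZ -astarD norm_astar scaleN1r.
by near: s; exact: fc.
Unshelve. all: by end_near. Qed.

Let zero_clamp : forall t, ((fun=> 0) : R -> B) t = (fun=> 0) (clamp01 t).
Proof. by []. Qed.

Let add_clamp (f g : path_alg) t : f t + g t = f (clamp01 t) + g (clamp01 t).
Proof. by rewrite -!path_clamp. Qed.

Let opp_clamp (f : path_alg) t : - f t = - f (clamp01 t).
Proof. by rewrite -path_clamp. Qed.

Let scale_clamp (k : C) (f : path_alg) t : k *: f t = k *: f (clamp01 t).
Proof. by rewrite -path_clamp. Qed.

Let mul_clamp (f g : path_alg) t :
  amul (f t) (g t) = amul (f (clamp01 t)) (g (clamp01 t)).
Proof. by rewrite -!path_clamp. Qed.

Let star_clamp (f : path_alg) t : astar (f t) = astar (f (clamp01 t)).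
Proof. by rewrite -path_clamp. Qed.

Definition path_zero := mk_path zero_cts zero_clamp.
Definition path_add f g := mk_path (@add_cts f g) (@add_clamp f g).
Definition path_opp f := mk_path (@opp_cts f) (@opp_clamp f).
Definition path_scale k f := mk_path (@scale_cts k f) (@scale_clamp k f).
Definition path_mul f g := mk_path (@mul_cts f g) (@mul_clamp f g).
Definition path_star f := mk_path (@star_cts f) (@star_clamp f).

Let path_addA : associative path_add.
Proof. by move=> f g h; apply: path_eq => t /=; rewrite addrA. Qed.

Let path_addC : commutative path_add.
Proof. by move=> f g; apply: path_eq => t /=; rewrite addrC. Qed.

Let path_add0 : left_id path_zero path_add.
Proof. by move=> f; apply: path_eq => t /=; rewrite add0r. Qed.

Let path_addN : left_inverse path_zero path_opp path_add.
Proof. by move=> f; apply: path_eq => t /=; rewrite addNr. Qed.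

HB.instance Definition _ := GRing.isZmodule.Build path_alg
  path_addA path_addC path_add0 path_addN.

Let path_scaleA k l f : path_scale k (path_scale l f) = path_scale (k * l) f.
Proof. by apply: path_eq => t /=; rewrite scalerA. Qed.

Let path_scale1 : left_id 1 path_scale.
Proof. by move=> f; apply: path_eq => t /=; rewrite scale1r. Qed.

Let path_scaleDr : right_distributive path_scale +%R.
Proof. by move=> k f g; apply: path_eq => t /=; rewrite scalerDr. Qed.

Let path_scaleDl f : {morph path_scale^~ f : k l / k + l}.
Proof. by move=> k l; apply: path_eq => t /=; rewrite scalerDl. Qed.

HB.instance Definition _ := GRing.Zmodule_isLmodule.Build C path_alg
  path_scaleA path_scale1 path_scaleDr path_scaleDl.

Let path_mulA (f g h : path_alg) :
  path_mul f (path_mul g h) = path_mul (path_mul f g) h.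
Proof. by apply: path_eq => t /=; rewrite amulA. Qed.

Let path_mulDl (f g h : path_alg) :
  path_mul (f + g) h = path_mul f h + path_mul g h.
Proof. by apply: path_eq => t /=; rewrite amulDl. Qed.

Let path_mulDr (f g h : path_alg) :
  path_mul f (g + h) = path_mul f g + path_mul f h.
Proof. by apply: path_eq => t /=; rewrite amulDr. Qed.

Let path_mulZl (k : C) (f g : path_alg) :
  path_mul (k *: f) g = k *: path_mul f g.
Proof. by apply: path_eq => t /=; rewrite amulZl. Qed.

Let path_mulZr (k : C) (f g : path_alg) :
  path_mul f (k *: g) = k *: path_mul f g.
Proof. by apply: path_eq => t /=; rewrite amulZr. Qed.

Let path_starK (f : path_alg) : path_star (path_star f) = f.
Proof. by apply: path_eq => t /=; rewrite astarK. Qed.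

Let path_starD (f g : path_alg) :
  path_star (f + g) = path_star f + path_star g.
Proof. by apply: path_eq => t /=; rewrite astarD. Qed.

Let path_starZ (k : C) (f : path_alg) :
  path_star (k *: f) = k^*%C *: path_star f.
Proof. by apply: path_eq => t /=; rewrite astarZ. Qed.

Let path_starM (f g : path_alg) :
  path_star (path_mul f g) = path_mul (path_star g) (path_star f).
Proof. by apply: path_eq => t /=; rewrite astarM. Qed.

HB.instance Definition _ := isStarAlgebra.Build R path_alg
  path_mulA path_mulDl path_mulDr path_mulZl path_mulZr
  path_starK path_starD path_starZ path_starM.

Let nrm (v : B) : R := complex.Re `|v|.

Let nrmE v : (nrm v)%:C = `|v|.
Proof. by rewrite /nrm RRe_real// normr_real. Qed.

Definition path_norm (f : path_alg) : C := (sup (range (nrm \o f)))%:C.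

Let path_ub (f : path_alg) : has_ubound (range (nrm \o f)).
Proof.
have nc : continuous (nrm \o f).
  move=> t; apply/cvgrPdist_le => /= e e0.
  have /cvgrPdist_le fc := @path_cts f t.
  near=> s.
  rewrite -lecR; apply: (@le_trans _ _ `|f t - f s|).
    have -> : (`|nrm (f t) - nrm (f s)|)%:C = `| `|f t| - `|f s| |.
      by rewrite -!nrmE -rmorphB/= normc_def/= expr0n addr0 sqrtr_sqr.
    exact: ler_dist_dist.
  by near: s; apply: fc; rewrite ltcR.
have [c _ hc] := @EVT_max R (nrm \o f) 0 1 ler01
  (continuous_subspaceT nc).
exists (nrm (f c)) => _ [t _ <-] /=.
by rewrite (path_clamp f t); apply: hc; rewrite in_itv/= clamp01_itv.
Unshelve. all: by end_near. Qed.

Lemma le_path_norm (f : path_alg) t : `|f t| <= path_norm f.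
Proof.
by rewrite /path_norm -nrmE lecR; apply: ub_le_sup; [exact: path_ub|exists t].
Qed.

Lemma path_norm_le (f : path_alg) (M : C) :
  (forall t, `|f t| <= M) -> path_norm f <= M.
Proof.
move=> fM; have M0 : 0 <= M by apply: le_trans (fM 0).
rewrite /path_norm -(RRe_real (ger0_real M0)) lecR.
apply: ge_sup; first by exists (nrm (f 0)), 0.
move=> _ [t _ <-] /=.
by rewrite -lecR nrmE RRe_real// ger0_real.
Qed.

Let path_norm_ge0 (f : path_alg) : 0 <= path_norm f.
Proof. exact: le_trans (le_path_norm f 0). Qed.

Let path_normD (f g : path_alg) : path_norm (f + g) <= path_norm f + path_norm g.
Proof.
apply: path_norm_le => t; apply: le_trans (ler_normD _ _) _.
by rewrite lerD// le_path_norm.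
Qed.

Let path_normZ_le (k : C) (f : path_alg) :
  path_norm (k *: f) <= `|k| * path_norm f.
Proof.
by apply: path_norm_le => t; rewrite normrZ ler_wpM2l// le_path_norm.
Qed.

Let path_normZ (k : C) (f : path_alg) : path_norm (k *: f) = `|k| * path_norm f.
Proof.
apply/eqP; rewrite eq_le path_normZ_le/=.
have [->|k0] := eqVneq k 0; first by rewrite normr0 mul0r.
have k1 : 0 < `|k| by rewrite normr_gt0.
rewrite -ler_pdivlMl// -normfV.
by rewrite -{1}[f](scalerK k0) path_normZ_le.
Qed.

Let path_norm0_eq0 (f : path_alg) : path_norm f = 0 -> f = 0.
Proof.
move=> f0; apply: path_eq => t /=; apply/normr0_eq0/eqP.
by rewrite eq_le normr_ge0 andbT -f0 le_path_norm.
Qed.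

HB.instance Definition _ := Lmodule_isNormed.Build C path_alg
  path_normD path_normZ path_norm0_eq0.

Let path_complete (F : set_system path_alg) :
  ProperFilter F -> cauchy F -> cvg F.
Proof.
move=> FF /cauchyP Fc.
have ptc t : cvg ((fun f : path_alg => f t) @ F).
  apply: cauchy_cvg; apply/cauchyP => e e0.
  have [f fF] := Fc e e0; exists (f t).
  apply: (@filterS _ F _ (ball f e)) fF => g.
  rewrite /= -!ball_normE/= => fg.
  exact: le_lt_trans (le_path_norm (f - g) t) fg.
pose l t : B := lim ((fun f : path_alg => f t) @ F).
have lcv t : (fun f : path_alg => f t) @ F --> l t by exact: ptc.
have lun (e : C) : 0 < e ->
    \forall f \near F, forall t, `|(f : path_alg) t - l t| <= e.
  move=> e0; have e30 : 0 < e / 3 by rewrite divr_gt0.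
  have [h hF] := Fc _ e30; apply: (@filterS _ F _ (ball h (e / 3))) (hF) => f hf t.
  have /cvgrPdist_le/(_ _ e30) lF := lcv t.
  have [g [/=]] := filter_ex (filterI hF lF).
  move: hf; rewrite -!ball_normE/= => hf hg lg.
  have -> : e = e / 3 + e / 3 + e / 3 by field.
  have -> : f t - l t = (f t - h t) + (h t - g t) + (g t - l t).
    by rewrite !addrA !subrK.
  rewrite (le_trans (ler_normD _ _))// lerD//; last by rewrite distrC.
  rewrite (le_trans (ler_normD _ _))// lerD//.
    by rewrite distrC; exact: le_trans (le_path_norm (h - f) t) (ltW hf).
  exact: le_trans (le_path_norm (h - g) t) (ltW hg).
have lcts : continuous l.
  move=> t; apply/cvgrPdist_le => /= e e0.
  have e30 : 0 < e / 3 by rewrite divr_gt0.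
  have [f fl] := filter_ex (lun _ e30).
  have /cvgrPdist_le/(_ _ e30) fc := @path_cts f t.
  near=> s.
  have -> : e = e / 3 + e / 3 + e / 3 by field.
  have -> : l t - l s = (l t - f t) + (f t - f s) + (f s - l s).
    by rewrite !addrA !subrK.
  rewrite (le_trans (ler_normD _ _))// lerD//.
  rewrite (le_trans (ler_normD _ _))// lerD//; first by rewrite distrC.
  by near: s.
have lcl t : l t = l (clamp01 t).
  by congr (lim (_ @ F)); apply/funext => f; rewrite -path_clamp.
apply/cvg_ex; exists (mk_path lcts lcl).
apply/cvgrPdist_le => e e0; apply: (@filterS _ F _ _ _ _ (lun _ e0)) => f fl.
by apply: path_norm_le => t /=; rewrite distrC; exact: fl.
Unshelve. all: by end_near. Qed.

HB.instance Definition _ := Uniform_isComplete.Build path_alg path_complete.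

Let path_ler_mul (f g : path_alg) : `|amul f g| <= `|f| * `|g|.
Proof.
apply: path_norm_le => t; apply: le_trans (ler_amul _ _) _.
by rewrite ler_pM// le_path_norm.
Qed.

Let path_cstar (f : path_alg) : `|amul (astar f) f| = `|f| ^+ 2.
Proof.
apply/eqP; rewrite eq_le; apply/andP; split.
  by apply: path_norm_le => t; rewrite cstar_identity ler_sqr ?nnegrE// le_path_norm.
rewrite -ler_sqrtC ?nnegrE ?exprn_ge0// sqrCK//.
apply: path_norm_le => t.
rewrite -(sqrCK (normr_ge0 (f t))) ler_sqrtC ?nnegrE ?exprn_ge0//.
by rewrite -cstar_identity; exact: (le_path_norm (amul (astar f) f)).
Qed.

HB.instance Definition _ := isCStarAlgebra.Build R path_alg
  path_ler_mul path_cstar.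

End path_algebra.

Section KK_theory.
Context {R : realType}.

(* Cycles for KK_0(A, B) (graded) and for KK_1(A, B) (ungraded). *)
Record kk_cycle (A B : cstarAlgType R) := KKCycle {
  kk_mod : hilbModType B;
  kk_rep : A -> kk_mod -> kk_mod;
  kk_gr : option (kk_mod -> kk_mod);
  kk_op : kk_mod -> kk_mod;
  kk_axioms : kasparov_module kk_rep kk_gr kk_op
}.

Arguments kk_mod {A B} c : rename.
Arguments kk_rep {A B} c a x : rename.
Arguments kk_gr {A B} c : rename.
Arguments kk_op {A B} c x : rename.

(* Evaluating the C([0,1], B)-cycle c at t gives c0, up to unitary equivalence:
   the evaluation E (x)_t B of a Hilbert C([0,1], B)-module E is the completion
   of E for the B-valued inner product (x, y) |-> <x, y>(t), so a unitary
   E (x)_t B -> X amounts to a map phi : E -> X as below. *)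
Definition evaluates_to (A B : cstarAlgType R) (t : R)
    (c : kk_cycle A (path_alg B)) (c0 : kk_cycle A B) : Prop :=
  exists phi : kk_mod c -> kk_mod c0,
  [/\ [/\ forall (k : R[i]) x y, phi (k *: x + y) = k *: phi x + phi y,
          forall x b, phi (ract x b) = ract (phi x) (b t),
          forall x y, ip (phi x) (phi y) = (ip x y) t
        & dense (range phi)],
      forall a x, phi (kk_rep c a x) = kk_rep c0 a (phi x),
      forall x, phi (kk_op c x) = kk_op c0 (phi x)
    & match kk_gr c, kk_gr c0 with
      | Some g, Some g0 => forall x, phi (g x) = g0 (phi x)
      | None, None => True
      | _, _ => False
      end].

Definition kk_homotopic (A B : cstarAlgType R) (c0 c1 : kk_cycle A B) : Prop :=
  exists2 c : kk_cycle A (path_alg B),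
    evaluates_to 0 c c0 & evaluates_to 1 c c1.

(* c0 and c1 have the same class in KK_*(A, B). *)
Definition same_kk_class (A B : cstarAlgType R) :
    kk_cycle A B -> kk_cycle A B -> Prop :=
  clos_refl_sym_trans _ (@kk_homotopic A B).

(* A is the C*-closure of the *-algebra calA, and rho the extension to A of the
   representation pi of calA. For the closure of pi(calA) in End^*(X), rho is
   the inclusion; rho need not be injective if calA is a given dense
   *-subalgebra of A. *)
Definition cstar_closure (B : cstarAlgType R) (X : hilbModType B)
    (calA : starAlgType R) (pi : calA -> X -> X) (A : cstarAlgType R)
    (iota : calA -> A) (rho : A -> X -> X) : Prop :=
  [/\ star_morphism iota, dense (range iota), star_representation rho
    & forall a x, rho (iota a) x = pi a x].

(* c is the cycle (A, X, D (1 + D^2)^(-1/2)). *)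
Definition is_bounded_transform (A B : cstarAlgType R) (X : hilbModType B)
    (rho : A -> X -> X) (gr : option (X -> X)) (D : set (X * X))
    (c : kk_cycle A B) : Prop :=
  exists (F : X -> X) (FP : kasparov_module rho gr F),
    graph F = bounded_transform D /\ c = KKCycle FP.

End KK_theory.

(* Main.v *)
(* For |l| >= 1 the identity [(D + il)^-1, a] = - (D + il)^-1 [D, a] (D + il)^-1
   and the eps-boundedness of [D, a] give |[(D + il)^-1, a]| = O(|l|^(-1-d)) with
   d = min(eps, 1). As ln t is (2 / pi) times the integral of ln(x) t / (t^2 + x^2)
   over x > 0, sgnlog is, up to a function in C_0(R), the sum of the functions
   w_n t / (t^2 + n^2) for n >= 1, where w_n is a multiple of the n-th harmonic
   number plus a constant. The w_n grow logarithmically, so the commutators of a with the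
   partial sums, which lie in C_0(R), converge in norm, and their limit is the
   closure of [D_log, a]. Since b f(D) and f(D) b are compact for f in C_0(R), so are
   b [D_log, a] and [D_log, a] b, and hence [D_log, ab] = a [D_log, b] + [D_log, a] b.
   With constant weights w_n the same argument shows that the bounded transform F
   of D is a Kasparov module. The bounded transform of D_log is F + k(D) with k in
   C_0(R), a locally compact perturbation of F, and the straight path F + t k(D) is
   a homotopy; the Hilbert module of paths needs square roots in C([0,1], B). *)

Require Import Defs.
From HB Require Import structures.
From mathcomp Require Import all_boot all_order all_algebra.
From mathcomp Require Import complex ring lra.
From mathcomp Require Import all_classical all_reals all_analysis.
From mathcomp Require Import separable cyclotomic.

Set Implicit Arguments.
Unset Strict Implicit.
Unset Printing Implicit Defensive.
Import Order.TTheory GRing.Theory Num.Theory.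
Import numFieldNormedType.Exports.

Local Open Scope classical_set_scope.
Local Open Scope complex_scope.
Local Open Scope ring_scope.

(** * Real-valued norms and functions on the line *)

(** Everything is derived from the bare axioms of C*-algebras and Hilbert modules, for algebras that
    need not be unital. Cauchy-Schwarz is available only with a constant 4, so operator norms are at
    first known only up to such factors. This is harmless for compactness and for convergent series,
    and where exact estimates matter they come from unimodular functions ([calc_isom]). Missing
    units are replaced by functions vanishing at 0: c G(c) lies in B even when G(c) does not. Only
    operators b f(D) with f in C_0(R) are known to be compact, so the norm limits that represent
    [D_log, a] become compact only after multiplication by some b; hence the products ab in the
    statement. A Kasparov cycle, on the other hand, requires compact commutators [F, a] for every a
    in A, and it has them because products are total in A. Series over the integers replace the
    usual integrals over resolvents: the commutators are then limits of finite sums, and the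
    comparison with the logarithm is reduced to Riemann sums of t / (t^2 + x^2), whose primitive in
    x is an arctangent. *)

Section real_norm.
Context {R : realType}.
Local Notation C := R[i].

(** Norms of R[i]-modules are elements of R[i]; their real parts are accessible to linear arithmetic
    over R. *)
Definition nrm {V : normedZmodType C} (v : V) : R := complex.Re `|v|.

Section zmod.
Context {V : normedZmodType C}.
Implicit Types x y z v : V.

Lemma nrmE v : (nrm v)%:C = `|v|.
Proof. by rewrite /nrm RRe_real// normr_real. Qed.

Lemma nrm_leC v (r : R) : (`|v| <= r%:C) = (nrm v <= r).
Proof. by rewrite -nrmE lecR. Qed.

Lemma nrm_ge0 v : 0 <= nrm v.
Proof. by rewrite -lecR nrmE; exact: normr_ge0. Qed.

Lemma nrm0 : nrm (0 : V) = 0.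
Proof. by rewrite /nrm normr0. Qed.

Lemma nrm_eq0 v : nrm v = 0 -> v = 0.
Proof. by move=> v0; apply/normr0_eq0; rewrite -nrmE v0. Qed.

Lemma nrm_le0 v : nrm v <= 0 -> v = 0.
Proof. by move=> v0; apply/nrm_eq0/eqP; rewrite eq_le v0 nrm_ge0. Qed.

Lemma nrmD x y : nrm (x + y) <= nrm x + nrm y.
Proof. by rewrite -lecR rmorphD/= !nrmE ler_normD. Qed.

Lemma nrmN x : nrm (- x) = nrm x.
Proof. by rewrite /nrm normrN. Qed.

Lemma nrmB x y : nrm (x - y) <= nrm x + nrm y.
Proof. by rewrite -(nrmN y) nrmD. Qed.

Lemma nrm_sym x y : nrm (x - y) = nrm (y - x).
Proof. by rewrite -nrmN opprB. Qed.

Lemma nrm_tri y x z : nrm (x - z) <= nrm (x - y) + nrm (y - z).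
Proof. by rewrite -{1}(subrK y x) -addrA nrmD. Qed.

Lemma nrm_le_dist x y : nrm x <= nrm y + nrm (x - y).
Proof. by rewrite addrC -{1}(subrK y x) nrmD. Qed.

Lemma nrm_sum I (r : seq I) (P : pred I) (F : I -> V) :
  nrm (\sum_(i <- r | P i) F i) <= \sum_(i <- r | P i) nrm (F i).
Proof.
apply: (big_ind2 (fun a b => nrm a <= b)) => [|x a y b xa yb|//].
  by rewrite nrm0.
exact: le_trans (nrmD _ _) (lerD xa yb).
Qed.

Lemma nrm_small_eq0 v : (forall e : R, 0 < e -> nrm v <= e) -> v = 0.
Proof. by move=> h; apply/nrm_le0/ler_addgt0Pr => e e0; rewrite add0r h. Qed.

Lemma nrm_small_eq x y : (forall e : R, 0 < e -> nrm (x - y) <= e) -> x = y.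
Proof. by move=> h; apply/eqP; rewrite -subr_eq0; apply/eqP/nrm_small_eq0. Qed.

End zmod.

Lemma nrmZ {V : normedModType C} (k : C) (v : V) : nrm (k *: v) = nrm k * nrm v.
Proof. by apply: complexI; rewrite rmorphM/= !nrmE normrZ. Qed.

Lemma nrmM (k l : C) : nrm (k * l) = nrm k * nrm l.
Proof. by apply: complexI; rewrite rmorphM/= !nrmE normrM. Qed.

Lemma nrmV (k : C) : nrm k^-1 = (nrm k)^-1.
Proof. by apply: complexI; rewrite fmorphV/= !nrmE normfV. Qed.

Lemma nrmX (k : C) n : nrm (k ^+ n) = nrm k ^+ n.
Proof. by apply: complexI; rewrite rmorphXn/= !nrmE normrX. Qed.

Lemma nrm_conj (k : C) : nrm k^*%C = nrm k.
Proof. by apply: complexI; rewrite !nrmE norm_conjC. Qed.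

Lemma nrm_real (r : R) : nrm r%:C = `|r|.
Proof. by rewrite /nrm normc_def/= expr0n addr0 sqrtr_sqr. Qed.

Lemma nrm1 : nrm (1 : C) = 1.
Proof. by rewrite /nrm normr1. Qed.

Lemma nrmi : nrm ('i%C : C) = 1.
Proof. by rewrite /nrm normc_def/= expr0n expr1n add0r sqrtr1. Qed.

Lemma nrm_sqr (k : C) : nrm k ^+ 2 = complex.Re k ^+ 2 + complex.Im k ^+ 2.
Proof. by rewrite /nrm normc_def/= sqr_sqrtr// addr_ge0// sqr_ge0. Qed.

Lemma nrm_mulJ (k : C) : k^*%C * k = (nrm k ^+ 2)%:C.
Proof.
rewrite nrm_sqr; case: k => a b; apply/eqP; rewrite eq_complex /=.
by rewrite mulNr opprK mulNr [b * a]mulrC subrr !expr2 !eqxx.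
Qed.

Lemma nrm_nat n : nrm (n%:R : C) = n%:R.
Proof. by have := nrm_real n%:R; rewrite rmorph_nat ger0_norm. Qed.

End real_norm.

Section real_norm_topology.
Context {R : realType}.
Local Notation C := R[i].

Lemma posC_real (e : C) : 0 < e -> e = (complex.Re e)%:C /\ 0 < complex.Re e.
Proof.
move=> e0; have ee : e = (complex.Re e)%:C by rewrite RRe_real// gtr0_real.
by split => //; rewrite -ltcR -ee.
Qed.

Lemma nbhs_nrmP (V : normedModType C) (x : V) (A : set V) :
  nbhs x A <-> exists2 e : R, 0 < e & forall y, nrm (x - y) < e -> A y.
Proof.
split => [/nbhs_normP[e /= /posC_real[-> e0] h]|[e e0 h]].
  by exists (complex.Re e) => // y xy; apply: h; rewrite /= -nrmE ltcR.
apply/nbhs_normP; exists e%:C; rewrite /= ?ltcR// => y /=.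
by rewrite -nrmE ltcR; apply: h.
Qed.

Lemma denseP (V : normedModType C) (S : set V) :
  dense S <-> forall x (e : R), 0 < e -> exists2 y, S y & nrm (y - x) < e.
Proof.
split=> [dS x e e0|h O [x Ox] oO].
  have : nbhs x [set y | nrm (y - x) < e].
    by apply/nbhs_nrmP; exists e => // y /=; rewrite nrm_sym.
  rewrite nbhsE => -[U [oU Ux] UA].
  have [|y [Uy Sy]] := dS U _ oU; first by exists x.
  by exists y => //; apply: UA.
have /nbhs_nrmP[e e0 xO] : nbhs x O by exact: open_nbhs_nbhs.
by have [y Sy yx] := h x e e0; exists y; split => //; apply: xO; rewrite nrm_sym.
Qed.

Lemma closureP (V : normedModType C) (S : set V) x :
  closure S x <-> forall e : R, 0 < e -> exists2 y, S y & nrm (y - x) < e.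
Proof.
split=> [cS e e0|h A /nbhs_nrmP[e e0 xA]].
  have /cS[y [Sy yx]] : nbhs x [set y | nrm (y - x) < e].
    by apply/nbhs_nrmP; exists e => // y /=; rewrite nrm_sym.
  by exists y.
by have [y Sy yx] := h e e0; exists y; split => //; apply: xA; rewrite nrm_sym.
Qed.

Lemma closedP (V : normedModType C) (S : set V) :
  closed S <-> forall x,
    (forall e : R, 0 < e -> exists2 y, S y & nrm (y - x) < e) -> S x.
Proof.
by split=> [cS x h|h x cx]; [apply/cS/closureP|apply/h/closureP].
Qed.

Lemma nrm_pair (V W : normedModType C) (p : V * W) :
  nrm p = Num.max (nrm p.1) (nrm p.2).
Proof.
apply: complexI; rewrite nrmE prod_normE -!nrmE /= !maxEle lecR.
by case: ifP.
Qed.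

Definition tends {V : normedZmodType C} (u : nat -> V) (l : V) :=
  forall e : R, 0 < e -> exists N, forall n, (N <= n)%N -> nrm (u n - l) <= e.

Lemma nrm_complete (V : completeNormedModType C) (u : nat -> V) :
  (forall e : R, 0 < e -> exists N, forall n m, (N <= n)%N -> (N <= m)%N ->
    nrm (u n - u m) <= e) -> exists l, tends u l.
Proof.
move=> cu.
have : cvg (u @ \oo).
  apply/cauchy_cvgP/cauchyP => e /posC_real[-> e0].
  have [|N hN] := cu (complex.Re e / 2); first by rewrite divr_gt0.
  exists (u N); exists N => // n /= Nn.
  rewrite -ball_normE/= -nrmE ltcR (le_lt_trans (hN N n _ _))//.
  by rewrite ltr_pdivrMr// ltr_pMr// ltr1n.
move=> /cvg_ex[l /cvgrPdist_le ul]; exists l => e e0.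
have [|N _ hN] := ul e%:C; first by rewrite ltcR.
by exists N => n /hN/=; rewrite nrm_leC nrm_sym.
Qed.

Lemma tends_unique {V : normedZmodType C} (u : nat -> V) l l' :
  tends u l -> tends u l' -> l = l'.
Proof.
move=> ul ul'; apply: nrm_small_eq => e e0.
have e20 : 0 < e / 2 by rewrite divr_gt0.
have [N hN] := ul _ e20; have [M hM] := ul' _ e20.
apply: le_trans (nrm_tri (u (maxn N M)) _ _) _.
rewrite (splitr e) lerD ?hM ?leq_maxr//.
by rewrite nrm_sym hN ?leq_maxl.
Qed.

End real_norm_topology.

(** * Continuous functions on the line and C_0(R) *)

Section C0_functions.
Context {R : realType}.
Local Notation C := R[i].
Implicit Types g h : R -> C.

(** The wrapper fixes the topology [R[i]^o] on the codomain once and keeps [continuous] from being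
    unfolded during unification. *)
Variant cont g : Prop := Cont of continuous (g : R -> R[i]^o).

Lemma contP g : cont g <-> forall t (e : R), 0 < e ->
  exists2 d : R, 0 < d & forall s, `|s - t| < d -> nrm (g s - g t) <= e.
Proof.
split=> [[cg] t e e0|h]; last split=> t.
  have /cvgrPdist_le/(_ e%:C) := cg t; rewrite ltcR => /(_ e0)/nbhs_normP[d /= d0 h].
  exists d => // s st; rewrite nrm_sym -nrm_leC; apply: h => /=.
  by rewrite distrC.
apply/cvgrPdist_le => e /posC_real[-> e0].
have [d d0 hd] := h t _ e0; apply/nbhs_normP; exists d => // s /= st.
by rewrite nrm_leC nrm_sym; apply: hd; rewrite distrC.
Qed.

Lemma C0P g : C0 g <-> cont g /\
  forall e : R, 0 < e -> exists M : R, forall t, M <= `|t| -> nrm (g t) <= e.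
Proof.
split=> [[cg /cvgrPdist_le gp /cvgrPdist_le gm]|[[cg] h]].
  split => [|e e0]; first exact: Cont.
  have eC : 0 < e%:C by rewrite ltcR.
  have [M1 [_ h1]] := gp _ eC; have [M2 [_ h2]] := gm _ eC.
  exists (Num.max (M1 + 1) (1 - M2)) => t; rewrite ge_max => /andP[t1 t2].
  case: (lerP 0 t) => t0.
    have := h1 t; rewrite ger0_norm// in t1 t2.
    by rewrite sub0r normrN nrm_leC; apply; rewrite (lt_le_trans _ t1)// ltrDl.
  have := h2 t; rewrite ltr0_norm// in t1 t2.
  by rewrite sub0r normrN nrm_leC; apply; rewrite -ltrN2 (lt_le_trans _ t2)// ltrDr.
split => //; apply/cvgrPdist_le => e /posC_real[-> e0];
  have [M hM] := h _ e0.
  exists M; split; rewrite ?num_real// => t Mt; rewrite sub0r normrN nrm_leC.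
  by apply: hM; rewrite (le_trans (ltW Mt))// ler_norm.
exists (- M); split; rewrite ?num_real// => t Mt; rewrite sub0r normrN nrm_leC.
by apply: hM; rewrite -normrN (le_trans _ (ler_norm _))// lerNr ltW.
Qed.

Lemma C0_cont g : C0 g -> cont g. Proof. by case. Qed.

Lemma contM g h : cont g -> cont h -> cont (fun t => g t * h t).
Proof. by move=> [cg] [ch]; split=> t; apply: (@cvgM C); [exact: cg|exact: ch]. Qed.

Lemma contD g h : cont g -> cont h -> cont (fun t => g t + h t).
Proof. by move=> [cg] [ch]; split=> t; apply: (@cvgD C C^o); [exact: cg|exact: ch]. Qed.

Lemma cont_cst (k : C) : cont (fun=> k).
Proof. by split=> t; exact: cvg_cst. Qed.

Lemma contN g : cont g -> cont (fun t => - g t).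
Proof. by move=> [cg]; split=> t; apply: (@cvgN C C^o); exact: cg. Qed.

Lemma contB g h : cont g -> cont h -> cont (fun t => g t - h t).
Proof. by move=> cg ch; exact: (contD cg (contN ch)). Qed.

Lemma contV g : cont g -> (forall t, g t != 0) -> cont (fun t => (g t)^-1).
Proof. by move=> [cg] g0; split=> t; apply: (@cvgV C) => //; exact: cg. Qed.

Lemma contR (f : R -> R) : continuous f -> cont (fun t => (f t)%:C).
Proof.
move=> cf; apply/contP => t e e0.
have /cvgrPdist_le/(_ e e0)/nbhs_normP[d /= d0 h] := cf t.
exists d => // s st; rewrite -rmorphB/= nrm_real distrC; apply: h => /=.
by rewrite distrC.
Qed.

Lemma cont_conj g : cont g -> cont (fun t => (g t)^*%C).
Proof.
move=> /contP cg; apply/contP => t e e0; have [d d0 h] := cg t e e0.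
by exists d => // s st; rewrite -rmorphB/= nrm_conj h.
Qed.

Lemma cont_comp g (f : R -> R) : cont g -> continuous f -> cont (fun t => g (f t)).
Proof. by move=> [cg] cf; split=> t; apply: (@continuous_comp _ _ _ f (g : R -> C^o)); [exact: cf|exact: cg]. Qed.

Lemma cont_norm g : cont g -> continuous (fun t => nrm (g t)).
Proof.
move=> /contP cg t; apply/cvgrPdist_le => e e0.
have [d d0 h] := cg t e e0; apply/nbhs_normP; exists d => // s /= st.
apply: le_trans (h s _); last by rewrite distrC.
rewrite ler_norml; apply/andP; split.
  by rewrite lerNl opprB lerBlDl nrm_le_dist.
by rewrite lerBlDl [X in _ + X]nrm_sym nrm_le_dist.
Qed.

Lemma cont_series (g_ : nat -> R -> C) g : (forall n : nat, cont (g_ n)) ->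
  (forall K e : R, 0 < e -> exists n, forall t, `|t| <= K ->
    nrm (g_ n t - g t) <= e) -> cont g.
Proof.
move=> cg_ h; apply/contP => t e e0.
have e30 : 0 < e / 3 by rewrite divr_gt0.
have [n hn] := h (`|t| + 1) _ e30.
have /contP/(_ t _ e30)[d d0 hd] := cg_ n.
(* A radius of at most 1 keeps s in the ball of radius |t| + 1, on which the approximation by [g_ n]
   is uniform. *)
exists (Num.min d 1); first by rewrite lt_min d0 ltr01.
move=> s; rewrite lt_min => /andP[sd s1].
have -> : e = e / 3 + (e / 3 + e / 3) by field.
apply: le_trans (nrm_tri (g_ n s) _ _) _; apply: lerD.
  rewrite nrm_sym hn//; have := ler_normD t (s - t).
  by rewrite addrCA subrr addr0; move/le_trans; apply; rewrite lerD2l ltW.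
apply: le_trans (nrm_tri (g_ n t) _ _) _; apply: lerD; first exact: hd.
by rewrite hn// lerDl.
Qed.

Lemma C0_dom g h : cont g -> C0 h -> (exists K : R, forall t,
  nrm (g t) <= K * nrm (h t)) -> C0 g.
Proof.
move=> cg /C0P[_ h0] [K hK]; apply/C0P; split => // e e0.
have K0 : 0 < `|K| + 1 by rewrite ltr_wpDl.
have [M hM] := h0 (e / (`|K| + 1)) (divr_gt0 e0 K0).
exists M => t /hM ht; apply: le_trans (hK t) _.
have -> : e = (`|K| + 1) * (e / (`|K| + 1)) by rewrite mulrC divfK// gt_eqF.
apply: (@le_trans _ _ ((`|K| + 1) * nrm (h t))); last by rewrite ler_pM2l.
by rewrite ler_wpM2r ?nrm_ge0// (le_trans (ler_norm _))// lerDl.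
Qed.

Lemma C0M g h : C0 g -> cont h -> (exists K, forall t, nrm (h t) <= K) ->
  C0 (fun t => h t * g t).
Proof.
move=> g0 ch [K hK]; apply: (C0_dom _ g0); first by apply: contM => //; exact: C0_cont.
by exists K => t; rewrite nrmM ler_wpM2r ?nrm_ge0.
Qed.

Lemma C0_bounded g : C0 g -> exists2 K, 0 < K & forall t, nrm (g t) <= K.
Proof.
move=> g0; have /C0P[_ h] := g0; have [M hM] := h 1 ltr01.
pose N := `|M| + 1; have N0 : 0 < N by rewrite ltr_wpDl.
have [] := @EVT_max R (fun t => nrm (g t)) (- N) N.
- by move: (ltW N0); lra.
- by apply/continuous_subspaceT; exact: cont_norm (C0_cont g0).
move=> c _ hc; exists (nrm (g c) + 1); first by rewrite ltr_wpDl// nrm_ge0.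
move=> t; case: (lerP `|t| N) => tN.
  by rewrite (le_trans (hc t _))// ?lerDl// in_itv/= -ler_norml.
rewrite (le_trans (hM t _))// ?lerDr ?nrm_ge0//.
by rewrite (le_trans _ (ltW tN))// (le_trans (ler_norm _))// lerDl.
Qed.

Lemma C0D g h : C0 g -> C0 h -> C0 (fun t => g t + h t).
Proof.
move=> /C0P[cg g0] /C0P[ch h0]; apply/C0P; split; first exact: contD.
move=> e e0; have e20 : 0 < e / 2 by rewrite divr_gt0.
have [M1 h1] := g0 _ e20; have [M2 h2] := h0 _ e20.
exists (Num.max M1 M2) => t; rewrite ge_max => /andP[t1 t2].
by rewrite (splitr e) (le_trans (nrmD _ _))// lerD ?h1 ?h2.
Qed.

Lemma C0Z (k : C) g : C0 g -> C0 (fun t => k * g t).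
Proof.
by move=> g0; apply: (@C0M _ (fun=> k)) => //; [exact: cont_cst|exists (nrm k)].
Qed.

Lemma C0N g : C0 g -> C0 (fun t => - g t).
Proof.
by move=> /(@C0Z (-1)) h; congr C0: h; apply/funext => t; rewrite mulN1r.
Qed.

Lemma C0B g h : C0 g -> C0 h -> C0 (fun t => g t - h t).
Proof. by move=> g0 h0; exact: (C0D g0 (C0N h0)). Qed.

Lemma C0_0 : C0 (fun=> 0 : C).
Proof.
apply/C0P; split; first exact: cont_cst.
by move=> e e0; exists 0 => t _; rewrite nrm0 ltW.
Qed.

Lemma C0_mul g h : C0 g -> C0 h -> C0 (fun t => g t * h t).
Proof.
move=> /[dup] g0 /C0_bounded[K _ hK] h0; apply: C0M => //; first exact: C0_cont.
by exists K.
Qed.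

Lemma C0_conj g : C0 g -> C0 (fun t => (g t)^*%C).
Proof.
move=> g0; apply: (C0_dom _ g0); first by apply: cont_conj; exact: C0_cont.
by exists 1 => t; rewrite nrm_conj mul1r.
Qed.

Lemma C0_comp g (f : R -> R) : C0 g -> continuous f ->
  (forall M : R, exists N : R, forall t, N <= `|t| -> M <= `|f t|) ->
  C0 (fun t => g (f t)).
Proof.
move=> /C0P[cg g0] cf pf; apply/C0P; split; first exact: cont_comp.
move=> e /g0[M hM]; have [N hN] := pf M.
by exists N => t /hN /hM.
Qed.

End C0_functions.

(* Reflection behind the tactic lmod: an equation between linear combinations is
   reduced to equations between the coefficients of each atom. *)
(** * Adjointable and compact operators *)

Section linear_combinations.
Context {K : nzRingType} {V : lmodType K}.

Inductive lexpr :=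
  LVar of nat | LZero | LAdd of lexpr & lexpr | LOpp of lexpr | LScale of K & lexpr.

Fixpoint leval (vs : seq V) e : V :=
  match e with
  | LVar i => nth 0 vs i
  | LZero => 0
  | LAdd a b => leval vs a + leval vs b
  | LOpp a => - leval vs a
  | LScale k a => k *: leval vs a
  end.

Fixpoint lcoef e (i : nat) : K :=
  match e with
  | LVar j => (i == j)%:R
  | LZero => 0
  | LAdd a b => lcoef a i + lcoef b i
  | LOpp a => - lcoef a i
  | LScale k a => k * lcoef a i
  end.

Fixpoint lcoef_eq e1 e2 n : Prop :=
  if n is k.+1 then lcoef e1 k = lcoef e2 k /\ lcoef_eq e1 e2 k else True.

Lemma levalE vs e : leval vs e = \sum_(i < size vs) lcoef e i *: nth 0 vs i.
Proof.
elim: e => /= [j||a IHa b IHb|a IHa|k a IHa]; rewrite ?IHa ?IHb.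
- have [js|sj] := ltnP j (size vs); last first.
    rewrite nth_default// big1// => i _; case: eqP => [ij|]; last by rewrite scale0r.
    by have := ltn_ord i; rewrite ij ltnNge sj.
  rewrite (bigD1 (Ordinal js))//= eqxx scale1r big1 ?addr0// => i /eqP ij.
  by case: eqP => [e|]; rewrite ?scale0r//; case: ij; apply/val_inj.
- by rewrite big1// => i _; rewrite scale0r.
- by rewrite -big_split; apply: eq_bigr => i _; rewrite scalerDl.
- by rewrite -sumrN; apply: eq_bigr => i _; rewrite scaleNr.
- by rewrite scaler_sumr; apply: eq_bigr => i _; rewrite scalerA.
Qed.

Lemma leval_eq vs e1 e2 : lcoef_eq e1 e2 (size vs) -> leval vs e1 = leval vs e2.
Proof.
rewrite !levalE; move: (nth 0 vs) => v.
elim: (size vs) => [|n IH] /=; first by rewrite !big_ord0.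
by move=> [e /IH h]; rewrite !big_ord_recr/= h e.
Qed.

End linear_combinations.

Ltac lmod_index x l :=
  lazymatch l with
  | ?a :: ?l' => match a with
    | _ => let _ := match goal with _ => constr_eq a x end in constr:(O)
    | _ => let n := lmod_index x l' in constr:(S n)
    end
  end.

Ltac lmod_mem x l :=
  match l with
  | [::] => constr:(false)
  | ?a :: _ => let _ := match goal with _ => constr_eq a x end in constr:(true)
  | _ :: ?l' => lmod_mem x l'
  end.

Ltac lmod_atoms t l :=
  lazymatch t with
  | (?a + ?b)%R => let l' := lmod_atoms a l in lmod_atoms b l'
  | (- ?a)%R => lmod_atoms a l
  | (_ *: ?a)%R => lmod_atoms a l
  | (0)%R => l
  | _ => lazymatch lmod_mem t l with true => l | false => constr:(t :: l) end
  end.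

Ltac lmod_reify K l t :=
  lazymatch t with
  | (?a + ?b)%R => let x := lmod_reify K l a in let y := lmod_reify K l b in
      constr:(@LAdd K x y)
  | (- ?a)%R => let x := lmod_reify K l a in constr:(@LOpp K x)
  | (?k *: ?a)%R => let x := lmod_reify K l a in constr:(@LScale K k x)
  | (0)%R => constr:(@LZero K)
  | _ => let n := lmod_index t l in constr:(@LVar K n)
  end.

Ltac lmod_with K :=
  lazymatch goal with
  | |- @eq ?T ?a ?b =>
    let l0 := lmod_atoms a (@nil T) in
    let l := lmod_atoms b l0 in
    let x := lmod_reify K l a in
    let y := lmod_reify K l b in
    apply: (@leval_eq K _ l x y); cbn [lcoef_eq lcoef size];
    rewrite ?eqxx/=; repeat split; (ring || by field)
  end.

Ltac lmod := match goal with R : realType |- _ =>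
  lmod_with (R[i] : nzRingType) end.

Section star_algebra_basics.
Context {R : realType} {A : starAlgType R}.
Implicit Types a b c : A.

Lemma amulNl a b : amul (- a) b = - amul a b.
Proof. by rewrite -scaleN1r amulZl scaleN1r. Qed.

Lemma amulNr a b : amul a (- b) = - amul a b.
Proof. by rewrite -scaleN1r amulZr scaleN1r. Qed.

Lemma amulBl a b c : amul (a - b) c = amul a c - amul b c.
Proof. by rewrite amulDl amulNl. Qed.

Lemma amulBr a b c : amul a (b - c) = amul a b - amul a c.
Proof. by rewrite amulDr amulNr. Qed.

Lemma amul0l a : amul 0 a = 0.
Proof. by rewrite -(subrr a) amulBl !subrr. Qed.

Lemma astarN a : astar (- a) = - astar a.
Proof. by rewrite -scaleN1r astarZ rmorphN1 scaleN1r. Qed.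

Lemma astarB a b : astar (a - b) = astar a - astar b.
Proof. by rewrite astarD astarN. Qed.

End star_algebra_basics.

Lemma eq_le_r (R : numDomainType) (x y : R) : x = y -> x <= y.
Proof. by move->. Qed.

Section geometric.
Context {R : realType}.

Lemma tends_le (V : normedZmodType R[i]) (u : nat -> V) l x N (b : R) :
  tends u l -> (forall n, (N <= n)%N -> nrm (u n - x) <= b) -> nrm (l - x) <= b.
Proof.
move=> ul ub; apply/ler_addgt0Pr => e e0; have [M hM] := ul e e0.
apply: le_trans (nrm_tri (u (maxn N M)) _ _) _; rewrite addrC lerD ?ub ?leq_maxl//.
by rewrite nrm_sym hM ?leq_maxr.
Qed.

Lemma small_pow (q c e : R) : 0 <= q -> q < 1 -> 0 < e ->
  exists N, forall n, (N <= n)%N -> c * q ^+ n <= e.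
Proof.
move=> q0 q1 e0; have c0 : 0 < `|c| + 1 by rewrite ltr_wpDl.
have : (GRing.exp q) @ \oo --> (0 : R) by apply: cvg_expr; rewrite ger0_norm.
move=> /cvgrPdist_le/(_ (e / (`|c| + 1)) (divr_gt0 e0 c0))[N _ h].
exists N => n /h; rewrite sub0r normrN normrX ger0_norm// ler_pdivlMr// mulrC.
by apply: le_trans; rewrite ler_wpM2r ?exprn_ge0// (le_trans (ler_norm _))// lerDl.
Qed.

Lemma geometric_dist (V : normedZmodType R[i]) (u : nat -> V) (c q : R) :
  0 <= c -> 0 <= q -> q < 1 -> (forall n, nrm (u n.+1 - u n) <= c * q ^+ n) ->
  forall n m, (n <= m)%N -> nrm (u m - u n) <= c / (1 - q) * q ^+ n.
Proof.
move=> c0 q0 q1 h n m nm; rewrite -(subnKC nm); move: (m - n)%N => k {m nm}; elim: k n => [|k IH] n.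
  by rewrite addn0 subrr nrm0 !mulr_ge0 ?exprn_ge0// invr_ge0 subr_ge0 ltW.
rewrite addnS -addSn (le_trans (nrm_tri (u n.+1) _ _))//.
rewrite (le_trans (lerD (IH _) (h n)))// exprS.
suff -> : c / (1 - q) * (q * q ^+ n) + c * q ^+ n = c / (1 - q) * q ^+ n by [].
by field; rewrite subr_eq0 gt_eqF.
Qed.

Lemma geometric_complete (V : completeNormedModType R[i]) (u : nat -> V) (c q : R) :
  0 <= c -> 0 <= q -> q < 1 -> (forall n, nrm (u n.+1 - u n) <= c * q ^+ n) ->
  exists2 l, tends u l & forall n, nrm (l - u n) <= c / (1 - q) * q ^+ n.
Proof.
move=> c0 q0 q1 h; have hd := geometric_dist c0 q0 q1 h.
have [l ul] : exists l, tends u l.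
  apply: nrm_complete => e e0.
  have [N hN] := small_pow (c / (1 - q)) q0 q1 (divr_gt0 e0 (ltr0n R 2)).
  exists N => n m Nn Nm; apply: le_trans (nrm_tri (u N) _ _) _.
  rewrite (splitr e) lerD// ?[nrm (u N - _)]nrm_sym (le_trans (hd _ _ _))// ?hN//.
by exists l => // n; apply: (tends_le ul) => m; exact: hd.
Qed.

End geometric.

Section hilbert_basics.
Context {R : realType} {B : cstarAlgType R}.

Lemma nrm_amul (a b : B) : nrm (amul a b) <= nrm a * nrm b.
Proof. by rewrite -lecR rmorphM/= !nrmE ler_amul. Qed.

Lemma nrm_star (a : B) : nrm (astar a) = nrm a.
Proof. by rewrite /nrm norm_astar. Qed.

Lemma nrm_cstar (a : B) : nrm (amul (astar a) a) = nrm a ^+ 2.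
Proof. by apply: complexI; rewrite rmorphXn/= !nrmE cstar_identity. Qed.

Context {X : hilbModType B}.
Implicit Types x y z : X.

Lemma ipDl x y z : ip (x + y) z = ip x z + ip y z.
Proof. by rewrite -ip_star ipDr astarD !ip_star. Qed.

Lemma ipZl (k : R[i]) x y : ip (k *: x) y = k^*%C *: ip x y.
Proof. by rewrite -ip_star ipZr astarZ ip_star. Qed.

Lemma ipNl x y : ip (- x) y = - ip x y.
Proof. by rewrite -scaleN1r ipZl rmorphN1 scaleN1r. Qed.

Lemma ipNr x y : ip x (- y) = - ip x y.
Proof. by rewrite -scaleN1r ipZr scaleN1r. Qed.

Lemma ipBl x y z : ip (x - y) z = ip x z - ip y z.
Proof. by rewrite ipDl ipNl. Qed.

Lemma ipBr x y z : ip x (y - z) = ip x y - ip x z.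
Proof. by rewrite ipDr ipNr. Qed.

Lemma ip0l x : ip 0 x = 0.
Proof. by rewrite -(subrr x) ipBl subrr. Qed.

Lemma ip0r x : ip x 0 = 0.
Proof. by rewrite -(subrr x) ipBr subrr. Qed.

Lemma ip_ractl x y b : ip (ract x b) y = amul (astar b) (ip x y).
Proof. by rewrite -ip_star ip_ract astarM ip_star. Qed.

Lemma ip_sumr x I (r : seq I) (F : I -> X) :
  ip x (\sum_(i <- r) F i) = \sum_(i <- r) ip x (F i).
Proof. by elim/big_rec2: _ => [|i y z _ <-]; rewrite ?ip0r ?ipDr. Qed.

Lemma ip_suml x I (r : seq I) (F : I -> X) :
  ip (\sum_(i <- r) F i) x = \sum_(i <- r) ip (F i) x.
Proof. by elim/big_rec2: _ => [|i y z _ <-]; rewrite ?ip0l ?ipDl. Qed.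

Lemma nrm_ip x : nrm x ^+ 2 = nrm (ip x x).
Proof. by apply: complexI; rewrite rmorphXn/= !nrmE hnormE. Qed.

Lemma ip_eq0 x : ip x x = 0 -> x = 0.
Proof.
move=> x0; apply/nrm_eq0/eqP; rewrite -sqrf_eq0; apply/eqP.
by rewrite nrm_ip x0 nrm0.
Qed.

Lemma ip_ext x y : (forall z, ip z x = ip z y) -> x = y.
Proof.
move=> h; apply/eqP; rewrite -subr_eq0; apply/eqP/ip_eq0.
by rewrite ipBr h subrr.
Qed.

Lemma nrm_ract x b : nrm (ract x b) <= nrm x * nrm b.
Proof.
rewrite -(@ler_pXn2r _ 2) ?nnegrE ?mulr_ge0 ?nrm_ge0// nrm_ip ip_ract ip_ractl.
rewrite (le_trans (nrm_amul _ _))// exprMn.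
rewrite (le_trans (ler_wpM2r (nrm_ge0 _) (nrm_amul _ _)))//.
by rewrite nrm_star -nrm_ip; apply: eq_le_r; ring.
Qed.

(** Polarisation: the sum is half the difference of <x + y, x + y> and <x - y, x - y>, and the norms
    of these are squares of norms by [nrm_ip]. *)
Lemma ip_polar_le x y : nrm (ip x y + ip y x) <= (nrm x + nrm y) ^+ 2.
Proof.
have e : 2 *: (ip x y + ip y x) = ip (x + y) (x + y) - ip (x - y) (x - y).
  by rewrite !(ipDl, ipDr, ipNl, ipNr); lmod.
have : nrm (2 *: (ip x y + ip y x)) <= 2 * (nrm x + nrm y) ^+ 2.
  rewrite e (le_trans (nrmB _ _))// -!nrm_ip mulrDl mul1r.
  by rewrite lerD// ler_pXn2r ?nnegrE ?addr_ge0 ?nrm_ge0 ?nrmD ?nrmB.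
by rewrite nrmZ nrm_nat ler_pM2l.
Qed.

(* Weaker than the Cauchy-Schwarz inequality, but needs no positivity in B. *)
Lemma nrm_ip_le x y : nrm (ip x y) <= 4 * nrm x * nrm y.
Proof.
have h (u v : X) : nrm (ip u v) <= (nrm u + nrm v) ^+ 2.
  have e : 2 *: ip u v = (ip u v + ip v u) - 'i%C *: (ip u ('i%C *: v) + ip ('i%C *: v) u).
    have i2 : 'i%C * ('i%C)^*%C = 1 :> R[i] by rewrite mulrC nrm_mulJ nrmi expr1n.
    rewrite ipZr ipZl scalerDr !scalerA i2 -expr2 sqr_i.
    by lmod.
  have : nrm (2 *: ip u v) <= 2 * (nrm u + nrm v) ^+ 2.
    rewrite e (le_trans (nrmB _ _))// mulrDl mul1r nrmZ nrmi mul1r lerD//.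
      exact: ip_polar_le.
    by rewrite (le_trans (ip_polar_le _ _))// nrmZ nrmi mul1r.
  by rewrite nrmZ nrm_nat ler_pM2l.
have [->|x0] := eqVneq x 0; first by rewrite ip0l !nrm0 mulr0 mul0r.
have [->|y0] := eqVneq y 0; first by rewrite ip0r !nrm0 mulr0.
have xp : 0 < nrm x by rewrite lt_neqAle nrm_ge0 eq_sym andbT; apply/eqP => /nrm_eq0/eqP; rewrite (negPf x0).
have yp : 0 < nrm y by rewrite lt_neqAle nrm_ge0 eq_sym andbT; apply/eqP => /nrm_eq0/eqP; rewrite (negPf y0).
(* Rescaling x to the norm of y turns (|x| + |y|)^2 into 4 |y|^2, which is the origin of the
   constant 4. *)
have := h ((nrm y / nrm x)%:C *: x) y.
rewrite ipZl !nrmZ nrm_conj nrm_real ger0_norm ?divr_ge0 ?nrm_ge0// divfK ?gt_eqF//.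
rewrite -ler_pdivlMl ?divr_gt0// invf_div => /le_trans; apply; apply: eq_le_r.
by field; rewrite gt_eqF.
Qed.

End hilbert_basics.

Section adjointable.
Context {R : realType} {B : cstarAlgType R} {X : hilbModType B}.
Implicit Types (x y z : X) (S T : X -> X).

Definition bounded_by T (M : R) := forall x, nrm (T x) <= M * nrm x.

Lemma adj_sym T S : is_adjoint T S -> is_adjoint S T.
Proof. by move=> h x y; rewrite -ip_star -h ip_star. Qed.

Lemma adj_lin T S : is_adjoint T S ->
  forall (k : R[i]) x y, T (k *: x + y) = k *: T x + T y.
Proof.
move=> /adj_sym h k x y; apply: ip_ext => z.
by rewrite ipDr ipZr -!h ipDr ipZr.
Qed.

Lemma adjD T S x y : is_adjoint T S -> T (x + y) = T x + T y.
Proof. by move=> h; rewrite -[x]scale1r (adj_lin h) !scale1r. Qed.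

Lemma adj0 T S : is_adjoint T S -> T 0 = 0.
Proof. by move=> h; apply: ip_ext => z; rewrite -(adj_sym h) !ip0r. Qed.

Lemma adjZ T S (k : R[i]) x : is_adjoint T S -> T (k *: x) = k *: T x.
Proof. by move=> h; rewrite -[k *: x]addr0 (adj_lin h) (adj0 h) addr0. Qed.

Lemma adjN T S x : is_adjoint T S -> T (- x) = - T x.
Proof. by move=> h; rewrite -scaleN1r (adjZ _ _ h) scaleN1r. Qed.

Lemma adjB T S x y : is_adjoint T S -> T (x - y) = T x - T y.
Proof. by move=> h; rewrite (adjD _ _ h) (adjN _ h). Qed.

Lemma adj_ract T S x b : is_adjoint T S -> T (ract x b) = ract (T x) b.
Proof.
move=> /adj_sym h; apply: ip_ext => z.
by rewrite ip_ract -!h ip_ract.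
Qed.

Lemma adj_sum T S I (r : seq I) (F : I -> X) : is_adjoint T S ->
  T (\sum_(i <- r) F i) = \sum_(i <- r) T (F i).
Proof.
move=> h; elim/big_rec2: _ => [|i y z _ <-]; first exact: adj0 h.
by rewrite (adjD _ _ h).
Qed.

Lemma is_adjoint_id : is_adjoint (fun x => x) (fun x : X => x).
Proof. by []. Qed.

Lemma is_adjoint_comp T S T' S' : is_adjoint T S -> is_adjoint T' S' ->
  is_adjoint (fun x => T (T' x)) (fun x => S' (S x)).
Proof. by move=> h h' x y; rewrite h h'. Qed.

Lemma is_adjoint_lin (k : R[i]) T S T' S' : is_adjoint T S -> is_adjoint T' S' ->
  is_adjoint (fun x => k *: T x + T' x) (fun x => k^*%C *: S x + S' x).
Proof. by move=> h h' x y; rewrite ipDl ipDr ipZl ipZr h h'. Qed.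

Lemma is_adjointB T S T' S' : is_adjoint T S -> is_adjoint T' S' ->
  is_adjoint (fun x => T x - T' x) (fun x => S x - S' x).
Proof. by move=> h h' x y; rewrite ipBl ipBr h h'. Qed.

Lemma is_adjointZ (k : R[i]) T S : is_adjoint T S ->
  is_adjoint (fun x => k *: T x) (fun x => k^*%C *: S x).
Proof. by move=> h x y; rewrite ipZl ipZr h. Qed.

(* Sokal's gliding hump: y is built as a sum of multiples 17^-n of the
   normalised T x_n, with signs keeping <T x_n, y> = <x_n, S y> large. *)
Lemma adjointable_bounded T S : is_adjoint T S ->
  exists2 M, 0 <= M & bounded_by T M.
Proof.
move=> h; apply: contrapT => nb.
(* With ratio 1/17 all corrections after step n sum to at most q^n / 16, so the constant 4 of
   [nrm_ip_le] makes them cost at most a quarter of q^n |T x_n|. *)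
pose q : R := 17^-1.
have q0 : 0 < q by rewrite invr_gt0.
have q1 : q < 1 by rewrite invf_lt1// ltr1n.
have /choice[x hx] (n : nat) : exists x, nrm x = 1 /\ n.+1%:R / q ^+ n * 2 < nrm (T x).
  apply: contrapT => hn; apply: nb; exists (n.+1%:R / q ^+ n * 2).
    by rewrite !mulr_ge0// invr_ge0 exprn_ge0// ltW.
  move=> x; have [->|x0] := eqVneq x 0; first by rewrite (adj0 h) !nrm0 mulr0.
  have xp : 0 < nrm x.
    by rewrite lt_neqAle nrm_ge0 eq_sym andbT; apply/eqP => /nrm_eq0/eqP; rewrite (negPf x0).
  rewrite leNgt; apply/negP => xn; apply: hn.
  exists ((nrm x)^-1%:C *: x); rewrite (adjZ _ _ h) !nrmZ nrm_real ger0_norm ?invr_ge0 ?ltW//.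
  by rewrite mulVf ?gt_eqF//; split => //; rewrite [ltRHS]mulrC ltr_pdivlMr.
have Tp n : 0 < nrm (T (x n)).
  apply: lt_trans (hx n).2; rewrite !mulr_gt0// invr_gt0 exprn_gt0//.
pose z n := (q ^+ n / nrm (T (x n)))%:C *: T (x n).
have zn n : nrm (z n) = q ^+ n.
  rewrite nrmZ nrm_real ger0_norm ?divr_ge0 ?nrm_ge0 ?exprn_ge0// ?divfK ?gt_eqF//.
  exact: ltW.
have ipz n : nrm (ip (T (x n)) (z n)) = q ^+ n * nrm (T (x n)).
  rewrite ipZr nrmZ nrm_real ger0_norm ?divr_ge0 ?nrm_ge0 ?exprn_ge0//; last exact: ltW.
  by rewrite -nrm_ip expr2 mulrA divfK ?gt_eqF.
pose step n y := if q ^+ n * nrm (T (x n)) <= nrm (ip (T (x n)) (y + z n))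
  then y + z n else y - z n.
(* One of the two signs always works, since <T x_n, z_n> is half the difference of the two candidate
   values. *)
have stepP n y : q ^+ n * nrm (T (x n)) <= nrm (ip (T (x n)) (step n y)).
  rewrite /step; case: ifPn => //; rewrite -ltNge => hlt.
  have e : 2 *: ip (T (x n)) (z n) = ip (T (x n)) (y + z n) - ip (T (x n)) (y - z n).
    by rewrite !(ipDr, ipNr); lmod.
  have := nrmB (ip (T (x n)) (y + z n)) (ip (T (x n)) (y - z n)).
  rewrite -e nrmZ nrm_nat ipz mulrDl mul1r => /le_trans/(_ (lerD (ltW hlt) (lexx _))).
  by rewrite lerD2l.
pose y := fix y n := if n is k.+1 then step k (y k) else 0.
have ys n : nrm (y n.+1 - y n) <= 1 * q ^+ n.
  rewrite mul1r -zn /= /step; case: ifP => _; first by rewrite addrC addKr.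
  by rewrite addrC addKr nrmN.
have [l _ hl] := geometric_complete ler01 (ltW q0) q1 ys.
have low n : n.+1%:R <= nrm (ip (x n) (S l)).
  rewrite -h; have a := stepP n (y n); have b := hl n.+1.
  have c : nrm (ip (T (x n)) (y n.+1)) <= nrm (ip (T (x n)) l) + nrm (ip (T (x n)) (y n.+1 - l)).
    by rewrite ipBr nrm_le_dist.
  have d := nrm_ip_le (T (x n)) (y n.+1 - l).
  have [_ e] := hx n.
  have f : 1 / (1 - q) * q ^+ n.+1 = q ^+ n / 16 by rewrite /q exprS; field.
  rewrite nrm_sym f in b.
  have g : 4 * nrm (T (x n)) * nrm (y n.+1 - l) <= 4 * nrm (T (x n)) * (q ^+ n / 16).
    by rewrite ler_wpM2l// mulr_ge0 ?nrm_ge0.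
  have k : n.+1%:R * 2 < q ^+ n * nrm (T (x n)).
    by move: e; rewrite mulrAC ltr_pdivrMr ?exprn_gt0// [ltRHS]mulrC.
  have k0 : 0 <= n.+1%:R :> R by [].
  rewrite -/(y n.+1) in a.
  move: (nrm (ip _ (y n.+1))) a c => A a c.
  move: (nrm (ip _ (y n.+1 - l))) c d => A' c d.
  by lra.
pose N := Num.Def.archi_bound (4 * nrm (S l)).
have := low N; have [x1 _] := hx N.
have := nrm_ip_le (x N) (S l); rewrite x1 mulr1 => /[swap] /le_trans/[apply].
rewrite leNgt => /negP; apply.
have := archi_boundP (mulr_ge0 (ler0n R 4) (nrm_ge0 (S l))); move/lt_le_trans; apply.
by rewrite ler_nat.
Qed.

(** |S y|^2 is the norm of <T S y, y>, so [nrm_ip_le] bounds it by 4 M |S y| |y|. *)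
Lemma adj_bound T S M : is_adjoint T S -> bounded_by T M ->
  0 <= M -> bounded_by S (4 * M).
Proof.
move=> h hT M0 y; have [->|y0] := eqVneq (S y) 0.
  by rewrite nrm0 !mulr_ge0// nrm_ge0.
have Sp : 0 < nrm (S y).
  by rewrite lt_neqAle nrm_ge0 eq_sym andbT; apply/eqP => /nrm_eq0/eqP; rewrite (negPf y0).
rewrite -(ler_pM2l Sp) -expr2 nrm_ip -h (le_trans (nrm_ip_le _ _))//.
have := hT (S y); rewrite -(ler_pM2r (x := 4 * nrm y + 1)); last by rewrite ltr_wpDl ?mulr_ge0 ?nrm_ge0.
move=> _; rewrite [leRHS](_ : _ = 4 * (M * nrm (S y)) * nrm y); last by ring.
by rewrite ler_wpM2r ?nrm_ge0// ler_wpM2l.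
Qed.

Lemma adj_tends T S u l : is_adjoint T S -> tends u l ->
  tends (fun n => T (u n)) (T l).
Proof.
move=> h ul e e0; have [M M0 hM] := adjointable_bounded h.
have M1 : 0 < M + 1 by rewrite ltr_wpDl.
have [N hN] := ul _ (divr_gt0 e0 M1); exists N => n /hN; rewrite ler_pdivlMr// mulrC.
rewrite -(adjB _ _ h); apply: le_trans; apply: le_trans (hM _) _.
by rewrite ler_wpM2r ?nrm_ge0// lerDl.
Qed.

End adjointable.

Section compact_operators.
Context {R : realType} {B : cstarAlgType R} {X : hilbModType B}.
Implicit Types (x y z : X) (S T K : X -> X).

Lemma compactP K : compact_op K <-> forall e : R, 0 < e ->
  exists n (x y : 'I_n -> X), forall z,
    nrm (K z - \sum_(j < n) ract (x j) (ip (y j) z)) <= e * nrm z.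
Proof.
split=> h e /h[n [x [y hxy]]]; exists n, x, y => z.
  by rewrite -lecR nrmE rmorphM/= nrmE.
by rewrite -!nrmE -rmorphM lecR.
Qed.

Lemma compact0 : compact_op (fun _ : X => 0 : X).
Proof.
apply/compactP => e e0; exists 0%N, (fun=> 0), (fun=> 0) => z.
by rewrite big_ord0 subr0 nrm0 mulr_ge0 ?nrm_ge0 ?ltW.
Qed.

Lemma compact_eq K K' : (forall x, K x = K' x) -> compact_op K -> compact_op K'.
Proof. by move=> /funext ->. Qed.

Lemma compact_lim K : (forall e : R, 0 < e -> exists2 K', compact_op K' &
  forall z, nrm (K z - K' z) <= e * nrm z) -> compact_op K.
Proof.
move=> h; apply/compactP => e e0; have e20 : 0 < e / 2 by rewrite divr_gt0.
have [K' /compactP/(_ _ e20)[n [x [y hxy]]] hK] := h _ e20.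
exists n, x, y => z; apply: le_trans (nrm_tri (K' z) _ _) _.
by rewrite (splitr e) mulrDl lerD.
Qed.

Lemma compactD K K' : compact_op K -> compact_op K' ->
  compact_op (fun x => K x + K' x).
Proof.
move=> /compactP h /compactP h'; apply/compactP => e e0.
have e20 : 0 < e / 2 by rewrite divr_gt0.
have [n [x [y hxy]]] := h _ e20; have [n' [x' [y' hxy']]] := h' _ e20.
exists (n + n')%N, (fun i : 'I_(n + n') => match fintype.split i with inl j => x j | inr j => x' j end),
  (fun i : 'I_(n + n') => match fintype.split i with inl j => y j | inr j => y' j end) => z.
rewrite big_split_ord /=.
under eq_bigr => i _ do rewrite (unsplitK (inl i)).
under [X in _ - (_ + X)]eq_bigr => i _ do rewrite (unsplitK (inr i)).
by rewrite opprD addrACA (splitr e) mulrDl (le_trans (nrmD _ _))// lerD.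
Qed.

Lemma compact_compl K T S : is_adjoint T S -> compact_op K ->
  compact_op (fun x => T (K x)).
Proof.
move=> hT /compactP hK; apply/compactP => e e0.
have [M M0 hM] := adjointable_bounded hT.
have M1 : 0 < M + 1 by rewrite ltr_wpDl.
have [n [x [y hxy]]] := hK _ (divr_gt0 e0 M1).
exists n, (fun j => T (x j)), y => z.
under eq_bigr => i _ do rewrite -(adj_ract _ _ hT).
rewrite -(adj_sum _ _ hT) -(adjB _ _ hT) (le_trans (hM _))//.
apply: (@le_trans _ _ ((M + 1) * (e / (M + 1) * nrm z))).
  by apply: ler_pM; rewrite ?nrm_ge0// lerDl.
by rewrite mulrA mulrC [(M + 1) * _]mulrC divfK ?gt_eqF// mulrC.
Qed.

Lemma compact_compr K T S : is_adjoint T S -> compact_op K ->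
  compact_op (fun x => K (T x)).
Proof.
move=> hT /compactP hK; apply/compactP => e e0.
have [M M0 hM] := adjointable_bounded hT.
have M1 : 0 < M + 1 by rewrite ltr_wpDl.
have [n [x [y hxy]]] := hK _ (divr_gt0 e0 M1).
exists n, x, (fun j => S (y j)) => z.
under eq_bigr => i _ do rewrite (adj_sym hT).
apply: le_trans (hxy _) _.
apply: (@le_trans _ _ (e / (M + 1) * ((M + 1) * nrm z))).
  rewrite ler_wpM2l ?divr_ge0 ?(ltW e0) ?(ltW M1)//.
  by rewrite (le_trans (hM z))// ler_wpM2r ?nrm_ge0// lerDl.
by rewrite mulrA divfK ?gt_eqF.
Qed.

Lemma compactZ (k : R[i]) K : compact_op K -> compact_op (fun x => k *: K x).
Proof. by move=> hK; apply: (compact_compl (is_adjointZ k is_adjoint_id) hK). Qed.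

Lemma compactN K : compact_op K -> compact_op (fun x => - K x).
Proof. by move=> /(compactZ (-1)); apply: compact_eq => x; rewrite scaleN1r. Qed.

Lemma compactB K K' : compact_op K -> compact_op K' ->
  compact_op (fun x => K x - K' x).
Proof. by move=> hK /compactN; exact: compactD. Qed.

(** The adjoint of a finite sum of rank one operators exchanges the families x and y. The error is
    taken as e / 4 to absorb the factor in [adj_bound]. *)
Lemma compact_adj K S : is_adjoint K S -> compact_op K -> compact_op S.
Proof.
move=> hKS /compactP hK; apply/compactP => e e0.
have [|n [x [y hxy]]] := hK (e / 4); first by rewrite divr_gt0.
exists n, y, x => z.
have hF : is_adjoint (fun z => K z - \sum_(j < n) ract (x j) (ip (y j) z))
    (fun z => S z - \sum_(j < n) ract (y j) (ip (x j) z)).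
  move=> u v; rewrite ipBl ipBr hKS ip_suml ip_sumr; congr (_ - _).
  by apply: eq_bigr => j _; rewrite ip_ractl ip_ract ip_star.
have e40 : 0 <= e / 4 by rewrite divr_ge0 ?(ltW e0).
by have := adj_bound hF hxy e40 z; rewrite mulrCA divff ?mulr1.
Qed.

End compact_operators.

(** * Cayley transform and Fejer approximation *)

Section conjugation.
Context {R : rcfType}.
Implicit Types x y : R[i].

Lemma conjD x y : (x + y)^*%C = x^*%C + y^*%C. Proof. exact: rmorphD. Qed.
Lemma conjB x y : (x - y)^*%C = x^*%C - y^*%C. Proof. exact: rmorphB. Qed.
Lemma conjN x : (- x)^*%C = - x^*%C. Proof. exact: rmorphN. Qed.
Lemma conjM x y : (x * y)^*%C = x^*%C * y^*%C. Proof. exact: rmorphM. Qed.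
Lemma conjV x : (x^-1)^*%C = (x^*%C)^-1. Proof. exact: fmorphV. Qed.
Lemma conjX x n : (x ^+ n)^*%C = x^*%C ^+ n. Proof. exact: rmorphXn. Qed.
Lemma conj1 : (1 : R[i])^*%C = 1. Proof. exact: rmorph1. Qed.

Lemma conji : ('i%C : R[i])^*%C = - 'i%C.
Proof. by apply/eqP; rewrite eq_complex /= oppr0 !eqxx. Qed.

Lemma conj_real (t : R) : (t%:C : R[i])^*%C = t%:C.
Proof. by apply/eqP; rewrite eq_complex /= oppr0 !eqxx. Qed.

End conjugation.

Section roots.
Context {R : realType}.
Local Notation C := R[i].

Lemma prim_root_exists n : (0 < n)%N -> exists z : C, n.-primitive_root z.
Proof.
move=> n0; pose p : {poly C} := 'X^n - 1; have [r Dp] := closed_field_poly_normal p.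
rewrite (monicP _) ?monicXnsubC // scale1r in Dp.
have rn1 : all n.-unity_root r by apply/allP=> z; rewrite -root_prod_XsubC -Dp.
have sz_r : (n < (size r).+1)%N by rewrite -(size_prod_XsubC r id) -Dp size_XnsubC.
have [|z] := hasP (cyclic.has_prim_root n0 rn1 _ sz_r); last by exists z.
by rewrite -separable_prod_XsubC -Dp separable_Xn_sub_1 // pnatr_eq0 -lt0n.
Qed.

Lemma conj_unit (z : C) : nrm z = 1 -> z^*%C * z = 1.
Proof. by move=> z1; rewrite nrm_mulJ z1 expr1n. Qed.

(* The N-th roots of -1 are used instead of those of 1, since the Cayley
   transform of the real line misses the point 1. *)
Lemma minus_one_roots N : (0 < N)%N -> exists w : 'I_N -> C,
  [/\ forall j, nrm (w j) = 1, forall j, w j ^+ N = -1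
    & forall k l, (k < N)%N -> (l < N)%N ->
        \sum_j (w j)^*%C ^+ k * w j ^+ l = if k == l then N%:R else 0].
Proof.
move=> N0; have [|z pz] := @prim_root_exists (N * 2)%N; first by rewrite muln_gt0 N0.
have zN : z ^+ N = -1.
  have : (z ^+ N - 1) * (z ^+ N + 1) = 0.
    by rewrite -subr_sqr expr1n -exprM prim_expr_order// subrr.
  move/eqP; rewrite mulf_eq0 => /orP[|]; last by rewrite addr_eq0 => /eqP.
  rewrite subr_eq0 -(prim_order_dvd pz) => /dvdn_leq; rewrite N0 => /(_ isT).
  by rewrite leqNgt ltn_Pmulr.
have z1 : nrm z = 1.
  have : nrm z ^+ N == 1 by rewrite -nrmX zN nrmN nrm1.
  by rewrite pexpr_eq1// ?nrm_ge0// => /eqP.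
pose w (j : 'I_N) := z ^+ (2 * j).+1.
have w1 j : nrm (w j) = 1 by rewrite nrmX z1 expr1n.
have wN j : w j ^+ N = -1.
  by rewrite -exprM mulnC exprM zN exprS exprM sqrrN !expr1n mulr1.
have sw m : (0 < m)%N -> (m < N)%N -> \sum_j w j ^+ m = 0.
  move=> m0 mN; have zm : z ^+ (2 * m) - 1 != 0.
    rewrite subr_eq0 -(prim_order_dvd pz); apply/negP => /dvdn_leq.
    by rewrite muln_gt0 m0 => /(_ isT); rewrite mulnC leq_pmul2l// leqNgt mN.
  apply: (mulfI zm); rewrite mulr0.
  have -> : \sum_j w j ^+ m = z ^+ m * \sum_(j < N) (z ^+ (2 * m)) ^+ j.
    rewrite mulr_sumr; apply: eq_bigr => j _; rewrite -!exprM -exprD.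
    by congr (_ ^+ _); rewrite mulSn; congr addn; ring.
  rewrite mulrCA -subrX1 -exprM mulnAC [(2 * N)%N]mulnC exprM (prim_expr_order pz).
  by rewrite expr1n subrr mulr0.
exists w; split => // k l kN lN; case: eqVneq => [->|kl].
  rewrite (eq_bigr (fun=> 1)) ?sumr_const ?card_ord// => j _.
  by rewrite -exprMn conj_unit// expr1n.
have [lk|kl' |ekl] := ltngtP l k; last by rewrite ekl eqxx in kl.
- rewrite (eq_bigr (fun j => (w j ^+ (k - l))^*%C)); last first.
    move=> j _; rewrite -{1}(subnK (ltnW lk)) exprD -mulrA -exprMn conj_unit//.
    by rewrite expr1n mulr1 -conjX.
  by rewrite -rmorph_sum sw ?rmorph0// ?subn_gt0// (leq_ltn_trans (leq_subr _ _)).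
- rewrite (eq_bigr (fun j => w j ^+ (l - k))); last first.
    move=> j _; rewrite -{1}(subnK (ltnW kl')) exprD mulrCA -exprMn conj_unit//.
    by rewrite expr1n mulr1.
  by rewrite sw ?subn_gt0// (leq_ltn_trans (leq_subr _ _)).
Qed.

End roots.

Section cayley.
Context {R : realType}.
Local Notation C := R[i].

Definition cay (t : R) : C := (t%:C - 'i%C) / (t%:C + 'i%C).

Lemma nrm_addi (t l : R) : nrm (t%:C + l%:C * 'i%C) ^+ 2 = t ^+ 2 + l ^+ 2.
Proof. by rewrite nrm_sqr/= !(mul0r, mulr0, mulr1, subr0, addr0, add0r). Qed.

Lemma addi_neq0 (t l : R) : l != 0 -> t%:C + l%:C * 'i%C != 0.
Proof.
move=> l0; apply/eqP => h; have := nrm_addi t l; rewrite h nrm0 expr0n => /esym/eqP.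
by rewrite paddr_eq0 ?sqr_ge0// !sqrf_eq0 (negPf l0) andbF.
Qed.

Lemma addi1_neq0 (t : R) : t%:C + 'i%C != 0.
Proof. by have := addi_neq0 t (oner_neq0 R); rewrite rmorph1 mul1r. Qed.

Lemma subi1_neq0 (t : R) : t%:C - 'i%C != 0.
Proof.
have : (-1 : R) != 0 by rewrite oppr_eq0 oner_neq0.
by move=> /(addi_neq0 t); rewrite rmorphN1 mulN1r.
Qed.

Lemma i_neq0 : 'i%C != 0 :> C.
Proof.
apply/eqP => h; have := @nrmi R; rewrite h nrm0 => /esym/eqP.
by rewrite oner_eq0.
Qed.

Lemma ii : 'i%C * 'i%C = -1 :> C.
Proof. by rewrite -expr2 sqr_i. Qed.

Lemma cay_conj t : (cay t)^*%C * cay t = 1.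
Proof.
rewrite /cay conjM conjV conjB conjD conj_real conji opprK.
by field; rewrite addi1_neq0 subi1_neq0.
Qed.

Lemma nrm_cay t : nrm (cay t) = 1.
Proof.
have : nrm (cay t) ^+ 2 == 1.
  by have := cay_conj t; rewrite nrm_mulJ => /(@complexI _ _ 1) ->.
by rewrite sqrf_eq1 => /orP[/eqP//|/eqP h]; have := nrm_ge0 (cay t); rewrite h lerNr oppr0 ler10.
Qed.

Lemma cay_surj (z : C) : nrm z = 1 -> z != 1 -> exists t, cay t = z.
Proof.
move=> z1 zn1; have z0 : z != 0.
  by apply/eqP => z0; move: z1; rewrite z0 nrm0 => /esym/eqP; rewrite oner_eq0.
have dz : 1 - z != 0 by rewrite subr_eq0 eq_sym.
pose c := 'i%C * (1 + z) / (1 - z).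
have cz : z^*%C = z^-1 by apply: (mulIf z0); rewrite conj_unit// mulVf.
have cc : c^*%C = c.
  rewrite /c !conjM conjV conjD conjB conji conj1 cz.
  by field; rewrite z0 dz -opprB oppr_eq0 dz.
have cr : (complex.Re c)%:C = c.
  by move: cc; case: c => a b [/eqP]; rewrite eqNr => /eqP ->.
exists (complex.Re c); rewrite /cay cr.
have e1 : c - 'i%C = 2 * 'i%C * z / (1 - z) by rewrite /c; field.
have e2 : c + 'i%C = 2 * 'i%C / (1 - z) by rewrite /c; field.
rewrite e1 e2; field; rewrite dz /= .
exact: i_neq0.
Qed.

(** The chordal metric of the circle in the coordinates of the line. It is what allows a comparison
    of closeness under [cay] with closeness in R. *)
Lemma cay_dist s t : nrm (cay s - cay t) ^+ 2 * ((s ^+ 2 + 1) * (t ^+ 2 + 1)) =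
  4 * (s - t) ^+ 2.
Proof.
have ns := nrm_addi s 1; have nt := nrm_addi t 1; rewrite rmorph1 mul1r expr1n in ns nt.
rewrite -ns -nt -!exprMn -!nrmM.
have -> : (cay s - cay t) * ((s%:C + 'i%C) * (t%:C + 'i%C)) = (2 * (s - t))%:C * 'i%C.
  by rewrite /cay !rmorphM rmorphB /= rmorph_nat; field; rewrite !addi1_neq0.
by rewrite nrmM nrmi mulr1 nrm_real -normrX ger0_norm ?sqr_ge0// exprMn; ring.
Qed.

(* By the discrete Fourier transform at the N-th roots of -1. *)
Lemma cay_coef (p : {poly C}) M : (forall t, nrm p.[cay t] <= M) ->
  forall k, nrm p`_k <= M.
Proof.
move=> hM k; have M0 : 0 <= M by apply: le_trans (hM 0); exact: nrm_ge0.
have [kp|pk] := ltnP k (size p); last by rewrite nth_default// nrm0.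
have p0 : (0 < size p)%N by exact: leq_ltn_trans kp.
have [w [w1 wN ow]] := @minus_one_roots R _ p0.
have pw j : nrm p.[w j] <= M.
  have [|t <-//] := cay_surj (w1 j); apply/eqP => h; have := wN j; rewrite h expr1n.
  by move/eqP; rewrite -addr_eq0 -mulr2n pnatr_eq0.
have e : (size p)%:R * p`_k = \sum_j (w j)^*%C ^+ k * p.[w j].
  under eq_bigr => j _ do rewrite horner_coef mulr_sumr.
  rewrite exchange_big /= (bigD1 (Ordinal kp))//= [X in _ + X]big1 ?addr0.
    under eq_bigr => j _ do rewrite mulrCA.
    by rewrite -mulr_sumr ow// eqxx mulrC.
  move=> l /eqP kl; under eq_bigr => j _ do rewrite mulrCA.
  rewrite -mulr_sumr ow//; case: eqP => [h|]; last by rewrite mulr0.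
  by case: kl; apply/val_inj.
have pp : 0 < (size p)%:R :> R by rewrite ltr0n.
rewrite -(ler_pM2l pp) -(@nrm_nat R) -nrmM e (le_trans (nrm_sum _ _ _))//.
rewrite (le_trans (ler_sum _ (fun j _ => _ : _ <= M)))//; last first.
  by rewrite sumr_const card_ord nrm_nat mulr_natl.
by move=> j _; rewrite nrmM nrmX nrm_conj w1 expr1n mul1r.
Qed.

(** Heine-Cantor, except that only t is confined to the segment: s may leave it, which avoids a case
    distinction at the end points. *)
Lemma unif_cont_seg (V : normedZmodType C) (g : R -> V) (K e : R) :
  (forall t (e : R), 0 < e ->
    exists2 d : R, 0 < d & forall s, `|s - t| < d -> nrm (g s - g t) <= e) ->
  0 < e ->
  exists2 d : R, 0 < d & forall s t, `|t| <= K -> `|s - t| < d -> nrm (g s - g t) <= e.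
Proof.
move=> cg e0; have e20 : 0 < e / 2 by rewrite divr_gt0.
have := @segment_compact R (- K) K; rewrite compact_near_coveringP => hc.
have hP : forall x, `[- K, K]%classic x -> \forall x' \near x & d \near (0 : R)^'+,
    forall s, `|s - x'| < d -> nrm (g s - g x') <= e.
  move=> x _; have [d d0 hd] := cg x _ e20.
  have d20 : 0 < d / 2 by rewrite divr_gt0.
  exists ([set x' | `|x - x'| < d / 2], [set d' | d' < d / 2]).
    by split => /=; [exact: nbhsx_ballx|exact: nbhs_right_lt].
  move=> [x' d'] /= [xx' dd'] s sx'.
  apply: le_trans (nrm_tri (g x) _ _) _; rewrite (splitr e) lerD//.
    apply: hd; rewrite -(subrK x' s) -addrA (le_lt_trans (ler_normD _ _))//.
    by rewrite (splitr d) ltrD// ?(lt_trans sx')// distrC.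
  rewrite nrm_sym; apply: hd; rewrite distrC (lt_le_trans xx')//.
  by rewrite ler_pdivrMr// ler_peMr// ?ler1n// ltW.
have /(_ _)[d [d0 hd]] := filter_ex (filterI (hc _ _ _ _ hP) (nbhs_right_gt (0 : R))).
exists d => // s t tK; apply: d0.
by rewrite /= in_itv/= -ler_norml.
Qed.

(** Through [cay], g becomes a continuous function on the compact circle that vanishes at the point
    1. In coordinates there are three cases: s and t both in [-2M, 2M], where [unif_cont_seg]
    applies; both beyond M, where g is small; and one inside [-M, M] with the other outside
    [-2M, 2M], which closeness on the circle excludes. *)
Lemma cay_unif_cont (g : R -> C) (e : R) : C0 g -> 0 < e ->
  exists2 d : R, 0 < d & forall s t, nrm (cay s - cay t) < d -> nrm (g s - g t) <= e.
Proof.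
move=> /C0P[cg g0] e0; have e20 : 0 < e / 2 by rewrite divr_gt0.
have [M0 hM0] := g0 _ e20.
pose M := Num.max M0 1.
have M1 : 1 <= M by rewrite le_max lexx orbT.
have hM t : M <= `|t| -> nrm (g t) <= e / 2.
  by move=> Mt; apply: hM0; apply: le_trans Mt; rewrite le_max lexx.
have [d d0 hd] := unif_cont_seg (2 * M) (proj1 (contP _) cg) e0.
pose K := 4 * M ^+ 2 + 1.
have K1 : 1 <= K by rewrite lerDr mulr_ge0 ?sqr_ge0.
have K0 : 0 < K by exact: lt_le_trans K1.
(* The first bound serves s and t in [-2M, 2M], where s^2 + 1 and t^2 + 1 are at most K; the second
   rules out |t| < M together with |s| > 2M. *)
pose d' := Num.min (2 * d / K) (2 * K)^-1.
have d'0 : 0 < d' by rewrite lt_min !(divr_gt0, mulr_gt0, invr_gt0).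
exists d' => //.
have key s t : nrm (cay s - cay t) < d' -> `|t| <= 2 * M -> nrm (g s - g t) <= e.
  move=> st tM; have cd := cay_dist s t.
  have st2 : nrm (cay s - cay t) ^+ 2 < d' ^+ 2 by rewrite ltr_pXn2r ?nnegrE ?nrm_ge0// ltW.
  have tK : t ^+ 2 + 1 <= K.
    by rewrite lerD2r -real_normK ?num_real// (le_trans (y := (2 * M) ^+ 2))// ?ler_pXn2r ?nnegrE//; [rewrite mulr_ge0// (le_trans ler01)|rewrite exprMn -natrX].
  have s1 : 1 <= s ^+ 2 + 1 by rewrite lerDr sqr_ge0.
  have t1 : 1 <= t ^+ 2 + 1 by rewrite lerDr sqr_ge0.
  have [sM|Ms] := lerP `|s| (2 * M).
    have sK : s ^+ 2 + 1 <= K.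
      by rewrite lerD2r -real_normK ?num_real// (le_trans (y := (2 * M) ^+ 2))// ?ler_pXn2r ?nnegrE//; [rewrite mulr_ge0// (le_trans ler01)|rewrite exprMn -natrX].
    apply: hd => //; rewrite -(@ltr_pXn2r _ 2) ?nnegrE ?normr_ge0 ?ltW// real_normK ?num_real//.
    have h1 : d' * K <= 2 * d by rewrite -ler_pdivlMr// ge_min lexx.
    have h2 : d' ^+ 2 * K ^+ 2 <= 4 * d ^+ 2.
      have -> : 4 * d ^+ 2 = (2 * d) ^+ 2 by rewrite exprMn -natrX.
      by rewrite -exprMn ler_pXn2r ?nnegrE ?mulr_ge0 ?(ltW d'0) ?(ltW K0) ?(ltW d0).
    have h3 : (s ^+ 2 + 1) * (t ^+ 2 + 1) <= K ^+ 2.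
      by rewrite expr2 ler_pM// (le_trans ler01).
    have h4 : 4 * (s - t) ^+ 2 < 4 * d ^+ 2.
      rewrite -cd; apply: lt_le_trans h2.
      apply: (@le_lt_trans _ _ (nrm (cay s - cay t) ^+ 2 * K ^+ 2)).
        by rewrite ler_wpM2l ?sqr_ge0.
      by rewrite ltr_pM2r// exprn_gt0.
    by move: h4; rewrite ltr_pM2l.
  have [tM'|tM'] := lerP M `|t|.
    apply: le_trans (nrmB _ _) _; rewrite (splitr e) lerD ?hM// ltW// (le_lt_trans _ Ms)//.
    by rewrite ler_peMl ?ler1n// (le_trans ler01).
  exfalso; have h1 : `|s| / 2 <= `|s - t|.
    have := ler_normD (s - t) t; rewrite subrK => h.
    by move: tM' Ms h; lra.
  have h2 : s ^+ 2 <= 4 * (s - t) ^+ 2.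
    have : (`|s| / 2) ^+ 2 <= `|s - t| ^+ 2 by rewrite ler_pXn2r ?nnegrE ?divr_ge0.
    rewrite exprMn !real_normK ?num_real// exprVn ler_pdivrMr -?natrX ?ltr0n//.
    by rewrite mulrC.
  have h3 : 1 <= s ^+ 2.
    rewrite -real_normK ?num_real// exprn_ege1// (le_trans M1)// ltW// (le_lt_trans _ Ms)//.
    by rewrite ler_peMl ?ler1n// (le_trans ler01).
  have h4 : d' * (2 * K) <= 1 by rewrite -ler_pdivlMr ?mulr_gt0// mul1r ge_min lexx orbT.
  have h5 : d' ^+ 2 * (2 * K) <= 1.
    rewrite expr2 -mulrA (le_trans (y := d' * 1))// ?ler_pM2l// mulr1.
    by rewrite (le_trans _ h4)// ler_peMr ?(ltW d'0)// -[leLHS]mulr1 ler_pM ?ler1n.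
  have h6 : s ^+ 2 < d' ^+ 2 * ((s ^+ 2 + 1) * (t ^+ 2 + 1)).
    by rewrite (le_lt_trans h2)// -cd ltr_pM2r// mulr_gt0// (lt_le_trans ltr01).
  have h7 : (s ^+ 2 + 1) * (t ^+ 2 + 1) <= s ^+ 2 * (2 * K).
    rewrite mulrA ler_pM ?(le_trans ler01 s1) ?(le_trans ler01 t1)//.
    by rewrite mulrDr mulr1 lerD2l.
  have h8 : d' ^+ 2 * ((s ^+ 2 + 1) * (t ^+ 2 + 1)) <= s ^+ 2.
    rewrite (le_trans (ler_wpM2l (sqr_ge0 _) h7))// mulrCA.
    by rewrite ler_piMr ?sqr_ge0.
  by move: h6; rewrite ltNge h8.
move=> s t st; have [tM|Mt] := lerP `|t| (2 * M); first exact: key.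
have [sM|Ms] := lerP `|s| (2 * M); first by rewrite nrm_sym key// nrm_sym.
apply: le_trans (nrmB _ _) _; rewrite (splitr e).
have MM : M <= 2 * M by rewrite ler_peMl ?ler1n// (le_trans ler01).
by rewrite lerD// hM// ltW// (le_lt_trans MM).
Qed.

(* Fejer's approximation with the integral over the circle replaced by a sum
   over the N-th roots w_j of -1; (1/N^2) |sum_(k < N) (z / w_j)^k|^2 is the
   Fejer kernel. *)
Lemma fejer_approx (g : R -> C) (e : R) : C0 g -> 0 < e ->
  exists N (c w : 'I_N -> C), forall t,
    nrm (g t - \sum_(j < N) c j * ((\sum_(k < N) ((w j)^*%C * cay t) ^+ k) *
      (\sum_(k < N) (w j * (cay t)^*%C) ^+ k))) <= e.
Proof.
move=> g0 e0; have e20 : 0 < e / 2 by rewrite divr_gt0.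
have [d d0 hd] := cay_unif_cont g0 e20.
have [G G0 hG] := C0_bounded g0.
(* Large enough for the nodes farther than d from [cay t] to contribute at most e / 2, by the
   estimate [NG]. *)
pose N := (Num.Def.archi_bound (16 * G / (e * d ^+ 2))).+1.
have N0 : (0 < N)%N by [].
have Np : 0 < N%:R :> R by rewrite ltr0n.
have NG : 8 * G / (N%:R * d ^+ 2) <= e / 2.
  have : 16 * G / (e * d ^+ 2) < N%:R.
    rewrite (lt_le_trans (archi_boundP _))// ?ler_nat//.
    by rewrite divr_ge0 ?mulr_ge0 ?sqr_ge0 ?ltW.
  rewrite ltr_pdivrMr ?mulr_gt0 ?exprn_gt0// => h.
  rewrite ler_pdivrMr ?mulr_gt0 ?exprn_gt0//.
  by move: h; set D := d ^+ 2; nra.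
have [w [w1 wN ow]] := @minus_one_roots R _ N0.
have /choice[t ht] j : exists t, cay t = w j.
  apply: cay_surj => //; apply/eqP => h; have := wN j; rewrite h expr1n.
  by move/eqP; rewrite -addr_eq0 -mulr2n pnatr_eq0.
pose s j x := \sum_(k < N) ((w j)^*%C * cay x) ^+ k.
have sc j x : \sum_(k < N) (w j * (cay x)^*%C) ^+ k = (s j x)^*%C.
  rewrite /s rmorph_sum; apply: eq_bigr => k _ /=.
  by rewrite rmorphXn /= conjM conjcK.
(* Orthogonality of the powers at the nodes: after division by N^2 the kernel has total mass 1. *)
have ss x : \sum_j nrm (s j x) ^+ 2 = N%:R ^+ 2.
  apply: complexI; rewrite rmorph_sum rmorphXn rmorph_nat /=.
  under eq_bigr => j _ do rewrite -nrm_mulJ -sc /s mulr_suml.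
  move: (cay x) (cay_conj x) => z zz.
  under eq_bigr => j _.
    under eq_bigr => k _.
      rewrite mulr_sumr.
      under eq_bigr => l _ do rewrite !exprMn mulrACA [w j ^+ _ * _]mulrC.
      over.
    over.
  rewrite exchange_big /=.
  under eq_bigr => k _ do rewrite exchange_big /=.
  have -> : \sum_(k < N) \sum_(l < N) \sum_(i < N)
      (w i)^*%C ^+ l * w i ^+ k * (z^*%C ^+ k * z ^+ l) = \sum_(k < N) (N%:R : C).
    apply: eq_bigr => k _; rewrite (bigD1 k)//= [X in _ + X]big1 ?addr0.
      by rewrite -mulr_suml ow// eqxx -exprMn zz expr1n mulr1.
    move=> l /eqP lk; rewrite -mulr_suml ow//; case: eqP; rewrite ?mul0r// => h.
    by case: lk; apply/val_inj.
  rewrite sumr_const card_ord.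
  by rewrite expr2 mulr_natl.
(* Decay of the kernel away from its node: (q - 1) times the geometric sum is q^N - 1, and |q| =
   1. *)
have sd j x : nrm (s j x) * nrm (cay x - w j) <= 2.
  have -> : nrm (cay x - w j) = nrm ((w j)^*%C * cay x - 1).
    by rewrite -(conj_unit (w1 j)) -mulrBr nrmM nrm_conj w1 mul1r.
  rewrite mulrC -nrmM -subrX1 exprMn -conjX wN conjN conj1 mulN1r.
  by rewrite (le_trans (nrmB _ _))// nrmN nrm1 nrmX nrm_cay expr1n.
exists N, (fun j => g (t j) / N%:R ^+ 2), w => x.
have -> : g x - \sum_(j < N) g (t j) / N%:R ^+ 2 *
     ((\sum_(k < N) ((w j)^*%C * cay x) ^+ k) * \sum_(k < N) (w j * (cay x)^*%C) ^+ k) =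
   \sum_(j < N) (nrm (s j x) ^+ 2 / N%:R ^+ 2)%:C * (g x - g (t j)).
  under [RHS]eq_bigr => j _ do rewrite mulrBr.
  rewrite sumrB -mulr_suml; congr (_ - _).
    rewrite -rmorph_sum -mulr_suml ss divff ?mul1r//.
    by rewrite expf_neq0// gt_eqF.
  apply: eq_bigr => j _; rewrite -/(s j x) sc [s j x * _]mulrC nrm_mulJ.
  move: (nrm (s j x) ^+ 2) => a.
  have -> : (a / N%:R ^+ 2)%:C = a%:C / N%:R ^+ 2.
    by rewrite rmorphM fmorphV rmorphXn rmorph_nat.
  by rewrite mulrC mulrA mulrAC.
apply: le_trans (nrm_sum _ _ _) _.
have K0 j : 0 <= nrm (s j x) ^+ 2 / N%:R ^+ 2 by rewrite divr_ge0 ?sqr_ge0.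
(* Nodes within d of [cay x] are handled by uniform continuity, the others by the decay [sd]; adding
   the two bounds avoids splitting the sum. *)
have bd j : nrm ((nrm (s j x) ^+ 2 / N%:R ^+ 2)%:C * (g x - g (t j))) <=
   nrm (s j x) ^+ 2 / N%:R ^+ 2 * (e / 2) + 8 * G / (N%:R ^+ 2 * d ^+ 2).
  rewrite nrmM nrm_real ger0_norm//.
  have [xd|dx] := ltP (nrm (cay x - w j)) d.
    rewrite -[leLHS]addr0 lerD//.
      by rewrite ler_wpM2l// hd// ht.
    by rewrite divr_ge0 ?mulr_ge0 ?sqr_ge0 ?ltW.
  rewrite -[leLHS]add0r lerD//; first exact: mulr_ge0 (K0 j) (ltW e20).
  have h1 : nrm (s j x) <= 2 / d.
    rewrite ler_pdivlMr//; apply: le_trans (sd j x).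
    by rewrite ler_wpM2l ?nrm_ge0.
  have h2 : nrm (s j x) ^+ 2 <= 4 / d ^+ 2.
    have -> : 4 / d ^+ 2 = (2 / d) ^+ 2 by rewrite exprMn exprVn -natrX.
    by rewrite ler_pXn2r// nnegrE ?nrm_ge0// divr_ge0// ltW.
  have h3 : nrm (g x - g (t j)) <= 2 * G.
    by rewrite (le_trans (nrmB _ _))// mulrDl mul1r lerD.
  have -> : 8 * G / (N%:R ^+ 2 * d ^+ 2) = 4 / d ^+ 2 / N%:R ^+ 2 * (2 * G).
    by field; rewrite !gt_eqF.
  by rewrite ler_pM ?nrm_ge0// ler_wpM2r ?invr_ge0 ?sqr_ge0.
apply: le_trans (ler_sum _ (fun j _ => bd j)) _.
rewrite big_split /= -!mulr_suml ss divff ?expf_neq0 ?gt_eqF// mul1r.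
rewrite sumr_const card_ord [X in _ <= X](splitr e) lerD2l.
suff -> : 8 *+ N * G / (N%:R ^+ 2 * d ^+ 2) = 8 * G / (N%:R * d ^+ 2) by [].
by rewrite -mulr_natr; field; rewrite !gt_eqF.
Qed.

End cayley.

(* The square of the linear lower bound 1 + 2^k (b 0 - 1) outgrows any linear
   function of 2^k. *)
Lemma squaring_growth (R : realType) (b : nat -> R) (s : R) : 1 < b 0%N ->
  (forall k, b k ^+ 2 <= b k.+1) -> ~ (forall k, b k <= s * 2 ^+ k + 1).
Proof.
move=> b1 bS bs; pose d := b 0%N - 1; have d0 : 0 < d by rewrite subr_gt0.
have low k : 1 + 2 ^+ k * d <= b k.
  elim: k => [|k IH]; first by rewrite expr0 mul1r addrC subrK.
  apply: le_trans (bS k); have k0 : 0 <= 2 ^+ k * d by rewrite mulr_ge0 ?exprn_ge0// ltW.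
  apply: (@le_trans _ _ ((1 + 2 ^+ k * d) ^+ 2)).
    by rewrite exprS; move: (2 ^+ k * d) k0 (mulrA 2 (2 ^+ k) d) => a a0 <-; nra.
  by rewrite ler_pXn2r// nnegrE; [rewrite addr_ge0|rewrite (le_trans _ IH)// addr_ge0].
have h k : 2 ^+ k * d ^+ 2 <= 2 * `|s| + 1.
  have p0 : 0 < 2 ^+ k :> R by rewrite exprn_gt0.
  have p1 : 1 <= 2 ^+ k :> R by rewrite exprn_ege1// ler1n.
  rewrite -(ler_pM2l p0).
  have h1 := le_trans (bS k) (bs k.+1); rewrite [2 ^+ k.+1]exprS in h1.
  have h2 := low k; have h3 := ler_norm s.
  have h4 : 0 <= 2 ^+ k * d by rewrite mulr_ge0// ltW.
  have h5 : (1 + 2 ^+ k * d) ^+ 2 <= b k ^+ 2.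
    by rewrite ler_pXn2r// nnegrE; [rewrite addr_ge0|rewrite (le_trans _ h2)// addr_ge0].
  have h6 : s * 2 ^+ k <= `|s| * 2 ^+ k by rewrite ler_pM2r.
  have -> : 2 ^+ k * (2 ^+ k * d ^+ 2) = (2 ^+ k * d) ^+ 2 by ring.
  move: (2 ^+ k) p0 p1 h1 h4 h5 h6 {h2} => a a0 a1.
  move: (b k ^+ 2) `|s| => B S h1 h4 h5 h6.
  by move: (a * d) h4 h5 => u u0 h5; nra.
pose N := Num.Def.archi_bound ((2 * `|s| + 1) / d ^+ 2).
have hN := archi_boundP (divr_ge0 (addr_ge0 (mulr_ge0 (ler0n R 2) (normr_ge0 s)) ler01) (sqr_ge0 d)).
have := h N; rewrite -ler_pdivlMr ?exprn_gt0// leNgt => /negP; apply.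
by rewrite (lt_le_trans hN)// -natrX ler_nat ltnW// ltn_expl.
Qed.

(** * Continuous functional calculus of D *)

Section unitary_calculus.
Context {R : realType} {B : cstarAlgType R} {X : hilbModType B}.
Local Notation C := R[i].
Variables U V : X -> X.
Hypothesis UV : is_adjoint U V.
Hypothesis VUK : forall x, V (U x) = x.
Hypothesis UVK : forall x, U (V x) = x.

Let nrmU x : nrm (U x) = nrm x.
Proof.
have : nrm (U x) ^+ 2 == nrm x ^+ 2 by rewrite !nrm_ip UV VUK.
by rewrite eqrXn2 ?nrm_ge0// => /eqP.
Qed.

Let nrmUn n x : nrm (iter n U x) = nrm x.
Proof. by elim: n => //= n IH; rewrite nrmU. Qed.

Let pact (p : {poly C}) x := \sum_(i < size p) p`_i *: iter i U x.

Let pactE n (p : {poly C}) x : (size p <= n)%N -> pact p x = \sum_(i < n) p`_i *: iter i U x.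
Proof.
move=> pn; rewrite /pact (big_ord_widen n (fun i => p`_i *: iter i U x) pn).
rewrite big_mkcond; apply: eq_bigr => i _; case: ifP => //.
by move/negbT; rewrite -leqNgt => /(nth_default 0) ->; rewrite scale0r.
Qed.

Let pact_lin k p q x : pact (k *: p + q) x = k *: pact p x + pact q x.
Proof.
pose n := maxn (size p) (size q).
rewrite (@pactE n); last first.
  by rewrite (leq_trans (size_polyD _ _))// geq_max (leq_trans (size_scale_leq _ _)) ?leq_maxl ?leq_maxr.
rewrite (@pactE n p) ?leq_maxl// (@pactE n q) ?leq_maxr// scaler_sumr -big_split.
by apply: eq_bigr => i _; rewrite coefD coefZ scalerDl scalerA.
Qed.

Let pact0 x : pact 0 x = 0.
Proof. by rewrite /pact size_poly0 big_ord0. Qed.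

Let pactC c x : pact c%:P x = c *: x.
Proof. by rewrite (@pactE 1) ?size_polyC_leq1// big_ord1 coefC. Qed.

Let pactD p q x : pact (p + q) x = pact p x + pact q x.
Proof. by rewrite -[p]scale1r pact_lin !scale1r. Qed.

Let pactU p x : pact p (U x) = U (pact p x).
Proof.
rewrite /pact (adj_sum _ _ UV); apply: eq_bigr => i _.
by rewrite (adjZ _ _ UV) -iterSr.
Qed.

Let pactX p x : pact (p * 'X) x = pact p (U x).
Proof.
rewrite (@pactE (size p).+1); last first.
  by rewrite (leq_trans (size_polyMleq _ _))// size_polyX addn2.
rewrite big_ord_recl coefMX scale0r add0r; apply: eq_bigr => i _.
by rewrite coefMX /= -iterSr.
Qed.

Let pactM p q x : pact (p * q) x = pact p (pact q x).
Proof.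
elim/poly_ind: p q x => [|p c IH] q x; first by rewrite mul0r !pact0.
rewrite mulrDl !pactD -mulrA [_ * q]mulrC -[c%:P * q]/(c%:P * q).
rewrite mul_polyC -[c *: q]addr0 pact_lin pact0 addr0 pactC; congr (_ + _).
by rewrite IH !pactX -pactU.
Qed.

Let pactXn n x : pact 'X^n x = iter n U x.
Proof.
elim: n x => [|n IH] x; first by rewrite expr0 pactC scale1r.
by rewrite exprSr pactX IH -iterSr.
Qed.

(* Laurent polynomials f in the Cayley transform, with T = f(U). *)
Inductive laurent : (R -> C) -> (X -> X) -> Prop :=
| laurent_u : laurent cay U
| laurent_v : laurent (fun t => (cay t)^*%C) V
| laurent_1 : laurent (fun=> 1) (fun x => x)
| laurent_lin k f T f' T' : laurent f T -> laurent f' T' ->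
    laurent (fun t => k * f t + f' t) (fun x => k *: T x + T' x)
| laurent_mul f T f' T' : laurent f T -> laurent f' T' ->
    laurent (fun t => f t * f' t) (fun x => T (T' x)).

Lemma laurent_adj f T : laurent f T ->
  exists2 S, is_adjoint T S & laurent (fun t => (f t)^*%C) S.
Proof.
elim=> [|||k g S g' S' _ [A hA lA] _ [A' hA' lA']|g S g' S' _ [A hA lA] _ [A' hA' lA']].
- by exists V => //; exact: laurent_v.
- exists U; first exact: adj_sym.
  have -> : (fun t : R => ((cay t)^*)^*%C) = cay by apply/funext => t; rewrite conjcK.
  exact: laurent_u.
- exists (fun x => x) => //.
  have -> : (fun=> (1 : C)^*%C) = (fun=> 1 : C) :> (R -> C) by rewrite conj1.
  exact: laurent_1.
- exists (fun x => k^*%C *: A x + A' x); first exact: is_adjoint_lin.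
  have -> : (fun t => (k * g t + g' t)^*%C) = (fun t => k^*%C * (g t)^*%C + (g' t)^*%C).
    by apply/funext => t; rewrite conjD conjM.
  exact: laurent_lin.
- exists (fun x => A' (A x)); first exact: is_adjoint_comp.
  have -> : (fun t => (g t * g' t)^*%C) = (fun t => (g' t)^*%C * (g t)^*%C).
    by apply/funext => t; rewrite conjM mulrC.
  exact: laurent_mul.
Qed.

(** Multiplication by the d-th power of the Cayley transform clears negative powers. As U is
    isometric, this reduces norm estimates for Laurent polynomials to estimates for polynomials. *)
Let normal_form d p (f : R -> C) T :=
  (forall t, f t * cay t ^+ d = p.[cay t]) /\ (forall x, iter d U (T x) = pact p x).

Let nf_mul d p f T d' p' f' T' : normal_form d p f T -> normal_form d' p' f' T' ->
  normal_form (d + d') (p * p') (fun t => f t * f' t) (fun x => T (T' x)).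
Proof.
move=> [h1 h2] [h3 h4]; split=> [t|x].
  by rewrite hornerM -h1 -h3 exprD mulrACA.
by rewrite addnC iterD h2 pactM -h4 -!pactXn -!pactM mulrC.
Qed.

Let nf_lin k d p f T d' p' f' T' : normal_form d p f T -> normal_form d' p' f' T' ->
  normal_form (d + d') (k *: (p * 'X^d') + p' * 'X^d)
    (fun t => k * f t + f' t) (fun x => k *: T x + T' x).
Proof.
move=> [h1 h2] [h3 h4]; split=> [t|x].
  by rewrite hornerD hornerZ !hornerM !hornerXn -h1 -h3 exprD; ring.
rewrite pact_lin !pactM.
have itD n y z : iter n U (k *: y + z) = k *: iter n U y + iter n U z.
  by elim: n => //= n ->; rewrite (adj_lin UV).
rewrite itD; congr (_ *: _ + _).
  by rewrite pactXn addnC iterD h2 -!pactXn -!pactM mulrC.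
by rewrite pactXn iterD h4 -!pactXn -!pactM mulrC.
Qed.

Let laurent_nf f T : laurent f T -> exists d p, normal_form d p f T.
Proof.
elim=> [|||k g S g' S' _ [d [p h]] _ [d' [p' h']]|g S g' S' _ [d [p h]] _ [d' [p' h']]].
- exists 0%N, 'X; split=> [t|x]; first by rewrite expr0 mulr1 hornerX.
  by rewrite -['X]mul1r pactX pactC scale1r.
- exists 1%N, 1; split=> [t|x]; first by rewrite expr1 cay_conj hornerC.
  by rewrite /= UVK pactC scale1r.
- exists 0%N, 1; split=> [t|x]; first by rewrite expr0 mulr1 hornerC.
  by rewrite /= pactC scale1r.
- by exists (d + d')%N, (k *: (p * 'X^d') + p' * 'X^d); exact: nf_lin.
- by exists (d + d')%N, (p * p'); exact: nf_mul.
Qed.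

Let nf_exp d p f T n : normal_form d p f T ->
  normal_form (d * n) (p ^+ n) (fun t => f t ^+ n) (iter n T).
Proof.
move=> h; elim: n => [|n IH].
  split=> [t|x]; first by rewrite muln0 !expr0 mulr1 hornerC.
  by rewrite muln0 /= expr0 pactC scale1r.
have := nf_mul h IH; rewrite mulnS exprS.
by have -> : (fun t => f t * f t ^+ n) = (fun t => f t ^+ n.+1)
  by apply/funext => t; rewrite exprS.
Qed.

(** The triangle inequality together with [cay_coef]. The factor [size p] is crude, but it grows
    only linearly when f is replaced by its powers, so that it disappears in [laurent_bound]. *)
Let nf_bound d p f T (M : R) : normal_form d p f T -> (forall t, nrm (f t) <= M) ->
  forall x, nrm (T x) <= (size p)%:R * M * nrm x.
Proof.
move=> [h1 h2] hM x; rewrite -(nrmUn d) h2.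
have pM k : nrm p`_k <= M.
  by apply: cay_coef => t; rewrite -h1 nrmM nrmX nrm_cay expr1n mulr1.
rewrite (le_trans (nrm_sum _ _ _))//.
rewrite (@le_trans _ _ (\sum_(i < size p) M * nrm x))//.
  by apply: ler_sum => i _; rewrite nrmZ nrmUn ler_wpM2r ?nrm_ge0.
by rewrite sumr_const card_ord -mulrnAl -[M *+ _]mulr_natl.
Qed.

(* Spectral radius argument: for Q = f(U)^* f(U), the norms of the powers Q^n
   exceed M^(2 n) by a factor that is at most linear in n. *)
Lemma laurent_bound f T (M : R) : laurent f T -> 0 < M -> (forall t, nrm (f t) <= M) ->
  forall x, nrm (T x) <= 4 * M * nrm x.
Proof.
move=> lT M0 hM x; have [S TS lS] := laurent_adj lT.
pose Q x := S (T x).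
have lQ : laurent (fun t => (f t)^*%C * f t) Q by exact: laurent_mul.
have QQ : is_adjoint Q Q by exact: (is_adjoint_comp (adj_sym TS) TS).
have [d [p nf]] := laurent_nf lQ.
have QM n y : nrm (iter n Q y) <= ((size p)%:R * n%:R + 1) * (M ^+ 2) ^+ n * nrm y.
  have := nf_bound (M := (M ^+ 2) ^+ n) (nf_exp n nf).
  move=> /(_ _ y)h; apply: le_trans (h _) _ => [t|].
    rewrite nrmX lerXn2r// ?nnegrE ?nrm_ge0 ?exprn_ge0 ?(ltW M0)//.
    by rewrite nrmM nrm_conj -expr2 lerXn2r// nnegrE ?nrm_ge0// ltW.
  rewrite ler_wpM2r ?nrm_ge0// ler_wpM2r ?exprn_ge0 ?(ltW M0)//.
  rewrite -natrM natr1 ler_nat (leq_trans (size_poly_exp_leq _ _))//.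
  by rewrite ltnS leq_mul2r leq_pred orbT.
have key : nrm (Q x) <= 4 * M ^+ 2 * nrm x.
  rewrite leNgt; apply/negP => hx.
  have x0 : 0 < nrm x.
    rewrite lt_neqAle nrm_ge0 andbT eq_sym; apply/eqP => /nrm_eq0 x0.
    by move: hx; rewrite x0 (adj0 QQ) !nrm0 mulr0 ltxx.
  have M20 k : 0 < (M ^+ 2) ^+ k by rewrite !exprn_gt0.
  (* The divisor 4 |x| is made for |Q^n x|^2 <= 4 |x| |Q^(2n) x|, which becomes b_k^2 <= b_(k+1);
     the negated claim is b_0 > 1. *)
  pose b k := nrm (iter (2 ^ k) Q x) / (4 * nrm x * (M ^+ 2) ^+ (2 ^ k)).
  apply: (@squaring_growth R b (size p)%:R).
  - by rewrite /b expn0 expr1 ltr_pdivlMr ?mulr_gt0 ?exprn_gt0// mul1r mulrAC.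
  - move=> k; rewrite /b expnS mul2n -addnn exprD iterD.
    set n := (2 ^ k)%N; set y := iter n Q x.
    have : nrm y ^+ 2 <= 4 * nrm x * nrm (iter n Q y).
      rewrite nrm_ip; suff -> : ip y y = ip x (iter n Q y) by exact: nrm_ip_le.
      suff itQ : is_adjoint (iter n Q) (iter n Q) by rewrite {1}/y itQ.
      elim: n {y} => [//|n IH]; have := is_adjoint_comp QQ IH.
      by move=> h u v; rewrite [in RHS]iterSr; exact: h.
    move: (M20 n); move: ((M ^+ 2) ^+ n) => a a0 h.
    rewrite exprMn exprVn ler_pdivlMr ?mulr_gt0// mulrAC ler_pdivrMr ?exprn_gt0 ?mulr_gt0//.
    apply: (@le_trans _ _ (4 * nrm x * nrm (iter n Q y) * (4 * nrm x * (a * a)))).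
      by rewrite ler_wpM2r// ltW// !mulr_gt0.
    by apply: eq_le_r; ring.
  - move=> k; rewrite /b ler_pdivrMr ?mulr_gt0//.
    apply: le_trans (QM _ _) _; rewrite natrX.
    set a := (size p)%:R * 2 ^+ k + 1.
    have a0 : 0 <= a by rewrite addr_ge0// mulr_ge0// exprn_ge0.
    rewrite -mulrA ler_wpM2l// mulrC -mulrA ler_peMl ?ler1n//.
    by rewrite mulr_ge0 ?(ltW x0) ?(ltW (M20 _)).
have : nrm (T x) ^+ 2 <= (4 * M * nrm x) ^+ 2.
  rewrite nrm_ip TS (le_trans (nrm_ip_le _ _))//.
  rewrite (@le_trans _ _ (4 * nrm x * (4 * M ^+ 2 * nrm x)))//.
    by rewrite ler_wpM2l ?mulr_ge0 ?nrm_ge0.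
  by apply: eq_le_r; ring.
by rewrite ler_pXn2r// nnegrE ?nrm_ge0// !mulr_ge0 ?nrm_ge0// ltW.
Qed.

Lemma laurent_ext f f' T T' : (forall t, f t = f' t) -> (forall x, T x = T' x) ->
  laurent f T -> laurent f' T'.
Proof. by move=> /funext -> /funext ->. Qed.

Lemma laurentZ k f T : laurent f T ->
  laurent (fun t => k * f t) (fun x => k *: T x).
Proof.
move=> lT; apply: laurent_ext (laurent_lin k lT (laurent_lin (-1) laurent_1 laurent_1)).
  by move=> t; rewrite mulN1r addNr addr0.
by move=> x; rewrite scaleN1r addNr addr0.
Qed.

Lemma laurentD f T f' T' : laurent f T -> laurent f' T' ->
  laurent (fun t => f t + f' t) (fun x => T x + T' x).
Proof.
move=> l l'; apply: laurent_ext (laurent_lin 1 l l').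
  by move=> t; rewrite mul1r.
by move=> x; rewrite scale1r.
Qed.

Lemma laurentB f T f' T' : laurent f T -> laurent f' T' ->
  laurent (fun t => f t - f' t) (fun x => T x - T' x).
Proof.
move=> l l'; apply: laurent_ext (laurentD l (laurentZ (-1) l')).
  by move=> t; rewrite mulN1r.
by move=> x; rewrite scaleN1r.
Qed.

Lemma laurent_ex_sum n (f : 'I_n -> R -> C) : (forall i, exists T, laurent (f i) T) ->
  exists T, laurent (fun t => \sum_(i < n) f i t) T.
Proof.
elim: n f => [|n IH] f h.
  exists (fun x => 0 *: x); apply: laurent_ext (laurentZ 0 laurent_1) => //.
  by move=> t; rewrite big_ord0 mul0r.
have [T lT] := h ord_max; have [S lS] := IH _ (fun i => h (widen_ord (leqnSn n) i)).
by exists (fun x => S x + T x); apply: laurent_ext (laurentD lS lT) => // t; rewrite big_ord_recr.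
Qed.

Lemma laurent_ex_mul f f' : (exists T, laurent f T) -> (exists T, laurent f' T) ->
  exists T, laurent (fun t => f t * f' t) T.
Proof. by move=> [T h] [T' h']; exists (fun x => T (T' x)); exact: laurent_mul. Qed.

Lemma laurent_ex_exp f n : (exists T, laurent f T) ->
  exists T, laurent (fun t => f t ^+ n) T.
Proof.
move=> h; elim: n => [|n IH]; first by exists (fun x => x); exact: laurent_1.
have [T lT] := laurent_ex_mul h IH; exists T.
by apply: laurent_ext lT => // t; rewrite exprS.
Qed.

Lemma laurent_dense (g : R -> C) (e : R) : C0 g -> 0 < e ->
  exists f T, laurent f T /\ forall t, nrm (g t - f t) <= e.
Proof.
move=> g0 e0; have [N [c [w h]]] := fejer_approx g0 e0.
suff [T lT] : exists T, laurent (fun t => \sum_(j < N) c j *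
    ((\sum_(k < N) ((w j)^*%C * cay t) ^+ k) *
     (\sum_(k < N) (w j * (cay t)^*%C) ^+ k))) T.
  by eexists; exists T; split; [exact: lT|exact: h].
apply: laurent_ex_sum => j.
have [||T lT] := @laurent_ex_mul
    (fun t => \sum_(k < N) ((w j)^*%C * cay t) ^+ k)
    (fun t => \sum_(k < N) (w j * (cay t)^*%C) ^+ k).
- apply: laurent_ex_sum => k; apply: laurent_ex_exp.
  by exists (fun x => (w j)^*%C *: U x); exact: laurentZ laurent_u.
- apply: laurent_ex_sum => k; apply: laurent_ex_exp.
  by exists (fun x => w j *: V x); exact: laurentZ laurent_v.
by exists (fun x => c j *: T x); exact: laurentZ.
Qed.

(** The graph of the calculus as a relation. [ucalc_unique] and [C0_ucalc] make it a function on
    C_0(R), while 1 and [cay], which do not vanish at infinity, remain in its domain. *)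
Definition ucalc (f : R -> C) (T : X -> X) := forall e : R, 0 < e ->
  exists f' T', [/\ laurent f' T', forall t, nrm (f t - f' t) <= e
    & forall x, nrm (T x - T' x) <= e * nrm x].

Lemma laurent_ucalc f T : laurent f T -> ucalc f T.
Proof.
move=> l e e0; exists f, T; split=> // [t|x]; first by rewrite subrr nrm0 ltW.
by rewrite subrr nrm0 mulr_ge0 ?nrm_ge0 ?ltW.
Qed.

Lemma ucalc_bound f T (M : R) : ucalc f T -> 0 <= M -> (forall t, nrm (f t) <= M) ->
  forall x, nrm (T x) <= 4 * M * nrm x.
Proof.
move=> h M0 hM x; apply/ler_addgt0Pr => e e0.
pose d := e / (5 * (nrm x + 1)).
have x1 : 0 < nrm x + 1 by rewrite ltr_wpDl ?nrm_ge0.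
have d0 : 0 < d by rewrite divr_gt0 ?mulr_gt0.
have [f' [T' [l ff TT]]] := h _ d0.
have M1 : 0 < M + d by rewrite ltr_wpDl.
have h1 : nrm (T' x) <= 4 * (M + d) * nrm x.
  apply: (laurent_bound l M1) => t; apply: le_trans (nrm_le_dist _ (f t)) _.
  by rewrite lerD// nrm_sym.
have h2 := TT x; have h3 := nrm_le_dist (T x) (T' x).
have h4 : d * nrm x * 5 <= e.
  rewrite /d -mulrA mulrAC ler_pdivrMr ?mulr_gt0// ler_wpM2l ?(ltW e0)//.
  by rewrite mulrC ler_pM2l// lerDl.
by move: h1 h2 h3 h4; rewrite mulrDr mulrDl -[4 * d * _]mulrA; move: (d * nrm x) => a; lra.
Qed.

Lemma ucalc_bounded f T : ucalc f T -> exists2 M, 0 < M & forall t, nrm (f t) <= M.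
Proof.
move=> h; have [f' [T' [l ff _]]] := h 1 ltr01.
suff [M M0 hM] : exists2 M, 0 < M & forall t, nrm (f' t) <= M.
  exists (M + 1); first by rewrite ltr_wpDr.
  by move=> t; apply: le_trans (nrm_le_dist _ (f' t)) _; rewrite lerD.
elim: l => [|||k g S g' S' _ [M M0 hM] _ [M' M'0 hM']|g S g' S' _ [M M0 hM] _ [M' M'0 hM']].
- by exists 1 => // t; rewrite nrm_cay.
- by exists 1 => // t; rewrite nrm_conj nrm_cay.
- by exists 1 => // t; rewrite nrm1.
- exists (nrm k * M + M'); first by rewrite ltr_wpDl ?mulr_ge0 ?nrm_ge0 ?ltW.
  by move=> t; rewrite (le_trans (nrmD _ _))// nrmM lerD// ler_wpM2l ?nrm_ge0.
- exists (M * M'); first exact: mulr_gt0.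
  by move=> t; rewrite nrmM ler_pM ?nrm_ge0.
Qed.

Lemma ucalc_unique f T T' : ucalc f T -> ucalc f T' -> forall x, T x = T' x.
Proof.
move=> h h' x; apply: nrm_small_eq => e e0.
pose d := e / (10 * (nrm x + 1)).
have x1 : 0 < nrm x + 1 by rewrite ltr_wpDl ?nrm_ge0.
have d0 : 0 < d by rewrite divr_gt0 ?mulr_gt0.
have [g [S [l gg SS]]] := h _ d0; have [g' [S' [l' gg' SS']]] := h' _ d0.
have d20 : 0 < 2 * d by rewrite mulr_gt0.
have := laurent_bound (laurentB l l') d20.
have hb t : nrm (g t - g' t) <= 2 * d.
  by rewrite (le_trans (nrm_tri (f t) _ _))// mulrDl mul1r lerD// nrm_sym.
move=> /(_ hb x) h1; have h2 := SS x; have h3 := SS' x.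
have h4 := nrm_tri (S x) (T x) (T' x); have h5 := nrm_tri (S' x) (S x) (T' x).
rewrite [nrm (S' x - T' x)]nrm_sym in h5.
have h6 : d * nrm x * 10 <= e.
  rewrite /d -mulrA mulrAC ler_pdivrMr ?mulr_gt0// ler_wpM2l ?(ltW e0)//.
  by rewrite mulrC ler_pM2l// lerDl.
have e1 : 4 * (2 * d) * nrm x = 8 * (d * nrm x) by ring.
by move: h1 h2 h3 h4 h5 h6; rewrite e1; move: (d * nrm x) => a; lra.
Qed.

Lemma ucalc_lin k f T f' T' : ucalc f T -> ucalc f' T' ->
  ucalc (fun t => k * f t + f' t) (fun x => k *: T x + T' x).
Proof.
move=> h h' e e0; pose d := e / (nrm k + 1).
have k1 : 0 < nrm k + 1 by rewrite ltr_wpDl ?nrm_ge0.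
have d0 : 0 < d by rewrite divr_gt0.
have dk : nrm k * d + d = e by rewrite -{2}[d]mul1r -mulrDl mulrC divfK ?gt_eqF.
have [g [S [l gg SS]]] := h _ d0; have [g' [S' [l' gg' SS']]] := h' _ d0.
exists (fun t => k * g t + g' t), (fun x => k *: S x + S' x); split.
- exact: laurent_lin.
- move=> t; rewrite opprD addrACA -mulrBr (le_trans (nrmD _ _))// nrmM -dk lerD//.
  by rewrite ler_wpM2l ?nrm_ge0.
- move=> x; rewrite opprD addrACA -scalerBr (le_trans (nrmD _ _))// nrmZ -dk mulrDl lerD//.
  by rewrite -mulrA ler_wpM2l ?nrm_ge0.
Qed.

Lemma ucalc_mul f T f' T' : ucalc f T -> ucalc f' T' ->
  ucalc (fun t => f t * f' t) (fun x => T (T' x)).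
Proof.
move=> h h' e e0; have [M M0 hM] := ucalc_bounded h.
have [M' M'0 hM'] := ucalc_bounded h'.
pose d := Num.min 1 (e / (8 * (M + M' + 1))).
have K0 : 0 < 8 * (M + M' + 1) by rewrite mulr_gt0// !addr_gt0.
have d0 : 0 < d by rewrite lt_min ltr01 divr_gt0.
have d1 : d <= 1 by rewrite ge_min lexx.
have dK : d * (8 * (M + M' + 1)) <= e by rewrite -ler_pdivlMr// ge_min lexx orbT.
have [g [S [l gg SS]]] := h _ d0; have [g' [S' [l' gg' SS']]] := h' _ d0.
have S_lin x y : S (x - y) = S x - S y.
  by have [A hA _] := laurent_adj l; exact: adjB hA.
have gM t : nrm (g t) <= M + 1.
  by rewrite (le_trans (nrm_le_dist _ (f t)))// lerD// nrm_sym (le_trans (gg t)).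
have M1 : 0 < M + 1 by rewrite addr_gt0.
have SM := laurent_bound l M1 gM.
exists (fun t => g t * g' t), (fun x => S (S' x)); split.
- exact: laurent_mul.
- move=> t; have -> : f t * f' t - g t * g' t = (f t - g t) * f' t + g t * (f' t - g' t) by ring.
  rewrite (le_trans (nrmD _ _))// !nrmM.
  rewrite (@le_trans _ _ (d * M' + (M + 1) * d))//; last by nra.
  by rewrite lerD// ler_pM ?nrm_ge0.
- move=> x.
  have h1 : nrm (T (T' x) - S (T' x)) <= d * (4 * M' * nrm x).
    rewrite (le_trans (SS _))// ler_wpM2l ?(ltW d0)//.
    exact: ucalc_bound h' (ltW M'0) hM' x.
  have h2 : nrm (S (T' x) - S (S' x)) <= 4 * (M + 1) * (d * nrm x).
    by rewrite -S_lin (le_trans (SM _))// ler_wpM2l// mulr_ge0// ltW.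
  apply: le_trans (nrm_tri (S (T' x)) _ _) _; apply: le_trans (lerD h1 h2) _.
  have -> : d * (4 * M' * nrm x) + 4 * (M + 1) * (d * nrm x) =
    (d * (4 * (M + M' + 1))) * nrm x by ring.
  by rewrite ler_wpM2r ?nrm_ge0//; nra.
Qed.

Lemma ucalc_exists (f : R -> C) : (forall e : R, 0 < e -> exists f' T',
  laurent f' T' /\ forall t, nrm (f t - f' t) <= e) -> exists T, ucalc f T.
Proof.
move=> h; pose e n : R := 2^-1 ^+ n.
have e0 n : 0 < e n by rewrite exprn_gt0// invr_gt0.
have /choice[F hF] n : exists F : (R -> C) * (X -> X),
    laurent F.1 F.2 /\ forall t, nrm (f t - F.1 t) <= e n.
  by have [f' [T' [l ff]]] := h _ (e0 n); exists (f', T').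
have half1 : 2^-1 < 1 :> R by rewrite invf_lt1// ltr1n.
have half0 : 0 <= 2^-1 :> R by rewrite invr_ge0.
have dF n x : nrm ((F n.+1).2 x - (F n).2 x) <= 8 * nrm x * e n.
  have [l1 h1] := hF n.+1; have [l2 h2] := hF n.
  have b t : nrm ((F n.+1).1 t - (F n).1 t) <= 2 * e n.
    rewrite (le_trans (nrm_tri (f t) _ _))// mulrDl mul1r lerD//.
    rewrite nrm_sym (le_trans (h1 t))// /e exprS ler_piMl ?exprn_ge0// ltW//.
  have := laurent_bound (laurentB l1 l2) (mulr_gt0 (ltr0n R 2) (e0 n)) b x.
  by move/le_trans; apply; apply: eq_le_r; ring.
have /choice[T hT] x : exists y, tends (fun n => (F n).2 x) y /\
    forall n, nrm (y - (F n).2 x) <= 8 * nrm x / (1 - 2^-1) * e n.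
  have x0 : 0 <= 8 * nrm x by rewrite mulr_ge0 ?nrm_ge0.
  by have [y y1 y2] := geometric_complete x0 half0 half1 (dF^~ x); exists y.
exists T => d d0; have [N hN] := small_pow 16 half0 half1 d0.
have [l1 h1] := hF N; exists (F N).1, (F N).2; split=> // [t|x].
  rewrite (le_trans (h1 t))// (le_trans _ (hN N (leqnn N)))//.
  by rewrite -/(e N) ler_peMl ?ler1n// ltW.
have [_ /(_ N)h2] := hT x; rewrite (le_trans h2)//.
have -> : 8 * nrm x / (1 - 2^-1) * e N = 16 * e N * nrm x by field.
by rewrite ler_wpM2r ?nrm_ge0// hN.
Qed.

Lemma ucalc_adjP f T g S : ucalc f T -> ucalc g S ->
  (forall t, g t = (f t)^*%C) -> is_adjoint T S.
Proof.
move=> h h' fg x y; apply: nrm_small_eq => e e0.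
pose K := 40 * (nrm x + 1) * (nrm y + 1).
have x1 : 0 < nrm x + 1 by rewrite ltr_wpDl ?nrm_ge0.
have y1 : 0 < nrm y + 1 by rewrite ltr_wpDl ?nrm_ge0.
have K0 : 0 < K by rewrite !mulr_gt0.
have d0 : 0 < e / K by rewrite divr_gt0.
have [f' [T' [l ff TT]]] := h _ d0.
have [S' hS' lS'] := laurent_adj l.
have SS z : nrm (S z - S' z) <= 4 * (e / K) * nrm z.
  have hb := ucalc_lin (-1) (laurent_ucalc lS') h'.
  have := ucalc_bound hb (ltW d0); move=> /(_ _ z)h1.
  rewrite addrC scaleN1r in h1; apply: h1 => t.
  by rewrite mulN1r addrC fg -conjB nrm_conj.
have -> : ip (T x) y - ip x (S y) = ip (T x - T' x) y - ip x (S y - S' y).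
  by rewrite ipBl ipBr hS'; lmod.
rewrite (le_trans (nrmB _ _))// (le_trans (lerD (nrm_ip_le _ _) (nrm_ip_le _ _)))//.
have xy : nrm x * nrm y <= (nrm x + 1) * (nrm y + 1).
  by rewrite ler_pM ?nrm_ge0// lerDl.
have h1 : 4 * nrm (T x - T' x) * nrm y <= 4 * (e / K * nrm x) * nrm y.
  by rewrite ler_wpM2r ?nrm_ge0// ler_wpM2l.
have h2 : 4 * nrm x * nrm (S y - S' y) <= 4 * nrm x * (4 * (e / K) * nrm y).
  by rewrite ler_wpM2l// mulr_ge0 ?nrm_ge0.
rewrite (le_trans (lerD h1 h2))//.
have -> : 4 * (e / K * nrm x) * nrm y + 4 * nrm x * (4 * (e / K) * nrm y) =
  20 * (e / K) * (nrm x * nrm y) by ring.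
rewrite (@le_trans _ _ (20 * (e / K) * ((nrm x + 1) * (nrm y + 1))))//.
  by apply: ler_wpM2l => //; apply: mulr_ge0 => //; exact: ltW.
have -> : 20 * (e / K) * ((nrm x + 1) * (nrm y + 1)) = e / 2.
  by rewrite /K; field; rewrite !gt_eqF.
by rewrite ler_pdivrMr// ler_peMr ?ler1n// ltW.
Qed.

Lemma C0_ucalc (f : R -> C) : C0 f -> exists T, ucalc f T.
Proof.
by move=> f0; apply: ucalc_exists => e e0; exact: laurent_dense.
Qed.

End unitary_calculus.

Section resolvent_function.
Context {R : realType}.

Lemma nrm_addi_ge (t l : R) : `|t| <= nrm (t%:C + l%:C * 'i%C : R[i]).
Proof.
rewrite -(@ler_pXn2r _ 2) ?nnegrE ?nrm_ge0// nrm_addi real_normK ?num_real//.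
by rewrite lerDl sqr_ge0.
Qed.

Lemma nrm_addi_gel (t l : R) : `|l| <= nrm (t%:C + l%:C * 'i%C : R[i]).
Proof.
rewrite -(@ler_pXn2r _ 2) ?nnegrE ?nrm_ge0// nrm_addi real_normK ?num_real//.
by rewrite lerDr sqr_ge0.
Qed.

Lemma cont_id : cont (fun t : R => t%:C : R[i]).
Proof. by apply: (@contR _ id) => t; exact: cvg_id. Qed.

Lemma C0_resolvent_gen (l : R) : l != 0 -> C0 (fun t : R => (t%:C + l%:C * 'i%C : R[i])^-1).
Proof.
move=> l0; apply/C0P; split.
  apply: contV => [|t]; last exact: addi_neq0.
  by apply: contD; [exact: cont_id|exact: cont_cst].
move=> e e0; exists e^-1 => t te; rewrite nrmV.
have h := le_trans te (nrm_addi_ge t l).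
by rewrite -[leRHS]invrK lef_pV2// posrE ?invr_gt0// (lt_le_trans _ h)// invr_gt0.
Qed.

Lemma C0_resolvent : C0 (fun t : R => (t%:C + 'i%C : R[i])^-1).
Proof. by have := C0_resolvent_gen (oner_neq0 R); rewrite rmorph1 mul1r. Qed.

End resolvent_function.

(** * Resolvents of a self-adjoint regular operator *)

Section resolvents.
Context {R : realType} {B : cstarAlgType R} {X : hilbModType B}.
Local Notation C := R[i].
Variable D : set (X * X).
Hypothesis Dsr : selfadjoint_regular D.

Lemma sa_fun x y y' : D (x, y) -> D (x, y') -> y = y'.
Proof. by case: Dsr => -[[_ h _ _] _ _ _] _; exact: h. Qed.

Lemma sa_lin (k : C) x y x' y' : D (x, y) -> D (x', y') -> D (k *: x + x', k *: y + y').
Proof. by case: Dsr => -[[_ _ h _] _ _ _] _; exact: h. Qed.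

Lemma sa_dense : dense (dom D).
Proof. by case: Dsr => -[[]]. Qed.

Lemma sa_closed : closed D.
Proof. by case: Dsr => -[]. Qed.

Lemma saD x y x' y' : D (x, y) -> D (x', y') -> D (x + x', y + y').
Proof. by move=> h /(sa_lin 1 h); rewrite !scale1r. Qed.

Lemma sa00 : D (0, 0).
Proof.
have /denseP/(_ 0 1 ltr01)[y [z Dyz] _] := sa_dense.
by have := sa_lin (-1) Dyz Dyz; rewrite !scaleN1r !addNr.
Qed.

Lemma saZ (k : C) x y : D (x, y) -> D (k *: x, k *: y).
Proof. by move=> h; have := sa_lin k h sa00; rewrite !addr0. Qed.

Lemma saB x y x' y' : D (x, y) -> D (x', y') -> D (x - x', y - y').
Proof. by move=> h /(saZ (-1)); rewrite !scaleN1r; exact: saD. Qed.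

Lemma sa_sym x y x' y' : D (x, y) -> D (x', y') -> ip y x' = ip x y'.
Proof. by case: Dsr => _ Da h; rewrite -{1}Da => /(_ _ _ h). Qed.

Lemma sa_adj x' y' : (forall x y, D (x, y) -> ip y x' = ip x y') -> D (x', y').
Proof. by case: Dsr => _ Da h; rewrite -Da => x y /h. Qed.

(* As D is symmetric, D + i and D - i have the same norm on each vector of the
   domain, so both dominate the norm of their half difference i x. *)
Lemma sa_addi_ge x y : D (x, y) -> nrm x <= nrm (y + 'i%C *: x) /\ nrm x <= nrm (y - 'i%C *: x).
Proof.
move=> h; have xy := sa_sym h h.
have e : nrm (y + 'i%C *: x) = nrm (y - 'i%C *: x).
  apply/eqP; rewrite -(@eqrXn2 _ 2) ?nrm_ge0// !nrm_ip; apply/eqP; congr nrm.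
  by rewrite !(ipDl, ipDr, ipNl, ipNr) !(ipZl, ipZr) -xy conji; lmod.
have : 2 * nrm x <= nrm (y + 'i%C *: x) + nrm (y - 'i%C *: x).
  have <- : nrm ((y + 'i%C *: x) - (y - 'i%C *: x)) = 2 * nrm x.
    have -> : (y + 'i%C *: x) - (y - 'i%C *: x) = (2 * 'i%C) *: x by lmod.
    by rewrite nrmZ nrmM nrm_nat nrmi mulr1.
  exact: nrmB.
by rewrite -e => hx; split; lra.
Qed.

Lemma sa_range_dense (z : X) (e : R) : 0 < e -> exists x y w,
  [/\ D (x, y), D (y, w) & nrm (x + w - z) < e].
Proof.
move=> e0; case: Dsr => -[_ _ _ /denseP/(_ z e e0)[_ [x [y [w [h1 h2 ->]]]] hz]] Da.
by exists x, y, w; split=> //; rewrite -Da.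
Qed.

Lemma sa_sign_ge (s : bool) x y : D (x, y) ->
  nrm x <= nrm (y - (-1) ^+ s *: ('i%C *: x)).
Proof.
move=> /sa_addi_ge[h1 h2].
by case: s; rewrite ?expr1 ?expr0 ?scaleN1r ?opprK ?scale1r.
Qed.

(** Regularity makes the range of 1 + D^2 = (D - i)(D + i) dense, hence also the ranges of D - i and
    D + i. Both operators are closed and, by [sa_addi_ge], bounded below, so these ranges are
    everything. *)
Lemma sa_surj (s : bool) z : exists x, D (x, z + (-1) ^+ s *: ('i%C *: x)).
Proof.
pose e n : R := 2^-1 ^+ n.
have e0 n : 0 < e n by rewrite exprn_gt0// invr_gt0.
have /choice[v hv] n : exists v : X, exists2 w, D (v, w) &
    nrm (w - (-1) ^+ s *: ('i%C *: v) - z) < e n.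
  have [x [y [w [h1 h2 h3]]]] := sa_range_dense z (e0 n).
  exists (y + (-1) ^+ s *: ('i%C *: x)), (w + (-1) ^+ s *: ('i%C *: y)).
    by apply: saD => //; do 2!apply: saZ.
  suff -> : w + (-1) ^+ s *: ('i%C *: y) - (-1) ^+ s *: ('i%C *: (y + (-1) ^+ s *: ('i%C *: x))) = x + w by [].
  have -> : (-1) ^+ s *: ('i%C *: (y + (-1) ^+ s *: ('i%C *: x))) =
     (-1) ^+ s *: ('i%C *: y) + ((-1) ^+ s * (-1) ^+ s) *: ('i%C * 'i%C *: x) by lmod.
  by rewrite -expr2 sqrr_sign scale1r ii; lmod.
have /choice[w hw] n : exists w, D (v n, w) /\ nrm (w - (-1) ^+ s *: ('i%C *: v n) - z) < e n.
  by have [w] := hv n; exists w.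
have half1 : 2^-1 < 1 :> R by rewrite invf_lt1// ltr1n.
have half0 : 0 <= 2^-1 :> R by rewrite invr_ge0.
have [l vl _] : exists2 l, tends v l & True.
  have dv n : nrm (v n.+1 - v n) <= 2 * 2^-1 ^+ n.
    have [d1 n1] := hw n; have [d2 n2] := hw n.+1.
    apply: le_trans (sa_sign_ge s (saB d2 d1)) _.
    have -> : w n.+1 - w n - (-1) ^+ s *: ('i%C *: (v n.+1 - v n)) =
      (w n.+1 - (-1) ^+ s *: ('i%C *: v n.+1) - z) - (w n - (-1) ^+ s *: ('i%C *: v n) - z) by lmod.
    rewrite (le_trans (nrmB _ _))// mulrDl mul1r lerD//; last exact: ltW n1.
    by rewrite (le_trans (ltW n2))// /e exprS ler_piMl ?exprn_ge0// ltW.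
  by have [l vl _] := geometric_complete (ler0n R 2) half0 half1 dv; exists l.
exists l; have /closedP := sa_closed; apply => d d0.
have [N1 h1] := vl _ (divr_gt0 d0 (ltr0n R 4)).
have [N2 h2] := small_pow 4 half0 half1 d0.
pose n := maxn N1 N2; have [Dn hn] := hw n.
exists (v n, w n) => //; rewrite nrm_pair /= gt_max.
have nv : nrm (v n - l) <= d / 4 by apply: h1; rewrite leq_maxl.
have ne : 4 * e n <= d by apply: h2; rewrite leq_maxr.
apply/andP; split; first by move: nv; lra.
have -> : w n - (z + (-1) ^+ s *: ('i%C *: l)) =
  (w n - (-1) ^+ s *: ('i%C *: v n) - z) + (-1) ^+ s *: ('i%C *: (v n - l)) by lmod.
apply: le_lt_trans (nrmD _ _) _; rewrite !nrmZ nrmi nrmX nrmN nrm1 expr1n !mul1r.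
by move: hn nv ne; lra.
Qed.

Lemma sa_resolvent : exists Rp Rm : X -> X,
  [/\ forall z x, Rp z = x <-> D (x, z - 'i%C *: x),
      forall z x, Rm z = x <-> D (x, z + 'i%C *: x) & is_adjoint Rp Rm].
Proof.
have /choice[Rp hp] z : exists x, D (x, z - 'i%C *: x).
  by have [x] := sa_surj true z; rewrite expr1 scaleN1r; exists x.
have /choice[Rm hm] z : exists x, D (x, z + 'i%C *: x).
  by have [x] := sa_surj false z; rewrite expr0 scale1r; exists x.
exists Rp, Rm; split.
- move=> z x; split=> [<-|h]; first exact: hp.
  have [h1 _] := sa_addi_ge (saB (hp z) h); apply/eqP; rewrite -subr_eq0; apply/eqP/nrm_le0.
  by apply: le_trans h1 _; rewrite [X in nrm X](_ : _ = 0) ?nrm0//; lmod.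
- move=> z x; split=> [<-|h]; first exact: hm.
  have [_ h1] := sa_addi_ge (saB (hm z) h); apply/eqP; rewrite -subr_eq0; apply/eqP/nrm_le0.
  by apply: le_trans h1 _; rewrite [X in nrm X](_ : _ = 0) ?nrm0//; lmod.
- move=> a b; have := sa_sym (hp a) (hm b).
  rewrite ipBl ipDr ipZl ipZr conji => h.
  by apply: (addIr ('i%C *: ip (Rp a) (Rm b))); rewrite -h; lmod.
Qed.

Lemma C0_calculus_exists : exists Phi, C0_calculus D Phi.
Proof.
have [Rp [Rm [hp hm pm]]] := sa_resolvent.
(* U = (D - i)(D + i)^-1 is the Cayley transform of D, and V is its inverse. *)
pose U z := z - (2 * 'i%C) *: Rp z; pose V z := z + (2 * 'i%C) *: Rm z.
have UV : is_adjoint U V.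
  move=> x y; rewrite ipBl ipDr ipZl ipZr pm conjM conji.
  have -> : (2 : C)^*%C = 2 by have := conj_real (2 : R); rewrite rmorph_nat.
  by lmod.
have Rpz z : D (Rp z, z - 'i%C *: Rp z) by apply/hp.
have Rmz z : D (Rm z, z + 'i%C *: Rm z) by apply/hm.
have VUK x : V (U x) = x.
  rewrite /V (_ : Rm (U x) = Rp x) /U; first by lmod.
  by apply/hm; have := Rpz x; congr D; congr pair; lmod.
have UVK x : U (V x) = x.
  rewrite /U (_ : Rp (V x) = Rm x) /V; first by lmod.
  by apply/hp; have := Rmz x; congr D; congr pair; lmod.
pose u := @ucalc _ _ _ U V.
pose Phi (g : R -> C) : X -> X := xget (fun=> 0) [set T | u g T].
have PhiP g : C0 g -> u g (Phi g).
  by move=> /(C0_ucalc UV VUK UVK)[T hT]; exact: (xgetPex (fun=> 0) (ex_intro _ T hT)).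
have Phi_eq g T x : C0 g -> u g T -> Phi g x = T x.
  by move=> g0 hT; exact: (ucalc_unique UV VUK UVK (PhiP _ g0) hT).
exists Phi; split.
- move=> k g h x g0 h0; apply: (Phi_eq _ (fun y => k *: Phi g y + Phi h y)).
    exact: C0D (C0Z k g0) h0.
  exact: (ucalc_lin k (PhiP _ g0) (PhiP _ h0)).
- move=> g h x g0 h0; apply: (Phi_eq _ (fun y => Phi g (Phi h y))); first exact: C0_mul.
  exact: (ucalc_mul UV VUK UVK (PhiP _ g0) (PhiP _ h0)).
- move=> g g0; apply: (ucalc_adjP UV VUK UVK (PhiP _ g0) (PhiP _ (C0_conj g0))) => t //.
- move=> x z; rewrite (Phi_eq _ Rp); first exact: hp.
    exact: C0_resolvent.
  (* The resolvent function is affine in the Cayley transform, (t + i)^-1 = (1 - cay t) / 2i, so the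
     calculus gives it the correct operator without any limit. *)
  have l : laurent U V (fun t => - (2 * 'i%C)^-1 * cay t + (2 * 'i%C)^-1 * 1)
    (fun x => - (2 * 'i%C)^-1 *: U x + (2 * 'i%C)^-1 *: x).
    by apply: laurent_lin; [exact: laurent_u|exact: laurentZ (laurent_1 _ _)].
  apply: laurent_ucalc; apply: laurent_ext l => [t|y].
    by rewrite /cay; field; rewrite addi1_neq0 i_neq0.
  have i2 : (2 * 'i%C) != 0 :> C by rewrite mulf_neq0 ?i_neq0 ?pnatr_eq0.
  rewrite /U scalerBr scaleNr scalerA mulNr mulVf// scaleN1r opprK.
  by lmod.
Qed.

End resolvents.

(** * Cutoffs and norm estimates for the calculus *)

Section cutoff.
Context {R : realType}.
Local Notation C := R[i].

Definition cutoff (n : nat) (t : R) : R := Num.max 0 (Num.min 1 (n.+1%:R - `|t|)).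

Lemma cutoff_ge0 n t : 0 <= cutoff n t.
Proof. by rewrite le_max lexx. Qed.

Lemma cutoff_le1 n t : cutoff n t <= 1.
Proof. by rewrite ge_max ler01 ge_min lexx. Qed.

Lemma cutoff_eq1 n t : `|t| <= n%:R -> cutoff n t = 1.
Proof.
move=> tn; rewrite /cutoff (min_idPl _) ?(max_idPr _)//.
by rewrite lerBrDl -natr1 lerD2r.
Qed.

Lemma cutoff_eq0 n t : n.+1%:R <= `|t| -> cutoff n t = 0.
Proof.
move=> nt; rewrite /cutoff (max_idPl _)// ge_min subr_le0 nt orbT//.
Qed.

Lemma continuous_max (f g : R -> R) : continuous f -> continuous g ->
  continuous (fun t => Num.max (f t) (g t)).
Proof.
move=> cf cg t; rewrite (_ : (fun t => _) = fun t => (f t + g t + `|f t - g t|) / 2).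
  apply: cvgM; last exact: cvg_cst.
  apply: cvgD; first by apply: cvgD; [exact: cf|exact: cg].
  by apply: cvg_norm; apply: cvgB; [exact: cf|exact: cg].
by apply/funext => s; rewrite -[RHS](_ : Num.max (f s) (g s) = _)// maxr_absE.
Qed.

Lemma continuous_cutoff n : continuous (cutoff n).
Proof.
apply: continuous_max => [t|]; first exact: cvg_cst.
rewrite (_ : (fun t => _) = fun t => - Num.max (- 1) (- (n.+1%:R - `|t|))); last first.
  by apply/funext => t; rewrite oppr_max !opprK.
move=> t; apply: cvgN; move: t; apply: continuous_max => t; first exact: cvg_cst.
apply: cvgN; apply: cvgB; first exact: cvg_cst.
by apply: cvg_norm; exact: cvg_id.
Qed.

(** Compact support makes f g an element of C_0(R) for every continuous f; unbounded functions of D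
    are therefore tested against this class. *)
Definition Cc (g : R -> C) := cont g /\ exists M : R, forall t, M <= `|t| -> g t = 0.

Lemma Cc_C0 g : Cc g -> C0 g.
Proof.
move=> [cg [M hM]]; apply/C0P; split=> // e e0; exists M => t /hM ->.
by rewrite nrm0 ltW.
Qed.

Lemma CcM g h : cont h -> Cc g -> Cc (fun t => h t * g t).
Proof.
move=> ch [cg [M hM]]; split; first exact: contM.
by exists M => t /hM ->; rewrite mulr0.
Qed.

Lemma Cc_conj g : Cc g -> Cc (fun t => (g t)^*%C).
Proof.
move=> [cg [M hM]]; split; first exact: cont_conj.
by exists M => t /hM ->; exact: conjc0.
Qed.

Lemma Cc_cutoff n : Cc (fun t => (cutoff n t)%:C).
Proof.
split; first by apply: contR; exact: continuous_cutoff.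
by exists n.+1%:R => t /cutoff_eq0 ->; rewrite rmorph0.
Qed.

Lemma nrm_cutoff n t : nrm ((cutoff n t)%:C : C) <= 1.
Proof. by rewrite nrm_real ger0_norm ?cutoff_ge0 ?cutoff_le1. Qed.

Lemma cutoff_approx g (e : R) : C0 g -> 0 < e -> exists N, forall n t, (N <= n)%N ->
  nrm ((cutoff n t)%:C * g t - g t) <= e.
Proof.
move=> /C0P[_ g0] e0; have [M hM] := g0 e e0.
exists (Num.Def.archi_bound `|M|) => n t Nn.
have [tn|nt] := lerP `|t| n%:R.
  by rewrite cutoff_eq1// rmorph1 mul1r subrr nrm0 ltW.
have -> : (cutoff n t)%:C * g t - g t = (cutoff n t - 1)%:C * g t.
  by rewrite rmorphB rmorph1 mulrBl mul1r.
rewrite nrmM nrm_real (@le_trans _ _ (nrm (g t)))//.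
  rewrite ler_piMl ?nrm_ge0// distrC ger0_norm ?subr_ge0 ?cutoff_le1//.
  by rewrite lerBlDr lerDl cutoff_ge0.
apply: hM; rewrite (le_trans (ler_norm _))// ltW// (le_lt_trans _ nt)//.
by rewrite (le_trans (ltW (archi_boundP _)))// ler_nat.
Qed.

End cutoff.

Section calculus.
Context {R : realType} {B : cstarAlgType R} {X : hilbModType B}.
Local Notation C := R[i].
Variable D : set (X * X).
Hypothesis Dsr : selfadjoint_regular D.
Variable Phi : (R -> C) -> X -> X.
Hypothesis PhiD : C0_calculus D Phi.
Implicit Types (g h : R -> C) (x y z : X).

Let r (t : R) : C := (t%:C + 'i%C)^-1.
Let r0 : C0 r := C0_resolvent.

Lemma calc_ext g h x : (forall t, g t = h t) -> Phi g x = Phi h x.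
Proof. by move=> /funext ->. Qed.

Lemma calc_adj g : C0 g -> is_adjoint (Phi g) (Phi (fun t => (g t)^*%C)).
Proof. by case: PhiD => _ _ h _; exact: h. Qed.

Lemma calcM g h x : C0 g -> C0 h -> Phi (fun t => g t * h t) x = Phi g (Phi h x).
Proof. by case: PhiD => _ hm _ _; exact: hm. Qed.

Lemma calc_lin k g h x : C0 g -> C0 h ->
  Phi (fun t => k * g t + h t) x = k *: Phi g x + Phi h x.
Proof. by case: PhiD => hl _ _ _; exact: hl. Qed.

Lemma calcD g h x : C0 g -> C0 h -> Phi (fun t => g t + h t) x = Phi g x + Phi h x.
Proof.
move=> g0 h0; rewrite -[Phi g x]scale1r -calc_lin//.
by apply: calc_ext => t; rewrite mul1r.
Qed.

Lemma calc0 x : Phi (fun=> 0) x = 0.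
Proof.
have := calcD x (C0_0 (R := R)) (C0_0 (R := R)).
rewrite (calc_ext _ (h := fun=> 0)) => [/eqP|t]; last by rewrite addr0.
by rewrite -subr_eq0 opprD addrA subrr sub0r oppr_eq0 => /eqP.
Qed.

Lemma calcZ k g x : C0 g -> Phi (fun t => k * g t) x = k *: Phi g x.
Proof.
move=> g0; rewrite -[RHS]addr0 -(calc0 x) -calc_lin//; last exact: C0_0.
by apply: calc_ext => t; rewrite addr0.
Qed.

Lemma calcB g h x : C0 g -> C0 h -> Phi (fun t => g t - h t) x = Phi g x - Phi h x.
Proof.
move=> g0 h0; rewrite -scaleN1r -calcZ// -calcD//; last exact: C0Z.
by apply: calc_ext => t; rewrite mulN1r.
Qed.

Lemma calcC g h x : C0 g -> C0 h -> Phi g (Phi h x) = Phi h (Phi g x).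
Proof.
by move=> g0 h0; rewrite -!calcM//; apply: calc_ext => t; rewrite mulrC.
Qed.

Lemma calc_resP x z : Phi r z = x <-> D (x, z - 'i%C *: x).
Proof. by case: PhiD => _ _ _; apply. Qed.

Lemma calc_res z : D (Phi r z, z - 'i%C *: Phi r z).
Proof. exact/calc_resP. Qed.

Lemma calc_res_surj x y : D (x, y) -> x = Phi r (y + 'i%C *: x).
Proof. by move=> h; apply/esym/calc_resP; rewrite addrK. Qed.

Lemma calc_res_dense x (e : R) : 0 < e -> exists z, nrm (Phi r z - x) < e.
Proof.
move=> e0; have /denseP/(_ x e e0)[y [w Dyw] yx] := sa_dense Dsr.
by exists (w + 'i%C *: y); rewrite -calc_res_surj.
Qed.

(** In the inner product of the left side with itself the conjugate of v cancels v. No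
    Cauchy-Schwarz inequality enters, so the equality is exact, and the sharp bounds that follow
    rest on it. *)
Lemma calc_isom v g x : cont v -> (forall t, nrm (v t) = 1) -> C0 g ->
  nrm (Phi (fun t => v t * g t) x) = nrm (Phi g x).
Proof.
move=> cv v1 g0; have vg : C0 (fun t => v t * g t).
  by apply: C0M => //; exists 1 => t; rewrite v1.
apply/eqP; rewrite -(@eqrXn2 _ 2) ?nrm_ge0// !nrm_ip !calc_adj// -!calcM//.
- apply/eqP; congr (nrm (ip _ _)); apply: calc_ext => t.
  by rewrite conjM mulrACA (conj_unit (v1 t)) mul1r.
- exact: C0_conj.
- exact: C0_conj.
Qed.

Lemma continuous_sqrt (f : R -> R) : continuous f -> continuous (fun t => Num.sqrt (f t)).
Proof. by move=> cf t; apply: continuous_comp; [exact: cf|exact: sqrt_continuous]. Qed.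

(* A continuous f with |f| <= 1 is (v - conj v) / 2i for the unimodular function
   v = sqrt (1 - f^2) + i f. *)
Lemma calc_mono_real1 (f : R -> R) g x : continuous f -> (forall t, `|f t| <= 1) -> C0 g ->
  nrm (Phi (fun t => (f t)%:C * g t) x) <= nrm (Phi g x).
Proof.
move=> cf f1 g0; pose s t := Num.sqrt (1 - f t ^+ 2).
have cs : continuous s.
  apply: continuous_sqrt => t; apply: cvgB; first exact: cvg_cst.
  by rewrite expr2; apply: cvgM; exact: cf.
pose v t : C := (s t)%:C + (f t)%:C * 'i%C.
have cv : cont v.
  by apply: contD; [exact: contR|apply: contM; [exact: contR|exact: cont_cst]].
have v1 t : nrm (v t) = 1.
  have : nrm (v t) ^+ 2 == 1.
    rewrite nrm_addi sqr_sqrtr ?subrK// subr_ge0 -real_normK ?num_real//.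
    by rewrite exprn_ile1.
  rewrite sqrf_eq1 => /orP[/eqP//|/eqP h]; have := nrm_ge0 (v t).
  by rewrite h lerNr oppr0 ler10.
have cv' : cont (fun t => (v t)^*%C) by exact: cont_conj.
have v1' t : nrm (v t)^*%C = 1 by rewrite nrm_conj.
have c0 (w : R -> C) : cont w -> (forall t, nrm (w t) = 1) -> C0 (fun t => w t * g t).
  by move=> cw w1; apply: C0M => //; exists 1 => t; rewrite w1.
have -> : Phi (fun t => (f t)%:C * g t) x = (2 * 'i%C)^-1 *:
    (Phi (fun t => v t * g t) x - Phi (fun t => (v t)^*%C * g t) x).
  rewrite -(calcB x (c0 v cv v1) (c0 _ cv' v1')) -(calcZ _ x (C0B (c0 v cv v1) (c0 _ cv' v1'))).
  apply: calc_ext => t; rewrite /v conjD conjM !conj_real conji.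
  by field; rewrite i_neq0.
rewrite nrmZ nrmV nrmM nrm_nat nrmi mulr1.
have := nrmB (Phi (fun t => v t * g t) x) (Phi (fun t => (v t)^*%C * g t) x).
by rewrite !calc_isom//; lra.
Qed.

Lemma calc_mono_real (f : R -> R) g x M : continuous f -> 0 < M ->
  (forall t, `|f t| <= M) -> C0 g ->
  nrm (Phi (fun t => (f t)%:C * g t) x) <= M * nrm (Phi g x).
Proof.
move=> cf M0 fM g0.
have cf' : continuous (fun t => f t / M).
  by move=> t; apply: cvgM; [exact: cf|exact: cvg_cst].
have f1 t : `|f t / M| <= 1.
  by rewrite normrM normfV (gtr0_norm M0) ler_pdivrMr// mul1r.
have fg : C0 (fun t => (f t / M)%:C * g t).
  by apply: C0M => //; [exact: contR|exists 1 => t; rewrite nrm_real].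
have := calc_mono_real1 x cf' f1 g0; rewrite -(ler_pM2l M0); apply: le_trans.
rewrite -{1}(gtr0_norm M0) -nrm_real -nrmZ -calcZ//.
apply: eq_le_r; congr nrm; apply: calc_ext => t.
have {1}-> : f t = M * (f t / M) by rewrite mulrC divfK ?gt_eqF.
by rewrite rmorphM mulrA.
Qed.

Lemma cont_Re g : cont g -> continuous (fun t => complex.Re (g t)).
Proof.
move=> /contP cg t; apply/cvgrPdist_le => e e0.
have [d d0 h] := cg t e e0; apply/nbhs_normP; exists d => // s /= st.
apply: le_trans (h s _); last by rewrite distrC.
rewrite distrC -[leLHS](@ger0_norm _ `|_|) ?normr_ge0// -(@ler_pXn2r _ 2) ?nnegrE ?nrm_ge0//.
rewrite nrm_sqr real_normK ?num_real// real_normK ?num_real//.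
by case: (g s) (g t) => a b [c d'] /=; rewrite lerDl sqr_ge0.
Qed.

Lemma cont_Im g : cont g -> continuous (fun t => complex.Im (g t)).
Proof.
move=> cg; have := cont_Re (contM (cont_cst (- 'i%C)) cg).
suff -> : (fun t => complex.Re (- 'i%C * g t)) = (fun t => complex.Im (g t)) by [].
by apply/funext => t; case: (g t) => a b /=; rewrite oppr0 mul0r sub0r mulN1r opprK.
Qed.

Lemma Re_le (k : C) : `|complex.Re k| <= nrm k.
Proof.
rewrite -(@ler_pXn2r _ 2) ?nnegrE ?nrm_ge0// nrm_sqr real_normK ?num_real//.
by rewrite lerDl sqr_ge0.
Qed.

Lemma Im_le (k : C) : `|complex.Im k| <= nrm k.
Proof.
rewrite -(@ler_pXn2r _ 2) ?nnegrE ?nrm_ge0// nrm_sqr real_normK ?num_real//.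
by rewrite lerDr sqr_ge0.
Qed.

Lemma ReIm (k : C) : k = (complex.Re k)%:C + 'i%C * (complex.Im k)%:C.
Proof.
by case: k => a b; apply/eqP; rewrite eq_complex /= !(mul0r, mul1r, subr0, add0r, addr0, mulr0) !eqxx.
Qed.

Lemma calc_mono f g x M : cont f -> 0 < M -> (forall t, nrm (f t) <= M) -> C0 g ->
  nrm (Phi (fun t => f t * g t) x) <= 2 * M * nrm (Phi g x).
Proof.
move=> cf M0 fM g0.
have fr : forall t, `|complex.Re (f t)| <= M by move=> t; exact: le_trans (Re_le _) (fM t).
have fi : forall t, `|complex.Im (f t)| <= M by move=> t; exact: le_trans (Im_le _) (fM t).
have h1 : C0 (fun t => (complex.Re (f t))%:C * g t).
  by apply: C0M => //; [apply: contR; exact: cont_Re|exists M => t; rewrite nrm_real].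
have h2 : C0 (fun t => (complex.Im (f t))%:C * g t).
  by apply: C0M => //; [apply: contR; exact: cont_Im|exists M => t; rewrite nrm_real].
rewrite (@calc_ext _ (fun t => 'i%C * ((complex.Im (f t))%:C * g t) + (complex.Re (f t))%:C * g t)); last first.
  by move=> t; rewrite {1}[f t]ReIm mulrDl addrC mulrA.
rewrite calc_lin// (le_trans (nrmD _ _))// nrmZ nrmi mul1r mulrAC mulrDl mulrDl !mul1r.
by rewrite -[X in _ <= X + _]mulrC -[X in _ <= _ + X]mulrC lerD// calc_mono_real//; [exact: cont_Im|exact: cont_Re].
Qed.

(** [calc_mono] compares with [Phi h] for h in C_0(R), which excludes h = 1. On the dense range of
    the resolvent, Phi g (Phi r z) = Phi (g r) z brings it into play, and [Phi g] is already known
    to be bounded by some K. *)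
Lemma calc_bound g x M : C0 g -> (forall t, nrm (g t) <= M) -> 0 <= M ->
  nrm (Phi g x) <= 2 * M * nrm x.
Proof.
move=> g0 gM; rewrite le_eqVlt => /orP[/eqP M0|M0].
  rewrite (@calc_ext _ (fun=> 0)) ?calc0 ?nrm0 -?M0 ?mulr0 ?mul0r// => t.
  by apply: nrm_le0; rewrite M0.
apply/ler_addgt0Pr => e e0.
have [K K0 hK] := adjointable_bounded (calc_adj g0).
have K1 : 0 < 2 * M + K + 1 by move: M0 K0; lra.
pose d := e / (2 * M + K + 1).
have d0 : 0 < d by rewrite divr_gt0.
have [z hz] := calc_res_dense x d0; set y := Phi r z in hz.
have h1 : nrm (Phi g y) <= 2 * M * nrm y.
  rewrite /y -calcM//; apply: calc_mono => //; exact: C0_cont.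
have h2 : nrm (Phi g x) <= nrm (Phi g y) + K * d.
  rewrite (le_trans (nrm_le_dist _ (Phi g y)))// lerD2l -(adjB _ _ (calc_adj g0)).
  by rewrite (le_trans (hK _))// ler_wpM2l// nrm_sym ltW.
have h3 : nrm y <= nrm x + d by rewrite (le_trans (nrm_le_dist _ x))// lerD2l ltW.
have h4 : d * (2 * M + K + 1) = e by rewrite /d divfK ?gt_eqF.
have h5 : 2 * M * nrm y <= 2 * M * (nrm x + d) by rewrite ler_wpM2l// mulr_ge0// ltW.
by move: h1 h2 h3 h4 h5 d0; nra.
Qed.

Lemma calc_cutoff_bound n x : nrm (Phi (fun t => (cutoff n t)%:C) x) <= 2 * nrm x.
Proof.
have := @calc_bound (fun t => (cutoff n t)%:C) x 1 (Cc_C0 (Cc_cutoff n)) (nrm_cutoff n) ler01.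
by rewrite mulr1.
Qed.

Lemma calc_cutoff g x (e : R) : C0 g -> 0 < e -> exists N, forall n, (N <= n)%N ->
  nrm (Phi (fun t => (cutoff n t)%:C * g t) x - Phi g x) <= e.
Proof.
move=> g0 e0; have x1 : 0 < 2 * (nrm x + 1) by rewrite mulr_gt0 ?ltr_wpDl ?nrm_ge0.
have d0 : 0 < e / (2 * (nrm x + 1)) by rewrite divr_gt0.
have [N hN] := cutoff_approx g0 d0; exists N => n Nn.
have kg : C0 (fun t => (cutoff n t)%:C * g t) by apply: C0_mul => //; exact: Cc_C0 (Cc_cutoff n).
rewrite -calcB//.
have h := calc_bound x (C0B kg g0) (fun t => hN n t Nn) (ltW d0).
rewrite (le_trans h)// [leLHS](_ : _ = e * (nrm x / (nrm x + 1))).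
  by rewrite ler_piMr ?(ltW e0)// ler_pdivrMr ?ltr_wpDl ?nrm_ge0// mul1r lerDl.
by field; rewrite gt_eqF// ltr_wpDl ?nrm_ge0.
Qed.

(** On the dense range of the resolvent this is uniform convergence of the cutoffs times r;
    [calc_cutoff_bound] extends it to all vectors. *)
Lemma calc_tends x : tends (fun n => Phi (fun t => (cutoff n t)%:C) x) x.
Proof.
move=> e e0; have d0 : 0 < e / 4 by rewrite divr_gt0.
have [z hz] := calc_res_dense x d0; set y := Phi r z in hz.
have [N hN] := calc_cutoff z r0 d0; exists N => n /hN.
have kn0 := Cc_C0 (@Cc_cutoff R n).
rewrite calcM// -/y => h1.
have h2 := calc_cutoff_bound n (x - y).
rewrite (adjB _ _ (calc_adj kn0)) in h2.
move: h1 h2 hz; set a := Phi _ y; set b := Phi _ x => h1 h2 hz.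
have h3 := nrm_tri a b x; have h4 := nrm_tri y a x.
by rewrite [nrm (x - y)]nrm_sym in h2; move: h1 h2 h3 h4 hz; lra.
Qed.

Lemma calc_eq0 x : (forall n, Phi (fun t => (cutoff n t)%:C) x = 0) -> x = 0.
Proof.
move=> h; apply: (tends_unique (calc_tends x)) => e e0; exists 0%N => n _.
by rewrite h subrr nrm0 ltW.
Qed.

End calculus.

(** * Uniqueness of the C_0-calculus *)

Section calculus_unique.
Context {R : realType} {B : cstarAlgType R} {X : hilbModType B}.
Local Notation C := R[i].
Variable D : set (X * X).
Hypothesis Dsr : selfadjoint_regular D.
Variables Phi Psi : (R -> C) -> X -> X.
Hypothesis PhiD : C0_calculus D Phi.
Hypothesis PsiD : C0_calculus D Psi.

Let r (t : R) : C := (t%:C + 'i%C)^-1.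
Let r0 : C0 r := C0_resolvent.
Let rc (t : R) : C := (r t)^*%C.
Let rc0 : C0 rc := C0_conj r0.

Let eq_r x : Phi r x = Psi r x.
Proof. by apply/(calc_resP PhiD); exact: calc_res PsiD x. Qed.

Let eq_rc x : Phi rc x = Psi rc x.
Proof.
apply: ip_ext => z.
by rewrite -(calc_adj PhiD r0) -(calc_adj PsiD r0) eq_r.
Qed.

(** Multipliers that preserve the agreement of the two calculi. Unlike agreement itself, this makes
    sense for functions that do not vanish at infinity, such as [cay]. *)
Let good (f : R -> C) := [/\ cont f, exists M, forall t, nrm (f t) <= M
  & forall h, C0 h -> (forall x, Phi h x = Psi h x) ->
      forall x, Phi (fun t => f t * h t) x = Psi (fun t => f t * h t) x].

Let cayE t : cay t = 1 - 2 * 'i%C * r t.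
Proof. by rewrite /cay /r; field; exact: addi1_neq0. Qed.

Let cont_cay : cont (@cay R).
Proof.
rewrite (_ : @cay R = fun t => 1 - 2 * 'i%C * r t); last by apply/funext => t; exact: cayE.
by apply: contB; [exact: cont_cst|apply: contM; [exact: cont_cst|exact: C0_cont]].
Qed.

(** Only the functions are of interest here, so the identity stands in for both operators of
    [laurent]. *)
Let laurent_good f (T : X -> X) : laurent (fun x => x) (fun x => x) f T -> good f.
Proof.
have affine (s : R -> C) (k : C) : C0 s -> (forall x, Phi s x = Psi s x) ->
    forall h, C0 h -> (forall x, Phi h x = Psi h x) -> forall x,
    Phi (fun t => (1 - k * s t) * h t) x = Psi (fun t => (1 - k * s t) * h t) x.
  move=> s0 hs h h0 hh x.
  have e t : (1 - k * s t) * h t = - k * (s t * h t) + h t by ring.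
  have sh : C0 (fun t => s t * h t) by exact: C0_mul.
  rewrite (calc_ext Phi _ e) (calc_ext Psi _ e) (calc_lin PhiD)// (calc_lin PsiD)//.
  by rewrite (calcM PhiD)// (calcM PsiD)// hh hs.
elim=> [|||k g S g' S' _ [c1 [M1 b1] h1] _ [c2 [M2 b2] h2]|
  g S g' S' _ [c1 [M1 b1] h1] _ [c2 [M2 b2] h2]].
- split; [exact: cont_cay|by exists 1 => t; rewrite nrm_cay|].
  move=> h h0 hh x; have e t : cay t * h t = (1 - 2 * 'i%C * r t) * h t by rewrite cayE.
  by rewrite (calc_ext Phi _ e) (calc_ext Psi _ e); exact: affine.
- split; [exact: cont_conj cont_cay|by exists 1 => t; rewrite nrm_conj nrm_cay|].
  move=> h h0 hh x.
  have e t : (cay t)^*%C * h t = (1 - (2 * 'i%C)^*%C * rc t) * h t.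
    by rewrite cayE conjB conj1 conjM.
  by rewrite (calc_ext Phi _ e) (calc_ext Psi _ e); exact: affine.
- split; [exact: cont_cst|by exists 1 => t; rewrite nrm1|].
  move=> h h0 hh x; have e t : 1 * h t = h t by rewrite mul1r.
  by rewrite (calc_ext Phi _ e) (calc_ext Psi _ e).
- split.
  + by apply: contD => //; apply: contM => //; exact: cont_cst.
  + exists (nrm k * M1 + M2) => t; rewrite (le_trans (nrmD _ _))// nrmM lerD//.
    by rewrite ler_wpM2l ?nrm_ge0.
  + move=> h h0 hh x.
    have e t : (k * g t + g' t) * h t = k * (g t * h t) + g' t * h t by ring.
    have gh : C0 (fun t => g t * h t) by apply: C0M => //; exists M1.
    have gh' : C0 (fun t => g' t * h t) by apply: C0M => //; exists M2.
    by rewrite (calc_ext Phi _ e) (calc_ext Psi _ e) (calc_lin PhiD)// (calc_lin PsiD)// h1// h2.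
- split.
  + exact: contM.
  + exists (M1 * M2) => t; rewrite nrmM ler_pM ?nrm_ge0//.
  + move=> h h0 hh x.
    have e t : (g t * g' t) * h t = g t * (g' t * h t) by rewrite mulrA.
    have gh' : C0 (fun t => g' t * h t) by apply: C0M => //; exists M2.
    by rewrite (calc_ext Phi _ e) (calc_ext Psi _ e) h1// => y; exact: h2.
Qed.

(** Laurent polynomials f approximate g uniformly but need not lie in C_0(R). On vectors [Phi r z]
    only g r and f r occur, and f r is covered by [laurent_good]; such vectors are dense. *)
Theorem C0_calculus_unique g x : C0 g -> Phi g x = Psi g x.
Proof.
move=> g0; have cg : cont g by exact: C0_cont.
have key z : Phi g (Phi r z) = Psi g (Psi r z).
  rewrite -(calcM PhiD)// -(calcM PsiD)//; apply: nrm_small_eq => e e0.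
  have z1 : 0 < 4 * (nrm z + 1) by rewrite mulr_gt0 ?ltr_wpDl ?nrm_ge0.
  pose d := e / (4 * (nrm z + 1)); have d0 : 0 < d by rewrite divr_gt0.
  have [f [T [lf hf]]] := @laurent_dense R B X (fun x => x) (fun x => x) g d g0 d0.
  have [cf [M hM] fP] := laurent_good lf.
  have fr : C0 (fun t => f t * r t) by apply: C0M => //; exists M.
  have gr : C0 (fun t => g t * r t) by exact: C0_mul.
  have rb t : nrm (r t) <= 1.
    rewrite nrmV invf_le1; last first.
      by rewrite (lt_le_trans ltr01)//; have := nrm_addi_gel t 1; rewrite rmorph1 mul1r normr1.
    by have := nrm_addi_gel t 1; rewrite rmorph1 mul1r normr1.
  have db t : nrm (g t * r t - f t * r t) <= d.
    rewrite -mulrBl nrmM -[leRHS]mulr1 ler_pM ?nrm_ge0//.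
  have hb (P : (R -> C) -> X -> X) : C0_calculus D P ->
     nrm (P (fun t => g t * r t) z - P (fun t => f t * r t) z) <= 2 * d * nrm z.
    move=> hP; rewrite -(calcB hP)//.
    by apply: (calc_bound Dsr hP) => //; [exact: C0B|exact: ltW].
  apply: le_trans (nrm_tri (Phi (fun t => f t * r t) z) _ _) _.
  rewrite {2}fP// [X in _ + X]nrm_sym (le_trans (lerD (hb _ PhiD) (hb _ PsiD)))//.
  have -> : 2 * d * nrm z + 2 * d * nrm z = e * (nrm z / (nrm z + 1)).
    by rewrite /d; field; rewrite gt_eqF// ltr_wpDl ?nrm_ge0.
  by rewrite ler_piMr ?(ltW e0)// ler_pdivrMr ?ltr_wpDl ?nrm_ge0// mul1r lerDl.
apply: nrm_small_eq => e e0.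
have [K K0 hK] := adjointable_bounded (is_adjointB (calc_adj PhiD g0) (calc_adj PsiD g0)).
have K1 : 0 < K + 1 by rewrite ltr_wpDl.
have [z hz] := calc_res_dense Dsr PhiD x (divr_gt0 e0 K1).
have := hK (x - Phi r z); rewrite (adjB _ _ (calc_adj PhiD g0)) (adjB _ _ (calc_adj PsiD g0)).
rewrite key !eq_r.
have -> : Phi g x - Psi g (Psi r z) - (Psi g x - Psi g (Psi r z)) = Phi g x - Psi g x by lmod.
move=> /le_trans; apply; rewrite nrm_sym -eq_r.
apply: (@le_trans _ _ ((K + 1) * (e / (K + 1)))); last by rewrite mulrC divfK ?gt_eqF.
by rewrite ler_pM ?nrm_ge0 ?lerDl// ltW.
Qed.

End calculus_unique.

Section tends_lemmas.
Context {R : realType}.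

Lemma realC_eq0 (a : R) : (a%:C == 0 :> R[i]) = (a == 0).
Proof. by rewrite eq_complex/= eqxx andbT. Qed.

Lemma tends_ext (V : normedZmodType R[i]) (u v : nat -> V) l :
  (forall n, u n = v n) -> tends u l -> tends v l.
Proof. by move=> /funext ->. Qed.

Context {B : cstarAlgType R} {X : hilbModType B}.
Implicit Types x y : X.

Lemma tends_ipr x (u : nat -> X) l : tends u l -> tends (fun n => ip x (u n)) (ip x l).
Proof.
move=> ul e e0; have x1 : 0 < 4 * nrm x + 1 by rewrite ltr_wpDl ?mulr_ge0 ?nrm_ge0.
have [N hN] := ul _ (divr_gt0 e0 x1); exists N => n /hN h.
rewrite -ipBr (le_trans (nrm_ip_le _ _))//.
apply: (@le_trans _ _ ((4 * nrm x + 1) * (e / (4 * nrm x + 1)))).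
  by rewrite ler_pM ?mulr_ge0 ?nrm_ge0// lerDl.
by rewrite mulrC divfK ?gt_eqF.
Qed.

Lemma tends_ipl x (u : nat -> X) l : tends u l -> tends (fun n => ip (u n) x) (ip l x).
Proof.
move=> /(tends_ipr x) ul e /ul[N hN]; exists N => n /hN.
by rewrite -(nrm_star (ip x (u n) - _)) astarB !ip_star.
Qed.

End tends_lemmas.

(** * Unbounded functions of D *)

Section functional_calculus.
Context {R : realType} {B : cstarAlgType R} {X : hilbModType B}.
Local Notation C := R[i].
Variable D : set (X * X).
Hypothesis Dsr : selfadjoint_regular D.
Variable Phi : (R -> C) -> X -> X.
Hypothesis PhiD : C0_calculus D Phi.
Implicit Types (g h : R -> C) (f : R -> R) (x y z : X).

Let kc n : C0 (fun t : R => (cutoff n t)%:C : C) := Cc_C0 (Cc_cutoff n).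

Let CcfM f g : continuous f -> Cc g -> Cc (fun t => (f t)%:C * g t).
Proof. by move=> cf; apply: CcM; exact: contR. Qed.

(** The working description of f(D): the closure in [func_calc] becomes an identity between bounded
    operators, and the calculus becomes the fixed [Phi], by uniqueness. For the converse, the
    cutoffs supply the approximating pairs. *)
Lemma func_calcP f x y : continuous f -> func_calc D f (x, y) <->
  forall g, Cc g -> Phi (fun t => (f t)%:C * g t) x = Phi g y.
Proof.
move=> cf; split=> [[Psi PsiD cl] g Cg|h].
  have fg := Cc_C0 (CcfM cf Cg); have g0 := Cc_C0 Cg.
  have [K1 K10 hK1] := adjointable_bounded (calc_adj PhiD fg).
  have [K2 K20 hK2] := adjointable_bounded (calc_adj PhiD g0).
  apply: nrm_small_eq => e e0; have K0 : 0 < K1 + K2 + 1 by move: K10 K20; lra.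
  move/closureP: cl => /(_ _ (divr_gt0 e0 K0))[_ [h [z [h0 fh0 ->]]]].
  rewrite nrm_pair /= gt_max => /andP[hx hy].
  have e1 : Phi (fun t => (f t)%:C * g t) (Psi h z) = Phi g (Psi (fun t => (f t)%:C * h t) z).
    rewrite -!(C0_calculus_unique Dsr PhiD PsiD)// -!(calcM PhiD)//.
    by apply: calc_ext => t; ring.
  have -> : Phi (fun t => (f t)%:C * g t) x - Phi g y =
     Phi g (Psi (fun t => (f t)%:C * h t) z - y) - Phi (fun t => (f t)%:C * g t) (Psi h z - x).
    by rewrite (adjB _ _ (calc_adj PhiD fg)) (adjB _ _ (calc_adj PhiD g0)) e1; lmod.
  rewrite (le_trans (nrmB _ _))// (le_trans (lerD (hK2 _) (hK1 _)))//.
  set d := e / _ in hx hy *.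
  have dK : d * (K1 + K2 + 1) = e by rewrite /d divfK ?gt_eqF.
  have d0 : 0 < d by rewrite /d divr_gt0.
  by move: hx hy; move: (nrm (_ - x)) (nrm (_ - y)) => a b; nra.
exists Phi => //; apply/closureP => e e0.
have e20 : 0 < e / 2 by rewrite divr_gt0.
have [N1 h1] := calc_tends Dsr PhiD x e20; have [N2 h2] := calc_tends Dsr PhiD y e20.
pose n := maxn N1 N2.
exists (Phi (fun t => (cutoff n t)%:C) x, Phi (fun t => (f t)%:C * (cutoff n t)%:C) x).
  exists (fun t => (cutoff n t)%:C), x; split=> //.
  exact: Cc_C0 (CcfM cf (Cc_cutoff n)).
rewrite nrm_pair /= gt_max h; last exact: Cc_cutoff.
apply/andP; split; apply: (@le_lt_trans _ _ (e / 2)).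
- by apply: h1; rewrite leq_maxl.
- by rewrite ltr_pdivrMr// ltr_pMr// ltr1n.
- by apply: h2; rewrite leq_maxr.
- by rewrite ltr_pdivrMr// ltr_pMr// ltr1n.
Qed.

Lemma func_calc_core f g z : continuous f -> C0 g -> C0 (fun t => (f t)%:C * g t) ->
  func_calc D f (Phi g z, Phi (fun t => (f t)%:C * g t) z).
Proof.
move=> cf g0 fg0; apply/(func_calcP _ _ cf) => h Ch.
rewrite -!(calcM PhiD)//; [|exact: Cc_C0|exact: Cc_C0 (CcfM cf Ch)].
by apply: calc_ext => t; ring.
Qed.

Lemma func_calc_cutoff f n z : continuous f -> func_calc D f
  (Phi (fun t => (cutoff n t)%:C) z, Phi (fun t => (f t)%:C * (cutoff n t)%:C) z).
Proof.
by move=> cf; apply: func_calc_core => //; exact: Cc_C0 (CcfM cf (Cc_cutoff n)).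
Qed.

Lemma func_calc_fun f x y y' : continuous f ->
  func_calc D f (x, y) -> func_calc D f (x, y') -> y = y'.
Proof.
move=> cf /(func_calcP _ _ cf)h /(func_calcP _ _ cf)h'.
apply/eqP; rewrite -subr_eq0; apply/eqP/(calc_eq0 Dsr PhiD) => n.
by rewrite (adjB _ _ (calc_adj PhiD (kc n))) -h ?h' ?subrr//; exact: Cc_cutoff.
Qed.

Lemma func_calc_sym f x y x' y' : continuous f ->
  func_calc D f (x, y) -> func_calc D f (x', y') -> ip y x' = ip x y'.
Proof.
move=> cf /(func_calcP _ _ cf)h /(func_calcP _ _ cf)h'.
have t1 := tends_ipl x' (calc_tends Dsr PhiD y).
have t2 := tends_ipr x (calc_tends Dsr PhiD y').
apply: (tends_unique t1); apply: tends_ext t2 => n.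
have Ck := @Cc_cutoff R n; have Cfk := CcfM cf Ck.
rewrite -h// -h'// (calc_adj PhiD (Cc_C0 Cfk)).
by congr (ip x _); apply: calc_ext => t; rewrite conjM !conj_real.
Qed.

(** Vectors [Phi h z] with h of compact support lie in the domain of f(D); pairing with them turns
    the adjoint relation into the test of [func_calcP]. *)
Lemma func_calc_adj f : continuous f -> adj (func_calc D f) = func_calc D f.
Proof.
move=> cf; apply/seteqP; split=> -[x y] /=; last first.
  by move=> h u v h'; exact: func_calc_sym h' h.
move=> h; apply/(func_calcP _ _ cf) => g Cg; apply: ip_ext => z.
have g0 := Cc_C0 Cg; have Cc' := Cc_conj Cg; have gc0 := Cc_C0 Cc'.
have := h _ _ (func_calc_core z cf gc0 (Cc_C0 (CcfM cf Cc'))) => /=.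
rewrite (calc_adj PhiD (Cc_C0 (CcfM cf Cc'))) (calc_adj PhiD gc0).
have -> : (fun t => ((f t)%:C * (g t)^*%C)^*%C) = (fun t => (f t)%:C * g t).
  by apply/funext => t; rewrite conjM conj_real conjcK.
by have -> : (fun t => (g t)^*%C^*%C) = g by apply/funext => t; rewrite conjcK.
Qed.

Theorem func_calc_sa f : continuous f -> selfadjoint_regular (func_calc D f).
Proof.
move=> cf; have dd : dense (dom (func_calc D f)).
  apply/denseP => x e e0; have [N hN] := calc_tends Dsr PhiD x (divr_gt0 e0 (ltr0n R 2)).
  exists (Phi (fun t => (cutoff N t)%:C) x).
    by eexists; exact: func_calc_cutoff.
  by rewrite (le_lt_trans (hN N (leqnn N)))// ltr_pdivrMr// ltr_pMr// ltr1n.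
split; last exact: func_calc_adj.
split.
- split=> //.
  + by move=> x y y'; exact: func_calc_fun.
  + move=> k x y x' y' /(func_calcP _ _ cf)h /(func_calcP _ _ cf)h'.
    apply/(func_calcP _ _ cf) => g Cg.
    rewrite (adj_lin (calc_adj PhiD (Cc_C0 (CcfM cf Cg)))).
    by rewrite (adj_lin (calc_adj PhiD (Cc_C0 Cg))) h// h'.
  + move=> x y b /(func_calcP _ _ cf)h; apply/(func_calcP _ _ cf) => g Cg.
    rewrite (adj_ract _ _ (calc_adj PhiD (Cc_C0 (CcfM cf Cg)))).
    by rewrite (adj_ract _ _ (calc_adj PhiD (Cc_C0 Cg))) h.
- apply/closedP => -[x y] h; rewrite -func_calc_adj// => u v huv /=.
  apply: nrm_small_eq => e e0; pose K := 4 * nrm u + 4 * nrm v + 1.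
  have u0 := nrm_ge0 u; have v0 := nrm_ge0 v.
  have K0 : 0 < K by rewrite /K; lra.
  have [[x' y'] hxy] := h _ (divr_gt0 e0 K0).
  rewrite nrm_pair /= gt_max => /andP[hx hy].
  have -> : ip v x - ip u y = ip u (y' - y) - ip v (x' - x).
    by rewrite !ipBr (func_calc_sym cf huv hxy); lmod.
  rewrite (le_trans (nrmB _ _))// (le_trans (lerD (nrm_ip_le _ _) (nrm_ip_le _ _)))//.
  set d := e / _ in hx hy *.
  have dK : d * K = e by rewrite /d divfK ?gt_eqF.
  have d0 : 0 < d by rewrite /d divr_gt0.
  by move: hx hy dK; rewrite /K; move: (nrm (_ - x)) (nrm (_ - y)) => a b; nra.
- by rewrite func_calc_adj.
- rewrite func_calc_adj//; apply/denseP => z e e0.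
  have [N hN] := calc_tends Dsr PhiD z (divr_gt0 e0 (ltr0n R 2)).
  exists (Phi (fun t => (cutoff N t)%:C) z); last first.
    by rewrite (le_lt_trans (hN N (leqnn N)))// ltr_pdivrMr// ltr_pMr// ltr1n.
  have f2 t : (f t)%:C * (f t)%:C + 1 != 0 :> C.
    have -> : (f t)%:C * (f t)%:C + 1 = (f t * f t + 1)%:C :> C.
      by rewrite rmorphD rmorphM rmorph1.
    by rewrite realC_eq0 gt_eqF// ltr_wpDl// -expr2 sqr_ge0.
  (* Dividing the cutoff by 1 + f^2 exhibits the cutoff of z as (1 + f(D)^2) g(D) z, so the range of
     1 + f(D)^2 is dense. *)
  pose g t : C := ((f t)%:C * (f t)%:C + 1)^-1 * (cutoff N t)%:C.
  have cfC := contR cf.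
  have Cg : Cc g.
    apply: CcM (Cc_cutoff N); apply: contV => //.
    by apply: contD; [exact: contM|exact: cont_cst].
  have Cfg := CcfM cf Cg; have Cffg := CcfM cf Cfg.
  exists (Phi g z), (Phi (fun t => (f t)%:C * g t) z),
    (Phi (fun t => (f t)%:C * ((f t)%:C * g t)) z); split.
  + exact: func_calc_core (Cc_C0 Cg) (Cc_C0 Cfg).
  + exact: func_calc_core (Cc_C0 Cfg) (Cc_C0 Cffg).
  + rewrite -(calcD PhiD); [|exact: Cc_C0|exact: Cc_C0].
    by apply: calc_ext => t; rewrite /g; field; exact: f2.
Qed.

(** One inclusion suffices: the self-adjoint D has no proper symmetric extension, and
    [func_calc D id] is symmetric. *)
Lemma func_calc_id : func_calc D id = D.
Proof.
have cid : continuous (@id R) by move=> t; exact: cvg_id.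
have sub x y : D (x, y) -> func_calc D id (x, y).
  move=> h; apply/(func_calcP _ _ cid) => g Cg; have g0 := Cc_C0 Cg.
  have r0 := @C0_resolvent R; have tg0 := Cc_C0 (CcfM cid Cg).
  have xE := calc_res_surj PhiD h.
  rewrite {1}xE -(calcM PhiD)//.
  rewrite (calc_ext _ _ (h := fun t => - 'i%C * (g t * (t%:C + 'i%C)^-1) + g t)); last first.
    by move=> t; field; exact: addi1_neq0.
  rewrite (calc_lin PhiD)//; last exact: C0_mul.
  rewrite (calcM PhiD)// -xE (adjD _ _ (calc_adj PhiD g0)) (adjZ _ _ (calc_adj PhiD g0)).
  by lmod.
apply/seteqP; split=> -[x y]; last exact: sub.
move=> h; apply: (sa_adj Dsr) => u v /sub h'; exact: func_calc_sym h' h.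
Qed.

Lemma func_calc_C0 f : continuous f -> C0 (fun t => (f t)%:C) ->
  func_calc D f = graph (Phi (fun t => (f t)%:C)).
Proof.
move=> cf f0; have h x : func_calc D f (x, Phi (fun t => (f t)%:C) x).
  apply/(func_calcP _ _ cf) => g Cg; rewrite -(calcM PhiD)//; last exact: Cc_C0.
  by apply: calc_ext => t; rewrite mulrC.
apply/seteqP; split=> -[x y]; rewrite /graph/=; last by move=> <-.
by move=> hxy; exact: func_calc_fun (h x) hxy.
Qed.

(** With k the difference of two cutoffs, |(f k)(D) x| <= M |k(D) x|, so the values of f times the
    cutoffs on x form a Cauchy sequence. The closed operator f(D) is therefore defined everywhere,
    although f need not vanish at infinity. *)
Lemma func_calc_bounded f M : continuous f -> 0 < M -> (forall t, `|f t| <= M) ->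
  exists F, [/\ func_calc D f = graph F, is_adjoint F F,
    forall g x, C0 g -> F (Phi g x) = Phi (fun t => (f t)%:C * g t) x &
    forall g x, C0 g -> Phi g (F x) = Phi (fun t => (f t)%:C * g t) x].
Proof.
move=> cf M0 fM.
have fC g : C0 g -> C0 (fun t => (f t)%:C * g t).
  by move=> g0; apply: C0M => //; [exact: contR|exists M => t; rewrite nrm_real].
have /choice[F hF] x : exists y, func_calc D f (x, y).
  have [l hl] : exists l, tends (fun n => Phi (fun t => (f t)%:C * (cutoff n t)%:C) x) l.
    apply: nrm_complete => e e0.
    have d0 : 0 < e / M / 2 by rewrite !divr_gt0.
    have [N hN] := calc_tends Dsr PhiD x d0; exists N => n m Nn Nm.
    rewrite -(calcB PhiD); [|exact: fC|exact: fC].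
    rewrite (calc_ext _ _ (h := fun t => (f t)%:C * ((cutoff n t)%:C - (cutoff m t)%:C))); last first.
      by move=> t; rewrite mulrBr.
    rewrite (le_trans (calc_mono_real PhiD _ cf M0 fM _))//; first exact: C0B.
    rewrite (calcB PhiD)// mulrC -ler_pdivlMr// (le_trans (nrm_tri x _ _))//.
    by rewrite [leRHS]splitr lerD ?hN// nrm_sym hN.
  exists l; have /closedP := sa_closed (func_calc_sa cf); apply => e e0.
  have e20 : 0 < e / 2 by rewrite divr_gt0.
  have [N1 h1] := calc_tends Dsr PhiD x e20; have [N2 h2] := hl _ e20.
  pose n := maxn N1 N2.
  exists (Phi (fun t => (cutoff n t)%:C) x, Phi (fun t => (f t)%:C * (cutoff n t)%:C) x).
    exact: func_calc_cutoff.
  rewrite nrm_pair /= gt_max; apply/andP; split; apply: (@le_lt_trans _ _ (e / 2)).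
  - by apply: h1; rewrite leq_maxl.
  - by rewrite ltr_pdivrMr// ltr_pMr// ltr1n.
  - by apply: h2; rewrite leq_maxr.
  - by rewrite ltr_pdivrMr// ltr_pMr// ltr1n.
have FF : is_adjoint F F by move=> x y; exact: func_calc_sym (hF x) (hF y).
have Fl g x : C0 g -> F (Phi g x) = Phi (fun t => (f t)%:C * g t) x.
  move=> g0; apply: (func_calc_fun cf (hF _)).
  by apply: func_calc_core => //; exact: fC.
exists F; split=> //.
  apply/seteqP; split=> -[x y]; rewrite /graph/=; last by move=> <-.
  by move=> hxy; exact: func_calc_fun (hF x) hxy.
move=> g x g0; apply: ip_ext => z; have gc0 := C0_conj g0.
rewrite -(adj_sym (calc_adj PhiD g0)) -FF Fl// (calc_adj PhiD (fC _ gc0)).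
by congr (ip z _); apply: calc_ext => t; rewrite conjM conj_real conjcK.
Qed.

(** Properness of f keeps g \o f in C_0(R). For f = [sgnlog] this is the passage from D to D_log:
    all that is proved for a pair of operator and calculus applies again. *)
Lemma func_calc_comp f : continuous f ->
  (forall M : R, exists N : R, forall t, N <= `|t| -> M <= `|f t|) ->
  C0_calculus (func_calc D f) (fun g => Phi (fun t => g (f t))).
Proof.
move=> cf pf; have c0 g : C0 g -> C0 (fun t => g (f t)) by move=> g0; exact: C0_comp.
split.
- by move=> k g h x g0 h0; apply: (calc_lin PhiD); exact: c0.
- by move=> g h x g0 h0; apply: (calcM PhiD); exact: c0.
- by move=> g g0; apply: (calc_adj PhiD); exact: c0.
move=> x z; pose q (t : R) : C := ((f t)%:C + 'i%C)^-1.
have q0 : C0 q by exact: c0 C0_resolvent.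
have hq : func_calc D f (Phi q z, z - 'i%C *: Phi q z).
  apply/(func_calcP _ _ cf) => g Cg; have g0 := Cc_C0 Cg.
  rewrite -(calcM PhiD)//; last exact: Cc_C0 (CcfM cf Cg).
  rewrite (adjB _ _ (calc_adj PhiD g0)) (adjZ _ _ (calc_adj PhiD g0)) -(calcM PhiD)//.
  have gq0 := C0_mul g0 q0.
  rewrite -(calcZ PhiD)// -(calcB PhiD)//; last exact: C0Z.
  by apply: calc_ext => t; rewrite /q; field; exact: addi1_neq0.
split=> [<- //|h].
have [h1 _] := sa_addi_ge (func_calc_sa cf) (saB (func_calc_sa cf) hq h).
apply/eqP; rewrite -subr_eq0; apply/eqP/nrm_le0; apply: le_trans h1 _.
by rewrite [X in nrm X](_ : _ = 0) ?nrm0//; lmod.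
Qed.

Lemma calc_resm z x : Phi (fun t => (t%:C - 'i%C)^-1) z = x <-> D (x, z + 'i%C *: x).
Proof.
have q0 : C0 (fun t : R => (t%:C - 'i%C)^-1 : C).
  have m1 : (-1 : R) != 0 by rewrite oppr_eq0 oner_neq0.
  by have := C0_resolvent_gen m1; rewrite rmorphN1 mulN1r.
have cid : continuous (@id R) by move=> t; exact: cvg_id.
have hq : D (Phi (fun t => (t%:C - 'i%C)^-1) z, z + 'i%C *: Phi (fun t => (t%:C - 'i%C)^-1) z).
  rewrite -[D in D (_, _)]func_calc_id; apply/(func_calcP _ _ cid) => g Cg; have g0 := Cc_C0 Cg.
  rewrite -(calcM PhiD)//; last exact: Cc_C0 (CcfM cid Cg).
  rewrite (adjD _ _ (calc_adj PhiD g0)) (adjZ _ _ (calc_adj PhiD g0)) -(calcM PhiD)//.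
  have gq0 := C0_mul g0 q0.
  rewrite -(calcZ PhiD)// -(calcD PhiD)//; last exact: C0Z.
  by apply: calc_ext => t; field; exact: subi1_neq0.
split=> [<- //|h].
have [_ h1] := sa_addi_ge Dsr (saB Dsr hq h).
apply/eqP; rewrite -subr_eq0; apply/eqP/nrm_le0; apply: le_trans h1 _.
by rewrite [X in nrm X](_ : _ = 0) ?nrm0//; lmod.
Qed.

Section grading.
Variable gam : X -> X.
Hypothesis gamK : forall x, gam (gam x) = x.
Hypothesis gam_adj : is_adjoint gam gam.
Hypothesis gam_odd : forall x y, D (x, y) -> D (gam x, - gam y).

(** Conjugating by [gam] and reflecting the line gives another C_0-calculus of D, since [gam] turns
    D into -D; uniqueness identifies it with [Phi]. *)
Lemma calc_grading g x : C0 g -> gam (Phi g x) = Phi (fun t => g (- t)) (gam x).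
Proof.
have cN : continuous (fun t : R => - t) by move=> t; apply: cvgN; exact: cvg_id.
have c0 h : C0 h -> C0 (fun t => h (- t)).
  by move=> h0; apply: C0_comp => // M; exists M => t; rewrite normrN.
pose Psi h z := gam (Phi (fun t => h (- t)) (gam z)).
have PsiD : C0_calculus D Psi.
  split.
  - by move=> k h h' z h0 h0'; rewrite /Psi (calc_lin PhiD _ _ (c0 _ h0) (c0 _ h0')) (adj_lin gam_adj).
  - by move=> h h' z h0 h0'; rewrite /Psi (calcM PhiD _ (c0 _ h0) (c0 _ h0')) gamK.
  - by move=> h h0 z z'; rewrite /Psi gam_adj (calc_adj PhiD (c0 _ h0)) gam_adj.
  - move=> w z; rewrite /Psi.
    have q0 : C0 (fun t : R => (t%:C - 'i%C)^-1 : C).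
      have m1 : (-1 : R) != 0 by rewrite oppr_eq0 oner_neq0.
      by have := C0_resolvent_gen m1; rewrite rmorphN1 mulN1r.
    rewrite (calc_ext _ _ (h := fun t : R => -1 * (t%:C - 'i%C)^-1)); last first.
      move=> t; have -> : (- t)%:C + 'i%C = - (t%:C - 'i%C) by rewrite rmorphN opprB addrC.
      by rewrite invrN mulN1r.
    rewrite (calcZ PhiD)// scaleN1r (adjN _ gam_adj).
    split=> [<-|h].
      have := gam_odd ((calc_resm (gam z) _).1 erefl).
      move=> /(saZ Dsr (-1)); rewrite !scaleN1r opprK => h; move: h.
      rewrite (adjD _ _ gam_adj) (adjZ _ _ gam_adj) gamK.
      by congr D; congr pair; lmod.
    rewrite (calc_resm (gam z) (- gam w)).2 ?(adjN _ gam_adj) ?gamK ?opprK//.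
    have := saZ Dsr (-1) (gam_odd h); rewrite !scaleN1r opprK.
    rewrite (adjB _ _ gam_adj) (adjZ _ _ gam_adj).
    by congr D; congr pair; lmod.
move=> g0; rewrite (C0_calculus_unique Dsr PhiD PsiD)// /Psi gamK.
by [].
Qed.

Lemma func_calc_odd f x y : continuous f -> (forall t, f (- t) = - f t) ->
  func_calc D f (x, y) -> func_calc D f (gam x, - gam y).
Proof.
move=> cf fN /(func_calcP _ _ cf)h; apply/(func_calcP _ _ cf) => g Cg.
have cN : continuous (fun t : R => - t) by move=> t; apply: cvgN; exact: cvg_id.
have Cg' : Cc (fun t => g (- t)).
  case: Cg => cg [M hM]; split; first exact: cont_comp.
  by exists M => t tM; rewrite hM// normrN.
have g0' := Cc_C0 Cg'; have g0 := Cc_C0 Cg; have fg0' := Cc_C0 (CcfM cf Cg').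
have h1 : Phi (fun t => (f t)%:C * g t) (gam x) = - gam (Phi (fun t => (f t)%:C * g (- t)) x).
  rewrite (calc_grading _ fg0') -scaleN1r -(calcZ PhiD); last first.
    have := Cc_C0 (CcfM cf Cg) => /(C0Z (-1)); congr C0; apply/funext => t.
    by rewrite fN opprK rmorphN mulN1r mulNr.
  by apply: calc_ext => t; rewrite fN opprK rmorphN mulN1r mulNr opprK.
rewrite h1 h// (calc_grading _ g0') (adjN _ (calc_adj PhiD g0)); congr (- Phi _ _).
by apply/funext => t; rewrite opprK.
Qed.

End grading.

End functional_calculus.

(** * Square roots and representations of C*-algebras *)

Section bounded_selfadjoint.
Context {R : realType} {B : cstarAlgType R} {X : hilbModType B}.
Local Notation C := R[i].
Variable T : X -> X.
Hypothesis TT : is_adjoint T T.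
Hypothesis Tb : bounded_by T (2^-1).

(** Seen as an unbounded operator, a bounded self-adjoint T inherits the calculus already built. The
    bound 1/2 serves regularity: x |-> z - T^2 x contracts by 1/4, and its iterates solve (1 + T^2)
    x = z approximately. *)
Lemma graph_sa : selfadjoint_regular (graph T).
Proof.
have ad : adj (graph T) = graph T.
  apply/seteqP; split=> -[x y]; rewrite /adj /graph /=.
    by move=> h; apply: ip_ext => z; rewrite -TT; exact: h.
  by move=> <- u _ <-; exact: TT.
have dT : dense (dom (graph T)).
  by apply/denseP => x e e0; exists x; [exists (T x)|rewrite subrr nrm0].
split=> //; split=> //.
- split=> //; rewrite /graph /=.
  + by move=> x y y' -> .
  + by move=> k x y x' y' <- <-; rewrite (adj_lin TT).
  + by move=> x y b <-; rewrite (adj_ract _ _ TT).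
- apply/closedP => -[x y] h; rewrite /graph /=; apply: nrm_small_eq => e e0.
  have [[x' y'] h' ] := h _ (divr_gt0 e0 (ltr0n R 2)).
  rewrite nrm_pair /= gt_max => /andP[hx hy]; rewrite /graph /= in h'.
  have -> : T x - y = (y' - y) - T (x' - x) by rewrite (adjB _ _ TT) h'; lmod.
  rewrite (le_trans (nrmB _ _))// (splitr e) lerD ?(ltW hy)//.
  rewrite (le_trans (Tb _))// mulrC ler_pdivrMr// (le_trans (ltW hx))//.
  by rewrite ler_peMr ?ler1n// divr_ge0// ltW.
- by rewrite ad.
rewrite ad; apply/denseP => z e e0.
pose xs := fix xs n := if n is k.+1 then z - T (T (xs k)) else 0.
have q0 : 0 <= 4^-1 :> R by rewrite invr_ge0.
have q1 : 4^-1 < 1 :> R by rewrite invf_lt1// ltr1n.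
have xsB n : nrm (xs n.+1 - xs n) <= nrm z * 4^-1 ^+ n.
  elim: n => [|n IH]; first by rewrite /= (adj0 TT) (adj0 TT) !subr0 expr0 mulr1.
  have -> : xs n.+2 - xs n.+1 = - T (T (xs n.+1 - xs n)).
    have xsS k : xs k.+1 = z - T (T (xs k)) by [].
    by rewrite (xsS n.+1) [in X in _ - X = _]xsS !(adjB _ _ TT); lmod.
  rewrite nrmN (le_trans (Tb _))//.
  have h := Tb (xs n.+1 - xs n); rewrite exprS; move: h IH; set a := nrm (T _); set b := nrm (_ - _).
  by set c := nrm z; set d := 4^-1 ^+ n; move=> h1 h2; nra.
have [N hN] := small_pow (nrm z) q0 q1 (divr_gt0 e0 (ltr0n R 2)).
exists (xs N + T (T (xs N))); first by exists (xs N), (T (xs N)), (T (T (xs N))).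
have -> : xs N + T (T (xs N)) - z = - (xs N.+1 - xs N) by rewrite /=; lmod.
rewrite nrmN (le_lt_trans (xsB N))// (le_lt_trans (hN N (leqnn N)))//.
by rewrite ltr_pdivrMr// ltr_pMr// ltr1n.
Qed.

Variable Phi : (R -> C) -> X -> X.
Hypothesis PhiT : C0_calculus (graph T) Phi.

Let cid : continuous (@id R). Proof. by move=> t; exact: cvg_id. Qed.

Let calc_id g x : Cc g -> T (Phi g x) = Phi (fun t => t%:C * g t) x.
Proof.
move=> Cg; have := func_calc_core graph_sa PhiT x cid (Cc_C0 Cg).
rewrite (func_calc_id graph_sa PhiT); apply.
exact: Cc_C0 (CcM (contR cid) Cg).
Qed.

(** Write h = (t - rho)^(2n) h_n. The operator T - rho has norm at most r, while h_n is bounded by a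
    constant times (r + d)^(-2n), so [Phi h x] is at most a constant times (r / (r + d))^(2n) for
    every n. *)
Lemma calc_spectrum (rho r d : R) h x : 0 <= r -> 0 < d ->
  (forall z, nrm (T z - rho%:C *: z) <= r * nrm z) ->
  Cc h -> (forall t, `|t - rho| <= r + d -> h t = 0) -> Phi h x = 0.
Proof.
move=> r0 d0 hr Ch hv; have h0 := Cc_C0 Ch.
(* Equal to (t - rho)^2 wherever h is nonzero, but bounded away from 0, so that it may be inverted
   everywhere. *)
pose q t := Num.max ((t - rho) ^+ 2) ((r + d) ^+ 2).
have rd : 0 < r + d by rewrite ltr_wpDl.
have q0 t : 0 < q t by rewrite lt_max [X in _ || X]exprn_gt0 ?orbT.
have cq : continuous q.
  apply: continuous_max => t; last exact: cvg_cst.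
  have c : (fun s : R => s - rho) s @[s --> t] --> t - rho.
    by apply: cvgB; [exact: cvg_id|exact: cvg_cst].
  rewrite (_ : (fun s => _) = (fun s : R => (s - rho) * (s - rho))); first exact: cvgM.
  by apply/funext => s; rewrite expr2.
pose hn n t := (((q t) ^+ n)%:C)^-1 * h t.
have Chn n : Cc (hn n).
  apply: CcM => //; apply: contV => [|t]; last by rewrite realC_eq0 expf_neq0// gt_eqF.
  apply: contR => t; apply: (@continuous_comp _ _ _ q (fun s => s ^+ n)); first exact: cq.
  exact: exprn_continuous.
have qh t : h t != 0 -> q t = (t - rho) ^+ 2.
  move=> ht; rewrite /q (max_idPl _)// -[leRHS]real_normK ?num_real//.
  rewrite ler_pXn2r// ?nnegrE ?(ltW rd)//; apply/ltW; rewrite ltNge.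
  by apply/negP => /hv h0t; rewrite h0t eqxx in ht.
have iterA k g y : Cc g -> iter k (fun z => T z - rho%:C *: z) (Phi g y) =
    Phi (fun t => (t - rho)%:C ^+ k * g t) y.
  move=> Cg; elim: k => [|k IH]; first by apply: calc_ext => t; rewrite expr0 mul1r.
  have Ck : Cc (fun t => (t - rho)%:C ^+ k * g t).
    apply: CcM => //; elim: k {IH} => [|k IH]; first exact: cont_cst.
    rewrite (_ : (fun t : R => _) = fun t : R => (t - rho)%:C * (t - rho)%:C ^+ k); last first.
      by apply/funext => t; rewrite exprS.
    apply: contM => //; apply: contR => t.
    by apply: cvgB; [exact: cvg_id|exact: cvg_cst].
  rewrite iterS IH calc_id// -(calcZ PhiT _ _ (Cc_C0 Ck)) -(calcB PhiT).
  - by apply: calc_ext => t; rewrite exprS rmorphB /=; ring.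
  - exact: Cc_C0 (CcM (contR cid) Ck).
  - exact: C0Z (Cc_C0 Ck).
have [K K0 hK] := C0_bounded h0.
have bd n : nrm (Phi h x) <= 2 * K * nrm x * ((r / (r + d)) ^+ 2) ^+ n.
  have -> : Phi h x = iter (2 * n) (fun z => T z - rho%:C *: z) (Phi (hn n) x).
    rewrite iterA//; apply: calc_ext => t; rewrite /hn.
    have [->|ht] := eqVneq (h t) 0; first by rewrite !mulr0.
    rewrite (qh _ ht) mulrA -exprM -rmorphXn divff ?mul1r//.
    rewrite realC_eq0 exprM expf_neq0// -(qh _ ht) gt_eqF//.
  have itb k y : nrm (iter k (fun z => T z - rho%:C *: z) y) <= r ^+ k * nrm y.
    elim: k => [|k IH]; first by rewrite expr0 mul1r.
    by rewrite iterS (le_trans (hr _))// exprS -mulrA ler_wpM2l.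
  rewrite (le_trans (itb _ _))//.
  have hnb t : nrm (hn n t) <= K / ((r + d) ^+ 2) ^+ n.
    rewrite /hn nrmM nrmV nrm_real mulrC ler_pM ?nrm_ge0 ?invr_ge0//.
    rewrite ger0_norm ?exprn_ge0 ?(ltW (q0 _))// lef_pV2 ?posrE ?exprn_gt0//.
    by rewrite lerXn2r ?nnegrE ?sqr_ge0 ?(ltW (q0 _))// le_max lexx orbT.
  have Kn0 : 0 <= K / ((r + d) ^+ 2) ^+ n by rewrite divr_ge0 ?exprn_ge0 ?(ltW K0) ?(ltW rd).
  have h1 := calc_bound graph_sa PhiT x (Cc_C0 (Chn n)) hnb Kn0.
  rewrite (le_trans (ler_wpM2l (exprn_ge0 _ r0) h1))//.
  by apply: eq_le_r; rewrite exprM !expr_div_n; field; rewrite !expf_neq0// gt_eqF.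
apply: nrm_le0; apply/ler_addgt0Pr => e e0; rewrite add0r.
have p0 : 0 <= (r / (r + d)) ^+ 2 by rewrite sqr_ge0.
have p1 : (r / (r + d)) ^+ 2 < 1.
  rewrite expr_lt1// ?divr_ge0 ?(ltW rd)//.
  by rewrite ltr_pdivrMr// mul1r ltrDl.
have [N hN] := small_pow (2 * K * nrm x) p0 p1 e0.
exact: le_trans (bd N) (hN N (leqnn N)).
Qed.

End bounded_selfadjoint.

(* The interval [-1, 1] is a neighbourhood of the spectrum of T. *)
Definition is_bcalc {R : realType} {B : cstarAlgType R} {X : hilbModType B}
    (T : X -> X) (Psi : (R -> R[i]) -> X -> X) : Prop :=
  [/\ [/\ forall k F G x, cont F -> cont G ->
            Psi (fun t => k * F t + G t) x = k *: Psi F x + Psi G x,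
          forall F G x, cont F -> cont G ->
            Psi (fun t => F t * G t) x = Psi F (Psi G x)
        & forall F, cont F -> is_adjoint (Psi F) (Psi (fun t => (F t)^*%C))],
      [/\ forall x, Psi (fun=> 1) x = x, forall x, Psi (fun t => t%:C) x = T x
        & forall F G x, cont F -> cont G -> (forall t, `|t| <= 1 -> F t = G t) ->
            Psi F x = Psi G x]
    & forall (F : R -> R) M x, continuous F -> 0 < M ->
        (forall t, `|t| <= 1 -> `|F t| <= M) ->
        nrm (Psi (fun t => (F t)%:C) x) <= M * nrm x].

(** The function [kap] equals 1 on [-1, 1], and by [calc_spectrum], with radius 1/2 and margin 1/2,
    nothing outside matters. So [kap] acts as the identity, and multiplication by it makes every
    continuous function admissible. *)
Lemma bcalc_exists (R : realType) (B : cstarAlgType R) (X : hilbModType B) (T : X -> X) :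
  is_adjoint T T -> bounded_by T (2^-1) -> exists Psi, is_bcalc T Psi.
Proof.
move=> TT Tb; have sa := graph_sa TT Tb.
have [Phi PhiT] := C0_calculus_exists sa.
pose kap (t : R) : R[i] := (cutoff 1 t)%:C.
have Ck : Cc kap := Cc_cutoff 1.
have T0 z : nrm (T z - (0 : R)%:C *: z) <= 2^-1 * nrm z.
  by rewrite rmorph0 scale0r subr0; exact: Tb.
have half0 : 0 <= 2^-1 :> R by rewrite invr_ge0.
have half1 : 0 < 2^-1 :> R by rewrite invr_gt0.
have van h x : Cc h -> (forall t, `|t| <= 1 -> h t = 0) -> Phi h x = 0.
  move=> Ch hv; apply: (calc_spectrum TT Tb PhiT _ half0 half1 T0 Ch) => t.
  by move=> ht; apply: hv; move: ht; rewrite subr0; lra.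
have ext g h x : Cc g -> Cc h -> (forall t, `|t| <= 1 -> g t = h t) -> Phi g x = Phi h x.
  move=> Cg Ch gh; apply/eqP; rewrite -subr_eq0 -(calcB PhiT); [|exact: Cc_C0|exact: Cc_C0].
  apply/eqP/van; last by move=> t /gh ->; rewrite subrr.
  case: Cg Ch => cg [M hM] [ch [N hN]]; split; first exact: contB.
  by exists (Num.max M N) => t; rewrite ge_max => /andP[/hM -> /hN ->]; rewrite subrr.
have kap1 t : `|t| <= 1 -> kap t = 1 by move=> t1; rewrite /kap cutoff_eq1// rmorph1.
have id_k x : Phi kap x = x.
  apply: (tends_unique _ (calc_tends sa PhiT x)) => e e0; exists 1%N => n n1.
  rewrite (ext _ kap)// ?subrr ?nrm0 ?(ltW e0)//; first exact: Cc_cutoff.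
  move=> t t1; rewrite kap1// cutoff_eq1 ?rmorph1//.
  by rewrite (le_trans t1)// ler1n.
have cF F : cont F -> Cc (fun t => F t * kap t) by move=> cf; exact: CcM.
exists (fun F => Phi (fun t => F t * kap t)); split; [split|split|].
- move=> k F G x cf cg; rewrite -(calc_lin PhiT); [|exact: Cc_C0 (cF _ cf)|exact: Cc_C0 (cF _ cg)].
  by apply: calc_ext => t; ring.
- move=> F G x cf cg; rewrite -(calcM PhiT); [|exact: Cc_C0 (cF _ cf)|exact: Cc_C0 (cF _ cg)].
  apply: ext => [||t t1]; first by apply: cF; exact: contM.
    by apply: CcM (cF _ cg); have [] := cF _ cf.
  by rewrite kap1//; ring.
- move=> F cf x y; rewrite (calc_adj PhiT (Cc_C0 (cF _ cf))).
  congr (ip x _); apply: calc_ext => t.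
  by rewrite conjM /kap conj_real.
- by move=> x; rewrite -[RHS]id_k; apply: calc_ext => t; rewrite mul1r.
- move=> x; have cid : continuous (@id R) by move=> t; exact: cvg_id.
  have := func_calc_core sa PhiT x cid (Cc_C0 Ck) (Cc_C0 (CcM (contR cid) Ck)).
  by rewrite (func_calc_id sa PhiT) /graph /= id_k => ->.
- move=> F G x cf cg FG; apply: ext; [exact: cF|exact: cF|].
  by move=> t t1; rewrite FG.
- move=> F M x cf M0 hM.
  (* Clamping to [-1, 1] turns a bound on that interval into the global one required by
     [calc_mono_real]. *)
  pose cl (t : R) := Num.max (-1) (- Num.max (-1) (- t)).
  have ccl : continuous cl.
    apply: continuous_max => t; first exact: cvg_cst.
    apply: cvgN; move: t; apply: continuous_max => t; first exact: cvg_cst.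
    by apply: cvgN; exact: cvg_id.
  have cl1 t : `|cl t| <= 1.
    rewrite ler_norml /cl le_max lexx /= ge_max; apply/andP; split; first by lra.
    by rewrite lerNl le_max lexx.
  have clE t : `|t| <= 1 -> cl t = t.
    rewrite ler_norml => /andP[h1 h2]; rewrite /cl.
    have -> : Num.max (-1) (- t) = - t by apply/max_idPr; lra.
    by rewrite opprK; apply/max_idPr.
  have cFl : continuous (fun t => F (cl t)).
    by move=> t; apply: continuous_comp; [exact: ccl|exact: cf].
  rewrite (ext _ (fun t => (F (cl t))%:C * kap t)); last first.
  + by move=> t t1; rewrite clE.
  + by apply: cF; exact: contR.
  + by apply: cF; exact: contR.
  rewrite -{2}[x]id_k; apply: (calc_mono_real PhiT) => //; last exact: Cc_C0.
  by move=> t; exact: hM.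
Qed.

Section bcalc_theory.
Context {R : realType} {B : cstarAlgType R} {X : hilbModType B}.
Local Notation C := R[i].
Variables (T : X -> X) (Psi : (R -> C) -> X -> X).
Hypothesis hPsi : is_bcalc T Psi.

Lemma bcalc0 x : Psi (fun=> 0) x = 0.
Proof.
case: hPsi => -[lin _ _] [one _ _] _; have c1 := cont_cst (1 : C).
rewrite (_ : (fun=> 0) = (fun _ : R => -1 * 1 + 1 : C)); last first.
  by apply/funext => t; rewrite mulN1r addNr.
by rewrite lin// scaleN1r addNr.
Qed.

Lemma bcalcB F G x : cont F -> cont G ->
  Psi (fun t => F t - G t) x = Psi F x - Psi G x.
Proof.
case: hPsi => -[lin _ _] _ _ cF cG.
rewrite (_ : (fun t => F t - G t) = (fun t => -1 * G t + F t)); last first.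
  by apply/funext => t; rewrite mulN1r addrC.
by rewrite lin// scaleN1r addrC.
Qed.

Lemma bcalcN F x : cont F -> Psi (fun t => - F t) x = - Psi F x.
Proof.
move=> cF; rewrite -[RHS]sub0r -(bcalc0 x) -bcalcB//; last exact: cont_cst.
by congr Psi; apply/funext => t; rewrite sub0r.
Qed.

Lemma bcalcM F G x : cont F -> cont G -> Psi (fun t => F t * G t) x = Psi F (Psi G x).
Proof. by case: hPsi => -[_ mul _] _ _; exact: mul. Qed.

End bcalc_theory.

(** * Functional calculus for elements of a C*-algebra *)

Section self_module.
Context {R : realType} (B : cstarAlgType R).

(** As a module over itself, B acts adjointably by left multiplication, so its self-adjoint elements
    have a functional calculus. The alias carries the module structure. *)
Definition self_mod : Type := B.

HB.instance Definition _ := CompleteNormedModule.copy self_mod B.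

Let self_ge0 (x : self_mod) : exists b : B, amul (astar (x : B)) x = amul (astar b) b.
Proof. by exists x. Qed.

HB.instance Definition _ := @isHilbertModule.Build R B self_mod
  (fun x b => amul (x : B) b) (fun x y => amul (astar (x : B)) y)
  (fun x y b => amulDl (x : B) y b) (fun x b c => amulDr (x : B) b c)
  (fun k x b => amulZl k (x : B) b) (fun k x b => amulZr k (x : B) b)
  (fun x b c => amulA (x : B) b c)
  (fun x y z => amulDr (astar (x : B)) y z)
  (fun k x y => amulZr k (astar (x : B)) y)
  (fun x y b => amulA (astar (x : B)) y b)
  (fun x y => etrans (astarM (astar (x : B)) y) (congr1 (fun z => amul _ z) (astarK (x : B))))
  self_ge0
  (fun x => esym (cstar_identity (x : B))).

End self_module.

Section elements.
Context {R : realType} {B : cstarAlgType R}.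
Local Notation C := R[i].
Local Notation M := (self_mod B).
Implicit Types a b c d m : B.

Definition lmul c : M -> M := fun z : B => amul c z.

Lemma lmul_adj c : is_adjoint (lmul c) (lmul (astar c)).
Proof. by move=> x y; rewrite /ip /= /lmul astarM -amulA. Qed.

Lemma lmul_sa c : astar c = c -> is_adjoint (lmul c) (lmul c).
Proof. by move=> h; have := lmul_adj c; rewrite h. Qed.

Lemma nrm_le_sqr (a e : R) : 0 <= a -> a ^+ 2 <= e * a -> a <= e \/ a = 0.
Proof.
rewrite le_eqVlt => /orP[/eqP <-|a0]; first by right.
by rewrite expr2 ler_pM2r//; left.
Qed.

(** Testing on z = astar a gives |a|^2 on the left side, by the C*-identity. *)
Lemma lmul_norm a e : 0 <= e -> (forall z, nrm (amul a z) <= e * nrm z) -> nrm a <= e.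
Proof.
move=> e0 /(_ (astar a)) h; have := nrm_cstar (astar a).
rewrite astarK => h'; rewrite h' nrm_star in h.
by case: (nrm_le_sqr (nrm_ge0 a) h) => // ->.
Qed.

Lemma lmul_inj a b : (forall z, amul a z = amul b z) -> a = b.
Proof.
move=> h; apply/eqP; rewrite -subr_eq0; apply/eqP/nrm_le0/lmul_norm => // z.
by rewrite amulBl h subrr nrm0 mul0r.
Qed.

Lemma lmul_half c : nrm c <= 2^-1 -> bounded_by (lmul c) (2^-1).
Proof.
by move=> h z; rewrite (le_trans (nrm_amul _ _))// ler_wpM2r ?nrm_ge0.
Qed.

Section calculus_of_element.
Variable c : B.
Hypothesis cc : astar c = c.
Variable Psi : (R -> C) -> M -> M.
Hypothesis hPsi : is_bcalc (lmul c) Psi.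

Lemma cont_tid : cont (fun t : R => t%:C : C).
Proof. exact: cont_id. Qed.

(** The element h(c) for h(t) = t G(t): functions with a factor t stay in B, which need not contain
    a unit. *)
Definition elt (G : R -> C) : B := Psi G c.

Lemma eltE G z : cont G -> amul (elt G) z = Psi (fun t => G t * t%:C) z.
Proof.
case: hPsi => -[lin mul adj] [one idt ext] bd cG.
rewrite mul//; last exact: cont_tid.
by rewrite idt /lmul; have := adj_ract (c : M) z (adj _ cG).
Qed.

Lemma elt_star (G : R -> C) : cont G -> (forall t, (G t)^*%C = G t) -> astar (elt G) = elt G.
Proof.
case: hPsi => -[lin mul adj] [one idt ext] bd cG rG; apply: lmul_inj => z.
have cGt : cont (fun t => G t * t%:C) by apply: contM => //; exact: cont_tid.
rewrite eltE//; apply: (@ip_ext _ _ M) => y.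
have -> : ip y (amul (astar (elt G)) z : M) = ip (amul (elt G) y : M) z.
  by rewrite /ip /= astarM -amulA.
rewrite eltE// adj//; congr (ip y (Psi _ z)); apply/funext => t.
by rewrite conjM conj_real rG.
Qed.

Lemma bcalc_sqr0 (F : R -> R) : continuous F ->
  (forall z, Psi (fun t => (F t)%:C * (F t)%:C) z = 0) -> forall z, Psi (fun t => (F t)%:C) z = 0.
Proof.
case: hPsi => -[lin mul adj] [one idt ext] bd cF h z; apply: ip_eq0.
have cFC := contR cF; rewrite adj//.
have -> : (fun t => ((F t)%:C : C)^*%C) = (fun t => (F t)%:C).
  by apply/funext => t; rewrite conj_real.
by rewrite -mul// h (ip0r (X := M)).
Qed.

Lemma one_sub_sqr_bound (z : M) : nrm (z - amul c (amul c z)) <= nrm z.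
Proof.
case: hPsi => -[lin mul adj] [one idt ext] bd.
have cF : continuous (fun t : R => 1 - t * t).
  move=> t; apply: cvgB; first exact: cvg_cst.
  by apply: cvgM; exact: cvg_id.
have h := bd _ 1 z cF ltr01 _; rewrite mul1r in h.
have -> : z - amul c (amul c z) = Psi (fun t : R => (1 - t * t)%:C) z.
  have ct := cont_tid.
  rewrite (_ : (fun t : R => (1 - t * t)%:C) = fun t => -1 * (t%:C * t%:C) + 1); last first.
    by apply/funext => t; rewrite rmorphB rmorph1 rmorphM mulN1r addrC.
  rewrite lin; [|exact: contM|exact: cont_cst].
  by rewrite one mul// !idt scaleN1r addrC.
apply: h => t; rewrite ler_norml => /andP[h1 h2].
by rewrite ler_norml; apply/andP; split; nra.
Qed.

End calculus_of_element.

(* If d^* d = - m^2 then (2 - d d^* ) d = d (2 + m^2), where d d^* is a sum of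
   squares with |2 - d d^*| <= 2; so m^2 (2 + m^2)^n grows at most like 2^n. *)
Let neg_square_small d m : astar m = m -> nrm d <= 4^-1 -> nrm m <= 2^-1 ->
  amul (astar d) d = - amul m m -> m = 0.
Proof.
move=> mm dh mh dm.
(* The squares satisfy (e^2 + f^2) / 2 = d d^* + d^* d. With d^* d = - m^2 this writes 2 - d d^* as
   (1 - e^2) / 2 + (1 - f^2) / 2 + (1 - m^2), and [one_sub_sqr_bound] applies to each summand. *)
pose e := d + astar d; pose f := 'i%C *: (d - astar d).
have ee : astar e = e by rewrite /e astarD astarK addrC.
have ff : astar f = f.
  by rewrite /f astarZ conji astarB astarK scaleNr -scalerN opprB.
have eh : nrm e <= 2^-1.
  by rewrite (le_trans (nrmD _ _))// nrm_star; move: dh; lra.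
have fh : nrm f <= 2^-1.
  by rewrite /f nrmZ nrmi mul1r (le_trans (nrmB _ _))// nrm_star; move: dh; lra.
have [Pe hPe] := bcalc_exists (lmul_sa ee) (lmul_half eh).
have [Pf hPf] := bcalc_exists (lmul_sa ff) (lmul_half fh).
have [Psi hPsi] := bcalc_exists (lmul_sa mm) (lmul_half mh).
pose A (z : B) := 2 *: z - amul d (amul (astar d) z).
pose Q (z : B) := 2 *: z + amul m (amul m z).
have Ab z : nrm (A z) <= 2 * nrm z.
  have -> : A z = 2^-1 *: (z - amul e (amul e z)) + 2^-1 *: (z - amul f (amul f z)) +
      (z - amul m (amul m z)).
    have dmz : amul m (amul m z) = - amul (astar d) (amul d z).
      by rewrite !amulA dm amulNl opprK.
    rewrite dmz /A /e /f !(amulZl, amulZr) scalerA ii !(amulDl, amulDr, amulNl, amulNr).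
    by lmod.
  have h1 := one_sub_sqr_bound hPe z; have h2 := one_sub_sqr_bound hPf z.
  have h3 := one_sub_sqr_bound hPsi z.
  rewrite (le_trans (nrmD _ _))// (le_trans (lerD (nrmD _ _) (lexx _)))//.
  rewrite !nrmZ nrmV nrm_nat; move: h1 h2 h3; rewrite /nrm /=; lra.
have Ad z : A (amul d z) = amul d (Q z).
  by rewrite /A /Q amulDr amulZr (amulA (astar d)) dm amulNl amulNr opprK -amulA.
have itA n z : iter n A (amul d z) = amul d (iter n Q z).
  by elim: n => //= n ->.
have itb n z : nrm (iter n A z) <= 2 ^+ n * nrm z.
  elim: n => [|n IH]; first by rewrite expr0 mul1r.
  by rewrite iterS (le_trans (Ab _))// exprS -mulrA ler_wpM2l.
have mQ n z : nrm (amul m (amul m (iter n Q z))) <= 2 ^+ n * nrm z.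
  have -> : amul m (amul m (iter n Q z)) = - amul (astar d) (iter n A (amul d z)).
    by rewrite itA !amulA dm amulNl opprK.
  rewrite nrmN (le_trans (nrm_amul _ _))// nrm_star.
  have h1 := itb n (amul d z); have h2 := nrm_amul d z; have h3 := nrm_ge0 z.
  have h4 : nrm d * nrm z <= 4^-1 * nrm z by rewrite ler_wpM2r.
  have h5 : 0 <= 2 ^+ n :> R by rewrite exprn_ge0.
  have h6 := nrm_ge0 d.
  rewrite (@le_trans _ _ (4^-1 * (2 ^+ n * (4^-1 * nrm z))))//; last first.
    by move: h3 h5; move: (nrm z) (2 ^+ n) => u v u0 v0; nra.
  rewrite ler_pM ?nrm_ge0// (le_trans h1)// ler_wpM2l//.
  by rewrite (le_trans h2).
case: (hPsi) => -[lin mul adj] [one idt ext] bd.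
apply: nrm_small_eq0 => dl dl0; apply: lmul_norm; first exact: ltW.
move=> z.
(* Soft thresholding: s vanishes on [-dl, dl] and differs from t by at most dl, so s(m) = 0 implies
   |m| <= dl, for every dl > 0. *)
pose s t := Num.max (t - dl) 0 - Num.max (- t - dl) 0.
have cs : continuous s.
  have ca : continuous (fun t : R => t - dl).
    by move=> t; apply: cvgB; [exact: cvg_id|exact: cvg_cst].
  have cb : continuous (fun t : R => - t - dl).
    by move=> t; apply: cvgB; [apply: cvgN; exact: cvg_id|exact: cvg_cst].
  have c0 : continuous (fun _ : R => 0 : R) by move=> t; exact: cvg_cst.
  by move=> t; apply: cvgB; [exact: (continuous_max ca c0)|exact: (continuous_max cb c0)].
have ts t : `|t - s t| <= dl.
  by rewrite /s ler_norml; apply/andP; split; case: (leP (t - dl) 0); case: (leP (- t - dl) 0); move: dl0; lra.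
have s_t t : `|s t| <= `|t|.
  rewrite /s; case: (leP (t - dl) 0) => h1; case: (leP (- t - dl) 0) => h2; rewrite ?subrr ?normr0 ?normr_ge0//.
  - by rewrite sub0r normrN gtr0_norm// ltr0_norm; move: h1 h2 dl0; lra.
  - by rewrite subr0 !gtr0_norm//; move: h1 h2 dl0; lra.
  - by exfalso; move: h1 h2 dl0; lra.
have s0 t : `|t| <= dl -> s t = 0.
  rewrite ler_norml => /andP[h1 h2]; rewrite /s (max_idPr _) ?(max_idPr _) ?subrr//; lra.
have cid : continuous (fun t : R => t) by move=> t; exact: cvg_id.
have ct2 : continuous (fun t : R => t * t) by move=> t; apply: cvgM; exact: cvg_id.
pose P n (t : R) : R := (t * t) * (2 + t * t) ^+ n.
have c2 : continuous (fun t : R => 2 + t * t).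
  by move=> t; apply: cvgD; [exact: cvg_cst|exact: ct2].
have c2n n : continuous (fun t : R => (2 + t * t) ^+ n).
  by move=> t; apply: (@continuous_comp _ _ _ (fun t : R => 2 + t * t) (fun s => s ^+ n)); [exact: c2|exact: exprn_continuous].
have cP n : continuous (P n) by move=> t; apply: cvgM; [exact: ct2|exact: c2n].
have PP n x : Psi (fun t => (P n t)%:C) x = amul m (amul m (iter n Q x)).
  have ctC := contR cid; have ct2C := contR ct2; have c2C := contR c2.
  have h2 y : Psi (fun t : R => (2 + t * t)%:C) y = Q y.
    rewrite (_ : (fun t : R => (2 + t * t)%:C) = (fun t : R => 2 * 1 + t%:C * t%:C : C)); last first.
      by apply/funext => t; rewrite mulr1 rmorphD rmorph_nat rmorphM.
    by rewrite lin; [rewrite one mul// !idt|exact: cont_cst|exact: contM].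
  have h3 y : Psi (fun t : R => ((2 + t * t) ^+ n)%:C) y = iter n Q y.
    elim: n => [|n IH]; first by rewrite -[RHS]one; congr Psi; apply/funext => t; rewrite expr0 rmorph1.
    rewrite iterS -IH -h2 -mul//; last exact: contR.
    by congr Psi; apply/funext => t; rewrite exprS rmorphM.
  rewrite (_ : (fun t => (P n t)%:C) = (fun t : R => t%:C * (t%:C * ((2 + t * t) ^+ n)%:C) : C)); last first.
    by apply/funext => t; rewrite /P !rmorphM mulrA.
  have c2nC := contR (c2n n).
  by rewrite mul ?idt//; [rewrite mul// idt h3|exact: contM].
have dl2 : 0 < dl * dl by rewrite mulr_gt0.
pose w (t : R) : R := Num.max (t * t) (dl * dl).
have w0 t : 0 < w t by rewrite lt_max dl2 orbT.
have cw : continuous w by apply: continuous_max => // t; exact: cvg_cst.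
have p2 t : 0 < 2 + t * t :> R by rewrite ltr_wpDr// -expr2 sqr_ge0.
(* The quotient of s by P_n, with t^2 replaced by the positive [w], which agrees with it off
   [-dl, dl]. On [-1, 1] it is of order (2 + dl^2)^(-n) and so beats the growth 2^n of P_n(m). *)
pose q n t : R := s t * (w t * (2 + t * t) ^+ n)^-1.
have cq n : continuous (q n).
  move=> t; apply: cvgM; first exact: cs.
  apply: cvgV; first by rewrite mulf_neq0 ?expf_neq0// gt_eqF.
  by apply: cvgM; [exact: cw|exact: c2n].
have sq n t : s t = q n t * P n t.
  have [tdl|dlt] := lerP `|t| dl; first by rewrite /q s0// !mul0r.
  rewrite /q /P; have t0 : t != 0.
    by apply/eqP => t0; move: dlt; rewrite t0 normr0 ltNge ltW.
  rewrite /q (_ : w t = t * t); last first.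
    by rewrite /w (max_idPl _)// -!expr2 -[leRHS]real_normK ?num_real// ler_pXn2r ?nnegrE// ltW.
  by field; rewrite t0 expf_neq0// gt_eqF.
have qb n t : `|t| <= 1 -> `|q n t| <= (dl * dl * (2 + dl * dl) ^+ n)^-1.
  move=> t1; have [tdl|dlt] := lerP `|t| dl.
    by rewrite /q s0// mul0r normr0 invr_ge0 mulr_ge0 ?exprn_ge0 ?(ltW dl2)// addr_ge0 ?(ltW dl2).
  rewrite /q normrM normfV -[leRHS]mul1r ler_pM ?normr_ge0 ?invr_ge0//.
    by rewrite (le_trans (s_t t)).
  have W0 : 0 < w t * (2 + t * t) ^+ n by rewrite mulr_gt0 ?exprn_gt0.
  rewrite (gtr0_norm W0) lef_pV2 ?posrE//; last by rewrite mulr_gt0 ?exprn_gt0 ?addr_gt0.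
  rewrite ler_pM ?(ltW dl2) ?exprn_ge0 ?addr_ge0 ?(ltW dl2)//.
    by rewrite le_max lexx orbT.
  rewrite lerXn2r ?nnegrE ?addr_ge0 ?(ltW dl2) ?(ltW (p2 _))// ?lerD2l.
    by rewrite -expr2 sqr_ge0.
  by rewrite -!expr2 -[leRHS]real_normK ?num_real// ler_pXn2r ?nnegrE ?(ltW dlt) ?(ltW dl0).
have Ps : Psi (fun t => (s t)%:C) z = 0.
  apply: nrm_small_eq0 => e' e'0.
  have r0 : 0 <= 2 / (2 + dl * dl) :> R by rewrite divr_ge0 ?addr_ge0 ?(ltW dl2).
  have r1 : 2 / (2 + dl * dl) < 1 :> R.
    by rewrite ltr_pdivrMr ?addr_gt0// mul1r ltrDl.
  have [N hN] := small_pow ((dl * dl)^-1 * nrm z) r0 r1 e'0.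
  have -> : Psi (fun t => (s t)%:C) z = Psi (fun t => (q N t)%:C) (amul m (amul m (iter N Q z))).
    rewrite -PP -mul; [|exact: contR (cq N)|exact: contR (cP N)].
    by congr Psi; apply/funext => t; rewrite (sq N t) rmorphM.
  have M0 : 0 < (dl * dl * (2 + dl * dl) ^+ N)^-1.
    by rewrite invr_gt0 mulr_gt0 ?exprn_gt0 ?addr_gt0.
  rewrite (le_trans (bd _ _ _ (cq N) M0 (qb N)))//.
  rewrite (le_trans (ler_wpM2l (ltW M0) (mQ N z)))// (le_trans _ (hN N (leqnn N)))//.
  by apply: eq_le_r; rewrite expr_div_n; field; rewrite ?expf_neq0 ?gt_eqF ?addr_gt0.
have ctC := contR cid; have csC := contR cs.
have -> : amul m z = Psi (fun t => (t - s t)%:C) z.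
  rewrite (_ : (fun t => (t - s t)%:C) = (fun t => -1 * (s t)%:C + t%:C)); last first.
    by apply/funext => t; rewrite rmorphB mulN1r addrC.
  by rewrite lin// Ps scaler0 add0r idt.
apply: bd => //; move=> t.
by apply: cvgB; [exact: cvg_id|exact: cs].
Qed.

Lemma neg_square_eq0 d m : astar m = m -> amul (astar d) d = - amul m m -> m = 0.
Proof.
move=> mm dm; pose k := (4 * (nrm d + nrm m + 1))^-1.
have K0 : 0 < 4 * (nrm d + nrm m + 1) by have := nrm_ge0 d; have := nrm_ge0 m; lra.
have k0 : 0 < k by rewrite invr_gt0.
have kK : k * (4 * (nrm d + nrm m + 1)) = 1 by rewrite /k mulVf// gt_eqF.
have kn (a : B) : nrm (k%:C *: a) = k * nrm a by rewrite nrmZ nrm_real gtr0_norm.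
have d0 := nrm_ge0 d; have m0 := nrm_ge0 m.
have : k%:C *: m = 0.
  apply: (@neg_square_small (k%:C *: d)).
  - by rewrite astarZ conj_real mm.
  - by rewrite kn; nra.
  - by rewrite kn; nra.
  - by rewrite astarZ conj_real !(amulZl, amulZr) dm !scalerN.
by move/eqP; rewrite scaler_eq0 realC_eq0 gt_eqF//= => /eqP.
Qed.

(* The hypothesis holds when c is pointwise or globally of the form b^* b, by
   neg_square_eq0; it kills the negative part of c. *)
Let selfadjoint_sqrt_small c : astar c = c -> nrm c <= 2^-1 ->
  (forall k m, astar k = k -> astar m = m -> amul k (amul c k) = - amul m m -> m = 0) ->
  exists2 s, astar s = s & amul s s = c.
Proof.
move=> cc ch H; have [Psi hPsi] := bcalc_exists (lmul_sa cc) (lmul_half ch).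
case: (hPsi) => -[lin mul adj] [one idt ext] bd.
have cid : continuous (fun t : R => t) by move=> t; exact: cvg_id.
have c0 : continuous (fun _ : R => 0 : R) by move=> t; exact: cvg_cst.
pose N (t : R) := Num.max (- t) 0; pose P (t : R) := Num.max t 0.
have cN : continuous N by apply: continuous_max => // t; apply: cvgN; exact: cvg_id.
have cP : continuous P by exact: continuous_max.
have csN := continuous_sqrt cN; have csP := continuous_sqrt cP.
have cNC := contR cN; have cPC := contR cP; have ctC := contR cid.
have csNC := contR csN; have csPC := contR csP.
have N0 t : 0 <= N t by rewrite le_max lexx orbT.
have P0 t : 0 <= P t by rewrite le_max lexx orbT.
have NPt t : P t - N t = t /\ N t * P t = 0.
  by rewrite /N /P; case: (leP t 0) => h1; case: (leP (- t) 0) => h2; split; nra.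
(* Where N is nonzero, t = -N. Hence [elt] of N is k = -N^2 and [elt] of G is m = N^(5/2), both
   evaluated at c, and k c k = -N^5 = -m^2 as the hypothesis requires. *)
pose G (t : R) : C := - ((N t)%:C * (Num.sqrt (N t))%:C).
have cG : cont G by apply: contN; exact: contM.
have real_star (F : R -> R) : (fun t => ((F t)%:C : C)^*%C) = (fun t => (F t)%:C).
  by apply/funext => t; rewrite conj_real.
have m0 : elt c Psi G = 0.
  apply: (H (elt c Psi (fun t => (N t)%:C))).
  - by apply: elt_star => // t; rewrite conj_real.
  - by apply: elt_star => // t; rewrite /G conjN conjM !conj_real.
  - apply: lmul_inj => z; rewrite amulNl -!amulA !(eltE hPsi)//.
    have cGt : cont (fun t => G t * t%:C) by exact: contM.
    have cNt : cont (fun t => (N t)%:C * t%:C) by exact: contM.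
    rewrite -/(lmul c _) -idt -!(bcalcM hPsi)//; [|exact: contM].
    rewrite -(bcalcN hPsi); last exact: contM.
    congr Psi; apply/funext => t; have [h1 h2] := NPt t.
    have sN : Num.sqrt (N t) * Num.sqrt (N t) = N t by rewrite -expr2 sqr_sqrtr.
    rewrite /G -!rmorphM -!rmorphN -!rmorphM -rmorphN; congr (_%:C).
    have e : N t * t = - (N t * N t) by rewrite -{2}h1 mulrBr h2 sub0r.
    have gen (S a : R) : S * S = a -> a * t = - (a * a) ->
        a * (t * (a * t)) * t = - ((- (a * S) * t) * (- (a * S) * t)).
      move=> sa ea; transitivity ((a * t) * (a * t) * t); first by ring.
      transitivity (- ((S * S) * (a * t) * (a * t))); last by ring.
      rewrite sa ea; transitivity (a * a * a * (a * t)); first by ring.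
      by rewrite ea; ring.
    by rewrite -(gen _ _ sN e); ring.
have Gt0 z : Psi (fun t => G t * t%:C) z = 0 by rewrite -(eltE hPsi)// m0 amul0l.
have cGt : cont (fun t => G t * t%:C) by exact: contM.
pose N2 t := N t * N t; pose N4 t := N2 t * N2 t.
have cN2 : continuous N2 by move=> t; apply: cvgM; exact: cN.
have cN4 : continuous N4 by move=> t; apply: cvgM; exact: cN2.
(* N^8 = N^5 N^3 with N^5 = m^2 and m = 0; [bcalc_sqr0] then descends from N^8 to N^4, N^2 and N. *)
have N8 z : Psi (fun t => (N4 t)%:C * (N4 t)%:C) z = 0.
  pose H3 t := (N t)%:C * (N2 t)%:C.
  have cH3 : cont H3 by apply: contM => //; exact: contR.
  have cGG : cont (fun t => (G t * t%:C) * (G t * t%:C)) by exact: contM.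
  have : Psi (fun t => (G t * t%:C) * ((G t * t%:C) * H3 t)) z = 0.
    by rewrite (bcalcM hPsi) ?Gt0//; exact: contM.
  have -> // : (fun t => (G t * t%:C) * ((G t * t%:C) * H3 t)) = (fun t => (N4 t)%:C * (N4 t)%:C).
  apply/funext => t; rewrite mulrA mulrC; have [h1 h2] := NPt t.
  have sN : Num.sqrt (N t) * Num.sqrt (N t) = N t by rewrite -expr2 sqr_sqrtr.
  rewrite /G /H3 -!rmorphM -!rmorphN -!rmorphM; congr (_%:C).
  have e : N t * t = - (N t * N t) by rewrite -{2}h1 mulrBr h2 sub0r.
  have gen (S a : R) : S * S = a -> a * t = - (a * a) ->
      a * (a * a) * (- (a * S) * t * (- (a * S) * t)) = a * a * (a * a) * (a * a * (a * a)).
    move=> sa ea; transitivity (a * a * a * (S * S) * (a * t) * (a * t)); first by ring.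
    by rewrite sa ea; ring.
  by rewrite /N4 /N2 -(gen _ _ sN e).
have Nz0 z : Psi (fun t => (N t)%:C) z = 0.
  have sq (F : R -> R) : (fun t => (F t * F t)%:C : C) = (fun t => (F t)%:C * (F t)%:C).
    by apply/funext => t; rewrite rmorphM.
  have n4 := bcalc_sqr0 hPsi cN4 N8; rewrite /N4 sq in n4.
  have n2 := bcalc_sqr0 hPsi cN2 n4; rewrite /N2 sq in n2.
  exact: (bcalc_sqr0 hPsi cN n2).
pose S z := Psi (fun t => (Num.sqrt (P t))%:C) z.
have SS : is_adjoint S S by have := adj _ csPC; rewrite real_star.
(* The root of P is not visibly t times a continuous function. The function t g_e(t) is, and differs
   from the root by at most e, which exhibits the square root as a limit of elements of the
   algebra. *)
pose g e (t : R) : R := Num.sqrt (P t) * (P t + e * e)^-1.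
have Pe e t : 0 < e -> 0 < P t + e * e by move=> e0; rewrite ltr_wpDl// mulr_gt0.
have cg e : 0 < e -> continuous (g e).
  move=> e0 t; apply: cvgM; first exact: csP.
  apply: cvgV; first by rewrite gt_eqF// Pe.
  by apply: cvgD; [exact: cP|exact: cvg_cst].
have gS e z : 0 < e -> nrm (S z - amul (elt c Psi (fun t => (g e t)%:C)) z) <= e * nrm z.
  move=> e0; have cgC := contR (cg _ e0).
  rewrite (eltE hPsi)// /S -(bcalcB hPsi)//; last exact: contM.
  rewrite (_ : (fun t => _) = (fun t => (Num.sqrt (P t) - g e t * t)%:C)); last first.
    by apply/funext => t; rewrite rmorphB /=; congr (_ - _); rewrite -rmorphM.
  apply: bd => // [t|t _].
    by apply: cvgB; [exact: csP|apply: cvgM; [exact: cg|exact: cvg_id]].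
  have [h1 h2] := NPt t; have hP := P0 t; have hPe := Pe e t e0.
  have sP : Num.sqrt (P t) * Num.sqrt (P t) = P t by rewrite -expr2 sqr_sqrtr.
  have sN : Num.sqrt (P t) * N t = 0.
    have /eqP := h2; rewrite mulf_eq0 => /orP[/eqP ->|/eqP ->]; first by rewrite mulr0.
    by rewrite sqrtr0 mul0r.
  have s0 : 0 <= Num.sqrt (P t) by exact: sqrtr_ge0.
  have -> : Num.sqrt (P t) - g e t * t = Num.sqrt (P t) * (e * e) / (P t + e * e).
    have gen (a b d : R) : 0 < b + e * e -> a * d = 0 ->
        a - a / (b + e * e) * (b - d) = a * (e * e) / (b + e * e).
      move=> be ad; transitivity ((a * (e * e) + a * d) / (b + e * e)); last by rewrite ad addr0.
      by field; rewrite gt_eqF.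
    by rewrite -(gen _ _ _ hPe sN) h1.
  rewrite ger0_norm ?divr_ge0 ?mulr_ge0 ?(ltW e0) ?(ltW hPe)// ler_pdivrMr//.
  have gen (a : R) : 0 <= a -> a * (e * e) <= e * (a * a + e * e).
    by move=> a0; rewrite mulrCA ler_pM2l//; nra.
  by have := gen _ s0; rewrite sP.
pose en n : R := 2^-1 ^+ n.
have en0 n : 0 < en n by rewrite exprn_gt0// invr_gt0.
pose sn n := elt c Psi (fun t => (g (en n) t)%:C).
have snd n k : nrm (sn n - sn k) <= en n + en k.
  apply: lmul_norm; first by rewrite addr_ge0// ltW.
  move=> z; have -> : amul (sn n - sn k) z = (S z - amul (sn k) z) - (S z - amul (sn n) z).
    by rewrite amulBl; lmod.
  by rewrite (le_trans (nrmB _ _))// addrC mulrDl lerD// gS.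
have half1 : 2^-1 < 1 :> R by rewrite invf_lt1// ltr1n.
have half0 : 0 <= 2^-1 :> R by rewrite invr_ge0.
have ensmall e : 0 < e -> exists k, forall n, (k <= n)%N -> en n <= e.
  move=> e0; have [k hk] := small_pow 1 half0 half1 e0; exists k => n /hk.
  by rewrite mul1r.
have [s hs] : exists s, tends sn s.
  apply: nrm_complete => e e0; have [k hk] := ensmall _ (divr_gt0 e0 (ltr0n R 2)).
  by exists k => n l kn kl; rewrite (le_trans (snd _ _))// (splitr e) lerD// hk.
have sE z : amul s z = S z.
  apply: nrm_small_eq => e e0.
  have z1 : 0 < 2 * (nrm z + 1) by rewrite mulr_gt0// ltr_wpDl ?nrm_ge0.
  have d0 : 0 < e / (2 * (nrm z + 1)) by rewrite divr_gt0.
  have [k1 h1] := hs _ d0; have [k2 h2] := ensmall _ d0; pose n := maxn k1 k2.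
  have -> : amul s z - S z = - (amul (sn n - s) z) - (S z - amul (sn n) z).
    by rewrite (amulBl (sn n) s z) opprB opprB addrA subrK.
  rewrite (le_trans (nrmB _ _))// nrmN.
  have b1 : nrm (amul (sn n - s) z) <= e / (2 * (nrm z + 1)) * nrm z.
    by rewrite (le_trans (nrm_amul _ _))// ler_wpM2r ?nrm_ge0// h1// leq_maxl.
  have b2 : nrm (S z - amul (sn n) z) <= e / (2 * (nrm z + 1)) * nrm z.
    by rewrite (le_trans (gS _ _ (en0 n)))// ler_wpM2r ?nrm_ge0// h2// leq_maxr.
  rewrite (le_trans (lerD b1 b2))//.
  have -> : e / (2 * (nrm z + 1)) * nrm z + e / (2 * (nrm z + 1)) * nrm z = e * (nrm z / (nrm z + 1)).
    by field; rewrite gt_eqF// ltr_wpDl ?nrm_ge0.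
  by rewrite ler_piMr ?(ltW e0)// ler_pdivrMr ?ltr_wpDl ?nrm_ge0// mul1r lerDl.
exists s.
  apply: lmul_inj => z; rewrite sE; apply: (@ip_ext _ _ M) => y.
  rewrite -SS -sE; have := lmul_adj s y z; rewrite /lmul => <-.
  by [].
apply: lmul_inj => z; rewrite -amulA !sE /S -(bcalcM hPsi)//.
rewrite (_ : (fun t => _) = (fun t => 1 * t%:C + (N t)%:C)); last first.
  apply/funext => t; have [h1 _] := NPt t.
  by rewrite mul1r -rmorphM -expr2 sqr_sqrtr// -rmorphD -{2}h1 subrK.
by rewrite lin// Nz0 addr0 scale1r idt.
Qed.

Lemma selfadjoint_sqrt c : astar c = c ->
  (forall k m, astar k = k -> astar m = m -> amul k (amul c k) = - amul m m -> m = 0) ->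
  exists2 s, astar s = s & amul s s = c.
Proof.
move=> cc H; pose l := (2 * (nrm c + 1))^-1.
have L0 : 0 < 2 * (nrm c + 1) by have := nrm_ge0 c; lra.
have l0 : 0 < l by rewrite invr_gt0.
pose a := Num.sqrt l; have a0 : 0 < a by rewrite sqrtr_gt0.
have aa : a * a = l by rewrite -expr2 sqr_sqrtr// ltW.
have [||k m kk mm e|s ss sc] := @selfadjoint_sqrt_small (l%:C *: c).
- by rewrite astarZ conj_real cc.
- rewrite nrmZ nrm_real gtr0_norm//.
  have : l * (2 * (nrm c + 1)) = 1 by rewrite mulVf// gt_eqF.
  by have := nrm_ge0 c; nra.
- apply: (H (a%:C *: k)) => //; first by rewrite astarZ conj_real kk.
  by rewrite -e !(amulZl, amulZr) scalerA -rmorphM aa.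
exists (a^-1%:C *: s); first by rewrite astarZ conj_real ss.
rewrite amulZl amulZr sc !scalerA -!rmorphM -invfM aa mulVf ?gt_eqF//.
by rewrite rmorph1 scale1r.
Qed.

(** After scaling h to norm at most 1/2, k = h^2 / (h^2 + e'^2) does it: |t| e'^2 / (t^2 + e'^2) <=
    e'. This k lies in the algebra, unlike 1. *)
Lemma product_approx (h : B) (e : R) : astar h = h -> 0 < e -> exists k, nrm (h - amul h k) <= e.
Proof.
have small (c : B) (e' : R) : astar c = c -> nrm c <= 2^-1 -> 0 < e' ->
    exists k, nrm (c - amul c k) <= e'.
  move=> cc ch e0; have [Psi hPsi] := bcalc_exists (lmul_sa cc) (lmul_half ch).
  case: (hPsi) => -[lin mul adj] [one idt ext] bd.
  have ee : 0 < e' * e' by rewrite mulr_gt0.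
  have p t : 0 < t * t + e' * e' :> R by rewrite ltr_wpDl// -expr2 sqr_ge0.
  have cid : continuous (fun t : R => t) by move=> t; exact: cvg_id.
  pose G (t : R) : R := t / (t * t + e' * e').
  have cG : continuous G.
    move=> t; apply: cvgM; first exact: cvg_id.
    apply: cvgV; first by rewrite gt_eqF.
    by apply: cvgD; [apply: cvgM; exact: cvg_id|exact: cvg_cst].
  have cGC := contR cG; have ctC := contR cid.
  exists (elt c Psi (fun t => (G t)%:C)); apply: lmul_norm; first exact: ltW.
  move=> z; rewrite amulBl -amulA (eltE hPsi)// -!/(lmul c _) -!idt -(mul _ _ _ ctC (contM cGC ctC)).
  rewrite -(bcalcB hPsi)//; last by apply: contM => //; exact: contM.
  rewrite (_ : (fun t => _) = (fun t => (t - t * (G t * t))%:C)); last first.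
    by apply/funext => t; rewrite rmorphB !rmorphM.
  apply: bd => // [t|t _].
    apply: cvgB; first exact: cvg_id.
    by apply: cvgM; [exact: cvg_id|apply: cvgM; [exact: cG|exact: cvg_id]].
  have -> : t - t * (G t * t) = t * (e' * e') / (t * t + e' * e').
    by rewrite /G; field; rewrite gt_eqF.
  rewrite normrM normfV (gtr0_norm (p t)) ler_pdivrMr// normrM (gtr0_norm ee).
  have -> : t * t = `|t| * `|t| by rewrite -normrM ger0_norm// -expr2 sqr_ge0.
  have -> : `|t| * (e' * e') = e' * (`|t| * e') by ring.
  by rewrite ler_pM2l//; have := normr_ge0 t; nra.
move=> hh e0; pose l := (2 * (nrm h + 1))^-1.
have L0 : 0 < 2 * (nrm h + 1) by have := nrm_ge0 h; lra.
have l0 : 0 < l by rewrite invr_gt0.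
have [|||k hk] := small (l%:C *: h) (l * e); last 1 first.
- exists k; move: hk; rewrite amulZl -scalerBr nrmZ nrm_real gtr0_norm//.
  by rewrite ler_pM2l.
- by rewrite astarZ conj_real hh.
- rewrite nrmZ nrm_real gtr0_norm//.
  have : l * (2 * (nrm h + 1)) = 1 by rewrite mulVf// gt_eqF.
  by have := nrm_ge0 h; nra.
- by rewrite mulr_gt0.
Qed.

(* The relations say that 1 - s + i h is unitary; A need not contain 1. *)
Lemma unitary_dilation (h : B) : astar h = h -> nrm h <= 2^-1 -> exists s,
  [/\ astar s = s, amul s h = amul h s & s + s - amul s s = amul h h].
Proof.
move=> hh h2; have [Psi hPsi] := bcalc_exists (lmul_sa hh) (lmul_half h2).
case: (hPsi) => -[lin mul adj] [one idt ext] bd.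
have cid : continuous (fun t : R => t) by move=> t; exact: cvg_id.
pose r (t : R) := Num.sqrt (1 - t * t).
have cr : continuous r.
  apply: continuous_sqrt => t; apply: cvgB; first exact: cvg_cst.
  by apply: cvgM; exact: cvg_id.
have r1 t : 0 < 1 + r t by rewrite ltr_wpDr// sqrtr_ge0.
(* Chosen so that t G(t) = 1 - sqrt(1 - t^2) for |t| <= 1. *)
pose G (t : R) : R := t / (1 + r t).
have cG : continuous G.
  move=> t; apply: cvgM; first exact: cvg_id.
  apply: cvgV; first by rewrite gt_eqF.
  by apply: cvgD; [exact: cvg_cst|exact: cr].
have cGC := contR cG; have ctC := contR cid; have cGt := contM cGC ctC.
exists (elt h Psi (fun t => (G t)%:C)); split.
- by apply: elt_star => // t; rewrite conj_real.
- apply: lmul_inj => z; rewrite -!amulA !(eltE hPsi)// -!/(lmul h _) -!idt -!mul//.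
  by congr Psi; apply/funext => t; rewrite mulrC.
- apply: lmul_inj => z; rewrite amulBl amulDl -!amulA !(eltE hPsi)// -!/(lmul h _) -!idt.
  rewrite -!mul//.
  have cGG := contM cGt cGt.
  have -> : Psi (fun t => (G t)%:C * t%:C) z + Psi (fun t => (G t)%:C * t%:C) z =
     Psi (fun t => 1 * ((G t)%:C * t%:C) + (G t)%:C * t%:C) z by rewrite lin// scale1r.
  have c1 : cont (fun t => 1 * ((G t)%:C * t%:C) + (G t)%:C * t%:C).
    by apply: contD => //; apply: contM => //; exact: cont_cst.
  rewrite -(bcalcB hPsi)//; apply: ext => [||t t1]; first exact: contB.
    exact: contM.
  rewrite mul1r -!rmorphM -rmorphD -rmorphB; congr (_%:C).
  have rr : r t * r t = 1 - t * t.
    rewrite -expr2 sqr_sqrtr// subr_ge0 -expr2 -real_normK ?num_real//.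
    by rewrite exprn_ile1.
  have -> : G t * t + G t * t - G t * t * (G t * t) =
    t * t * (2 * (1 + r t) - t * t) / ((1 + r t) * (1 + r t)).
    by rewrite /G; field; rewrite gt_eqF.
  have -> : 2 * (1 + r t) - t * t = (1 + r t) * (1 + r t).
    by transitivity (1 + r t + r t + r t * r t); [rewrite rr; ring|ring].
  by rewrite mulfK// mulf_neq0// gt_eqF.
Qed.

End elements.

Section cartesian_decomposition.
Context {R : realType} {A : starAlgType R}.
Implicit Types a : A.

Definition re_part a : A := 2^-1 *: (a + astar a).
Definition im_part a : A := (- (2^-1 * 'i%C)) *: (a - astar a).

Lemma re_part_sa a : astar (re_part a) = re_part a.
Proof.
rewrite /re_part astarZ astarD astarK conjV addrC.
by have -> : (2 : R[i])^*%C = 2 by rewrite -(rmorph_nat (real_complex R)) conj_real.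
Qed.

Lemma im_part_sa a : astar (im_part a) = im_part a.
Proof.
rewrite /im_part astarZ astarB astarK conjN conjM conjV conji.
have -> : (2 : R[i])^*%C = 2 by rewrite -(rmorph_nat (real_complex R)) conj_real.
by rewrite mulrN opprK -opprB scalerN scaleNr.
Qed.

Lemma re_im_part a : a = re_part a + 'i%C *: im_part a.
Proof.
rewrite /re_part /im_part scalerA.
have -> : 'i%C * - (2^-1 * 'i%C) = 2^-1 :> R[i].
  by rewrite mulrN mulrCA -expr2 sqr_i mulrN1 opprK.
by lmod.
Qed.

End cartesian_decomposition.

Section cartesian_norms.
Context {R : realType} {A : cstarAlgType R}.
Implicit Types a : A.

Let nrm_half : nrm (2^-1 : R[i]) = 2^-1 :> R.
Proof. by rewrite nrmV -(rmorph_nat (real_complex R)) nrm_real normr_nat. Qed.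

Lemma nrm_re_part a : nrm (re_part a) <= nrm a.
Proof.
rewrite nrmZ nrm_half ler_pdivrMl// (le_trans (nrmD _ _))// nrm_star.
by rewrite mulrDl mul1r.
Qed.

Lemma nrm_im_part a : nrm (im_part a) <= nrm a.
Proof.
rewrite nrmZ nrmN nrmM nrmi mulr1 nrm_half ler_pdivrMl// (le_trans (nrmB _ _))// nrm_star.
by rewrite mulrDl mul1r.
Qed.

(* As A need not be unital, the totality of products rests on product_approx. *)
Lemma products_total (calA : starAlgType R) (iota : calA -> A) (S : set A) :
  dense (range iota) ->
  (forall a, (forall e : R, 0 < e -> exists2 b, S b & nrm (b - a) <= e) -> S a) ->
  (forall (k : R[i]) a b, S a -> S b -> S (k *: a + b)) ->
  (forall a b : calA, S (amul (iota a) (iota b))) -> forall a, S a.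
Proof.
move=> /denseP di cl lin pr.
have pA x y : S (amul x y).
  apply: cl => e e0; pose K := nrm x + nrm y + 1.
  have K0 : 0 < K by have := nrm_ge0 x; have := nrm_ge0 y; rewrite /K; lra.
  pose d := Num.min 1 (e / K).
  have d0 : 0 < d by rewrite lt_min ltr01 divr_gt0.
  have [_ [a _ <-] ha] := di x _ d0; have [_ [b _ <-] hb] := di y _ d0.
  exists (amul (iota a) (iota b)) => //.
  have -> : amul (iota a) (iota b) - amul x y =
      amul (iota a - x) (iota b - y) + amul (iota a - x) y + amul x (iota b - y).
    by rewrite !amulBl !amulBr; lmod.
  have h1 := nrm_amul (iota a - x) (iota b - y).
  have h2 := nrm_amul (iota a - x) y; have h3 := nrm_amul x (iota b - y).
  have dd : d <= 1 by rewrite ge_min lexx.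
  have de : d * K <= e by rewrite -ler_pdivlMr// ge_min lexx orbT.
  have a0 := nrm_ge0 (iota a - x); have b0 := nrm_ge0 (iota b - y).
  have x0 := nrm_ge0 x; have y0 := nrm_ge0 y.
  have t1 := nrmD (amul (iota a - x) (iota b - y) + amul (iota a - x) y) (amul x (iota b - y)).
  have t2 := nrmD (amul (iota a - x) (iota b - y)) (amul (iota a - x) y).
  rewrite (le_trans t1)// (le_trans _ de)//.
  have : nrm (iota a - x) * nrm (iota b - y) <= d * 1.
    by rewrite ler_pM ?(ltW ha)// (le_trans (ltW hb)).
  have : nrm (iota a - x) * nrm y <= d * nrm y by rewrite ler_wpM2r ?(ltW ha).
  have : nrm x * nrm (iota b - y) <= nrm x * d by rewrite ler_wpM2l ?(ltW hb).
  by rewrite /K; lra.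
have sA h : astar h = h -> S h.
  move=> hh; apply: cl => e e0; have [k hk] := product_approx hh e0.
  by exists (amul h k); rewrite // nrm_sym.
move=> a; rewrite (re_im_part a) addrC; apply: lin; apply: sA.
  exact: im_part_sa.
exact: re_part_sa.
Qed.

End cartesian_norms.

(** * Automatic continuity of star representations *)

Section representations.
Context {R : realType} {A : starAlgType R} {B : cstarAlgType R} {X : hilbModType B}.
Variable rho : A -> X -> X.
Hypothesis hrho : star_representation rho.

Lemma repD a b x : rho (a + b) x = rho a x + rho b x.
Proof. by case: hrho => lin _ _; have := lin 1 a b x; rewrite !scale1r. Qed.

Lemma rep0 x : rho 0 x = 0.
Proof. by apply: (addrI (rho 0 x)); rewrite -repD !addr0. Qed.

Lemma repZ k a x : rho (k *: a) x = k *: rho a x.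
Proof. by case: hrho => lin _ _; have := lin k a 0 x; rewrite addr0 rep0 addr0. Qed.

Lemma repB a b x : rho (a - b) x = rho a x - rho b x.
Proof. by rewrite -scaleN1r repD repZ scaleN1r. Qed.

Lemma repM a b x : rho (amul a b) x = rho a (rho b x).
Proof. by case: hrho => _ mul _; exact: mul. Qed.

Lemma rep_adj a : is_adjoint (rho a) (rho (astar a)).
Proof. by case: hrho => _ _; exact. Qed.

End representations.

Section bounded_representations.
Context {R : realType} {A B : cstarAlgType R} {X : hilbModType B}.
Variable rho : A -> X -> X.
Hypothesis hrho : star_representation rho.

(** By [unitary_dilation] the vectors x - rho(s) x + i rho(h) x and x - rho(s) x - i rho(h) x have
    the norm of x, and their difference is 2i rho(h) x. Only algebraic relations are used, so
    nothing has to be known about the continuity of rho. *)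
Let rep_half h x : astar h = h -> nrm h <= 2^-1 -> nrm (rho h x) <= nrm x.
Proof.
move=> hh h2; have [s [ss sh sq]] := unitary_dilation hh h2.
have hadj := rep_adj hrho h; rewrite hh in hadj.
have sadj := rep_adj hrho s; rewrite ss in sadj.
pose V (k : R[i]) := (x - rho s x) + k *: rho h x.
have iso k : k^*%C = - k -> k * k = - 1 -> nrm (V k) = nrm x.
  move=> kc kk; apply/eqP; rewrite -(eqrXn2 (n := 2)) ?nrm_ge0//; apply/eqP.
  rewrite !nrm_ip; congr nrm; rewrite /V.
  rewrite !(ipDl, ipDr, ipZl, ipZr, ipNl, ipNr, ipBl, ipBr) kc.
  rewrite !sadj !hadj -!(repM hrho) sh.
  have e1 : ip x (rho (amul h h) x) =
      ip x (rho s x) + ip x (rho s x) - ip x (rho (amul s s) x).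
    by rewrite -sq (repB hrho) (repD hrho) ipBr ipDr.
  have e2 u : k *: (- k *: u) = u by rewrite scalerA mulrN kk opprK scale1r.
  rewrite e1 !(scalerBr, scalerDr, scalerN).
  rewrite !scaleNr !scalerA !kk; lmod.
have V1 : nrm (V 'i%C) = nrm x by apply: iso; rewrite ?conji// -expr2 sqr_i.
have V2 : nrm (V (- 'i%C)) = nrm x.
  by apply: iso; rewrite ?conjN ?conji// mulrNN -expr2 sqr_i.
have e : (2 * 'i%C) *: rho h x = V 'i%C - V (- 'i%C) by rewrite /V; lmod.
have := nrmB (V 'i%C) (V (- 'i%C)); rewrite -e V1 V2 nrmZ nrmM nrmi mulr1.
rewrite -(rmorph_nat (real_complex R)) nrm_real normr_nat.
by rewrite (_ : nrm x + nrm x = 2 * nrm x) ?ler_pM2l//; ring.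
Qed.

Let rep_sa h x : astar h = h -> nrm (rho h x) <= 2 * nrm h * nrm x.
Proof.
move=> hh; have [h0|h0] := eqVneq (nrm h) 0.
  by rewrite [h](@nrm_eq0 _ _ h) ?h0// (rep0 hrho) !nrm0 mulr0 mul0r.
have hp : 0 < nrm h by rewrite lt_def h0 nrm_ge0.
have kp : 0 < (2 * nrm h)^-1 by rewrite invr_gt0 mulr_gt0.
have : nrm (rho ((2 * nrm h)^-1%:C *: h) x) <= nrm x.
  apply: rep_half; first by rewrite astarZ conj_real hh.
  by rewrite nrmZ nrm_real (gtr0_norm kp) invfM -mulrA mulVf// mulr1.
by rewrite (repZ hrho) nrmZ nrm_real (gtr0_norm kp) ler_pdivrMl// mulr_gt0.
Qed.

Lemma rep_bounded a : bounded_by (rho a) (4 * nrm a).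
Proof.
move=> x; rewrite {1}(re_im_part a) (repD hrho) (repZ hrho _ (im_part a)).
rewrite (le_trans (nrmD _ _))// nrmZ nrmi mul1r.
have h1 := rep_sa x (re_part_sa a); have h2 := rep_sa x (im_part_sa a).
rewrite (le_trans (lerD h1 h2))//.
have x0 := nrm_ge0 x; have := nrm_re_part a; have := nrm_im_part a; nra.
Qed.

End bounded_representations.

(** * The Hilbert module of paths and compact perturbations *)

Section continuous_paths.
Context {R : realType}.
Local Notation C := R[i].

Lemma continuous_nrmP (V : normedModType C) (f : R -> V) :
  continuous f <-> forall t (e : R), 0 < e ->
    exists2 d : R, 0 < d & forall s, `|s - t| < d -> nrm (f s - f t) <= e.
Proof.
split=> [cf t e e0|h t].
  have /cvgrPdist_le/(_ e%:C) := cf t; rewrite ltcR => /(_ e0)/nbhs_normP[d /= d0 h].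
  exists d => // s st; rewrite nrm_sym -nrm_leC; apply: h => /=.
  by rewrite distrC.
apply/cvgrPdist_le => e /posC_real[-> e0].
have [d d0 hd] := h t _ e0; apply/nbhs_normP; exists d => // s /= st.
by rewrite nrm_leC nrm_sym; apply: hd; rewrite distrC.
Qed.

Lemma continuous_bilinear (V W Z : normedModType C) (b : V -> W -> Z) (M : R) f g :
  0 <= M -> (forall x y z, b (x - y) z = b x z - b y z) ->
  (forall x y z, b x (y - z) = b x y - b x z) ->
  (forall x y, nrm (b x y) <= M * nrm x * nrm y) ->
  continuous f -> continuous g -> continuous (fun t : R => b (f t) (g t)).
Proof.
move=> M0 bl br bM /continuous_nrmP cf /continuous_nrmP cg.
apply/continuous_nrmP => t e e0; pose K := M * (nrm (f t) + nrm (g t) + 1) + 1.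
have f0 := nrm_ge0 (f t); have g0 := nrm_ge0 (g t).
have K0 : 0 < K by rewrite ltr_wpDl// mulr_ge0// !addr_ge0.
pose d := Num.min 1 (e / K); have d0 : 0 < d by rewrite lt_min ltr01 divr_gt0.
have [d1 d10 h1] := cf t _ d0; have [d2 d20 h2] := cg t _ d0.
exists (Num.min d1 d2) => [|s]; first by rewrite lt_min d10.
rewrite lt_min => /andP[/h1 hf /h2 hg].
have -> : b (f s) (g s) - b (f t) (g t) =
    b (f s - f t) (g s - g t) + b (f s - f t) (g t) + b (f t) (g s - g t).
  by rewrite !bl !br; lmod.
have dd : d <= 1 by rewrite ge_min lexx.
have de : d * K <= e by rewrite -ler_pdivlMr// ge_min lexx orbT.
rewrite (le_trans (nrmD _ _))// (le_trans (lerD (nrmD _ _) (lexx _)))//.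
rewrite (le_trans (lerD (lerD (bM _ _) (bM _ _)) (bM _ _)))// (le_trans _ de)//.
have a0 := nrm_ge0 (f s - f t); have b0 := nrm_ge0 (g s - g t).
have : M * nrm (f s - f t) * nrm (g s - g t) <= M * d * 1.
  by rewrite !ler_pM ?mulr_ge0// (le_trans hg).
have : M * nrm (f s - f t) * nrm (g t) <= M * d * nrm (g t).
  by rewrite !ler_pM ?mulr_ge0.
have : M * nrm (f t) * nrm (g s - g t) <= M * nrm (f t) * d.
  by rewrite ler_wpM2l ?mulr_ge0.
have : d * (M * (nrm (f t) + nrm (g t) + 1)) <= d * K by rewrite ler_pM2l// lerDl.
by rewrite /K; lra.
Qed.

Lemma continuous_lipschitz (V W : normedModType C) (b : V -> W) (M : R) f :
  0 <= M -> (forall x y, nrm (b x - b y) <= M * nrm (x - y)) ->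
  continuous f -> continuous (fun t : R => b (f t)).
Proof.
move=> M0 h /continuous_nrmP cf; apply/continuous_nrmP => t e e0.
have M1 : 0 < M + 1 by rewrite ltr_wpDl.
have [d d0 hd] := cf t _ (divr_gt0 e0 M1); exists d => // s /hd.
rewrite ler_pdivlMr// => hs; rewrite (le_trans (h _ _))// (le_trans _ hs)//.
by rewrite mulrC ler_wpM2l ?nrm_ge0// lerDl.
Qed.

Lemma clamp01_dist (s t : R) : `|clamp01 s - clamp01 t| <= `|s - t|.
Proof.
rewrite /clamp01 ler_norml; have := ler_norm (s - t); have := ler_norm (t - s).
rewrite [`|t - s|]distrC.
case: (leP 0 (Num.min s 1)); case: (leP 0 (Num.min t 1));
  case: (leP s 1) => hs; case: (leP t 1) => ht; lra.
Qed.

Lemma continuous_clamp01 : continuous (@clamp01 R).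
Proof.
move=> t; apply/cvgrPdist_le => e e0; apply/nbhs_normP; exists e => // s /= st.
exact: le_trans (clamp01_dist _ _) (ltW st).
Qed.

End continuous_paths.

Section path_module.
Context {R : realType} {B : cstarAlgType R} (X : hilbModType B).
Local Notation C := R[i].

Record path_mod := PathMod {
  pm_fun :> R -> X;
  _ : `[< continuous pm_fun /\ pm_fun = pm_fun \o clamp01 >]
}.

HB.instance Definition _ := [isSub for pm_fun].
HB.instance Definition _ := [Choice of path_mod by <:].

Implicit Types f g : path_mod.

Lemma pm_cts f : continuous f.
Proof. by case: f => f /= /asboolP[]. Qed.

Lemma pm_clamp f t : f t = f (clamp01 t).
Proof. by case: f => f /= /asboolP[_ {1}->]. Qed.

Lemma pm_eq f g : (forall t, f t = g t) -> f = g.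
Proof. by move=> fg; apply/val_inj/funext. Qed.

Let pm_zero_subproof : `[< continuous ((fun=> 0) : R -> X) /\
  ((fun=> 0) : R -> X) = (fun=> 0) \o clamp01 >].
Proof. by apply/asboolP; split=> // t; exact: cvg_cst. Qed.

Let pm_subproof (F : R -> X) : continuous (F \o clamp01) ->
  `[< continuous (F \o clamp01) /\ F \o clamp01 = (F \o clamp01) \o clamp01 >].
Proof.
by move=> cF; apply/asboolP; split=> //; apply/funext => t /=; rewrite clamp01K.
Qed.

(* The junk value, for discontinuous F, is the zero path. *)
Definition pmk (F : R -> X) : path_mod :=
  if pselect (continuous (F \o clamp01)) is left cF then PathMod (pm_subproof cF)
  else PathMod pm_zero_subproof.

Lemma pmkE F t : continuous F -> pmk F t = F (clamp01 t).
Proof.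
move=> cF; rewrite /pmk; case: pselect => // -[] s; apply: continuous_comp.
  exact: continuous_clamp01.
exact: cF.
Qed.

Lemma pmk_id F t : continuous F -> (forall s, F s = F (clamp01 s)) -> pmk F t = F t.
Proof. by move=> cF Fc; rewrite pmkE. Qed.

Definition pm_zero := pmk (fun=> 0).
Definition pm_add f g := pmk (fun t => f t + g t).
Definition pm_opp f := pmk (fun t => - f t).
Definition pm_scale (k : C) f := pmk (fun t => k *: f t).

Let pm0E t : pm_zero t = 0.
Proof. by rewrite pmkE// => s; exact: cvg_cst. Qed.

Let pmDE f g t : pm_add f g t = f t + g t.
Proof.
by rewrite pmk_id => [//|s|s]; [apply: cvgD; exact: pm_cts|rewrite -!pm_clamp].
Qed.

Let pmNE f t : pm_opp f t = - f t.
Proof. by rewrite pmk_id => [//|s|s]; [apply: cvgN; exact: pm_cts|rewrite -!pm_clamp]. Qed.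

Let pmZE k f t : pm_scale k f t = k *: f t.
Proof. by rewrite pmk_id => [//|s|s]; [apply: cvgZr; exact: pm_cts|rewrite -!pm_clamp]. Qed.

Let pm_addA : associative pm_add.
Proof. by move=> f g h; apply: pm_eq => t; rewrite !pmDE addrA. Qed.

Let pm_addC : commutative pm_add.
Proof. by move=> f g; apply: pm_eq => t; rewrite !pmDE addrC. Qed.

Let pm_add0 : left_id pm_zero pm_add.
Proof. by move=> f; apply: pm_eq => t; rewrite pmDE pm0E add0r. Qed.

Let pm_addN : left_inverse pm_zero pm_opp pm_add.
Proof. by move=> f; apply: pm_eq => t; rewrite pmDE pmNE pm0E addNr. Qed.

HB.instance Definition _ := GRing.isZmodule.Build path_mod pm_addA pm_addC pm_add0 pm_addN.

Let pm_scaleA k l f : pm_scale k (pm_scale l f) = pm_scale (k * l) f.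
Proof. by apply: pm_eq => t; rewrite !pmZE scalerA. Qed.

Let pm_scale1 : left_id 1 pm_scale.
Proof. by move=> f; apply: pm_eq => t; rewrite pmZE scale1r. Qed.

Let pm_scaleDr : right_distributive pm_scale +%R.
Proof.
by move=> k f g; apply: pm_eq => t; rewrite pmDE !pmZE pmDE scalerDr.
Qed.

Let pm_scaleDl f : {morph pm_scale^~ f : k l / k + l}.
Proof.
by move=> k l; apply: pm_eq => t; rewrite pmDE !pmZE scalerDl.
Qed.

HB.instance Definition _ := GRing.Zmodule_isLmodule.Build C path_mod
  pm_scaleA pm_scale1 pm_scaleDr pm_scaleDl.

Lemma path_mod0 t : (0 : path_mod) t = 0. Proof. exact: pm0E. Qed.
Lemma path_modD f g t : (f + g) t = f t + g t. Proof. exact: pmDE. Qed.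
Lemma path_modN f t : (- f) t = - f t. Proof. exact: pmNE. Qed.
Lemma path_modB f g t : (f - g) t = f t - g t.
Proof. by rewrite path_modD path_modN. Qed.
Lemma path_modZ k f t : (k *: f) t = k *: f t. Proof. exact: pmZE. Qed.

Let ip_cts f g : continuous (fun t => ip (f t) (g t)).
Proof.
apply: (@continuous_bilinear _ _ _ _ _ 4) => //; [exact: ipBl|exact: ipBr| | |].
- exact: nrm_ip_le.
- exact: pm_cts.
- exact: pm_cts.
Qed.

Let ip_clamp f g t : ip (f t) (g t) = ip (f (clamp01 t)) (g (clamp01 t)).
Proof. by rewrite -!pm_clamp. Qed.

Definition pm_ip f g : path_alg B := mk_path (@ip_cts f g) (@ip_clamp f g).

Definition pm_ract f (b : path_alg B) : path_mod := pmk (fun t => ract (f t) (b t)).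

Lemma nrm_path_le (b : path_alg B) t : nrm (b t) <= nrm b.
Proof. by rewrite -lecR !nrmE; exact: le_path_norm. Qed.

Let pm_ractE f b t : pm_ract f b t = ract (f t) (b t).
Proof.
rewrite pmk_id => [//||s]; last by rewrite -pm_clamp -path_clamp.
apply: (@continuous_bilinear _ _ _ _ _ 1) => //.
- by move=> x y z; rewrite -scaleN1r ractDl ractZl scaleN1r.
- by move=> x y z; rewrite -scaleN1r ractDr ractZr scaleN1r.
- by move=> x y; rewrite mul1r nrm_ract.
- exact: pm_cts.
- exact: path_cts.
Qed.

Definition pm_nrm f : R := Num.sqrt (nrm (pm_ip f f)).

Let le_pm_nrm f t : nrm (f t) <= pm_nrm f.
Proof.
rewrite -[leLHS]ger0_norm ?nrm_ge0// -sqrtr_sqr nrm_ip ler_wsqrtr//.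
exact: nrm_path_le (pm_ip f f) t.
Qed.

Let pm_nrm_le f (M : R) : (forall t, nrm (f t) <= M) -> pm_nrm f <= M.
Proof.
move=> h; have M0 : 0 <= M by rewrite (le_trans _ (h 0)) ?nrm_ge0.
rewrite -[leRHS]ger0_norm// -sqrtr_sqr ler_wsqrtr// -lecR nrmE.
apply: path_norm_le => t; rewrite -nrmE lecR /= -nrm_ip.
by rewrite ler_sqr ?nnegrE ?nrm_ge0.
Qed.

Let pm_norm f : C := (pm_nrm f)%:C.

Let pm_normD f g : pm_norm (f + g) <= pm_norm f + pm_norm g.
Proof.
rewrite /pm_norm -rmorphD lecR; apply: pm_nrm_le => t.
by rewrite path_modD (le_trans (nrmD _ _))// lerD.
Qed.

Let pm_normZ_le (k : C) f : pm_nrm (k *: f) <= nrm k * pm_nrm f.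
Proof.
by apply: pm_nrm_le => t; rewrite path_modZ nrmZ ler_wpM2l ?nrm_ge0.
Qed.

Let pm_normZ (k : C) f : pm_norm (k *: f) = `|k| * pm_norm f.
Proof.
rewrite -nrmE -rmorphM; congr _%:C; apply/eqP; rewrite eq_le pm_normZ_le/=.
have [->|k0] := eqVneq k 0; first by rewrite nrm0 mul0r sqrtr_ge0.
have k1 : 0 < nrm k.
  by rewrite lt_def nrm_ge0 andbT; apply: contra k0 => /eqP/nrm_eq0 ->.
rewrite -ler_pdivlMl// -nrmV.
by rewrite -{1}[f](scalerK k0) pm_normZ_le.
Qed.

Let pm_norm0_eq0 f : pm_norm f = 0 -> f = 0.
Proof.
move=> /complexI f0; apply: pm_eq => t; rewrite path_mod0.
by apply: nrm_le0; rewrite -f0.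
Qed.

HB.instance Definition _ := Lmodule_isNormed.Build C path_mod
  pm_normD pm_normZ pm_norm0_eq0.

Lemma nrm_path_modE f : nrm f = pm_nrm f.
Proof. by apply: complexI; rewrite nrmE. Qed.

Lemma path_mod_nrm f t : nrm (f t) <= nrm f.
Proof. by rewrite nrm_path_modE. Qed.

Lemma path_mod_nrm_le f (M : R) : (forall t, nrm (f t) <= M) -> nrm f <= M.
Proof. by rewrite nrm_path_modE; exact: pm_nrm_le. Qed.

Let pm_complete (F : set_system path_mod) : ProperFilter F -> cauchy F -> cvg F.
Proof.
move=> FF /cauchyP Fc.
have le_norm f t : `|f t| <= `|f| by rewrite -!nrmE lecR path_mod_nrm.
have ptc t : cvg ((fun f : path_mod => f t) @ F).
  apply: cauchy_cvg; apply/cauchyP => e e0.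
  have [f fF] := Fc e e0; exists (f t).
  apply: (@filterS _ F _ (ball f e)) fF => g.
  rewrite /= -!ball_normE/= => fg.
  by rewrite -path_modB (le_lt_trans (le_norm _ _)).
pose l t : X := lim ((fun f : path_mod => f t) @ F).
have lcv t : (fun f : path_mod => f t) @ F --> l t by exact: ptc.
have lun (e : R) : 0 < e -> \forall f \near F, forall t, nrm ((f : path_mod) t - l t) <= e.
  move=> e0; have e20 : 0 < (e / 2)%:C :> C by rewrite ltcR divr_gt0.
  have [h hF] := Fc _ e20.
  have hb f : ball h (e / 2)%:C f -> nrm (f - h) <= e / 2.
    by rewrite -ball_normE/= distrC -nrmE ltcR => /ltW.
  apply: (@filterS _ F _ (ball h (e / 2)%:C)) (hF) => f /hb hf t.
  apply/ler_addgt0Pr => d d0; have d20 : 0 < d%:C :> C by rewrite ltcR.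
  have /cvgrPdist_le/(_ _ d20) lF := lcv t.
  have [g [/hb hg]] := filter_ex (filterI hF lF); rewrite nrm_leC nrm_sym => lg.
  rewrite (le_trans (nrm_tri (g t) _ _))// lerD//.
  rewrite (le_trans (nrm_tri (h t) _ _))// (splitr e) lerD// -path_modB.
    exact: le_trans (path_mod_nrm _ _) hf.
  by rewrite (le_trans (path_mod_nrm _ _))// nrm_sym.
have lcts : continuous l.
  apply/continuous_nrmP => t e e0; have e30 : 0 < e / 3 by rewrite divr_gt0.
  have [f fl] := filter_ex (lun _ e30).
  have /continuous_nrmP/(_ t _ e30)[d d0 fd] := @pm_cts f.
  exists d => // s /fd fs.
  have -> : e = e / 3 + (e / 3 + e / 3) by field.
  rewrite (le_trans (nrm_tri (f s) _ _))// lerD//; first by rewrite nrm_sym.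
  by rewrite (le_trans (nrm_tri (f t) _ _))// lerD.
have lcl t : l t = l (clamp01 t).
  by congr (lim (_ @ F)); apply/funext => f; rewrite -pm_clamp.
apply/cvg_ex; exists (pmk l).
apply/cvgrPdist_le => e /posC_real[-> e0]; apply: (@filterS _ F _ _ _ _ (lun _ e0)) => f fl.
rewrite nrm_leC; apply: path_mod_nrm_le => t.
by rewrite path_modB pmk_id// nrm_sym.
Qed.

HB.instance Definition _ := Uniform_isComplete.Build path_mod pm_complete.

(** At each t there is a factor b_t, but these need not depend continuously on t. A square root in
    the algebra of paths does; the hypothesis of [selfadjoint_sqrt] is checked pointwise, with b_t
    k_t as the element d of [neg_square_eq0]. *)
Let pm_ip_ge0 f : exists b, pm_ip f f = amul (astar b) b.
Proof.
have [||s ss sE] := @selfadjoint_sqrt R (path_alg B) (pm_ip f f).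
- by apply: path_eq => t /=; rewrite ip_star.
- move=> k m kk mm e; apply: path_eq => t /=.
  have [b hb] := ip_ge0 (f t).
  have kt : astar (k t) = k t by rewrite -{2}kk.
  apply: (@neg_square_eq0 _ _ (amul b (k t))).
    by rewrite -{2}mm.
  rewrite astarM kt -amulA [amul (astar b) _]amulA -hb.
  by have := congr1 (fun p : path_alg B => p t) e.
by exists s; rewrite ss.
Qed.

Let pm_hnorm f : `|f| ^+ 2 = `|pm_ip f f|.
Proof.
by rewrite -!nrmE -rmorphXn; congr _%:C; rewrite nrm_path_modE sqr_sqrtr ?nrm_ge0.
Qed.

Let pm_ractDl f g b : pm_ract (f + g) b = pm_ract f b + pm_ract g b.
Proof. by apply: pm_eq => t; rewrite path_modD !pm_ractE path_modD ractDl. Qed.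

Let pm_ractDr f b c : pm_ract f (b + c) = pm_ract f b + pm_ract f c.
Proof. by apply: pm_eq => t; rewrite path_modD !pm_ractE ractDr. Qed.

Let pm_ractZl k f b : pm_ract (k *: f) b = k *: pm_ract f b.
Proof. by apply: pm_eq => t; rewrite path_modZ !pm_ractE path_modZ ractZl. Qed.

Let pm_ractZr k f b : pm_ract f (k *: b) = k *: pm_ract f b.
Proof. by apply: pm_eq => t; rewrite path_modZ !pm_ractE ractZr. Qed.

Let pm_ractA f b c : pm_ract f (amul b c) = pm_ract (pm_ract f b) c.
Proof. by apply: pm_eq => t; rewrite !pm_ractE ractA. Qed.

Let pm_ipDr f g h : pm_ip f (g + h) = pm_ip f g + pm_ip f h.
Proof. by apply: path_eq => t /=; rewrite path_modD ipDr. Qed.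

Let pm_ipZr k f g : pm_ip f (k *: g) = k *: pm_ip f g.
Proof. by apply: path_eq => t /=; rewrite path_modZ ipZr. Qed.

Let pm_ip_ract f g b : pm_ip f (pm_ract g b) = amul (pm_ip f g) b.
Proof. by apply: path_eq => t /=; rewrite pm_ractE ip_ract. Qed.

Let pm_ip_star f g : astar (pm_ip f g) = pm_ip g f.
Proof. by apply: path_eq => t /=; rewrite ip_star. Qed.

HB.instance Definition _ := @isHilbertModule.Build R (path_alg B) path_mod
  pm_ract pm_ip pm_ractDl pm_ractDr pm_ractZl pm_ractZr pm_ractA
  pm_ipDr pm_ipZr pm_ip_ract pm_ip_star pm_ip_ge0 pm_hnorm.

Lemma path_mod_ract f (b : path_alg B) t : ract f b t = ract (f t) (b t).
Proof. exact: pm_ractE. Qed.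

Lemma path_mod_ip f g t : ip f g t = ip (f t) (g t).
Proof. by []. Qed.

Lemma path_mod_sum n (F : 'I_n -> path_mod) t : (\sum_(j < n) F j) t = \sum_(j < n) F j t.
Proof.
by elim/big_rec2: _ => [|j y z _ <-]; rewrite ?path_mod0// path_modD.
Qed.

End path_module.

Section path_module_operators.
Context {R : realType} {B : cstarAlgType R} (X : hilbModType B).
Local Notation C := R[i].
Local Notation E := (path_mod X).
Implicit Types (f g : E) (T S K : X -> X).

Lemma continuous_scale (c : R -> R) (h : R -> X) :
  continuous c -> continuous h -> continuous (fun t => (c t)%:C *: h t).
Proof.
move=> cc ch.
apply: (@continuous_bilinear R (R[i]^o) X X (fun k x => k *: x) 1 (fun t => (c t)%:C)) => //.
- by move=> x y z; rewrite scalerBl.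
- by move=> x y z; rewrite scalerBr.
- by move=> x y; rewrite nrmZ mul1r.
- by have [] := contR cc.
Qed.

Lemma continuous_cst_path (x : X) : continuous (fun _ : R => x).
Proof. by move=> t; exact: cvg_cst. Qed.

Definition const_path (x : X) : E := pmk (fun=> x).

Lemma const_pathE x t : const_path x t = x.
Proof. by rewrite pmkE//; exact: continuous_cst_path. Qed.

Definition const_path_alg (b : B) : path_alg B :=
  mk_path (fun t => cvg_cst b : (fun _ : R => b) x @[x --> t] --> b) (fun=> erefl).

Definition scaled_path (c : R -> R) (x : X) : E := pmk (fun t => (c t)%:C *: x).

Lemma scaled_pathE c x t : continuous c -> scaled_path c x t = (c (clamp01 t))%:C *: x.
Proof.
by move=> cc; rewrite pmkE//; apply: continuous_scale => //; exact: continuous_cst_path.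
Qed.

(** The hat function centred at j / N, as a difference of clamps so that the sum over j
    telescopes. *)
Definition tent (N j : nat) (t : R) : R :=
  clamp01 (N%:R * t - j%:R + 1) - clamp01 (N%:R * t - j%:R).

Lemma continuous_tent N j : continuous (tent N j).
Proof.
have ca : continuous (fun t : R => N%:R * t - j%:R).
  move=> t; apply: cvgB; last exact: cvg_cst.
  by apply: cvgM; [exact: cvg_cst|exact: cvg_id].
move=> t; apply: cvgB.
  apply: (@continuous_comp _ _ _ (fun t : R => N%:R * t - j%:R + 1) clamp01).
    by apply: cvgD; [exact: ca|exact: cvg_cst].
  exact: continuous_clamp01.
apply: (@continuous_comp _ _ _ (fun t : R => N%:R * t - j%:R) clamp01); first exact: ca.
exact: continuous_clamp01.
Qed.

Lemma clamp01_ge1 (t : R) : 1 <= t -> clamp01 t = 1.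
Proof. by move=> t1; rewrite /clamp01 (min_idPr t1) (max_idPr ler01). Qed.

Lemma clamp01_le0 (t : R) : t <= 0 -> clamp01 t = 0.
Proof.
by move=> t0; rewrite /clamp01 (min_idPl _) ?(max_idPl t0)// (le_trans t0).
Qed.

Lemma clamp01_homo (s t : R) : s <= t -> clamp01 s <= clamp01 t.
Proof.
move=> st; rewrite /clamp01; case: (leP 0 (Num.min s 1)); case: (leP 0 (Num.min t 1));
  case: (leP s 1) => hs; case: (leP t 1) => ht; lra.
Qed.

Lemma tent_ge0 N j t : 0 <= tent N j t.
Proof. by rewrite subr_ge0 clamp01_homo// lerDl. Qed.

Lemma tent_le1 N j t : tent N j t <= 1.
Proof.
have /andP[h1 h2] := clamp01_itv (N%:R * t - j%:R + 1).
have /andP[h3 h4] := clamp01_itv (N%:R * t - j%:R); rewrite /tent; lra.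
Qed.

Lemma tent_eq0 N j t : 1 <= `|N%:R * t - j%:R| -> tent N j t = 0.
Proof.
rewrite /tent; set y := N%:R * t - j%:R; rewrite ler_normr => /orP[h|h].
  by rewrite !clamp01_ge1 ?subrr//; lra.
by rewrite !clamp01_le0 ?subrr//; lra.
Qed.

Lemma tent_sum N t : 0 <= t <= 1 -> \sum_(j < N.+1) tent N j t = 1.
Proof.
move=> /andP[t0 t1].
have tele n : \sum_(j < n) tent N j t =
    clamp01 (N%:R * t + 1) - clamp01 (N%:R * t - n%:R + 1).
  elim: n => [|n IH]; first by rewrite big_ord0 subr0 subrr.
  rewrite big_ord_recr /= IH /tent -natr1.
  have -> : N%:R * t - (n%:R + 1) + 1 = N%:R * t - n%:R by ring.
  by lra.
have N0 : 0 <= N%:R :> R by [].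
rewrite tele -natr1 clamp01_ge1; last by rewrite lerDr mulr_ge0.
by rewrite clamp01_le0 ?subr0//; nra.
Qed.

Lemma tent_approx f (e : R) : 0 < e -> exists N,
  nrm (f - \sum_(j < N.+1) scaled_path (tent N j) (f (j%:R / N%:R))) <= e.
Proof.
move=> e0; have [d d0 hd] := unif_cont_seg 1 (proj1 (continuous_nrmP _) (@pm_cts _ _ _ f)) e0.
pose N := (Num.truncn d^-1).+1.
have N0 : 0 < N%:R :> R by rewrite ltr0n.
have Nd : N%:R^-1 < d.
  by rewrite invf_plt ?posrE// /N; have := truncnS_gt d^-1.
exists N; apply: path_mod_nrm_le => t.
rewrite path_modB path_mod_sum pm_clamp.
have s01 := clamp01_itv t; set s := clamp01 t in s01 *.
have -> : f s - \sum_(j < N.+1) scaled_path (tent N j) (f (j%:R / N%:R)) t =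
    \sum_(j < N.+1) (tent N j s)%:C *: (f s - f (j%:R / N%:R)).
  transitivity (\sum_(j < N.+1) ((tent N j s)%:C *: f s -
      (tent N j s)%:C *: f (j%:R / N%:R))); last by apply: eq_bigr => j _; rewrite scalerBr.
  rewrite sumrB -scaler_suml -rmorph_sum/= tent_sum// rmorph1 scale1r; congr (_ - _).
  by apply: eq_bigr => j _; rewrite scaled_pathE//; exact: continuous_tent.
rewrite (le_trans (nrm_sum _ _ _))//.
rewrite (le_trans (ler_sum _ (fun (j : 'I_N.+1) _ => _ : _ <= tent N j s * e)))//; last first.
  by rewrite -mulr_suml tent_sum// mul1r.
move=> j _; rewrite nrmZ nrm_real ger0_norm ?tent_ge0//.
have [h|h] := leP 1 `|N%:R * s - j%:R|; first by rewrite tent_eq0// !mul0r.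
rewrite ler_wpM2l ?tent_ge0// nrm_sym; apply: hd.
  by rewrite ger0_norm; case/andP: s01.
have -> : j%:R / N%:R - s = - (N%:R * s - j%:R) / N%:R :> R by field; rewrite gt_eqF.
rewrite normrM normrN normfV (gtr0_norm N0) (lt_trans _ Nd)//.
by rewrite ltr_pdivrMr// mulVf ?gt_eqF.
Qed.

Lemma path_mod_countably_generated :
  countably_generated X -> countably_generated E.
Proof.
move=> [u hu].
(* The generators are the hats times the generators u_n of X, enumerated through codes of triples;
   numbers that code no triple give 0. *)
exists (fun k => if unpickle k is Some (N, j, n) then scaled_path (tent N j) (u n) else 0).
move=> M cM lM rM gM.
have M0 : M 0.
  have := lM (-1) _ _ (gM 0%N) (gM 0%N).
  by rewrite scaleN1r addNr.
(* For fixed N and j the vectors x whose hat multiple lies in M form a closed submodule of X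
   containing all u_n. *)
have Mt N j x : M (scaled_path (tent N j) x).
  have tE y t := scaled_pathE y t (@continuous_tent N j).
  suff e : [set y | M (scaled_path (tent N j) y)] = setT.
    by have : [set y | M (scaled_path (tent N j) y)] x by rewrite e.
  apply: hu => [|k y z My Mz|y b My|n].
  - apply/closedP => y hy; move/closedP: cM; apply => e e0.
    have [z Mz yz] := hy e e0; exists (scaled_path (tent N j) z) => //.
    apply: le_lt_trans yz; apply: path_mod_nrm_le => t.
    rewrite path_modB !tE -scalerBr nrmZ nrm_real ger0_norm ?tent_ge0//.
    by rewrite ler_piMl ?nrm_ge0// tent_le1.
  - rewrite /=; suff <- : k *: scaled_path (tent N j) y + scaled_path (tent N j) z =
        scaled_path (tent N j) (k *: y + z) by exact: lM.
    by apply: pm_eq => t; rewrite path_modD path_modZ !tE scalerDr !scalerA mulrC.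
  - rewrite /=; suff <- : ract (scaled_path (tent N j) y) (const_path_alg b) =
        scaled_path (tent N j) (ract y b) by exact: rM.
    by apply: pm_eq => t; rewrite path_mod_ract !tE ractZl.
  - by have := gM (pickle (N, j, n)); rewrite pickleK.
apply/seteqP; split=> // f _; move/closedP: cM; apply => e e0.
have [N hN] := tent_approx f (divr_gt0 e0 (ltr0n R 2)).
exists (\sum_(j < N.+1) scaled_path (tent N j) (f (j%:R / N%:R))).
  elim/big_rec: _ => // j y _ My.
  by rewrite -[scaled_path _ _]scale1r; exact: lM.
by rewrite nrm_sym (le_lt_trans hN)// ltr_pdivrMr// ltr_pMr// ltr1n.
Qed.

Definition lift_op T f : E := pmk (fun t => T (f t)).

Lemma lift_opE T S f t : is_adjoint T S -> lift_op T f t = T (f t).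
Proof.
move=> TS; have [M M0 hM] := adjointable_bounded TS.
rewrite pmk_id => [//||s]; last by rewrite -pm_clamp.
apply: (continuous_lipschitz M0) => [x y|]; last exact: pm_cts.
by rewrite -(adjB _ _ TS).
Qed.

Lemma lift_op_adj T S : is_adjoint T S -> is_adjoint (lift_op T) (lift_op S).
Proof.
move=> TS f g; apply: path_eq => t; rewrite !path_mod_ip.
by rewrite (lift_opE _ _ TS) (lift_opE _ _ (adj_sym TS)) TS.
Qed.

Definition ramp f : E := pmk (fun t => t%:C *: f t).

Lemma rampE f t : ramp f t = (clamp01 t)%:C *: f t.
Proof.
rewrite pmkE -?pm_clamp//.
by apply: continuous_scale; [move=> s; exact: cvg_id|exact: pm_cts].
Qed.

Lemma ramp_adj : is_adjoint ramp ramp.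
Proof.
move=> f g; apply: path_eq => t.
by rewrite !path_mod_ip !rampE ipZl ipZr conj_real.
Qed.

(** [compact_op] does not ask for linearity; additivity, and with it the Lipschitz bound, is
    inherited from the approximating finite sums. *)
Lemma compact_lipschitz K : compact_op K ->
  exists2 M, 0 <= M & forall x y, nrm (K x - K y) <= M * nrm (x - y).
Proof.
move=> /compactP hK.
have KB x y : K (x - y) = K x - K y.
  apply: nrm_small_eq => e e0; pose s := nrm (x - y) + nrm x + nrm y + 1.
  have s0 : 0 < s by rewrite ltr_wpDl// !addr_ge0// nrm_ge0.
  have [n [u [v huv]]] := hK _ (divr_gt0 e0 s0).
  pose L z := \sum_(j < n) ract (u j) (ip (v j) z).
  have LB : L (x - y) = L x - L y.
    by rewrite -sumrB; apply: eq_bigr => j _; rewrite ipBr -scaleN1r ractDr ractZr scaleN1r.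
  have -> : K (x - y) - (K x - K y) =
      (K (x - y) - L (x - y)) - (K x - L x) + (K y - L y) by rewrite LB; lmod.
  rewrite (le_trans (nrmD _ _))// (le_trans (lerD (nrmB _ _) (lexx _)))//.
  rewrite (le_trans (lerD (lerD (huv _) (huv _)) (huv _)))// -!mulrDr.
  by rewrite -mulrA ler_piMr ?(ltW e0)// ler_pdivrMl// mulr1 lerDl.
have [n [u [v huv]]] := hK _ ltr01.
exists (1 + \sum_(j < n) nrm (u j) * (4 * nrm (v j))) => [|x y].
  by rewrite addr_ge0// sumr_ge0// => j _; rewrite !mulr_ge0 ?nrm_ge0.
rewrite -KB; set z := x - y; set L := \sum_(j < n) ract (u j) (ip (v j) z).
rewrite (le_trans (nrm_le_dist _ L))// addrC mulrDl lerD ?huv//.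
rewrite (le_trans (nrm_sum _ _ _))// mulr_suml ler_sum// => j _.
rewrite (le_trans (nrm_ract _ _))// -mulrA ler_wpM2l ?nrm_ge0//.
exact: nrm_ip_le.
Qed.

Definition weighted_op (c : R -> R) K f : E := pmk (fun t => (c t)%:C *: K (f t)).

Lemma weighted_opE c K f t : compact_op K -> continuous c ->
  weighted_op c K f t = (c (clamp01 t))%:C *: K (f t).
Proof.
move=> /compact_lipschitz[M M0 hM] cc; rewrite pmkE -?pm_clamp//.
apply: continuous_scale => //; apply: (continuous_lipschitz M0) => //.
exact: pm_cts.
Qed.

Lemma weighted_compact K (c : R -> R) : compact_op K -> continuous c ->
  (forall t, 0 <= t <= 1 -> `|c t| <= 1) -> compact_op (weighted_op c K).
Proof.
move=> cK cc c1; apply/compactP => e e0; move/compactP: (cK) => hK.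
have [n [x [y hxy]]] := hK e e0.
exists n, (fun j => scaled_path c (x j)), (fun j => const_path (y j)) => f.
apply: path_mod_nrm_le => t; rewrite path_modB path_mod_sum weighted_opE//.
rewrite (eq_bigr (fun j => (c (clamp01 t))%:C *: ract (x j) (ip (y j) (f t)))).
  rewrite -scaler_sumr -scalerBr nrmZ nrm_real.
  rewrite (le_trans (ler_pM _ _ (c1 _ (clamp01_itv t)) (hxy (f t)))) ?nrm_ge0//.
  by rewrite mul1r ler_pM2l// path_mod_nrm.
by move=> j _; rewrite path_mod_ract path_mod_ip scaled_pathE// const_pathE ractZl.
Qed.

End path_module_operators.

(** * The straight-line homotopy *)

Section compact_perturbations.
Context {R : realType} {A B : cstarAlgType R} {X : hilbModType B}.
Variables (rho : A -> X -> X) (gr : option (X -> X)) (F0 F1 : X -> X).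
Hypotheses (K0 : kasparov_module rho gr F0) (K1 : kasparov_module rho gr F1).
Hypotheses (F0s : is_adjoint F0 F0) (F1s : is_adjoint F1 F1).
Hypothesis Fc : forall a, compact_op (fun x => rho a (F1 x - F0 x)).
Local Notation E := (path_mod X).

Let k x := F1 x - F0 x.
Let ks : is_adjoint k k. Proof. exact: is_adjointB. Qed.
Let hrho : star_representation rho. Proof. by case: K0. Qed.

Let rep a : E -> E := lift_op (rho a).
Let repE a f t : rep a f t = rho a (f t).
Proof. exact: lift_opE (rep_adj hrho a). Qed.

Let F (f : E) : E := lift_op F0 f + ramp (lift_op k f).
Let FE f t : F f t = F0 (f t) + (clamp01 t)%:C *: k (f t).
Proof. by rewrite path_modD (lift_opE _ _ F0s) rampE (lift_opE _ _ ks). Qed.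

Let Fs : is_adjoint F F.
Proof.
move=> f g; rewrite /F ipDl ipDr (lift_op_adj F0s) ramp_adj (lift_op_adj ks).
congr (_ + ip f _); apply: pm_eq => t.
by rewrite rampE !(lift_opE _ _ ks) rampE (adjZ _ _ ks).
Qed.

Let c1 : continuous (fun _ : R => 1 : R). Proof. by move=> t; exact: cvg_cst. Qed.
Let ct : continuous (fun t : R => t : R). Proof. by move=> t; exact: cvg_id. Qed.
Let ctt : continuous (fun t : R => t * t : R).
Proof. by move=> t; apply: cvgM; exact: cvg_id. Qed.

(** The path of operators is affine in the parameter, so its square is quadratic; polynomials of
    degree 2 with compact coefficients are all that is needed. *)
Let path_compact (S0 S1 S2 : X -> X) (S : E -> E) :
  compact_op S0 -> compact_op S1 -> compact_op S2 ->
  (forall f t, S f t = S0 (f t) + (clamp01 t)%:C *: S1 (f t) +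
     (clamp01 t * clamp01 t)%:C *: S2 (f t)) -> compact_op S.
Proof.
move=> k0 k1 k2 hS.
have h0 : compact_op (weighted_op (fun=> 1) S0).
  by apply: weighted_compact => // t _; rewrite normr1.
have h1 : compact_op (weighted_op (fun t => t) S1).
  by apply: weighted_compact => // t /andP[t0 t1]; rewrite ger0_norm.
have h2 : compact_op (weighted_op (fun t => t * t) S2).
  apply: weighted_compact => // t /andP[t0 t1]; rewrite ger0_norm ?mulr_ge0//.
  by rewrite mulr_ile1.
apply: (compact_eq _ (compactD (compactD h0 h1) h2)) => f; apply: pm_eq => t.
by rewrite !path_modD !weighted_opE// hS rmorph1 scale1r.
Qed.

Let k_compact a : compact_op (fun x => rho a (k x)).
Proof. exact: Fc. Qed.

Let k_commutator_compact a : compact_op (fun x => k (rho a x) - rho a (k x)).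
Proof.
have [_ _ _ h0 _] := K0; have [_ _ _ h1 _] := K1.
apply: (compact_eq _ (compactB (proj2 (h1 a)) (proj2 (h0 a)))) => x.
by rewrite /k (adjB _ _ (rep_adj hrho a)); lmod.
Qed.

Let path_gr := omap (@lift_op R B X) gr.

Let path_module : kasparov_module rep path_gr F.
Proof.
have [cg _ _ h0 [isg evg odg0]] := K0; have [_ _ _ h1 [_ _ odg1]] := K1.
split.
- exact: path_mod_countably_generated.
- split=> [l a b f|a b f|a].
  + by apply: pm_eq => t; rewrite path_modD path_modZ !repE (repD hrho) (repZ hrho).
  + by apply: pm_eq => t; rewrite !repE (repM hrho).
  + exact: lift_op_adj (rep_adj hrho a).
- exists F => // a; apply: (compact_eq _ compact0) => f.
  by rewrite subrr; apply: pm_eq => t; rewrite repE !path_mod0 (adj0 (rep_adj hrho a)).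
- move=> a; have ra := rep_adj hrho a; split.
  + apply: (path_compact (proj1 (h0 a)) (S1 := fun x => rho a (F0 (k x)) + rho a (k (F0 x)))
      (S2 := fun x => rho a (k (k x)))).
    * apply: compactD; last exact: compact_compr F0s (k_compact a).
      (* Moving rho(a) past F0 costs a commutator: rho(a) F0 k = F0 rho(a) k - [F0, rho(a)] k, and
         both terms are compact. *)
      apply: (compact_eq _ (compactB (compact_compl F0s (k_compact a))
        (compact_compr ks (proj2 (h0 a))))) => x.
      by lmod.
    * exact: compact_compr ks (k_compact a).
    * move=> f t; rewrite repE path_modB !FE.
      move: (ks); generalize k => k' ks'.
      rewrite !(adjD _ _ F0s) !(adjD _ _ ks') !(adjZ _ _ F0s) !(adjZ _ _ ks').
      rewrite rmorphM !(adjB _ _ ra) !(adjD _ _ ra) !(adjZ _ _ ra) !(adjD _ _ ra) !(adjZ _ _ ra).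
      by lmod.
  + apply: (path_compact (proj2 (h0 a)) (k_commutator_compact a) compact0).
    move=> f t; rewrite path_modB FE !repE FE.
    generalize k => k'.
    by rewrite !(adjD _ _ ra) !(adjZ _ _ ra) scaler0 addr0; lmod.
- rewrite /path_gr; case: gr isg evg odg0 odg1 => [g|] //= [gg gs] evg odg0 odg1; split=> //.
  + split; last exact: lift_op_adj.
    by move=> f; apply: pm_eq => t; rewrite !(lift_opE _ _ gs) gg.
  + by move=> a f; apply: pm_eq => t; rewrite repE !(lift_opE _ _ gs) repE evg.
  + move=> f h; rewrite /graph /= => <-; apply: pm_eq => t.
    have o0 x : F0 (g x) = - g (F0 x) by exact: odg0 x (F0 x) erefl.
    have o1 x : F1 (g x) = - g (F1 x) by exact: odg1 x (F1 x) erefl.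
    rewrite path_modN FE !(lift_opE _ _ gs) FE /k o0 o1.
    by rewrite !(adjD _ _ gs) !(adjZ _ _ gs) !(adjB _ _ gs); lmod.
Qed.

Let evaluates (t : R) (F' : X -> X) (K' : kasparov_module rho gr F') :
  (forall x, F' x = F0 x + (clamp01 t)%:C *: k x) ->
  evaluates_to t (KKCycle path_module) (KKCycle K').
Proof.
move=> hF; exists (fun f : E => f t); split=> /=.
- split=> //.
  + by move=> l f g; rewrite path_modD path_modZ.
  + by move=> f b; rewrite path_mod_ract.
  + apply/denseP => x e e0; exists x; last by rewrite subrr nrm0.
    by exists (const_path x); rewrite ?const_pathE.
- by move=> a f; rewrite repE.
- by move=> f; rewrite FE hF.
- rewrite /path_gr; have [_ _ _ _ [isg _ _]] := K0.
  by case: gr isg => [g|] //= [_ gs] f; rewrite (lift_opE _ _ gs).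
Qed.

Lemma compact_perturbation_homotopic : kk_homotopic (KKCycle K0) (KKCycle K1).
Proof.
exists (KKCycle path_module); apply: evaluates => x.
  by rewrite clamp01_le0// rmorph0 scale0r addr0.
by rewrite clamp01_ge1// rmorph1 scale1r /k addrC subrK.
Qed.

End compact_perturbations.

(** * The series for sgnlog and for the bounded transform *)

Section summable_series.
Context {R : realType}.
Implicit Types (b : nat -> R) (n m : nat) (e t : R).

Definition summable_seq b := forall e, 0 < e ->
  exists N, forall m n, (N <= m)%N -> \sum_(m <= k < n) b k <= e.

Lemma summable_le b c K : (forall n, c n <= K * b n) -> (forall n, 0 <= b n) ->
  summable_seq b -> summable_seq c.
Proof.
move=> cb b0 sb e e0; have K0 : 0 < `|K| + 1 by rewrite ltr_wpDl.
have [N hN] := sb _ (divr_gt0 e0 K0); exists N => m n /(hN m n).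
rewrite ler_pdivlMr// => h; rewrite (le_trans _ h)// mulrC mulr_sumr.
rewrite ler_sum// => k _; rewrite (le_trans (cb k))// ler_wpM2r//.
by rewrite (le_trans (ler_norm K))// lerDl.
Qed.

Lemma sum_dist_le (V : normedZmodType R[i]) (u : nat -> V) b n m :
  (forall k, nrm (u k) <= b k) -> (n <= m)%N ->
  nrm (\sum_(k < m) u k - \sum_(k < n) u k) <= \sum_(n <= k < m) b k.
Proof.
move=> ub nm; rewrite -!(big_mkord xpredT u) (@big_cat_nat _ _ _ n 0 m)//= addrAC subrr add0r.
by rewrite (le_trans (nrm_sum _ _ _))// ler_sum.
Qed.

Lemma summable_cauchy (V : normedZmodType R[i]) (u : nat -> V) b :
  (forall k, nrm (u k) <= b k) -> summable_seq b -> forall e, 0 < e ->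
  exists N, forall n m, (N <= n)%N -> (N <= m)%N ->
    nrm (\sum_(k < n) u k - \sum_(k < m) u k) <= e.
Proof.
move=> ub sb e e0; have [N hN] := sb e e0; exists N => n m Nn Nm.
have [nm|/ltnW mn] := leqP n m; last by rewrite (le_trans (sum_dist_le ub mn))// hN.
by rewrite nrm_sym (le_trans (sum_dist_le ub nm))// hN.
Qed.

Lemma locally_uniform_series (f : nat -> R -> R) b :
  (forall n t, `|f n t| <= `|t| * b n) -> summable_seq b ->
  exists W : R -> R, forall K e, 0 < e -> exists N, forall n t, (N <= n)%N ->
    `|t| <= K -> `|\sum_(k < n) f k t - W t| <= e.
Proof.
move=> fb sb.
have cauchy K e : 0 < e -> exists N, forall n m t, (N <= n)%N -> (N <= m)%N ->
    `|t| <= K -> `|\sum_(k < n) f k t - \sum_(k < m) f k t| <= e.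
  move=> e0; have [b0|[k bk]] : (forall n, 0 <= b n) \/ exists n, ~~ (0 <= b n).
  - by apply: contrapT => /not_orP[h1 /forallNP h2]; apply: h1 => n; exact/negPn/negP.
  - have K0 : 0 < `|K| + 1 by rewrite ltr_wpDl.
    have [N hN] := sb _ (divr_gt0 e0 K0); exists N => n m t Nn Nm tK.
    have fk j : nrm ((f j t)%:C : R[i]) <= (`|K| + 1) * b j.
      rewrite nrm_real (le_trans (fb j t))// ler_wpM2r//.
      by rewrite (le_trans tK)// (le_trans (ler_norm K))// lerDl.
    rewrite -nrm_real rmorphB !rmorph_sum /=.
    wlog nm : n m Nn Nm / (n <= m)%N.
      by move=> wl; have /orP[h|h] := leq_total n m; [|rewrite nrm_sym]; exact: wl.
    rewrite nrm_sym (le_trans (sum_dist_le fk nm))// -mulr_sumr.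
    by rewrite -ler_pdivlMl// mulrC hN.
  - have := le_trans (normr_ge0 _) (fb k 1).
    by rewrite normr1 mul1r (negbTE bk).
have pt t : exists l : R, (fun n => \sum_(k < n) f k t) @ \oo --> l.
  apply/cvg_ex/cauchy_cvgP/cauchyP => e e0.
  have [N hN] := cauchy `|t| _ (divr_gt0 e0 (ltr0n R 2)).
  exists (\sum_(k < N) f k t); exists N => // n /= Nn; rewrite -ball_normE /=.
  rewrite (le_lt_trans (hN _ _ _ _ Nn _))//.
  by rewrite ltr_pdivrMr// ltr_pMr// ltr1n.
have [W hW] := choice pt; exists W => K e e0.
have [N hN] := cauchy K e e0; exists N => n t Nn tK.
have h : (fun m => `|\sum_(k < n) f k t - \sum_(k < m) f k t|) @ \oo -->
    `|\sum_(k < n) f k t - W t|.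
  by apply: cvg_norm; apply: cvgB; [exact: cvg_cst|exact: hW].
apply: (cvgr_to_le h); exists N => // m /= Nm; exact: hN.
Qed.

End summable_series.

Section p_series.
Context {R : realType}.
Implicit Types (n m : nat) (e t d : R).
Local Notation N1 n := (n.+1%:R : R).

Lemma powR_ge1Dln (x d : R) : 0 < x -> 1 + d * ln x <= x `^ d.
Proof. by move=> x0; rewrite /powR gt_eqF// expR_ge1Dx. Qed.

Lemma ln_ge_1BV (x : R) : 0 < x -> 1 - x^-1 <= ln x.
Proof.
move=> x0; have xi : 0 < x^-1 by rewrite invr_gt0.
have h : -1 < x^-1 - 1 by lra.
by have := le_ln1Dx h; rewrite [1 + _]addrC subrK lnV ?posrE//; lra.
Qed.

(** A discrete form of the primitive of x^(-1-d). It follows from x^d >= 1 + d ln x and ln x >= 1 -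
    1/x at x = (n + 2) / (n + 1). *)
Lemma powR_telescope d n : 0 < d ->
  N1 n.+1 `^ (- (1 + d)) <= d^-1 * (N1 n `^ (- d) - N1 n.+1 `^ (- d)).
Proof.
move=> d0; rewrite -ler_pdivrMl ?invr_gt0// invrK.
have a0 : 0 < N1 n by []. have b0 : 0 < N1 n.+1 by [].
have q0 : 0 < N1 n.+1 / N1 n by rewrite divr_gt0.
have e1 : N1 n `^ (- d) = N1 n.+1 `^ (- d) * (N1 n.+1 / N1 n) `^ d.
  rewrite powRM ?invr_ge0// mulrA -powRD; last by rewrite addNr eqxx /= gt_eqF.
  by rewrite addNr powRr0 mul1r -powR_inv1// -powRrM mulN1r.
have e2 : N1 n.+1 `^ (- (1 + d)) = N1 n.+1 `^ (- d) * (N1 n.+1)^-1.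
  by rewrite opprD addrC powRB ?powRr1//; apply/implyP => _; rewrite gt_eqF.
rewrite e1 e2 mulrCA -{3}[N1 n.+1 `^ (- d)]mulr1 -mulrBr ler_pM2l ?powR_gt0//.
have h := powR_ge1Dln d q0; have h' := ln_ge_1BV q0.
have e3 : 1 - (N1 n.+1 / N1 n)^-1 = (N1 n.+1)^-1.
  rewrite invf_div -[N1 n.+1]natr1; field.
  by rewrite gt_eqF// ltr_wpDl// addr_ge0.
rewrite e3 in h'; have : d * (N1 n.+1)^-1 <= d * ln (N1 n.+1 / N1 n) by rewrite ler_pM2l.
by move=> h2; rewrite lerBrDl (le_trans _ h)// lerD2l.
Qed.

Lemma powR_sum_le d m n : 0 < d ->
  \sum_(m <= k < n) N1 k.+1 `^ (- (1 + d)) <= d^-1 * N1 m `^ (- d).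
Proof.
move=> d0; have [mn|/ltnW nm] := leqP m n; last first.
  by rewrite big_geq// mulr_ge0 ?powR_ge0// invr_ge0 ltW.
rewrite (le_trans (ler_sum _ (fun k _ => powR_telescope k d0)))// -mulr_sumr.
rewrite ler_pM2l ?invr_gt0//.
rewrite (@telescope_sumr_eq _ _ _ (fun k => - N1 k `^ (- d))) // => [|k _].
  by rewrite opprK addrC lerBlDr lerDl powR_ge0.
by rewrite opprK addrC.
Qed.

Lemma summable_powR d : 0 < d -> summable_seq (fun k => N1 k `^ (- (1 + d))).
Proof.
(* The tail is at most d^-1 (m + 1)^(-d), which is below e once m + 1 >= (d e)^(-1/d); the
   additional unit pays for the shift of the summation index. *)
move=> d0 e e0; pose M := (Num.truncn ((d * e) `^ (- d^-1))).+2; exists M => -[|m] n // Mm.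
rewrite (_ : \sum_(_ <= k < n) _ = \sum_(m <= k < n.-1) N1 k.+1 `^ (- (1 + d))).
  rewrite (le_trans (powR_sum_le m n.-1 d0))// ler_pdivrMl//.
  have de : 0 < d * e by rewrite mulr_gt0.
  have h : (d * e) `^ (- d^-1) <= N1 m.
    rewrite ltW// (lt_le_trans (truncnS_gt _))// ler_nat ltnS.
    by move: Mm; rewrite /M ltnS => /ltnW.
  have -> : d * e = ((d * e) `^ (- d^-1)) `^ (- d).
    by rewrite -powRrM mulrNN mulVf ?gt_eqF// powRr1// ltW.
  rewrite ![_ `^ (- d)]powRN lef_pV2 ?posrE ?powR_gt0//.
  by rewrite ge0_ler_powR ?nnegrE ?powR_ge0 ?(ltW d0).
by case: n => [|n]; rewrite ?big_add1//= !big_geq.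
Qed.

Lemma powR_series_bounded d n : 0 < d ->
  \sum_(k < n) N1 k `^ (- (1 + d)) <= 1 + d^-1.
Proof.
move=> d0; case: n => [|n]; first by rewrite big_ord0 addr_ge0// invr_ge0 ltW.
rewrite big_ord_recl /= powR1 lerD2l.
rewrite (eq_bigr (fun k : 'I_n => N1 k.+1 `^ (- (1 + d)))); last by move=> k _.
rewrite -(big_mkord xpredT (fun k => N1 k.+1 `^ (- (1 + d)))).
by rewrite (le_trans (powR_sum_le 0 n d0))// powR1 mulr1.
Qed.

Definition harmonic_sum n : R := \sum_(k < n) (N1 k)^-1.

Lemma harmonic_sum_ge0 n : 0 <= harmonic_sum n.
Proof. by apply: sumr_ge0 => k _; rewrite invr_ge0. Qed.

(** Growth slower than every positive power is all that is needed, and it follows from 1/k =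
    k^(-1-d) k^d without comparison to a logarithm. *)
Lemma harmonic_sum_le d n : 0 < d -> harmonic_sum n.+1 <= (1 + d^-1) * N1 n `^ d.
Proof.
move=> d0; rewrite (le_trans _ (ler_wpM2r (powR_ge0 _ _) (powR_series_bounded n.+1 d0)))//.
rewrite mulr_suml ler_sum// => k _.
rewrite (_ : (N1 k)^-1 = N1 k `^ (- (1 + d)) * N1 k `^ d).
  by rewrite ler_wpM2l ?powR_ge0// ge0_ler_powR ?nnegrE ?(ltW d0)// ler_nat ltn_ord.
rewrite -powRD; last by apply/implyP => _; rewrite gt_eqF.
by rewrite opprD subrK powR_inv1.
Qed.

End p_series.

Section arctangent_sums.
Context {R : realType}.
Implicit Types (n m N : nat) (s t x : R).
Local Notation N1 n := (n.+1%:R : R).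

Lemma MVT_closed (f df : R -> R) (a b : R) : a <= b ->
  (forall x, a <= x <= b -> is_derive x 1 f (df x)) ->
  exists2 c, a <= c <= b & f b - f a = df c * (b - a).
Proof.
move=> ab hf.
have cf : {within `[a, b], continuous f}.
  apply: derivable_within_continuous => x; rewrite in_itv /= => xab.
  exact: @ex_derive _ _ _ _ _ _ _ (hf x xab).
have [x xab|c] := @MVT_segment R f df a b ab _ cf.
  by apply: hf; move: xab; rewrite in_itv /= => /andP[/ltW -> /ltW ->].
by rewrite in_itv /= => cab e; exists c.
Qed.

(** The mean of (t + il)^-1 and (t - il)^-1 for l = n + 1, as shown in [resf_resl]; indices start at
    0, so l starts at 1. *)
Definition resf n t : R := t / (t ^+ 2 + (N1 n) ^+ 2).

Lemma resf_den n t : 0 < t ^+ 2 + (N1 n) ^+ 2.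
Proof. by rewrite ltr_wpDl ?sqr_ge0// exprn_gt0. Qed.

Lemma resfN n t : resf n (- t) = - resf n t.
Proof. by rewrite /resf sqrrN mulNr. Qed.

(** As a function of x, atan(x / t) is a primitive of t / (t^2 + x^2), which decreases for x >= 0;
    the mean value lies between the values at the ends. *)
Lemma atan_step t x : 0 < t -> 0 <= x ->
  t / (t ^+ 2 + (x + 1) ^+ 2) <= atan ((x + 1) / t) - atan (x / t) <= t / (t ^+ 2 + x ^+ 2).
Proof.
move=> t0 x0; have tn : t != 0 by rewrite gt_eqF.
have d0 y : 0 < t ^+ 2 + y ^+ 2 by rewrite ltr_wpDr ?sqr_ge0 ?exprn_gt0.
have xt : x / t <= (x + 1) / t by rewrite ler_pM2r ?invr_gt0// lerDl.
have e' y : t / (t ^+ 2 + y ^+ 2) = (1 + (y / t) ^+ 2)^-1 * t^-1.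
  have -> : 1 + (y / t) ^+ 2 = (t ^+ 2 + y ^+ 2) / t ^+ 2.
    by rewrite expr_div_n mulrDl divff ?expf_neq0.
  by rewrite invf_div expr2; field; rewrite tn gt_eqF ?d0.
have dxt : (x + 1) / t - x / t = t^-1 by rewrite -mulrBl addrAC subrr add0r mul1r.
have [y /andP[y1 y2] ->] := @MVT_closed _ _ _ _ xt (fun y _ => is_derive1_atan y).
have y0 : 0 <= y by rewrite (le_trans _ y1)// divr_ge0// ltW.
have p (z : R) : 0 < 1 + z ^+ 2 by rewrite ltr_wpDr ?sqr_ge0.
rewrite dxt !e' !ler_pM2r ?invr_gt0// !lef_pV2 ?posrE ?p// !lerD2l; apply/andP; split.
  by rewrite ler_pXn2r ?nnegrE// (le_trans y0).
by rewrite ler_pXn2r ?nnegrE// divr_ge0// ltW.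
Qed.

Lemma resf_sum_bounds m n t : 0 < t -> (m <= n)%N ->
  atan (N1 n / t) - atan (N1 m / t) <= \sum_(m <= k < n) resf k t <=
  atan (n%:R / t) - atan (m%:R / t).
Proof.
move=> t0 mn; elim: n mn => [|n IH].
  by rewrite leqn0 => /eqP ->; rewrite big_geq// !subrr lexx.
rewrite leq_eqVlt => /orP[/eqP <-|]; first by rewrite big_geq// !subrr lexx.
rewrite ltnS => mn; have /andP[h1 h2] := IH mn.
have /andP[h3 _] := atan_step t0 (ler0n R n).
have /andP[_ h4] := atan_step t0 (ler0n R n.+1).
rewrite big_nat_recr//=; rewrite !natr1 in h3 h4.
have e k : resf k t = t / (t ^+ 2 + k.+1%:R ^+ 2) by [].
rewrite -e in h3; rewrite -e in h4.
by apply/andP; split; lra.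
Qed.

(** The function atan x + 1/x decreases, since 1 / (1 + x^2) < 1 / x^2, and it tends to pi / 2 at
    infinity. *)
Lemma atan_ge x : 0 < x -> pi / 2 - x^-1 <= atan x.
Proof.
move=> x0; rewrite lerBlDr; apply: (cvgr_to_le (@cvgy_atan R)).
exists x; split=> [|y /ltW xy]; first exact: num_real.
have pos z : x <= z <= y -> 0 < z by move=> /andP[xz _]; exact: lt_le_trans xz.
have [z /pos z0|z xzy e] := @MVT_closed (@atan R \+ (fun z => z^-1))
    (fun z => (1 + z ^+ 2)^-1 + - z ^- 2 *: 1) x y xy.
  apply: is_deriveD; apply: (@is_deriveV R id); first by rewrite gt_eqF.
have z0 := pos _ xzy; have y0 : 0 < y by rewrite (lt_le_trans x0).
have yi : 0 <= y^-1 by rewrite invr_ge0 ltW.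
suff : atan y + y^-1 - (atan x + x^-1) <= 0 by lra.
rewrite e mulr_le0_ge0 ?subr_ge0// scaler1 subr_le0 lef_pV2 ?posrE ?exprn_gt0//.
  by rewrite lerDr.
by rewrite ltr_wpDr ?sqr_ge0.
Qed.

(** The sum on the left stands in for the series with harmonic weights. Its derivative is close to
    pi / (2t), the derivative of (pi / 2) ln t, and this is how the logarithm enters. *)
Lemma harmonic_atan_derive N t : 0 < t -> is_derive t 1
  (fun t => \sum_(k < N) (N1 k)^-1 * (pi / 2 - atan (N1 k / t)))
  (t^-1 * \sum_(k < N) resf k t).
Proof.
move=> t0; elim: N => [|N IH].
  rewrite big_ord0 mulr0 (_ : (fun _ => _) = cst 0); first exact: is_derive_cst.
  by apply/funext => s; rewrite big_ord0.
rewrite (_ : (fun _ => _) = (fun t => \sum_(k < N) (N1 k)^-1 * (pi / 2 - atan (N1 k / t)))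
   \+ ((N1 N)^-1 \*: (cst (pi / 2) \- (@atan R \o ((N1 N) \*: (fun t => t^-1)))))); last first.
  by apply/funext => s; rewrite big_ord_recr.
have h : is_derive t 1 (fun t : R => t^-1) (- t ^- 2 *: 1).
  by apply: (@is_deriveV R id); rewrite gt_eqF.
rewrite big_ord_recr mulrDr; apply: is_deriveD.
apply: is_derive_eq.
rewrite /resf !scaler1 sub0r /GRing.scale /=.
have tn : t != 0 by rewrite gt_eqF.
have -> : 1 + (N1 N / t) ^+ 2 = (t ^+ 2 + N1 N ^+ 2) / t ^+ 2.
  by rewrite expr_div_n mulrDl divff ?expf_neq0.
have := resf_den N t; have : 0 < N1 N by [].
move: (N1 N) => a a0 d0; rewrite invf_div; field.
by rewrite tn gt_eqF ?gt_eqF.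
Qed.

End arctangent_sums.

Section resolvent_series.
Context {R : realType}.
Implicit Types (n m N k : nat) (s t x d e : R) (w : nat -> R) (g W : R -> R).
Local Notation N1 n := (n.+1%:R : R).

(* Slow enough growth for a series with terms [O (w_n n^(-1-d))] to converge. *)
Definition tame w := forall d, 0 < d -> exists C : R, forall n, `|w n| <= C * N1 n `^ d.

Definition resf_sum w n t := \sum_(k < n) w k * resf k t.

Definition resf_limit w W := forall K e, 0 < e -> exists N, forall n t, (N <= n)%N ->
  `|t| <= K -> `|resf_sum w n t - W t| <= e.

Lemma N1_powRM a b n : N1 n `^ a * N1 n `^ b = N1 n `^ (a + b).
Proof. by rewrite powRD//; apply/implyP => _; rewrite gt_eqF. Qed.

Lemma summable_tame w d : 0 < d -> tame w ->
  summable_seq (fun n => `|w n| * N1 n `^ (- (1 + d))).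
Proof.
move=> d0 tw; have d2 : 0 < d / 2 by rewrite divr_gt0.
have [C hC] := tw _ d2; apply: (summable_le (K := C) _ _ (summable_powR d2)) => n; last exact: powR_ge0.
rewrite (le_trans (ler_wpM2r (powR_ge0 _ _) (hC n)))// -mulrA N1_powRM.
by rewrite (_ : d / 2 + - (1 + d) = - (1 + d / 2))//; field.
Qed.

Lemma tame_cst c : tame (fun=> c).
Proof.
move=> d d0; exists `|c| => n; rewrite ler_peMr//.
by rewrite (le_trans _ (ler_powR _ (ltW d0))) ?powRr0// ler1n.
Qed.

Lemma tame_harmonic : tame (fun n => harmonic_sum n.+1).
Proof.
move=> d d0; exists (1 + d^-1) => n; rewrite ger0_norm ?harmonic_sum_ge0//.
exact: harmonic_sum_le.
Qed.

Lemma tameD w w' a b : tame w -> tame w' -> tame (fun n => a * w n + b * w' n).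
Proof.
move=> tw tw' d d0; have [C hC] := tw d d0; have [C' hC'] := tw' d d0.
exists (`|a| * C + `|b| * C') => n; rewrite (le_trans (ler_normD _ _))// !normrM mulrDl.
by rewrite -!mulrA lerD// ler_wpM2l.
Qed.

(** Since |resf n t| <= |t| / (n + 1)^2, tameness gives summability, locally uniformly in t. *)
Lemma tame_limit w : tame w -> exists W, resf_limit w W.
Proof.
move=> tw; have [n t|W hW] := @locally_uniform_series R (fun n t => w n * resf n t)
    (fun n => `|w n| * N1 n `^ (- (1 + 1))) _ (summable_tame ltr01 tw).
  rewrite normrM mulrCA ler_wpM2l// /resf normrM ler_wpM2l//.
  rewrite normfV gtr0_norm ?resf_den// powRN -[1 + 1]/(2%:R) powR_mulrn//.
  by rewrite lef_pV2 ?posrE ?resf_den ?exprn_gt0// lerDr sqr_ge0.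
by exists W.
Qed.

Lemma resf_limitD w w' W W' a b : resf_limit w W -> resf_limit w' W' ->
  resf_limit (fun n => a * w n + b * w' n) (fun t => a * W t + b * W' t).
Proof.
move=> hW hW' K e e0; have s0 : 0 < `|a| + `|b| + 1 by rewrite ltr_wpDl// addr_ge0.
have [N hN] := hW K _ (divr_gt0 e0 s0); have [N' hN'] := hW' K _ (divr_gt0 e0 s0).
exists (maxn N N') => n t; rewrite geq_max => /andP[Nn N'n] tK.
have -> : resf_sum (fun n => a * w n + b * w' n) n t - (a * W t + b * W' t) =
    a * (resf_sum w n t - W t) + b * (resf_sum w' n t - W' t).
  rewrite {1}/resf_sum (eq_bigr (fun k : 'I_n => a * (w k * resf k t) + b * (w' k * resf k t))).
    by rewrite big_split/= -!mulr_sumr -!/(resf_sum _ _ _); ring.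
  by move=> k _; ring.
rewrite (le_trans (ler_normD _ _))// !normrM.
rewrite (le_trans (lerD (ler_wpM2l (normr_ge0 a) (hN n t Nn tK))
  (ler_wpM2l (normr_ge0 b) (hN' n t N'n tK))))// -mulrDl mulrCA ler_piMr ?(ltW e0)//.
by rewrite ler_pdivrMr// mul1r lerDl.
Qed.

Lemma continuous_resf n : continuous (resf n : R -> R).
Proof.
move=> t; apply: cvgM; first exact: cvg_id.
apply: cvgV; first by rewrite gt_eqF// resf_den.
by apply: cvgD; [exact: exprn_continuous|exact: cvg_cst].
Qed.

Lemma continuous_resf_sum w n : continuous (resf_sum w n).
Proof.
elim: n => [|n IH] t.
  rewrite (_ : resf_sum w 0 = cst 0); first exact: cvg_cst.
  by apply/funext => s; rewrite /resf_sum big_ord0.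
rewrite (_ : resf_sum w n.+1 = (fun s => resf_sum w n s + w n * resf n s)).
  apply: cvgD; first exact: IH.
  by apply: cvgM; [exact: cvg_cst|exact: continuous_resf].
by apply/funext => s; rewrite /resf_sum big_ord_recr.
Qed.

Lemma resf_limit_cont w W : resf_limit w W -> cont (fun t => (W t)%:C : R[i]).
Proof.
move=> hW; apply: (@cont_series _ (fun n t => (resf_sum w n t)%:C)) => [n|K e e0].
  by apply: contR; exact: continuous_resf_sum.
have [N hN] := hW K e e0; exists N => t tK.
by rewrite -rmorphB nrm_real hN.
Qed.

Lemma resf_limitN w W t : resf_limit w W -> W (- t) = - W t.
Proof.
move=> hW; apply/eqP; rewrite -subr_eq0 opprK -normr_le0; apply/ler_addgt0Pr => e e0.
have [N hN] := hW `|t| _ (divr_gt0 e0 (ltr0n R 2)).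
have h1 := hN N t (leqnn N) (lexx _).
have h2 := hN N (- t) (leqnn N); rewrite normrN in h2; have {}h2 := h2 (lexx _).
have e1 : resf_sum w N (- t) = - resf_sum w N t.
  by rewrite /resf_sum -sumrN; apply: eq_bigr => k _; rewrite resfN mulrN.
rewrite e1 in h2; rewrite add0r (splitr e).
have -> : W (- t) + W t = - ((- resf_sum w N t - W (- t)) + (resf_sum w N t - W t)) by ring.
by rewrite normrN (le_trans (ler_normD _ _))// lerD.
Qed.

(** Both functions are odd, so decay at +oo is enough. The rate t^(-1/2) is the one that the
    estimate [resf_le] produces for the logarithm. *)
Lemma resf_limit_C0 w W g : resf_limit w W -> continuous g ->
  (forall t, g (- t) = - g t) ->
  (exists K : R, forall t, 1 <= t -> `|g t - W t| <= K / Num.sqrt t) ->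
  C0 (fun t => (g t - W t)%:C : R[i]).
Proof.
move=> hW cg go [K hK]; apply/C0P; split.
  have := contB (contR cg) (resf_limit_cont hW).
  by congr cont; apply/funext => t; rewrite rmorphB.
move=> e e0; pose M := Num.max 1 ((K / e) ^+ 2); exists M.
have h t : M <= t -> nrm ((g t - W t)%:C : R[i]) <= e.
  rewrite ge_max => /andP[t1 tK]; rewrite nrm_real (le_trans (hK t t1))//.
  have s0 : 0 < Num.sqrt t by rewrite sqrtr_gt0 (lt_le_trans ltr01).
  rewrite ler_pdivrMr// -ler_pdivrMl// mulrC.
  have [k0|k0] := leP (K / e) 0; first by rewrite (le_trans k0)// ltW.
  by rewrite -[leLHS]ger0_norm ?(ltW k0)// -sqrtr_sqr ler_wsqrtr.
move=> t; case: (lerP 0 t) => t0; first by rewrite ger0_norm//; exact: h.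
rewrite ltr0_norm// => /h; rewrite go (resf_limitN _ hW) nrm_real.
by rewrite nrm_real opprK addrC -normrN opprB.
Qed.

(* Termwise comparison with the integral of [t / (t^2 + x^2)] gives pi / 2. *)
Lemma sign_limit : exists2 chi : R -> R, resf_limit (fun=> 1) chi &
  forall t, 0 < t -> pi / 2 - t^-1 <= chi t <= pi / 2.
Proof.
have [chi hchi] := tame_limit (tame_cst 1); exists chi => // t t0.
have sumE n : resf_sum (fun=> 1) n t = \sum_(0 <= k < n) resf k t.
  by rewrite /resf_sum big_mkord; apply: eq_bigr => k _; rewrite mul1r.
have ti : 0 < t^-1 by rewrite invr_gt0.
apply/andP; split; apply/ler_addgt0Pr => e e0.
  have [N hN] := hchi `|t| _ (divr_gt0 e0 (ltr0n R 2)).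
  pose n := maxn N (Num.truncn (2 * t / e)).
  have := hN n t (leq_maxl _ _) (lexx _); rewrite ler_norml => /andP[_].
  have /andP[h1 _] := resf_sum_bounds t0 (leq0n n).
  have n0 : 0 < N1 n / t by rewrite divr_gt0.
  have h2 := atan_ge n0; rewrite invf_div in h2.
  have h3 : atan (N1 0 / t) <= t^-1.
    have := @MVT_closed R _ _ _ _ (ltW ti) (fun y _ => is_derive1_atan y).
    rewrite atan0 !subr0 mul1r => -[y /andP[y0 _] ->].
    have y1 : 1 <= 1 + y ^+ 2 by rewrite lerDl sqr_ge0.
    by rewrite ler_piMl ?(ltW ti)// invf_le1// (lt_le_trans ltr01).
  have h4 : t / N1 n <= e / 2.
    rewrite ler_pdivrMr// mulrC -ler_pdivrMr ?divr_gt0// invf_div mulrA [t * 2]mulrC.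
    by rewrite ltW// (lt_le_trans (truncnS_gt _))// ler_nat ltnS leq_maxr.
  have gen (P a b v S c u d : R) : a - b <= S -> P - v <= a -> b <= u -> v <= d / 2 ->
    S - c <= d / 2 -> P - u <= c + d by lra.
  by rewrite sumE; exact: gen h1 h2 h3 h4.
have [N hN] := hchi `|t| _ e0.
have := hN N t (leqnn _) (lexx _); rewrite ler_norml => /andP[h _].
have /andP[_ h1] := resf_sum_bounds t0 (leq0n N).
rewrite mul0r atan0 subr0 -sumE in h1.
have := atan_ltpi2 (N%:R / t); lra.
Qed.

Let inv_sqrt t : 1 <= t -> 0 < Num.sqrt t /\ t^-1 <= (Num.sqrt t)^-1.
Proof.
move=> t1; have t0 : 0 < t by rewrite (lt_le_trans ltr01).
have s0 : 0 < Num.sqrt t by rewrite sqrtr_gt0.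
split=> //; rewrite lef_pV2 ?posrE// -{2}[t]sqr_sqrtr ?(ltW t0)// expr2.
by rewrite ler_peMr ?(ltW s0)// -sqrtr1 ler_wsqrtr.
Qed.

Lemma bounded_transform_series : exists w (e : R -> R), [/\ tame w,
  C0 (fun t => (e t)%:C : R[i]) &
  resf_limit w (fun t => t * (1 + t ^+ 2) `^ (- (1 / 2)) - e t)].
Proof.
have [chi hchi hb] := sign_limit; have pi0 : 0 < pi :> R by exact: pi_gt0.
pose g t : R := t * (1 + t ^+ 2) `^ (- (1 / 2)).
have p t : 0 < 1 + t ^+ 2 :> R by rewrite ltr_wpDr ?sqr_ge0.
have gE t : g t = t / Num.sqrt (1 + t ^+ 2).
  by rewrite /g powRN div1r powR12_sqrt// ltW.
have hw : resf_limit (fun=> 2 / pi * 1 + 0 * 1) (fun t => 2 / pi * chi t + 0 * chi t).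
  exact: resf_limitD.
(* The error e is by definition g minus the limit of the series. It decays because g and (2 / pi)
   chi both lie between 1 - 1/t and 1 for t >= 1. The zero summand gives the weights the shape of
   [resf_limitD]. *)
exists (fun=> 2 / pi * 1 + 0 * 1), (fun t => g t - (2 / pi * chi t + 0 * chi t)).
split; first exact: tame_cst.
  apply: (resf_limit_C0 hw) => [t|t|].
  - rewrite (_ : g = (fun t => t / Num.sqrt (1 + t ^+ 2))); last by apply/funext.
    apply: cvgM; first exact: cvg_id.
    apply: cvgV; first by rewrite gt_eqF// sqrtr_gt0.
    have cs : continuous (fun t : R => 1 + t ^+ 2).
      by move=> s; apply: cvgD; [exact: cvg_cst|exact: exprn_continuous].
    exact: (continuous_sqrt cs).
  - by rewrite !gE sqrrN mulNr.
  exists 2 => t t1; have [s0 st] := inv_sqrt t1.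
  have t0 : 0 < t by rewrite (lt_le_trans ltr01).
  have /andP[h1 h2] := hb t t0.
  have q0 : 0 < Num.sqrt (1 + t ^+ 2) by rewrite sqrtr_gt0.
  have g1 : g t <= 1.
    rewrite gE ler_pdivrMr// mul1r -[leLHS]ger0_norm ?(ltW t0)// -sqrtr_sqr.
    by rewrite ler_wsqrtr// lerDr.
  have g2 : 1 - t^-1 <= g t.
    rewrite gE ler_pdivlMr// mulrBl mul1r lerBlDr.
    have q1 : Num.sqrt (1 + t ^+ 2) <= 1 + t.
      rewrite -[leRHS]ger0_norm ?addr_ge0 ?(ltW t0)// -sqrtr_sqr ler_wsqrtr//.
      by rewrite sqrrD expr1n mul1r lerD2r lerDl mulrn_wge0// ltW.
    rewrite (le_trans q1)// addrC lerD2l ler_pdivlMl// mulr1.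
    by rewrite -[leLHS]ger0_norm ?(ltW t0)// -sqrtr_sqr ler_wsqrtr// lerDr.
  have c1 : 2 / pi * chi t <= 1.
    have e : 2 / pi * (pi / 2) = 1 :> R by rewrite mulrA divfK ?gt_eqF// divff.
    by rewrite -[leRHS]e ler_wpM2l// divr_ge0// ltW.
  have c2 : 1 - t^-1 <= 2 / pi * chi t.
    have ti : 0 < t^-1 by rewrite invr_gt0.
    have : 2 / pi * (pi / 2 - t^-1) <= 2 / pi * chi t by rewrite ler_wpM2l ?divr_ge0 ?(ltW pi0).
    have e : 2 / pi * (pi / 2) = 1 :> R by rewrite mulrA divfK ?gt_eqF// divff.
    rewrite mulrBr e.
    have : 2 / pi * t^-1 <= 1 * t^-1 by rewrite ler_pM2r// ler_pdivrMr// mul1r pi_ge2.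
    by lra.
  rewrite ler_norml; have : 2 * t^-1 <= 2 / Num.sqrt t by rewrite ler_pM2l.
  have : 0 < t^-1 by rewrite invr_gt0.
  by lra.
move=> K e e0; have [N hN] := hw K e e0; exists N => n t Nn tK.
by rewrite subKr hN.
Qed.

Definition harm_pihalf N t : R :=
  \sum_(k < N) (N1 k)^-1 * (pi / 2 - atan (N1 k / t)).

Let A N t := harm_pihalf N t - pi / 2 * ln t.

(** The derivative of A at x is 1/x times the sum of the [resf k x] minus pi / 2, hence between
    -1/(N + 1) - 1/x^2 and 0. The mean value theorem for A gives the upper bound; for A - 1/x, where
    the term 1/x^2 is absorbed, it gives the lower one. *)
Let A_bounds N s t : 1 <= s -> s <= t ->
  - (t - s) / N1 N - s^-1 <= A N t - A N s <= 0.
Proof.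
move=> s1 st; have s0 : 0 < s by rewrite (lt_le_trans ltr01).
have t0 : 0 < t by rewrite (lt_le_trans s0).
have pos x : s <= x <= t -> 0 < x by move=> /andP[sx _]; exact: lt_le_trans sx.
pose dA x := x^-1 * \sum_(k < N) resf k x - pi / 2 * x^-1.
have hA x : 0 < x -> is_derive x 1 (A N) (dA x).
  move=> x0; have h1 := harmonic_atan_derive N x0; have h2 := is_derive1_ln x0.
  have h := @is_deriveB _ _ _ (harm_pihalf N) ((pi / 2) \*: (@ln R)) x 1 _ _ h1 _.
  by apply: h.
have bd x : 0 < x -> - (N1 N)^-1 - x ^- 2 <= dA x <= 0.
  move=> x0; have /andP[h1 h2] := resf_sum_bounds x0 (leq0n N).
  rewrite mul0r atan0 subr0 in h2; rewrite !big_mkord in h1 h2.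
  have n0 : 0 < N1 N / x by rewrite divr_gt0.
  have h3 := atan_ge n0; rewrite invf_div in h3.
  have xi : 0 < x^-1 by rewrite invr_gt0.
  have h4 : atan (N1 0 / x) <= x^-1.
    have := @MVT_closed R _ _ _ _ (ltW xi) (fun y _ => is_derive1_atan y).
    rewrite atan0 !subr0 mul1r => -[y /andP[y0 _] ->].
    have y1 : 1 <= 1 + y ^+ 2 by rewrite lerDl sqr_ge0.
    by rewrite ler_piMl ?(ltW xi)// invf_le1// (lt_le_trans ltr01).
  rewrite /dA; move: h1 h2; set S := \sum_(k < N) _ => h1 h2; apply/andP; split.
    have gen (P a b v u : R) : a - b <= S -> P - v <= a -> b <= u -> P - v - u <= S by lra.
    have h5 : x^-1 * (pi / 2 - x / N1 N - x^-1) <= x^-1 * S.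
      by rewrite ler_pM2l//; exact: gen h1 h3 h4.
    have gen2 (a b c d : R) : b - c - d <= a -> - c - d <= a - b by lra.
    apply: gen2; rewrite (le_trans _ h5)// !mulrBr [x^-1 * (x / _)]mulrA mulVf ?gt_eqF//.
    by rewrite mul1r -expr2 exprVn mulrC.
  by rewrite mulrC -mulrBl pmulr_lle0//; have := atan_ltpi2 (N%:R / x); lra.
have [x /pos/hA //|x /pos x0 e] := @MVT_closed R (A N) dA s t st.
have [y|y ys e'] := @MVT_closed R (A N \- (fun x => x^-1)) (fun x => dA x - (- x ^- 2 *: 1)) s t st.
  move=> /pos y0; apply: is_deriveB; first exact: hA.
  by apply: (@is_deriveV R id); rewrite gt_eqF.
have y0 := pos _ ys; apply/andP; split; last first.
  by rewrite e mulr_le0_ge0 ?subr_ge0//; have /andP[] := bd x x0.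
have ti : 0 < t^-1 by rewrite invr_gt0.
have : - (N1 N)^-1 * (t - s) <= A N t - t^-1 - (A N s - s^-1).
  rewrite e' ler_wpM2r ?subr_ge0// scaler1 opprK.
  by have /andP[h _] := bd y y0; rewrite -lerBlDr.
have gen (a b u v w : R) : 0 < w -> u <= a - w - (b - v) -> u - v <= a - b by lra.
by move/(gen _ _ _ _ _ ti); rewrite !mulNr [(t - s) * _]mulrC.
Qed.

(** Trades decay in t for summability in k. With t = a^2 and k + 1 = b^2 the inequality reads a^3 b
    <= a^4 + b^4. *)
Let resf_le k t : 0 < t -> (N1 k)^-1 * resf k t <= (Num.sqrt t)^-1 * N1 k `^ (- (1 + 2^-1)).
Proof.
move=> t0; pose b := Num.sqrt (N1 k); pose a := Num.sqrt t.
have a0 : 0 < a by rewrite sqrtr_gt0. have b0 : 0 < b by rewrite sqrtr_gt0.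
have te : t = a ^+ 2 by rewrite sqr_sqrtr// ltW.
have ne : N1 k = b ^+ 2 by rewrite sqr_sqrtr.
have -> : N1 k `^ (- (1 + 2^-1)) = (N1 k)^-1 * b^-1.
  by rewrite opprD -N1_powRM powR_inv1// powRN powR12_sqrt.
rewrite [leRHS]mulrCA ler_pM2l ?invr_gt0// /resf -/a te ne -invfM.
rewrite ler_pdivrMr; last by rewrite ltr_wpDr ?exprn_gt0// sqr_ge0.
rewrite mulrC ler_pdivlMr ?mulr_gt0//.
have [ab|/ltW ba] := leP a b.
  have h : a ^+ 2 <= b ^+ 2 by rewrite !expr2 ler_pM ?(ltW a0).
  have h' : a * b <= b ^+ 2 by rewrite expr2 ler_wpM2r// ltW.
  rewrite (le_trans (ler_pM _ _ h h')) ?sqr_ge0 ?mulr_ge0 ?(ltW a0) ?(ltW b0)//.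
  by rewrite -[X in X <= _]expr2 lerDr sqr_ge0.
have h : a * b <= a ^+ 2 by rewrite expr2 ler_wpM2l// ltW.
rewrite (le_trans (ler_wpM2l _ h)) ?sqr_ge0//.
by rewrite -[X in X <= _]expr2 lerDl sqr_ge0.
Qed.

(** Summation by parts: the inner tail sums are close to pi / 2 - atan((k + 1) / t), which leads to
    [harm_pihalf]. *)
Let harmonic_resf_sum n t : resf_sum (fun n => harmonic_sum n.+1) n t =
  \sum_(k < n) (N1 k)^-1 * \sum_(k <= j < n) resf j t.
Proof.
rewrite /resf_sum; elim: n => [|n IH]; first by rewrite !big_ord0.
rewrite big_ord_recr/= IH [RHS]big_ord_recr/= big_nat1 /harmonic_sum big_ord_recr/=.
rewrite mulrDl addrA mulr_suml -big_split/=; congr (_ + _).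
apply: eq_bigr => k _; rewrite big_nat_recr/= ?mulrDr//.
exact: ltnW (ltn_ord k).
Qed.

(** The inner sums are compared with arctangents by [resf_sum_bounds]. From above, splitting off the
    term j = k leaves a sum that the arctangents dominate, and the split terms add up by [resf_le]
    and the series of exponent 3/2; its bound 1 + 2 is the constant 3. *)
Let W_bounds N t : 0 < t ->
  - (harmonic_sum N * (t / N1 N)) <=
  resf_sum (fun n => harmonic_sum n.+1) N t - harm_pihalf N t <= 3 / Num.sqrt t.
Proof.
move=> t0; rewrite harmonic_resf_sum /harm_pihalf -sumrB; apply/andP; split.
  rewrite /harmonic_sum mulr_suml -sumrN ler_sum// => k _.
  rewrite -mulrBr -mulrN ler_pM2l ?invr_gt0//.
  have /andP[h _] := resf_sum_bounds t0 (ltnW (ltn_ord k)).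
  have n0 : 0 < N1 N / t by rewrite divr_gt0.
  have gen (P a b v S : R) : a - b <= S -> P - v <= a -> - v <= S - (P - b) by lra.
  by apply: (gen _ _ _ _ _ h); have := atan_ge n0; rewrite invf_div.
have h d : 0 < d -> \sum_(k < N) N1 k `^ (- (1 + d)) <= 1 + d^-1 :> R by exact: powR_series_bounded.
rewrite (@le_trans _ _ (\sum_(k < N) (Num.sqrt t)^-1 * N1 k `^ (- (1 + 2^-1))))//.
  rewrite ler_sum// => k _; rewrite (le_trans _ (resf_le k t0))// -mulrBr ler_pM2l ?invr_gt0//.
  rewrite (big_ltn (ltn_ord k)).
  have /andP[_ h'] := resf_sum_bounds t0 (ltn_ord k).
  by have := atan_ltpi2 (N%:R / t); lra.
rewrite -mulr_sumr mulrC ler_pM2r ?invr_gt0 ?sqrtr_gt0//.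
by rewrite (le_trans (h _ _))// ?invr_gt0// invrK; lra.
Qed.

Let harmonic_ratio e : 0 < e -> exists N, forall n, (N <= n)%N -> harmonic_sum n / N1 n <= e.
Proof.
move=> e0; pose N := Num.truncn ((3 / e) ^+ 2); exists N => n Nn.
have e3 : 0 < 3 / e by rewrite divr_gt0.
have q0 : 0 < Num.sqrt (N1 n) by rewrite sqrtr_gt0.
have h : 3 / e <= Num.sqrt (N1 n).
  rewrite -[leLHS]ger0_norm ?(ltW e3)// -sqrtr_sqr ler_wsqrtr//.
  by rewrite ltW// (lt_le_trans (truncnS_gt _))// ler_nat ltnS.
have h1 : harmonic_sum n <= 3 * Num.sqrt (N1 n).
  rewrite (@le_trans _ _ (harmonic_sum n.+1))//.
    by rewrite /harmonic_sum big_ord_recr/= lerDl invr_ge0.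
  have d0 : 0 < 2^-1 :> R by rewrite invr_gt0.
  rewrite (le_trans (harmonic_sum_le n d0))// powR12_sqrt// invrK.
  by rewrite ler_pM2r//; lra.
have qq : Num.sqrt (N1 n) * Num.sqrt (N1 n) = N1 n by rewrite -expr2 sqr_sqrtr.
rewrite ler_pdivrMr// (le_trans h1)// -[in leRHS]qq mulrA ler_pM2r//.
by rewrite -ler_pdivrMl// mulrC.
Qed.

Lemma log_limit : exists2 W : R -> R, resf_limit (fun n => harmonic_sum n.+1) W &
  exists L : R, forall t, 1 <= t -> `|W t - pi / 2 * ln t - L| <= 7 / Num.sqrt t.
Proof.
have [W hW] := tame_limit tame_harmonic; exists W => //.
pose V t := W t - pi / 2 * ln t.
(* 7 = 3 + 3 + 1: [W_bounds] contributes 3 at s and at t, and [A_bounds] contributes 1/s. The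
   remaining errors tend to 0 with n and are collected in e. *)
have cau s t : 1 <= s -> s <= t -> `|V t - V s| <= 7 / Num.sqrt s.
  move=> s1 st; have [s0' si] := inv_sqrt s1.
  have s0 : 0 < s by rewrite (lt_le_trans ltr01).
  have t0 : 0 < t by rewrite (lt_le_trans s0).
  have ts : 3 / Num.sqrt t <= 3 / Num.sqrt s.
    by rewrite ler_pM2l// lef_pV2 ?posrE ?sqrtr_gt0// ler_wsqrtr.
  apply/ler_addgt0Pr => e e0; have e6 : 0 < e / 6 by rewrite divr_gt0.
  have [N0 hN0] := hW t _ e6.
  have [N2 hN2] := harmonic_ratio (divr_gt0 e6 t0).
  pose n := maxn (maxn N0 N2) (Num.truncn (t / (e / 6))).
  have n0 : (N0 <= n)%N by rewrite !leq_max leqnn.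
  have n2 : (N2 <= n)%N by rewrite !leq_max leqnn orbT.
  have q0 : 0 < N1 n by [].
  have tq : t / N1 n <= e / 6.
    by rewrite ler_pdivrMr// mulrC -ler_pdivrMr// ltW// (lt_le_trans (truncnS_gt _))// ler_nat ltnS leq_maxr.
  have hq := hN2 n n2; rewrite ler_pdivlMr// in hq.
  have t1 : `|t| <= t by rewrite ger0_norm// ltW.
  have s1' : `|s| <= t by rewrite ger0_norm// ltW.
  have /ler_normlP[w1 w2] := hN0 n t n0 t1; have /ler_normlP[w3 w4] := hN0 n s n0 s1'.
  have /andP[b1 b2] := W_bounds n t0; have /andP[b3 b4] := W_bounds n s0.
  have /andP[a1 a2] := A_bounds n s1 st; rewrite /A in a1 a2.
  have hs : harmonic_sum n * (s / N1 n) <= harmonic_sum n * (t / N1 n).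
    by rewrite ler_wpM2l ?harmonic_sum_ge0// ler_pM2r ?invr_gt0.
  have hst : (t - s) / N1 n <= t / N1 n by rewrite ler_pM2r ?invr_gt0// lerBlDr lerDl ltW.
  have hh : harmonic_sum n * (t / N1 n) <= e / 6 by rewrite mulrCA mulrC.
  rewrite mulNr in a1.
  have si0 : 0 < (Num.sqrt s)^-1 by rewrite invr_gt0.
  rewrite /V; move: w1 w2 w3 w4 b1 b2 b3 b4 a1 a2 hs hst hh si ts si0 tq.
  rewrite ![_ / Num.sqrt _]mulrC.
  move: (Num.sqrt s)^-1 (Num.sqrt t)^-1 s^-1 (harmonic_sum n * (t / N1 n)) (harmonic_sum n * (s / N1 n)).
  move: (t / N1 n) ((t - s) / N1 n) (pi / 2 * ln t) (pi / 2 * ln s) => *.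
  by apply/ler_normlP; split; lra.
(* The limit is taken along the integers only; the uniform estimate [cau] extends it to all t. *)
have [L hL] : exists L : R, (fun n => V (N1 n)) @ \oo --> L.
  apply/cvg_ex/cauchy_cvgP/cauchyP => e e0.
  pose M := Num.truncn ((14 / e) ^+ 2); exists (V (N1 M)); exists M => // n /= Mn.
  rewrite -ball_normE /= distrC (le_lt_trans (cau (N1 M) _ _ _)) ?ler1n ?ler_nat//.
  have q0 : 0 < Num.sqrt (N1 M) by rewrite sqrtr_gt0.
  have e14 : 0 < 14 / e by rewrite divr_gt0.
  have h : 14 / e <= Num.sqrt (N1 M).
    rewrite -[leLHS]ger0_norm ?(ltW e14)// -sqrtr_sqr ler_wsqrtr//.
    by rewrite ltW// truncnS_gt.
  rewrite ltr_pdivrMr// -ltr_pdivrMl// mulrC (lt_le_trans _ h)// ltr_pM2r ?invr_gt0//.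
  by rewrite ltr_nat.
exists L => t t1.
have h : (fun n => `|V (N1 n) - V t|) @ \oo --> `|L - V t|.
  by apply: cvg_norm; apply: cvgB; [exact: hL|exact: cvg_cst].
rewrite -/(V t) distrC; apply: (cvgr_to_le h); exists (Num.truncn t) => // n /= tn.
by apply: cau => //; rewrite ltW// (lt_le_trans (truncnS_gt _))// ler_nat ltnS.
Qed.

Lemma sgnlogE t : sgnlog t = ln (1 + Num.max t 0) - ln (1 + Num.max (- t) 0).
Proof.
rewrite /sgnlog; case: (ltrgtP t 0) => t0.
- by rewrite ltr0_sg// ltr0_norm// mulN1r max_l ?addr0 ?ln1 ?sub0r// oppr_ge0 ltW.
- by rewrite gtr0_sg// gtr0_norm// mul1r max_r ?addr0 ?ln1 ?subr0// oppr_le0 ltW.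
- by rewrite t0 sgr0 mul0r oppr0 maxxx addr0 subrr.
Qed.

Lemma continuous_sgnlog : continuous (@sgnlog R).
Proof.
have c0 : continuous (fun _ : R => 0 : R) by move=> t; exact: cvg_cst.
have cl (f : R -> R) : continuous f -> continuous (fun t => ln (1 + Num.max (f t) 0)).
  move=> cf t; have cm := continuous_max cf c0.
  apply: (@continuous_comp _ _ _ (fun t => 1 + Num.max (f t) 0) (@ln R)).
    by apply: cvgD; [exact: cvg_cst|exact: cm].
  by apply: continuous_ln; rewrite ltr_wpDr// le_max lexx orbT.
have h1 : continuous (fun t : R => ln (1 + Num.max t 0)) by apply: cl => t; exact: cvg_id.
have h2 : continuous (fun t : R => ln (1 + Num.max (- t) 0)).
  by apply: cl => t; apply: cvgN; exact: cvg_id.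
rewrite (_ : @sgnlog R = (fun t => ln (1 + Num.max t 0) - ln (1 + Num.max (- t) 0))).
  by move=> t; apply: cvgB; [exact: h1|exact: h2].
by apply/funext => t; rewrite sgnlogE.
Qed.

Lemma sgnlogN t : sgnlog (- t) = - sgnlog t.
Proof. by rewrite /sgnlog normrN sgrN mulNr. Qed.

Lemma sgnlog_series : exists w (e : R -> R), [/\ tame w,
  C0 (fun t => (e t)%:C : R[i]) & resf_limit w (fun t => sgnlog t - e t)].
Proof.
have [chi hchi hb] := sign_limit; have [W hW [L hL]] := log_limit.
have pi0 : 0 < pi :> R by exact: pi_gt0.
(* Cancels the constant at infinity: (2 / pi) W(t) - ln t tends to (2 / pi) L, and chi(t) tends to
   pi / 2, so b chi(t) tends to - (2 / pi) L. *)
pose b := - (2 / pi) * (2 / pi) * L.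
have hw := resf_limitD (2 / pi) b hW hchi.
exists (fun n => 2 / pi * harmonic_sum n.+1 + b * 1), (fun t => sgnlog t - (2 / pi * W t + b * chi t)).
split; first exact: tameD tame_harmonic (tame_cst 1).
  apply: (resf_limit_C0 hw continuous_sgnlog sgnlogN).
  exists (1 + 7 + `|b|) => t t1; have [s0 st] := inv_sqrt t1.
  have t0 : 0 < t by rewrite (lt_le_trans ltr01).
  have -> : sgnlog t - (2 / pi * W t + b * chi t) =
     (sgnlog t - ln t) - 2 / pi * (W t - pi / 2 * ln t - L) + b * (pi / 2 - chi t).
    have e : 2 / pi * (pi / 2) = 1 :> R by rewrite mulrA divfK ?gt_eqF// divff.
    rewrite /b; move: (2 / pi) (pi / 2) e => q P e.
    transitivity (sgnlog t - (q * W t + - q * q * L * chi t) + (q * P - 1) * (ln t - q * L)).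
      by rewrite e subrr mul0r addr0.
    by ring.
  have n1 : `|sgnlog t - ln t| <= (Num.sqrt t)^-1.
    rewrite /sgnlog gtr0_sg// mul1r [`|t|]gtr0_norm// -ln_div ?posrE ?addr_gt0//.
    have -> : (1 + t) / t = 1 + t^-1 by rewrite mulrDl mul1r divff ?gt_eqF// addrC.
    have ti : 0 < t^-1 by rewrite invr_gt0.
    by rewrite ger0_norm ?ln_ge0 ?lerDl ?(ltW ti)// (le_trans (le_ln1Dx _))// (lt_trans _ ti).
  have n2 : `|2 / pi * (W t - pi / 2 * ln t - L)| <= 7 / Num.sqrt t.
    rewrite normrM ger0_norm ?divr_ge0 ?(ltW pi0)// -[leRHS]mul1r ler_pM ?divr_ge0 ?(ltW pi0)//.
      by rewrite ler_pdivrMr// mul1r pi_ge2.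
    exact: hL.
  have n3 : `|b * (pi / 2 - chi t)| <= `|b| / Num.sqrt t.
    rewrite normrM ler_wpM2l// (le_trans _ st)//; have /andP[h1 h2] := hb t t0.
    have ti : 0 < t^-1 by rewrite invr_gt0.
    by apply/ler_normlP; split; lra.
  rewrite (le_trans (ler_normD _ _))// [leRHS]mulrDl lerD//.
  rewrite (le_trans (ler_normB _ _))// [leRHS]mulrDl mul1r.
  exact: lerD n1 n2.
move=> K e e0; have [N hN] := hw K e e0; exists N => n t Nn tK.
by rewrite subKr hN.
Qed.

End resolvent_series.

(** * Commutators with functions of D *)

Section brackets.
Context {R : realType}.
Implicit Types (s t : R).

Definition brk s t : R := (1 + t ^+ 2) `^ s.

Lemma brk_base t : 0 < 1 + t ^+ 2.
Proof. by rewrite ltr_wpDr ?sqr_ge0. Qed.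

Lemma brk_gt0 s t : 0 < brk s t.
Proof. by rewrite powR_gt0// brk_base. Qed.

Lemma brkD s s' t : brk s t * brk s' t = brk (s + s') t.
Proof. by rewrite -powRD//; apply/implyP => _; rewrite gt_eqF// brk_base. Qed.

Lemma brk0 t : brk 0 t = 1. Proof. exact: powRr0. Qed.

Lemma brkN t s : brk s (- t) = brk s t. Proof. by rewrite /brk sqrrN. Qed.

Lemma continuous_brk s : continuous (brk s).
Proof.
rewrite (_ : brk s = (fun t => expR (s * ln (1 + t ^+ 2)))); last first.
  by apply/funext => t; rewrite /brk /powR gt_eqF ?brk_base.
move=> t; apply: (@continuous_comp _ _ _ (fun t => s * ln (1 + t ^+ 2)) (@expR R)); last exact: continuous_expR.
apply: cvgM; first exact: cvg_cst.
apply: (@continuous_comp _ _ _ (fun t => 1 + t ^+ 2) (@ln R)); last exact: continuous_ln (brk_base t).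
by apply: cvgD; [exact: cvg_cst|exact: exprn_continuous].
Qed.

Lemma C0_brk s : s < 0 -> C0 (fun t => (brk s t)%:C : R[i]).
Proof.
move=> s0; have [r r0 {s0}->] : exists2 r, 0 < r & s = - r by exists (- s); rewrite ?oppr_gt0 ?opprK.
apply/C0P; split; first by apply: contR; exact: continuous_brk.
move=> e e0; exists (Num.max 1 (e `^ (- r^-1))) => t; rewrite ge_max => /andP[t1 te].
rewrite nrm_real gtr0_norm ?brk_gt0//.
have -> : e = (e `^ (- r^-1)) `^ (- r) by rewrite -powRrM mulrNN mulVf ?gt_eqF// powRr1// ltW.
have h : e `^ (- r^-1) <= 1 + t ^+ 2.
  rewrite (le_trans te)// (@le_trans _ _ (`|t| ^+ 2))//.
    by rewrite expr2 ler_peMr.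
  by rewrite real_normK ?num_real// lerDr.
rewrite /brk ![_ `^ (- r)]powRN lef_pV2 ?posrE ?powR_gt0 ?brk_base//.
by rewrite ge0_ler_powR ?nnegrE ?powR_ge0 ?(ltW r0) ?(ltW (brk_base t)).
Qed.

Lemma sgnlog_proper (M : R) : exists N : R, forall t, N <= `|t| -> M <= `|sgnlog t|.
Proof.
exists (expR M) => t h; have e0 := expR_gt0 M.
have t0 : 0 < `|t| by exact: lt_le_trans h.
have tn : t != 0 by rewrite -normr_gt0.
rewrite /sgnlog normrM normr_sg tn mul1r ger0_norm ?ln_ge0 ?lerDl//.
by rewrite -[leLHS]expRK ler_ln ?posrE ?addr_gt0// (le_trans h)// lerDr.
Qed.

End brackets.

(** * Commutators with resolvents and with their series *)

Section commutator_estimates.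
Context {R : realType} {B : cstarAlgType R} {X : hilbModType B}.
Local Notation C := R[i].
Local Notation N1 n := (n.+1%:R : R).
Variable D : set (X * X).
Hypothesis Dsr : selfadjoint_regular D.
Variable Phi : (R -> C) -> X -> X.
Hypothesis PhiD : C0_calculus D Phi.

Lemma bracket_pow_C0 s : s < 0 ->
  bracket_pow D s = graph (Phi (fun t => (brk s t)%:C)).
Proof. by move=> s0; apply: (func_calc_C0 Dsr PhiD); [exact: continuous_brk|exact: C0_brk]. Qed.

Lemma bracket_pow0 : bracket_pow D 0 = graph id.
Proof.
have c1 : continuous (brk 0 : R -> R) by exact: continuous_brk.
have h x : bracket_pow D 0 (x, x).
  apply/(func_calcP Dsr PhiD _ _ c1) => g Cg; apply: (calc_ext Phi) => t.
  by rewrite brk0 rmorph1 mul1r.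
apply/seteqP; split=> -[x y]; rewrite /graph /=; last by move=> <-.
by move=> hy; exact: (func_calc_fun Dsr PhiD c1 (h x) hy).
Qed.

(* Approximate [h] by [h k] with [k] a cutoff; [h k] is a multiple of [(1 + t^2)^(-1/2)]. *)
Lemma calc_compact (T T' : X -> X) (s : R) h : is_adjoint T T' -> s < 0 ->
  is_compact (Defs.comp (graph T) (bracket_pow D s)) -> C0 h ->
  compact_op (fun x => T (Phi h x)).
Proof.
move=> TT s0 [K cK e] h0.
have KE x : K x = T (Phi (fun t => (brk s t)%:C) x).
  have : Defs.comp (graph T) (bracket_pow D s) (x, T (Phi (fun t => (brk s t)%:C) x)).
    by exists (Phi (fun t => (brk s t)%:C) x); rewrite ?bracket_pow_C0.
  by rewrite e.
have [M M0 hM] := adjointable_bounded TT.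
have M1 : 0 < 2 * (M + 1) by rewrite mulr_gt0// ltr_wpDl.
apply: compact_lim => d d0; have [N hN] := cutoff_approx h0 (divr_gt0 d0 M1).
pose hN' t := (cutoff N t)%:C * h t.
have ch := C0_cont h0.
have CN : Cc hN'.
  have := CcM ch (Cc_cutoff N); rewrite /Cc => -[c1 [L hL]]; split.
    by move: c1; congr cont; apply/funext => t; rewrite mulrC.
  by exists L => t /hL; rewrite mulrC.
pose q t := (brk (- s) t)%:C * hN' t.
have Cq : Cc q by apply: CcM => //; apply: contR; exact: continuous_brk.
exists (fun x => K (Phi q x)).
  exact: compact_compr (calc_adj PhiD (Cc_C0 Cq)) cK.
move=> z; rewrite KE -(calcM PhiD _ (C0_brk s0) (Cc_C0 Cq)) -(adjB _ _ TT).
rewrite (le_trans (hM _))//.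
have -> : Phi h z - Phi (fun t => (brk s t)%:C * q t) z = Phi (fun t => h t - hN' t) z.
  rewrite (calcB PhiD _ h0 (Cc_C0 CN)); congr (_ - _); apply: (calc_ext Phi) => t.
  by rewrite /q mulrA -rmorphM brkD subrr brk0 rmorph1 mul1r.
have b := calc_bound Dsr PhiD z (C0B h0 (Cc_C0 CN)) (M := d / (2 * (M + 1))) _ _.
rewrite (le_trans (ler_wpM2l M0 (b _ _)))//.
- by move=> t; rewrite nrm_sym hN.
- by rewrite divr_ge0 ?ltW.
- rewrite !mulrA ler_wpM2r ?nrm_ge0// -mulrA mulrCA -[leRHS]mulr1 ler_pM2l//.
  by rewrite ler_pdivrMr// mul1r mulrC ler_pM2l// lerDl.
Qed.

Let cid : continuous (@id R). Proof. by move=> t; exact: cvg_id. Qed.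

Definition resl (l t : R) : C := (t%:C + l%:C * 'i%C)^-1.

Let resl_id l t : l != 0 -> t%:C * resl l t = 1 - (l%:C * 'i%C) * resl l t.
Proof.
move=> l0; have := addi_neq0 t l0; rewrite /resl => h.
by apply: (mulIf h); rewrite divfK// mulrBl mul1r divfK// addrK.
Qed.

Lemma calc_resl l z : l != 0 ->
  D (Phi (resl l) z, z - (l%:C * 'i%C) *: Phi (resl l) z).
Proof.
move=> l0; have r0 : C0 (resl l) := C0_resolvent_gen l0.
rewrite -(func_calc_id Dsr PhiD); apply/(func_calcP Dsr PhiD _ _ cid) => g Cg.
have g0 := Cc_C0 Cg; have tg := Cc_C0 (CcM (contR cid) Cg).
rewrite (adjB _ _ (calc_adj PhiD g0)) (adjZ _ _ (calc_adj PhiD g0)).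
rewrite -(calcM PhiD _ tg r0) -(calcM PhiD _ g0 r0).
rewrite -(calcZ PhiD _ _ (C0_mul g0 r0)) -(calcB PhiD _ g0 (C0Z _ (C0_mul g0 r0))).
by apply: (calc_ext Phi) => t; rewrite mulrAC resl_id//; ring.
Qed.

Lemma calc_resl_inv l x y : l != 0 -> D (x, y) ->
  x = Phi (resl l) (y + (l%:C * 'i%C) *: x).
Proof.
move=> l0; have r0 : C0 (resl l) := C0_resolvent_gen l0.
rewrite -{1}(func_calc_id Dsr PhiD) => /(func_calcP Dsr PhiD _ _ cid) h.
apply/eqP; rewrite -subr_eq0; apply/eqP/(calc_eq0 Dsr PhiD) => n.
pose g t : C := (cutoff n t)%:C; have Cg : Cc g := Cc_cutoff n.
have g0 := Cc_C0 Cg; rewrite -[fun t => (cutoff n t)%:C]/g.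
have ag := calc_adj PhiD g0; have ar := calc_adj PhiD r0.
rewrite (adjB _ _ ag) (adjD _ _ ar) (adjZ _ _ ar) (adjD _ _ ag) (adjZ _ _ ag).
rewrite (calcC PhiD y g0 r0) -(h _ Cg).
have tg := Cc_C0 (CcM (contR cid) Cg).
rewrite -(calcM PhiD _ r0 tg) -(calcM PhiD _ g0 r0).
rewrite -(calcZ PhiD _ _ (C0_mul g0 r0)) -(calcD PhiD _ (C0_mul r0 tg) (C0Z _ (C0_mul g0 r0))).
rewrite -(calcB PhiD _ g0 (C0D (C0_mul r0 tg) (C0Z _ (C0_mul g0 r0)))) -[RHS](calc0 PhiD x).
apply: (calc_ext Phi) => t; rewrite mulrA [resl l t * _]mulrC resl_id//; ring.
Qed.

Lemma resf_resl n t : (resf n t)%:C = 2^-1 * resl (N1 n) t + 2^-1 * resl (- N1 n) t.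
Proof.
have n0 : N1 n != 0 by rewrite gt_eqF.
have n0' : - N1 n != 0 by rewrite oppr_eq0.
have h := addi_neq0 t n0; have h' := addi_neq0 t n0'.
have dn : t ^+ 2 + N1 n ^+ 2 != 0 by rewrite gt_eqF// resf_den.
have e : (t%:C + (N1 n)%:C * 'i%C) * (t%:C + (- N1 n)%:C * 'i%C) = (t ^+ 2 + N1 n ^+ 2)%:C.
  rewrite rmorphN mulNr mulrC -subr_sqr exprMn sqr_i mulrN1 opprK.
  by rewrite rmorphD !rmorphXn.
have e2 : (t%:C + (N1 n)%:C * 'i%C) + (t%:C + (- N1 n)%:C * 'i%C) = 2 * t%:C :> C.
  by rewrite rmorphN mulNr; ring.
rewrite /resf /resl -mulrDr.
have -> : (t / (t ^+ 2 + N1 n ^+ 2))%:C = t%:C / (t ^+ 2 + N1 n ^+ 2)%:C by rewrite rmorphM fmorphV.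
rewrite -e.
move: h h' e2; set a := t%:C + _; set b := t%:C + _ => h h' e2.
apply: (mulIf (mulf_neq0 h h')); rewrite divfK ?mulf_neq0//.
have -> : 2^-1 * (a^-1 + b^-1) * (a * b) = 2^-1 * (b + a).
  by rewrite -mulrA; congr (_ * _); rewrite mulrDl mulKf// [a * b]mulrC mulKf.
by rewrite addrC e2 mulKf// pnatr_eq0.
Qed.

Lemma C0_resf n : C0 (fun t => (resf n t)%:C : C).
Proof.
have n0 : N1 n != 0 by rewrite gt_eqF.
have n0' : - N1 n != 0 by rewrite oppr_eq0.
have := C0D (C0Z 2^-1 (C0_resolvent_gen n0)) (C0Z 2^-1 (C0_resolvent_gen n0')).
by congr C0; apply/funext => t; rewrite resf_resl.
Qed.

Section one_operator.
Variables (T T' : X -> X) (eps : R).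
Hypothesis TT : is_adjoint T T'.
Hypothesis eps0 : 0 < eps.
Hypothesis Tdom : forall x, dom D x -> dom D (T x).
Hypothesis Tbd : norm_bounded (Defs.comp (commutator D T) (bracket_pow D (- ((1 - eps) / 2)))).

Let d := Num.min eps 1.
Let d0 : 0 < d. Proof. by rewrite lt_min eps0 ltr01. Qed.

(** As 1 + t^2 <= t^2 + l^2, the weight is absorbed by the resolvent. Capping eps at 1 makes the
    exponent (1 - d) / 2 nonnegative, as monotonicity of powers requires. *)
Let nrm_resl l t : 1 <= `|l| -> brk ((1 - eps) / 2) t * nrm (resl l t) <= (t ^+ 2 + l ^+ 2) `^ (- (d / 2)).
Proof.
move=> l1; have l2 : 1 <= l ^+ 2 by rewrite -real_normK ?num_real// expr_ge1.
set Q := t ^+ 2 + l ^+ 2; have BQ : 1 + t ^+ 2 <= Q by rewrite addrC lerD2l.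
have Q0 : 0 < Q by rewrite (lt_le_trans (brk_base t)).
have B1 : 1 <= 1 + t ^+ 2 by rewrite lerDl sqr_ge0.
have -> : nrm (resl l t) = Q `^ (- 2^-1).
  by rewrite /resl nrmV powRN powR12_sqrt ?(ltW Q0)// /Q -nrm_addi sqrtr_sqr ger0_norm ?nrm_ge0.
have -> : - (d / 2) = (1 - d) / 2 + - 2^-1 by field.
rewrite powRD; last by apply/implyP => _; rewrite gt_eqF.
rewrite ler_wpM2r ?powR_ge0// (@le_trans _ _ ((1 + t ^+ 2) `^ ((1 - d) / 2)))//.
  by rewrite ler_powR// ler_pM2r ?invr_gt0// lerD2l lerN2 ge_min lexx.
by rewrite ge0_ler_powR ?nnegrE ?divr_ge0 ?subr_ge0 ?ge_min ?lexx ?orbT ?(ltW (brk_base t)) ?(ltW Q0).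
Qed.

Lemma resolvent_commutator : exists2 K, 0 <= K & forall l z, 1 <= `|l| ->
  nrm (Phi (resl l) (T z) - T (Phi (resl l) z)) <= K * `|l| `^ (- (1 + d)) * nrm z.
Proof.
have [M0 hM0] := Tbd; pose M := `|M0|.
have hM x y : Defs.comp (commutator D T) (bracket_pow D (- ((1 - eps) / 2))) (x, y) ->
    nrm y <= M * nrm x.
  move=> /hM0; rewrite -nrmE -nrmE -rmorphM lecR => h; rewrite (le_trans h)//.
  by rewrite ler_wpM2r ?nrm_ge0// ler_norm.
have Mge : 0 <= M by exact: normr_ge0.
exists (4 * M); first by rewrite mulr_ge0.
move=> l z l1; have lp : 0 < `|l| by exact: lt_le_trans l1.
have l0 : l != 0 by rewrite -normr_gt0.
have r0 : C0 (resl l) := C0_resolvent_gen l0; pose xi := Phi (resl l) z.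
have Dxi := calc_resl z l0; rewrite -/xi in Dxi.
have [v Dv] : dom D (T xi) by apply: Tdom; exists (z - (l%:C * 'i%C) *: xi).
pose u := z - (l%:C * 'i%C) *: xi; pose eta := v - T u.
have -> : Phi (resl l) (T z) - T xi = - Phi (resl l) eta.
  rewrite [X in _ - X](calc_resl_inv l0 Dv) -(adjB _ _ (calc_adj PhiD r0)) -(adjN _ (calc_adj PhiD r0)).
  by congr Phi; rewrite /eta /u (adjB _ _ TT) (adjZ _ _ TT); lmod.
have ql t : 0 < t ^+ 2 + l ^+ 2.
  by rewrite ltr_wpDl ?sqr_ge0// -real_normK ?num_real// exprn_gt0.
(* Factors xi as (1 + D^2)^(-(1 - eps) / 2) applied to g(D) z, the form in which eps-boundedness of
   the commutator can be used. The bound for g then supplies |l|^(-d), and the other resolvent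
   supplies |l|^(-1). *)
pose g t := (brk ((1 - eps) / 2) t)%:C * resl l t.
have gE t : nrm (g t) = brk ((1 - eps) / 2) t * nrm (resl l t).
  by rewrite /g nrmM nrm_real gtr0_norm ?brk_gt0.
have cg : cont g by apply: contM (C0_cont r0); apply: contR; exact: continuous_brk.
have dn : - (d / 2) < 0 by rewrite oppr_lt0 divr_gt0.
have g0 : C0 g.
  apply: (C0_dom cg (C0_brk dn)); exists 1 => t.
  rewrite mul1r gE nrm_real gtr0_norm ?brk_gt0// (le_trans (nrm_resl t l1))//.
  rewrite /brk !powRN lef_pV2 ?posrE ?powR_gt0 ?brk_base ?ql//.
  rewrite ge0_ler_powR ?nnegrE ?(ltW (brk_base t)) ?(ltW (ql t)) ?divr_ge0 ?(ltW d0)//.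
  by rewrite addrC lerD2l -real_normK ?num_real// expr_ge1.
have gb t : nrm (g t) <= `|l| `^ (- d).
  rewrite gE (le_trans (nrm_resl t l1))//.
  have -> : `|l| `^ (- d) = (l ^+ 2) `^ (- (d / 2)).
    rewrite -[l ^+ 2]real_normK ?num_real// -powR_mulrn// -powRrM; congr (_ `^ _); by field.
  rewrite !powRN lef_pV2 ?posrE ?powR_gt0 ?ql ?exprn_even_gt0//.
  rewrite ge0_ler_powR ?nnegrE ?sqr_ge0 ?(ltW (ql t)) ?divr_ge0 ?(ltW d0)//.
  by rewrite lerDr sqr_ge0.
have Pw : bracket_pow D (- ((1 - eps) / 2)) (Phi g z, xi).
  have e : Phi (fun t => (brk (- ((1 - eps) / 2)) t)%:C * g t) z = xi.
    by apply: (calc_ext Phi) => t; rewrite /g mulrA -rmorphM brkD addNr brk0 rmorph1 mul1r.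
  rewrite -e; apply: (func_calc_core Dsr PhiD z (@continuous_brk R (- ((1 - eps) / 2))) g0).
  have := r0; congr C0; apply/funext => t.
  by rewrite /g mulrA -rmorphM brkD addNr brk0 rmorph1 mul1r.
have he : nrm eta <= M * nrm (Phi g z) by apply: hM; exists xi => //; exists u, v.
have l0' : 0 <= `|l| `^ (- d) by exact: powR_ge0.
have hw := calc_bound Dsr PhiD z g0 gb l0'.
have rb t : nrm (resl l t) <= `|l|^-1.
  by rewrite /resl nrmV lef_pV2 ?posrE ?nrm_addi_gel// (lt_le_trans lp)// nrm_addi_gel.
have li : 0 <= `|l|^-1 by rewrite invr_ge0.
rewrite nrmN (le_trans (calc_bound Dsr PhiD eta r0 rb li))//.
have -> : `|l| `^ (- (1 + d)) = `|l|^-1 * `|l| `^ (- d).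
  by rewrite opprD powRD ?powR_inv1//; apply/implyP => _; rewrite gt_eqF.
have l2 : 0 <= 2 * `|l|^-1 by rewrite mulr_ge0.
rewrite (le_trans (ler_wpM2l l2 (le_trans he (ler_wpM2l Mge hw))))//.
by apply: eq_le_r; ring.
Qed.

Lemma resf_commutator : exists2 K, 0 <= K & forall n z,
  nrm (Phi (fun t => (resf n t)%:C) (T z) - T (Phi (fun t => (resf n t)%:C) z)) <=
  K * N1 n `^ (- (1 + d)) * nrm z.
Proof.
have [K K0 hK] := resolvent_commutator; exists K => // n z.
have n0 : N1 n != 0 by rewrite gt_eqF.
have n0' : - N1 n != 0 by rewrite oppr_eq0.
have r0 : C0 (resl (N1 n)) := C0_resolvent_gen n0.
have r0' : C0 (resl (- N1 n)) := C0_resolvent_gen n0'.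
have e x : Phi (fun t => (resf n t)%:C) x =
    2^-1 *: Phi (resl (N1 n)) x + 2^-1 *: Phi (resl (- N1 n)) x.
  rewrite -!(calcZ PhiD)// -(calcD PhiD); [|exact: C0Z|exact: C0Z].
  by apply: (calc_ext Phi) => t; rewrite resf_resl.
rewrite !e (adjD _ _ TT) !(adjZ _ _ TT).
have a1 : 1 <= `|N1 n| by rewrite ger0_norm ?ler1n.
have a2 : 1 <= `|- N1 n| by rewrite normrN.
have h1 := hK _ z a1; have h2 := hK _ z a2; rewrite normrN in h2; rewrite ger0_norm// in h1 h2.
have nh : nrm (2^-1 : C) = 2^-1 :> R by rewrite nrmV nrm_nat.
move: h1 h2; set u := Phi _ (T z); set u' := T (Phi _ z).
set v := Phi (resl (- _)) (T z); set v' := T (Phi (resl (- _)) z) => h1 h2.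
have -> : 2^-1 *: u + 2^-1 *: v - (2^-1 *: u' + 2^-1 *: v') =
  (2^-1 : C) *: ((u - u') + (v - v')) by lmod.
rewrite nrmZ nh ler_pdivrMl// (le_trans (nrmD _ _))//.
by rewrite mulrDl mul1r lerD.
Qed.

End one_operator.

Section series_commutator.
Variables (T T' : X -> X) (C d : R) (w : nat -> R) (g e : R -> R).
Hypothesis TT : is_adjoint T T'.
Hypothesis d0 : 0 < d.
Hypothesis C_ge0 : 0 <= C.
Hypothesis hC : forall n z,
  nrm (Phi (fun t => (resf n t)%:C) (T z) - T (Phi (fun t => (resf n t)%:C) z)) <=
  C * N1 n `^ (- (1 + d)) * nrm z.
Hypothesis w_tame : tame w.
Hypothesis e0 : C0 (fun t => (e t)%:C : R[i]).
Hypothesis cg : continuous g.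
Hypothesis wg : resf_limit w (fun t => g t - e t).

Let s N t : R[i] := (resf_sum w N t + e t)%:C.

Let s0 N : C0 (s N).
Proof.
rewrite (_ : s N = (fun t => (resf_sum w N t)%:C + (e t)%:C)); last first.
  by apply/funext => t; rewrite /s rmorphD.
apply: C0D => //; elim: N => [|N IH].
  by have := @C0_0 R; congr C0; apply/funext => t; rewrite /resf_sum big_ord0.
have := C0D IH (C0Z (w N)%:C (C0_resf N)); congr C0; apply/funext => t.
by rewrite /resf_sum big_ord_recr /= -rmorphM -rmorphD.
Qed.

Let c_ n z := Phi (fun t => (resf n t)%:C) (T z) - T (Phi (fun t => (resf n t)%:C) z).
Let ce z := Phi (fun t => (e t)%:C) (T z) - T (Phi (fun t => (e t)%:C) z).
Let TN N z := Phi (s N) (T z) - T (Phi (s N) z).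

Let sE N x : Phi (s N) x =
  \sum_(n < N) (w n)%:C *: Phi (fun t => (resf n t)%:C) x + Phi (fun t => (e t)%:C) x.
Proof.
elim: N => [|N IH].
  by rewrite big_ord0 add0r; apply: (calc_ext Phi) => t; rewrite /s /resf_sum big_ord0 add0r.
rewrite big_ord_recr/= addrAC -IH -(calcZ PhiD _ _ (C0_resf N)).
rewrite -(calcD PhiD _ (s0 N) (C0Z _ (C0_resf N))); apply: (calc_ext Phi) => t.
by rewrite /s /resf_sum big_ord_recr /= -rmorphM -rmorphD addrAC.
Qed.

Let TNE N z : TN N z = \sum_(n < N) (w n)%:C *: c_ n z + ce z.
Proof.
rewrite /TN !sE (adjD _ _ TT) (adj_sum _ _ TT) /ce opprD addrACA -sumrB; congr (_ + _).
by apply: eq_bigr => n _; rewrite (adjZ _ _ TT) scalerBr.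
Qed.

Let b n := `|w n| * N1 n `^ (- (1 + d)).

Let c_le z n : nrm ((w n)%:C *: c_ n z) <= (C * nrm z) * b n.
Proof.
rewrite nrmZ nrm_real (le_trans (ler_wpM2l _ (hC n z)))//.
by apply: eq_le_r; rewrite /b; ring.
Qed.

Let b_sum : summable_seq b. Proof. exact: summable_tame. Qed.
Let b_ge0 n : 0 <= b n. Proof. by rewrite mulr_ge0 ?powR_ge0. Qed.

(** Norm convergence of the commutators with partial sums yields K, but says nothing yet about the
    domain of g(D). Its invariance under T is checked first on vectors k(D) x with k of compact
    support, where the partial sums times k converge uniformly to g k, and then on the whole domain
    because g(D) is closed. *)
Lemma series_commutator : exists K : X -> X,
  (forall h, 0 < h -> exists2 u : R -> R[i], C0 u &
     forall z, nrm (K z - (Phi u (T z) - T (Phi u z))) <= h * nrm z) /\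
  forall x y, func_calc D g (x, y) -> func_calc D g (T x, T y + K x).
Proof.
have /choice[K0 hK0] z : exists l, tends (fun N => \sum_(n < N) (w n)%:C *: c_ n z) l.
  apply: nrm_complete; apply: (summable_cauchy (c_le z)).
  exact: (summable_le (fun n => lexx _) b_ge0 b_sum).
pose K z := K0 z + ce z.
have TNK z : tends (fun N => TN N z) (K z).
  move=> h h0; have [N hN] := hK0 z h h0; exists N => n /hN.
  by rewrite TNE /K opprD addrACA subrr addr0.
have unif h : 0 < h -> exists N, forall n z, (N <= n)%N -> nrm (TN n z - K z) <= h * nrm z.
  move=> h0; have C1 : 0 < C + 1 by rewrite ltr_wpDl.
  have [N hN] := b_sum (divr_gt0 h0 C1); exists N => n z Nn.
  apply/ler_addgt0Pr => r r0; have [M hM] := TNK z r r0; pose m := maxn M n.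
  rewrite (le_trans (nrm_tri (TN m z) _ _))// lerD ?hM ?leq_maxl//.
  rewrite !TNE opprD addrACA subrr addr0 nrm_sym.
  rewrite (le_trans (sum_dist_le (c_le z) (leq_maxr _ _)))// -mulr_sumr mulrAC ler_wpM2r ?nrm_ge0//.
  rewrite (le_trans (ler_wpM2l C_ge0 (hN n m Nn)))// mulrCA ler_piMr ?(ltW h0)//.
  by rewrite ler_pdivrMr// mul1r lerDl.
have Kb : exists2 M, 0 <= M & forall x y, nrm (K x - K y) <= M * nrm (x - y).
  have [N /(_ N _ (leqnn N)) hN] := unif 1 ltr01.
  (* K is only a pointwise limit so far. It is additive and within norm 1 of the adjointable [TN N],
     hence Lipschitz. *)
  have aN : is_adjoint (TN N) (fun x => T' (Phi (fun t => (s N t)^*%C) x) - Phi (fun t => (s N t)^*%C) (T' x)).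
    have a1 := calc_adj PhiD (s0 N).
    by apply: is_adjointB; [exact: is_adjoint_comp a1 TT|exact: is_adjoint_comp TT a1].
  have KB x y : K (x - y) = K x - K y.
    apply: (tends_unique (TNK (x - y))) => h h0; have h20 := divr_gt0 h0 (ltr0n R 2).
    have [N1' h1] := TNK x _ h20; have [N2 h2] := TNK y _ h20; exists (maxn N1' N2) => n.
    rewrite geq_max => /andP[/h1 n1 /h2 n2].
    have -> : TN n (x - y) - (K x - K y) = (TN n x - K x) - (TN n y - K y).
      rewrite /TN (adjB _ _ TT) !(adjB _ _ (calc_adj PhiD (s0 n))) (adjB _ _ TT); lmod.
    by rewrite (le_trans (nrmB _ _))// (splitr h) lerD.
  have [M M0 hM] := adjointable_bounded aN; exists (M + 1); first by rewrite addr_ge0.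
  move=> x y; rewrite -KB (le_trans (nrm_le_dist _ (TN N (x - y))))// mulrDl lerD//.
  by rewrite nrm_sym.
exists K; split.
  move=> h /unif[N hN]; exists (s N); first exact: s0.
  by move=> z; rewrite nrm_sym; exact: hN.
(* The series converges uniformly on the support of k and k vanishes elsewhere, so the convergence
   holds in the norm of C_0(R). *)
have lu k x : Cc k -> tends (fun N => Phi (fun t => s N t * k t) x) (Phi (fun t => (g t)%:C * k t) x).
  move=> Ck h h0; have k0 := Cc_C0 Ck; have [M M0 hM] := C0_bounded k0.
  have [L hL] := proj2 Ck.
  have q0 : 0 < 2 * M * (nrm x + 1) by rewrite !mulr_gt0// ltr_wpDl ?nrm_ge0.
  have [N hN] := wg L (divr_gt0 h0 q0); exists N => n Nn.
  have g0 := Cc_C0 (CcM (contR cg) Ck).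
  rewrite -(calcB PhiD _ (C0_mul (s0 n) k0) g0).
  have p0 : 0 <= h / (2 * M * (nrm x + 1)) * M by rewrite mulr_ge0 ?divr_ge0 ?ltW.
  rewrite (le_trans (calc_bound Dsr PhiD x (C0B (C0_mul (s0 n) k0) g0) (M := h / (2 * M * (nrm x + 1)) * M) _ p0))//.
    move=> t; rewrite -mulrBl nrmM.
    have [tL|Lt] := leP `|t| L; last by rewrite (hL t (ltW Lt)) nrm0 mulr0.
    rewrite ler_pM ?nrm_ge0// /s -rmorphB nrm_real.
    by have := hN n t Nn tL; congr (`|_| <= _); ring.
  rewrite (_ : 2 * _ * _ = h * (nrm x / (nrm x + 1))); last first.
    by field; rewrite !gt_eqF// ltr_wpDl ?nrm_ge0.
  by rewrite ler_piMr ?(ltW h0)// ler_pdivrMr ?ltr_wpDl ?nrm_ge0// mul1r lerDl.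
(* Tested against l(D), which commutes with the partial sums: one term of the commutator tends to (g
   l)(D) applied to T k(D) x, the other to l(D) T applied to (g k)(D) x. *)
have core k x : Cc k -> func_calc D g (T (Phi k x), T (Phi (fun t => (g t)%:C * k t) x) + K (Phi k x)).
  move=> Ck; apply/(func_calcP Dsr PhiD _ _ cg) => l Cl.
  have k0 := Cc_C0 Ck; have l0 := Cc_C0 Cl; have al := calc_adj PhiD l0.
  rewrite (adjD _ _ al); apply/eqP; rewrite addrC -subr_eq eq_sym; apply/eqP.
  apply: (tends_unique (adj_tends al (TNK (Phi k x)))) => h h0.
  have h20 := divr_gt0 h0 (ltr0n R 2).
  have [N1' h1] := lu l (T (Phi k x)) Cl _ h20.
  have [N2 h2] := adj_tends al (adj_tends TT (lu k x Ck)) h20.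
  exists (maxn N1' N2) => n; rewrite geq_max => /andP[/h1 n1 /h2 n2].
  rewrite /TN (adjB _ _ al) -(calcC PhiD _ (s0 n) l0) -(calcM PhiD _ (s0 n) l0).
  rewrite -(calcM PhiD _ (s0 n) k0).
  move: n1 n2; set a := Phi _ (T _); set a' := Phi _ (T _).
  set v := Phi l _; set v' := Phi l _ => n1 n2.
  have -> : a - v - (a' - v') = (a - a') - (v - v') by lmod.
  by rewrite (le_trans (nrmB _ _))// (splitr h) lerD.
have [M M0 hM] := Kb; have [MT MT0 hMT] := adjointable_bounded TT.
move=> x y hxy; have /closedP := sa_closed (func_calc_sa Dsr PhiD cg); apply => h h0.
have S0 : 0 < 2 * (MT + M + 1) by rewrite mulr_gt0// !ltr_wpDl// addr_ge0.
have q0 := divr_gt0 h0 S0.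
have [N1' h1] := calc_tends Dsr PhiD x q0; have [N2 h2] := calc_tends Dsr PhiD y q0.
pose n := maxn N1' N2; pose k t : R[i] := (cutoff n t)%:C; have Ck : Cc k := Cc_cutoff n.
have n1 : nrm (Phi k x - x) <= h / (2 * (MT + M + 1)) := h1 n (leq_maxl _ _).
have n2 : nrm (Phi k y - y) <= h / (2 * (MT + M + 1)) := h2 n (leq_maxr _ _).
have e1 : Phi (fun t => (g t)%:C * k t) x = Phi k y.
  by have /(func_calcP Dsr PhiD _ _ cg) := hxy; apply.
have := core k x Ck; rewrite e1 => hc.
exists (T (Phi k x), T (Phi k y) + K (Phi k x)) => //.
have hh : h / 2 < h by rewrite ltr_pdivrMr// ltr_pMr// ltr1n.
have hS : (MT + M + 1) * (h / (2 * (MT + M + 1))) = h / 2.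
  by field; rewrite gt_eqF// ltr_wpDl// addr_ge0.
have q1 := ltW q0; set q := h / (2 * _) in n1 n2 hS q1.
have t1 : nrm (T (Phi k x) - T x) <= MT * q.
  by rewrite -(adjB _ _ TT) (le_trans (hMT _))// ler_wpM2l.
have t2 : nrm (T (Phi k y) - T y) <= MT * q.
  by rewrite -(adjB _ _ TT) (le_trans (hMT _))// ler_wpM2l.
have t3 : nrm (K (Phi k x) - K x) <= M * q by rewrite (le_trans (hM _ _))// ler_wpM2l.
rewrite nrm_pair /= gt_max; apply/andP; split; apply: (le_lt_trans _ hh); rewrite -hS.
  by rewrite (le_trans t1)//; have := mulr_ge0 M0 q1; lra.
have -> : T (Phi k y) + K (Phi k x) - (T y + K x) =
  (T (Phi k y) - T y) + (K (Phi k x) - K x) by lmod.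
by rewrite (le_trans (nrmD _ _))//; lra.
Qed.

End series_commutator.
End commutator_estimates.

(** * Bounded transforms of D and of D_log *)

Section bounded_transforms.
Context {R : realType}.
Implicit Types t : R.

Definition btr t : R := t * brk (- (1 / 2)) t.

Lemma continuous_btr : continuous (btr : R -> R).
Proof. by move=> t; apply: cvgM; [exact: cvg_id|exact: continuous_brk]. Qed.

Lemma btrN t : btr (- t) = - btr t.
Proof. by rewrite /btr brkN mulNr. Qed.

Lemma btr_sqr t : btr t * btr t = 1 - brk (- 1) t.
Proof.
have -> : btr t * btr t = t ^+ 2 * brk (- 1) t.
  rewrite /btr mulrACA brkD -expr2; congr (_ * brk _ _); by field.
have h : (1 + t ^+ 2) * brk (- 1) t = 1.
  by rewrite /brk powR_inv1 ?divff ?gt_eqF ?(ltW (brk_base t)) ?brk_base.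
by rewrite -[X in _ = X - _]h mulrDl mul1r addrAC subrr add0r.
Qed.

Lemma btr_le1 t : `|btr t| <= 1.
Proof.
rewrite -(@ler_pXn2r _ 2) ?nnegrE// expr1n real_normK ?num_real// expr2 btr_sqr.
by rewrite gerBl ltW// brk_gt0.
Qed.

(** With u = [btr t] >= 0, (1 - u)(1 + u) = 1 - u^2 = (1 + t^2)^(-1). *)
Lemma btr_dist1 t : 0 <= t -> 0 <= 1 - btr t <= brk (- 1) t.
Proof.
move=> t0; have b0 : 0 <= btr t by rewrite mulr_ge0// ltW// brk_gt0.
have b1 := btr_le1 t; rewrite ger0_norm// in b1; rewrite subr_ge0 b1 /=.
have -> : brk (- 1) t = (1 - btr t) * (1 + btr t).
  by have := btr_sqr t => e; rewrite mulrDr mulr1 mulrBl mul1r e; ring.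
by rewrite ler_peMr ?subr_ge0// lerDl.
Qed.

(** Both functions are odd and tend to 1 at +oo, at rates given by [btr_dist1]; properness of
    [sgnlog] makes the second rate vanish at infinity. *)
Lemma C0_btr_sgnlog : C0 (fun t => (btr (sgnlog t) - btr t)%:C : R[i]).
Proof.
have n1 : - 1 < 0 :> R by rewrite oppr_lt0.
have b0 : C0 (fun t => (brk (- 1) t)%:C : R[i]) := C0_brk n1.
have bL := C0_comp b0 (@continuous_sgnlog R) (@sgnlog_proper R).
have ck : continuous (fun t => btr (sgnlog t) - btr t : R).
  move=> t; apply: cvgB; last exact: continuous_btr.
  by apply: continuous_comp; [exact: continuous_sgnlog|exact: continuous_btr].
apply: (C0_dom (contR ck) (C0D b0 bL)); exists 1 => t.
rewrite mul1r -rmorphD !nrm_real [leRHS]ger0_norm ?addr_ge0 ?(ltW (brk_gt0 _ _))//.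
wlog t0 : t / 0 <= t.
  move=> wl; have [|/ltW t0] := leP 0 t; first exact: wl.
  have := wl (- t); rewrite oppr_ge0 => /(_ t0).
  by rewrite sgnlogN !btrN !brkN -opprD normrN.
have L0 : 0 <= sgnlog t by rewrite /sgnlog mulr_ge0 ?sgr_ge0// ln_ge0// lerDl.
have /andP[h1 h2] := btr_dist1 t0; have /andP[h3 h4] := btr_dist1 L0.
by rewrite ler_norml; lra.
Qed.

Context {B : cstarAlgType R} {X : hilbModType B}.
Variable D : set (X * X).
Hypothesis Dsr : selfadjoint_regular D.
Variable Phi : (R -> R[i]) -> X -> X.
Hypothesis PhiD : C0_calculus D Phi.

Definition is_btr (F : X -> X) : Prop :=
  [/\ graph F = bounded_transform D, func_calc D btr = graph F, is_adjoint F F,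
    forall g x, C0 g -> F (Phi g x) = Phi (fun t => (btr t)%:C * g t) x &
    forall g x, C0 g -> Phi g (F x) = Phi (fun t => (btr t)%:C * g t) x].

(** The bounded transform is defined as a composition of graphs, while the estimates concern the
    function [btr] of D. That (1 + D^2)^(-1/2) maps every vector into the domain of D identifies the
    two. *)
Lemma bounded_transform_exists : exists F, is_btr F.
Proof.
have [F [FG FF Fl Fr]] := func_calc_bounded Dsr PhiD continuous_btr ltr01 btr_le1.
exists F; split=> //.
have n12 : - (1 / 2) < 0 :> R by rewrite oppr_lt0 divr_gt0.
have cid : continuous (@id R) by move=> t; exact: cvg_id.
pose p t : R[i] := (brk (- (1 / 2)) t)%:C; have p0 : C0 p := C0_brk n12.
have Dp x : D (Phi p x, F x).
  rewrite -(func_calc_id Dsr PhiD); apply/(func_calcP Dsr PhiD _ _ cid) => g Cg.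
  have g0 := Cc_C0 Cg; have tg := Cc_C0 (CcM (contR cid) Cg).
  rewrite Fr// -(calcM PhiD _ tg p0); apply: (calc_ext Phi) => t.
  by rewrite /btr /p rmorphM mulrAC.
rewrite /bounded_transform (bracket_pow_C0 Dsr PhiD n12) -/p.
apply/seteqP; split=> -[x y]; rewrite /graph /=.
  by move=> <-; exists (Phi p x).
by move=> [z]; rewrite /graph /= => <- h; exact: (sa_fun Dsr (Dp x) h).
Qed.

Variable F : X -> X.
Hypothesis hF : is_btr F.

Lemma btr_square x : F (F x) - x = Phi (fun t => - (brk (- 1) t)%:C) x.
Proof.
have [_ _ FF Fl Fr] := hF; have n1 : - 1 < 0 :> R by rewrite oppr_lt0.
have b0 : C0 (fun t => (brk (- 1) t)%:C : R[i]) := C0_brk n1.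
have nb0 := C0N b0.
have c1 : cont (fun t => (btr t)%:C : R[i]) by apply: contR; exact: continuous_btr.
have bC g : C0 g -> C0 (fun t => (btr t)%:C * g t : R[i]).
  by move=> g0; apply: C0M => //; exists 1 => t; rewrite nrm_real btr_le1.
apply/eqP; rewrite -subr_eq0; apply/eqP/(calc_eq0 Dsr PhiD) => n.
have k0 := Cc_C0 (@Cc_cutoff R n); have ak := calc_adj PhiD k0.
rewrite !(adjB _ _ ak) Fr// Fr; last exact: bC.
rewrite -(calcM PhiD _ k0 nb0) -(calcB PhiD); [|exact: bC (bC _ k0)|exact: k0].
rewrite -(calcB PhiD); [|exact: C0B (bC _ (bC _ k0)) k0|exact: C0_mul].
rewrite -[RHS](calc0 PhiD x); apply: (calc_ext Phi) => t.
by rewrite mulrA -rmorphM btr_sqr rmorphB rmorph1; ring.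
Qed.

Lemma btr_kasparov (A : cstarAlgType R) (rho : A -> X -> X) (gr : option (X -> X)) :
  countably_generated X -> star_representation rho ->
  (forall a h, C0 h -> compact_op (fun x => rho a (Phi h x))) ->
  (forall a, compact_op (fun x => F (rho a x) - rho a (F x))) ->
  is_grading gr -> (forall a, even_for gr (rho a)) -> odd_for gr D ->
  kasparov_module rho gr F.
Proof.
have [_ FG FF Fl Fr] := hF => cg hrho rc Fc isg ev od; split=> //.
- exists F => // a; apply: (compact_eq _ compact0) => x.
  by rewrite subrr (adj0 (rep_adj hrho a)).
- move=> a; split=> //; have n1 : - 1 < 0 :> R by rewrite oppr_lt0.
  by apply: (compact_eq _ (rc a _ (C0N (C0_brk n1)))) => x; rewrite btr_square.
- split=> //; rewrite -FG; case: gr isg od {ev} => [g|] //= [gK ga] od x y.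
  exact: (func_calc_odd Dsr PhiD gK ga od continuous_btr btrN).
Qed.

End bounded_transforms.

(** * Transfer to D_log and to the C*-closure *)

Section higher_order_modules.
Context {R : realType} {B : cstarAlgType R} {X : hilbModType B} {calA : starAlgType R}.
Variables (pi : calA -> X -> X) (gr : option (X -> X)) (m : R) (D : set (X * X)).
Hypothesis H : higher_order_kasparov m pi gr D.
Variable Phi : (R -> R[i]) -> X -> X.
Hypothesis PhiD : C0_calculus D Phi.

Let hpi : star_representation pi. Proof. by case: H => _ []. Qed.
Let Dsr : selfadjoint_regular D. Proof. by case: H => _ []. Qed.

Lemma rep_calc_compact a h : C0 h -> compact_op (fun x => pi a (Phi h x)).
Proof.
have n12 : - (1 / 2) < 0 :> R by rewrite oppr_lt0 divr_gt0.
have [_ _ hc _ _] := H.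
exact: (calc_compact Dsr PhiD (rep_adj hpi a) n12 (hc a)).
Qed.

Lemma calc_rep_compact a h : C0 h -> compact_op (fun x => Phi h (pi a x)).
Proof.
move=> h0; have hc0 := C0_conj h0.
have := is_adjoint_comp (rep_adj hpi (astar a)) (calc_adj PhiD hc0).
rewrite astarK => /compact_adj/(_ (rep_calc_compact (astar a) hc0)).
by apply: compact_eq => x; apply: (calc_ext Phi) => t; rewrite conjcK.
Qed.

(* [K a] is the closure of the commutator of [g(D)] with [a]. *)
Lemma commutators_exist (w : nat -> R) (g e : R -> R) :
  tame w -> C0 (fun t => (e t)%:C) -> continuous g ->
  resf_limit w (fun t => g t - e t) ->
  exists K : calA -> X -> X,
  [/\ forall a x y, func_calc D g (x, y) -> func_calc D g (pi a x, pi a y + K a x),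
      forall a, exists M, bounded_by (K a) M,
      forall a b, compact_op (fun x => pi b (K a x))
    & forall a b, compact_op (fun x => K a (pi b x))].
Proof.
move=> tw e0 cg wg; have [m0 _ _ hd _] := H.
have mi : 0 < m^-1 by rewrite invr_gt0.
have /choice[K hK] a : exists K : X -> X,
    (forall h, 0 < h -> exists2 u : R -> R[i], C0 u &
      forall z, nrm (K z - (Phi u (pi a z) - pi a (Phi u z))) <= h * nrm z) /\
    forall x y, func_calc D g (x, y) -> func_calc D g (pi a x, pi a y + K x).
  have [st [_ _ _ bd]] := hd a; have aa := rep_adj hpi a.
  have d0 : 0 < Num.min m^-1 1 by rewrite lt_min mi ltr01.
  have Tbd : norm_bounded (Defs.comp (commutator D (pi a)) (bracket_pow D (- ((1 - m^-1) / 2)))).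
    by have [_ []] := hd a.
  have [C C0 hC] := resf_commutator Dsr PhiD aa mi st Tbd.
  exact: (series_commutator Dsr PhiD aa d0 C0 hC tw e0 cg wg).
exists K; split.
- by move=> a; case: (hK a).
- move=> a; have [/(_ 1 ltr01)[u u0 hu] _] := hK a.
  have au := calc_adj PhiD u0; have aa := rep_adj hpi a.
  have [M M0 hM] := adjointable_bounded
    (is_adjointB (is_adjoint_comp au aa) (is_adjoint_comp aa au)).
  exists (M + 1) => x; rewrite mulrDl.
  rewrite (le_trans (nrm_le_dist _ (Phi u (pi a x) - pi a (Phi u x))))// lerD//.
- move=> a b; have ab := rep_adj hpi b; have [M M0 hM] := adjointable_bounded ab.
  have M1 : 0 < M + 1 by rewrite ltr_wpDl.
  apply: compact_lim => h h0; have [/(_ _ (divr_gt0 h0 M1))[u u0 hu] _] := hK a.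
  exists (fun x => pi b (Phi u (pi a x)) - pi (amul b a) (Phi u x)).
    apply: compactB; last exact: rep_calc_compact.
    exact: compact_compr (rep_adj hpi a) (rep_calc_compact b u0).
  move=> z; rewrite (repM hpi) -!(adjB _ _ ab) (le_trans (hM _))//.
  rewrite (le_trans (ler_wpM2l M0 (hu z)))// mulrA ler_wpM2r ?nrm_ge0//.
  by rewrite mulrCA ler_piMr ?(ltW h0)// ler_pdivrMr// mul1r lerDl.
- move=> a b; have ab := rep_adj hpi b; have [M M0 hM] := adjointable_bounded ab.
  have M1 : 0 < M + 1 by rewrite ltr_wpDl.
  apply: compact_lim => h h0; have [/(_ _ (divr_gt0 h0 M1))[u u0 hu] _] := hK a.
  exists (fun x => Phi u (pi (amul a b) x) - pi a (Phi u (pi b x))).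
    apply: compactB; first exact: calc_rep_compact.
    exact: compact_compr ab (rep_calc_compact a u0).
  move=> z; rewrite (repM hpi) (le_trans (hu _))//.
  have h1 : 0 <= h / (M + 1) by rewrite divr_ge0 ?ltW.
  rewrite (le_trans (ler_wpM2l h1 (hM z)))// mulrA ler_wpM2r ?nrm_ge0//.
  by rewrite -mulrA ler_piMr ?(ltW h0)// ler_pdivrMl// mulr1 lerDl.
Qed.

Let cL : continuous (@sgnlog R) := @continuous_sgnlog R.
Let PhiL : (R -> R[i]) -> X -> X := fun g => Phi (fun t => g (sgnlog t)).
Let PhiLD : C0_calculus (log_transform D) PhiL.
Proof. exact: (func_calc_comp Dsr PhiD cL (@sgnlog_proper R)). Qed.

Let C0L g : C0 g -> C0 (fun t => g (sgnlog t) : R[i]).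
Proof. by move=> g0; apply: C0_comp => //; exact: sgnlog_proper. Qed.

Lemma log_transform_sa : selfadjoint_regular (log_transform D).
Proof. exact: (func_calc_sa Dsr PhiD cL). Qed.
Let Lsr := log_transform_sa.

Lemma log_transform_odd : odd_for gr (log_transform D).
Proof.
have [_ _ _ _ [isg _ od]] := H; case: gr isg od => [g|] //= [gK ga] od x y.
exact: (func_calc_odd Dsr PhiD gK ga od cL (@sgnlogN R)).
Qed.

Section log_commutators.
Variable K : calA -> X -> X.
Hypothesis KD : forall a x y, log_transform D (x, y) -> log_transform D (pi a x, pi a y + K a x).

Lemma log_commutator a x y : commutator (log_transform D) (pi a) (x, y) -> K a x = y.
Proof.
move=> [u [v [/= xu xv ->]]]; have := sa_fun Lsr (KD a xu) xv.
by move=> <-; rewrite addrC addKr.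
Qed.

Lemma log_commutator_dense a : dense (dom (commutator (log_transform D) (pi a))).
Proof.
apply/denseP => x e e0; have /denseP/(_ x e e0)[z [y zy] zx] := sa_dense Lsr.
by exists z => //; exists (K a z), y, (pi a y + K a z); split=> //=; [exact: KD|rewrite addrC addKr].
Qed.

Lemma log_unbounded_kasparov : (forall a, exists M, bounded_by (K a) M) ->
  unbounded_kasparov pi gr (log_transform D).
Proof.
move=> Kb; have [_ [cg _ _] _ _ [isg ev _]] := H.
have n12 : - (1 / 2) < 0 :> R by rewrite oppr_lt0 divr_gt0.
split=> //.
- move=> a; exists (fun x => pi a (PhiL (fun t => (brk (- (1 / 2)) t)%:C) x)).
    exact: (rep_calc_compact a (C0L (C0_brk n12))).
  rewrite (bracket_pow_C0 Lsr PhiLD n12); apply/seteqP; split=> -[x y]; rewrite /graph /=.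
    by move=> [z /= <- <-].
  by move=> <-; exists (PhiL (fun t => (brk (- (1 / 2)) t)%:C) x).
- move=> a; split=> [x [y xy]|]; first by exists (pi a y + K a x); exact: KD.
  (* Order 1 means eps = 1: the exponent is 0, the weight is the identity, and eps-boundedness
     becomes boundedness. *)
  have P1 : bracket_pow (log_transform D) (- ((1 - 1^-1) / 2)) = graph id.
    by rewrite invr1 subrr mul0r oppr0 (bracket_pow0 Lsr PhiLD).
  have c1 G : Defs.comp G (graph id) = G :> set (X * X).
    apply/seteqP; split=> -[x y]; first by move=> [z]; rewrite /graph /= => <-.
    by move=> h; exists x.
  have c2 G : Defs.comp (graph id) G = G :> set (X * X).
    apply/seteqP; split=> -[x y]; first by move=> [z /= h]; rewrite /graph /= => <-.
    by move=> h; exists y.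
  rewrite /eps_bounded P1 c1 c2; have dd := log_commutator_dense a.
  have nb : norm_bounded (commutator (log_transform D) (pi a)).
    have [M hM] := Kb a; exists M => x y /log_commutator <-.
    by rewrite -!nrmE -rmorphM lecR.
  by split.
- by split=> //; exact: log_transform_odd.
Qed.

Lemma log_product_commutator a b :
  (forall a b, compact_op (fun x => pi b (K a x))) ->
  (forall a b, compact_op (fun x => K a (pi b x))) ->
  extends_to_compact (commutator (log_transform D) (pi (amul a b))).
Proof.
move=> Kl Kr; split; first exact: log_commutator_dense.
exists (fun x => pi a (K b x) + K a (pi b x)); first exact: compactD (Kl b a) (Kr a b).
move=> [x y] [u [v [/= xu xv ->]]]; rewrite /graph /=.
have := sa_fun Lsr (KD a (KD b xu)); rewrite -(repM hpi) => /(_ _ xv) <-.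
by rewrite (adjD _ _ (rep_adj hpi a)) -(repM hpi); lmod.
Qed.

End log_commutators.

Section closure.
Variables (A : cstarAlgType R) (iota : calA -> A) (rho : A -> X -> X).
Hypothesis hcl : cstar_closure pi iota rho.

Let hrho : star_representation rho. Proof. by case: hcl. Qed.
Let rho_iota a x : rho (iota a) x = pi a x. Proof. by case: hcl. Qed.
Let iota_dense (a : A) (e : R) : 0 < e -> exists b, nrm (iota b - a) <= e.
Proof.
move=> e0; have [_ di _ _] := hcl; have /denseP/(_ a e e0)[_ [b _ <-] h] := di.
by exists b; exact: ltW.
Qed.

(** Norm continuity of rho is no assumption of [cstar_closure]; it comes from [rep_bounded] and
    carries statements from the dense image of [calA] to A. *)
Let rep_dist a b x : nrm (rho a x - rho b x) <= 4 * nrm (a - b) * nrm x.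
Proof. by rewrite -(repB hrho); exact: rep_bounded. Qed.

Lemma closure_calc_compact a h : C0 h -> compact_op (fun x => rho a (Phi h x)).
Proof.
move=> h0; have [M M0 hM] := adjointable_bounded (calc_adj PhiD h0).
have M1 : 0 < 4 * (M + 1) by rewrite mulr_gt0// ltr_wpDl.
apply: compact_lim => e e0; have [b hb] := iota_dense a (divr_gt0 e0 M1).
exists (fun x => pi b (Phi h x)); first exact: rep_calc_compact.
move=> z; rewrite -rho_iota (le_trans (rep_dist _ _ _))//.
rewrite nrm_sym in hb.
rewrite (le_trans (ler_wpM2l _ (hM z))) ?mulr_ge0 ?nrm_ge0// mulrA ler_wpM2r ?nrm_ge0//.
rewrite -mulrA mulrCA (le_trans (ler_wpM2r _ hb)) ?mulr_ge0//.
by rewrite mulrAC ler_pdivrMr// ler_pM2l// ler_pM2l// lerDl.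
Qed.

Lemma closure_calc_compact' a h : C0 h -> compact_op (fun x => Phi h (rho a x)).
Proof.
move=> h0; have hc0 := C0_conj h0.
have := is_adjoint_comp (rep_adj hrho (astar a)) (calc_adj PhiD hc0).
rewrite astarK => /compact_adj/(_ (closure_calc_compact (astar a) hc0)).
by apply: compact_eq => x; apply: (calc_ext Phi) => t; rewrite conjcK.
Qed.

Lemma closure_even a : even_for gr (rho a).
Proof.
have [_ _ _ _ [isg ev _]] := H; case: gr isg ev => [g|] //= [_ ga] ev x.
have [M M0 hM] := adjointable_bounded ga.
apply: nrm_small_eq => e e0; have S0 : 0 < 4 * (nrm (g x) + M * nrm x + 1).
  by rewrite mulr_gt0// ltr_wpDl// addr_ge0 ?mulr_ge0 ?nrm_ge0.
have [b hb] := iota_dense a (divr_gt0 e0 S0); rewrite nrm_sym in hb.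
have -> : rho a (g x) - g (rho a x) =
    (rho a (g x) - rho (iota b) (g x)) - g (rho a x - rho (iota b) x).
  by rewrite (adjB _ _ ga) !rho_iota ev; lmod.
rewrite (le_trans (nrmB _ _))// (le_trans (lerD (rep_dist _ _ _) (hM _)))//.
rewrite (le_trans (lerD (lexx _) (ler_wpM2l M0 (rep_dist _ _ _))))//.
have -> : 4 * nrm (a - iota b) * nrm (g x) + M * (4 * nrm (a - iota b) * nrm x) =
  nrm (a - iota b) * (4 * (nrm (g x) + M * nrm x)) by ring.
rewrite (le_trans (ler_wpM2r _ hb)) ?mulr_ge0 ?addr_ge0 ?mulr_ge0 ?nrm_ge0//.
by rewrite mulrAC ler_pdivrMr// ler_pM2l// ler_pM2l// lerDl.
Qed.

Section closure_commutators.
Variable F : X -> X.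
Hypothesis hF : is_btr D Phi F.

(** On [calA] compactness is available only for products, through [F, cb] = c [F, b] + [F, c] b. The
    elements of A with compact commutator form a norm closed subspace, and [products_total]
    concludes. *)
Lemma closure_commutator_compact a : compact_op (fun x => F (rho a x) - rho a (F x)).
Proof.
have [_ FG FF _ _] := hF; have [w [e [tw e0 wg]]] := @bounded_transform_series R.
have [K [KD _ Kl Kr]] := commutators_exist tw e0 (@continuous_btr R) wg.
have KE b x : F (pi b x) = pi b (F x) + K b x.
  have : func_calc D btr (x, F x) by rewrite FG.
  by move/(KD b); rewrite FG.
have [M M0 hM] := adjointable_bounded FF.
have [[_ im _] di _ _] := hcl.
apply: (products_total (iota := iota) (S := fun a => compact_op (fun x => F (rho a x) - rho a (F x))) di).
- move=> c hc; apply: compact_lim => h h0.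
  (* The terms F (rho c - rho b) and (rho c - rho b) F each cost 4 M times the distance of c and
     b. *)
  have M1 : 0 < 8 * (M + 1) by rewrite mulr_gt0// ltr_wpDl.
  have [b Sb cb] := hc _ (divr_gt0 h0 M1); exists (fun x => F (rho b x) - rho b (F x)) => // z.
  rewrite nrm_sym in cb.
  have -> : F (rho c z) - rho c (F z) - (F (rho b z) - rho b (F z)) =
      F (rho c z - rho b z) - (rho c (F z) - rho b (F z)) by rewrite (adjB _ _ FF); lmod.
  rewrite (le_trans (nrmB _ _))// (le_trans (lerD (hM _) (rep_dist _ _ _)))//.
  have n0 := nrm_ge0 (c - b).
  have h1 : 0 <= 4 * nrm (c - b) by rewrite mulr_ge0.
  rewrite (le_trans (lerD (ler_wpM2l M0 (rep_dist _ _ _)) (ler_wpM2l h1 (hM _))))//.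
  have -> : M * (4 * nrm (c - b) * nrm z) + 4 * nrm (c - b) * (M * nrm z) =
    nrm (c - b) * (8 * M) * nrm z by ring.
  rewrite ler_wpM2r ?nrm_ge0// (le_trans (ler_wpM2r _ cb)) ?mulr_ge0//.
  by rewrite mulrAC ler_pdivrMr// ler_pM2l// ler_pM2l// lerDl.
- move=> k c b hc hb; apply: (compact_eq _ (compactD (compactZ k hc) hb)) => x.
  rewrite !(repD hrho) !(repZ hrho) (adjD _ _ FF) (adjZ _ _ FF); lmod.
- move=> c b; apply: (compact_eq _ (compactD (Kl b c) (Kr c b))) => x.
  rewrite !(repM hrho) !rho_iota !KE (adjD _ _ (rep_adj hpi c)); lmod.
Qed.

End closure_commutators.

Lemma closure_same_kk_class : exists c clog : kk_cycle A B,
  [/\ is_bounded_transform rho gr D c,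
      is_bounded_transform rho gr (log_transform D) clog & same_kk_class c clog].
Proof.
have [F hF] := bounded_transform_exists Dsr PhiD.
have [FL hFL] := bounded_transform_exists Lsr PhiLD.
have [FG _ FF _ Fr] := hF; have [FLG _ FLs _ FLr] := hFL.
have [_ [cg _ _] _ _ [isg _ od]] := H.
pose kap t : R[i] := (btr (sgnlog t) - btr t)%:C.
have kap0 : C0 kap by exact: C0_btr_sgnlog.
(* The two transforms are tested against cutoffs of D_log, which are the functions [cutoff n]
   composed with [sgnlog] of D, so the identity becomes one between functions. *)
have FLE x : FL x - F x = Phi kap x.
  apply/eqP; rewrite -subr_eq0; apply/eqP/(calc_eq0 Lsr PhiLD) => n.
  have k0 := Cc_C0 (@Cc_cutoff R n); have kL := C0L k0.
  have ak := calc_adj PhiLD k0.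
  rewrite !(adjB _ _ ak) FLr// /PhiL Fr// -(calcM PhiD _ kL kap0).
  have c1 : cont (fun t => (btr t)%:C : R[i]) by apply: contR; exact: continuous_btr.
  have bC g : C0 g -> C0 (fun t => (btr t)%:C * g t : R[i]).
    by move=> g0; apply: C0M => //; exists 1 => t; rewrite nrm_real btr_le1.
  have b1 := C0L (bC _ k0); have b2 := bC _ kL.
  rewrite -(calcB PhiD _ b1 b2) -(calcB PhiD _ (C0B b1 b2) (C0_mul kL kap0)).
  rewrite -[RHS](calc0 PhiD x); apply: (calc_ext Phi) => t.
  by rewrite /kap rmorphB; ring.
have Fc := closure_commutator_compact hF.
have K0 : kasparov_module rho gr F.
  apply: (btr_kasparov Dsr PhiD hF cg hrho _ Fc isg closure_even od) => a h.
  exact: closure_calc_compact.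
have K1 : kasparov_module rho gr FL.
  apply: (btr_kasparov Lsr PhiLD hFL cg hrho _ _ isg closure_even log_transform_odd) => a.
    by move=> h h0; exact: closure_calc_compact (C0L h0).
  (* The commutator of FL with rho(a) is that of F plus that of kap(D), whose two products with
     rho(a) are separately compact. *)
  have c1 := closure_calc_compact' a kap0; have c2 := closure_calc_compact a kap0.
  apply: (compact_eq _ (compactD (Fc a) (compactB c1 c2))) => x.
  by rewrite -!FLE (adjB _ _ (rep_adj hrho a)); lmod.
exists (KKCycle K0), (KKCycle K1); split; [by exists F, K0|by exists FL, K1|].
apply: Relation_Operators.rst_step; apply: compact_perturbation_homotopic => // a.
by apply: (compact_eq _ (closure_calc_compact a kap0)) => x; rewrite FLE.
Qed.

End closure.
End higher_order_modules.

Theorem theorem1p38 (R : realType) (B : cstarAlgType R) (X : hilbModType B)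
    (calA : starAlgType R) (pi : calA -> X -> X) (gr : option (X -> X))
    (m : R) (D : set (X * X)) :
  higher_order_kasparov m pi gr D ->
  [/\ unbounded_kasparov pi gr (log_transform D),
      forall (A : cstarAlgType R) (iota : calA -> A) (rho : A -> X -> X),
        cstar_closure pi iota rho ->
        exists c clog : kk_cycle A B,
          [/\ is_bounded_transform rho gr D c,
              is_bounded_transform rho gr (log_transform D) clog
            & same_kk_class c clog]
    & forall a b : calA,
        extends_to_compact (commutator (log_transform D) (pi (amul a b)))].
Proof.
move=> H; have Dsr : selfadjoint_regular D by case: H => _ [].
have [Phi PhiD] := C0_calculus_exists Dsr.
have [w [e [tw e0 wg]]] := @sgnlog_series R.
have [K [KD Kb Kl Kr]] := commutators_exist H PhiD tw e0 (@continuous_sgnlog R) wg.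
split.
- exact: (log_unbounded_kasparov H PhiD KD Kb).
- move=> A iota rho hcl; exact: (closure_same_kk_class H PhiD hcl).
- move=> a b; exact: (log_product_commutator H PhiD KD a b Kl Kr).
Qed.
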